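(* Let $d \ge 1$, $p \ge 2$, $s \in (0,1)$ and let $k \in \mathbb{N}$ with $1 \le k \le d$. Let $\alpha,\beta\in\mathbb{R}$ satisfy $\alpha,\ \beta,\ \alpha+\beta \in (-k, sp)$. Then, for all $u \in C^1_c(\mathbb{R}^d)$ when $sp < k+\alpha+\beta$, and for all $u \in C^1_c(\mathbb{R}^d\setminus K)$ when $sp > k+\alpha+\beta$, the following inequality holds: $$\int_{\mathbb{R}^d}\int_{\mathbb{R}^d} \frac{|u(x)-u(y)|^p}{|x-y|^{d+sp}}|x_k|^\alpha |y_k|^\beta\,dx\,dy - \mathcal{C}\int_{\mathbb{R}^d}\frac{|u(x)|^p}{|x_k|^{sp-\alpha-\beta}}\,dx$$ $$\ge\ c_p\int_{\mathbb{R}^d}\int_{\mathbb{R}^d}\frac{|v(x)-v(y)|^p}{|x-y|^{d+sp}}\,|x_k|^{-(k-\alpha+\beta-sp)/2}\,|y_k|^{-(k+\alpha-\beta-sp)/2}\,dx\,dy,$$ where $v(x)=|x_k|^{(k+\alpha+\beta-sp)/p}u(x)$, the constant $\mathcal{C}=\mathcal{C}(d,s,p,k,\alpha,\beta)>0$ is the one defined in the context (it is the optimal, i.e. largest possible, constant in the corresponding Hardy inequality without the remainder term), and $$c_p=\min_{0<\tau<1/2}\left((1-\tau)^p-\tau^p+p\tau^{p-1}\right).$$ For $p=2$ the inequality becomes an equality with $c_2=1$.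
   Context: Functions are real-valued. For $x\in\mathbb{R}^d$ write $x=(x_k,x_{d-k})$ with $x_k\in\mathbb{R}^k$, $x_{d-k}\in\mathbb{R}^{d-k}$ (for $k=d$, $x_k=x$). $K=\{x=(x_k,x_{d-k})\in\mathbb{R}^k\times\mathbb{R}^{d-k}: x_k=0\}$ for $k<d$, and $K=\{0\}$ for $k=d$. $C^1_c(\Omega)$ denotes the $C^1$ functions with compact support in the open set $\Omega$. For an integer $n\ge 1$ and $r\in(0,1)$ define $$\Phi_{n,s,p}(r)=|\mathbb{S}^{n-2}|\int_{-1}^1\frac{(1-t^2)^{\frac{n-3}{2}}}{(1-2tr+r^2)^{\frac{n+sp}{2}}}\,dt\quad (n\ge2),\qquad \Phi_{1,s,p}(r)=(1-r)^{-1-sp}+(1+r)^{-1-sp},$$ where $|\mathbb{S}^{n-2}|$ is the surface measure of the unit sphere in $\mathbb{R}^{n-1}$ ($|\mathbb{S}^0|=2$), and $$\mathcal{C}_1(n,s,p,\alpha,\beta)=\int_0^1 r^{sp-1}\left(r^{-\alpha}+r^{-\beta}\right)\left|1-r^{(n+\alpha+\beta-sp)/p}\right|^p\Phi_{n,s,p}(r)\,dr.$$ With $\Gamma$ the Gamma function, set $$\mathcal{C}(d,s,p,k,\alpha,\beta)=\frac{\pi^{(d-k)/2}\,\Gamma\!\left(\frac{k+sp}{2}\right)}{\Gamma\!\left(\frac{d+sp}{2}\right)}\,\mathcal{C}_1(k,s,p,\alpha,\beta).$$ *)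

(* Defs.v *)
From HB Require Import structures.
From mathcomp Require Import all_boot all_order all_algebra.
From mathcomp Require Import all_classical all_reals all_analysis.

Set Implicit Arguments.
Unset Strict Implicit.
Unset Printing Implicit Defensive.
Import Order.TTheory GRing.Theory Num.Theory.
Import numFieldNormedType.Exports.

Local Open Scope classical_set_scope.
Local Open Scope ring_scope.

Definition measure_rV_display : measure_display -> measure_display.
Proof. exact. Qed.

Section measurable_rV.
Context {d} {T : measurableType d}.
Variable n : nat.

Let coors : 'I_n -> 'rV[T]_n -> T := fun i x => x ord0 i.

Let rV_set0 : g_sigma_preimage coors set0.
Proof. exact: sigma_algebra0. Qed.

Let rV_setC A : g_sigma_preimage coors A -> g_sigma_preimage coors (~` A).
Proof. exact: sigma_algebraC. Qed.

Let rV_bigcup (F : _^nat) : (forall i, g_sigma_preimage coors (F i)) ->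
  g_sigma_preimage coors (\bigcup_i (F i)).
Proof. exact: sigma_algebra_bigcup. Qed.

HB.instance Definition _ := @isMeasurable.Build (measure_rV_display d)
  ('rV[T]_n) (g_sigma_preimage coors) rV_set0 rV_setC rV_bigcup.

Lemma measurable_coord (i : 'I_n) :
  measurable_fun [set: 'rV[T]_n] (fun x => x ord0 i).
Proof.
move=> _ Y mY; rewrite setTI; apply: sub_sigma_algebra => /=.
rewrite -bigcup_seq/=; exists i => /=; first by rewrite mem_index_enum.
by exists Y => //; rewrite setTI.
Qed.

Lemma measurable_fun_coordP d1 (T1 : measurableType d1) (f : T1 -> 'rV[T]_n) :
  measurable_fun [set: T1] f <->
  forall i, measurable_fun [set: T1] (fun t => f t ord0 i).
Proof.
split=> [mf i|mf]; first exact: (measurableT_comp (measurable_coord i) mf).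
apply: (@measurability _ _ _ _ _ _
  (\big[setU/set0]_(i < n) preimage_set_system setT (coors i) measurable)) => //.
move=> _ [B + <-]; rewrite -bigcup_seq => -[i /= _ [A mA <-]].
by rewrite !setTI -comp_preimage; have := mf i measurableT A mA; rewrite setTI.
Qed.

End measurable_rV.

Section lebesgue_rV.
Context {R : realType}.

Definition cons_rV n (p : measurableTypeR R * 'rV[R]_n) : 'rV[R]_n.+1 :=
  row_mx (p.1 : R)%:M p.2.

Lemma cons_rV0 n p : @cons_rV n p ord0 ord0 = p.1.
Proof.
transitivity ((p.1 : R)%:M ord0 (ord0 : 'I_1)); last by rewrite mxE.
rewrite -[RHS](row_mxEl _ p.2).
by congr (fun_of_matrix _ _ _); exact/val_inj.
Qed.

Lemma cons_rVS n p i : @cons_rV n p ord0 (lift ord0 i) = p.2 ord0 i.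
Proof.
have <- := row_mxEr (p.1 : R)%:M p.2 ord0 i.
by congr (fun_of_matrix _ _ _); exact/val_inj.
Qed.

Lemma measurable_cons_rV n : measurable_fun [set: _ * _] (@cons_rV n).
Proof.
apply/measurable_fun_coordP => i; have [j ->|->] := unliftP ord0 i.
  under eq_fun do rewrite cons_rVS.
  exact: (measurableT_comp (measurable_coord j) measurable_snd).
under eq_fun do rewrite cons_rV0.
exact: (@measurable_fst _ _ (measurableTypeR R) 'rV[R]_n).
Qed.

Definition uncons_rV n (x : 'rV[R]_n.+1) : measurableTypeR R * 'rV[R]_n :=
  (x ord0 ord0, \row_i x ord0 (lift ord0 i)).

Lemma cons_rVK n : cancel (@cons_rV n) (@uncons_rV n).
Proof.
move=> [t x]; rewrite /uncons_rV cons_rV0; congr pair.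
by apply/rowP => i; rewrite mxE cons_rVS.
Qed.

Lemma uncons_rVK n : cancel (@uncons_rV n) (@cons_rV n).
Proof.
move=> x; apply/rowP => i; have [j ->|->] := unliftP ord0 i.
  by rewrite cons_rVS mxE.
by rewrite cons_rV0.
Qed.

Lemma measurable_uncons_rV n : measurable_fun [set: _] (@uncons_rV n).
Proof.
apply/measurable_fun_pairP; split; first exact: measurable_coord.
apply/measurable_fun_coordP => i.
under eq_fun do rewrite mxE.
exact: measurable_coord.
Qed.

Section cons_measure.
Variables (n : nat) (mu : {sigma_finite_measure set 'rV[R]_n -> \bar R}).

Definition cons_measure : set 'rV[R]_n.+1 -> \bar R :=
  pushforward (lebesgue_measure \x mu)%E (@cons_rV n).

Let preimage_cons_measurable A :
  measurable A -> measurable (@cons_rV n @^-1` A).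
Proof.
by move=> mA; rewrite -[X in measurable X]setTI; exact: measurable_cons_rV.
Qed.

Let cons_measure0 : cons_measure set0 = 0%E.
Proof. by rewrite /cons_measure /pushforward preimage_set0 measure0. Qed.

Let cons_measure_ge0 A : (0 <= cons_measure A)%E.
Proof. by rewrite /cons_measure /pushforward; exact: measure_ge0. Qed.

Let cons_measure_sigma_additive : semi_sigma_additive cons_measure.
Proof.
move=> F mF tF mUF; rewrite /cons_measure /pushforward preimage_bigcup.
apply: measure_semi_sigma_additive.
- by move=> i; exact: preimage_cons_measurable.
- apply/trivIsetP => /= i j _ _ ij; rewrite -preimage_setI.
  by move/trivIsetP : tF => /(_ _ _ _ _ ij) ->//; rewrite preimage_set0.
- by rewrite -preimage_bigcup; exact: preimage_cons_measurable.
Qed.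

HB.instance Definition _ := isMeasure.Build _ _ _ cons_measure
  cons_measure0 cons_measure_ge0 cons_measure_sigma_additive.

Let cons_measure_sigma_finite : sigma_finite setT cons_measure.
Proof.
have /sigma_finiteP[F [FT ndF Foo]] := sigma_finiteT (@lebesgue_measure R).
have /sigma_finiteP[G [GT ndG Goo]] := sigma_finiteT mu.
exists (fun i => @uncons_rV n @^-1` (F i `*` G i)).
  rewrite -preimage_bigcup (_ : \bigcup_i _ = setT) ?preimage_setT//.
  apply/seteqP; split=> // -[t x] _.
  have [i _ Fit] : (\bigcup_i F i) t by rewrite -FT.
  have [j _ Gjx] : (\bigcup_i G i) x by rewrite -GT.
  exists (maxn i j) => //; split.
    by move: t Fit; exact/subsetPset/ndF/leq_maxl.
  by move: x Gjx; exact/subsetPset/ndG/leq_maxr.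
move=> i; have [mF Fioo] := Foo i; have [mG Gioo] := Goo i; split.
  rewrite -[X in measurable X]setTI; apply: measurable_uncons_rV => //.
  exact: measurableX.
rewrite /cons_measure /pushforward -comp_preimage.
rewrite (_ : _ \o _ = id) ?preimage_id; last first.
  by apply/funext => x; exact: cons_rVK.
by rewrite product_measure1E// lte_mul_pinfty// ge0_fin_numE.
Qed.

HB.instance Definition _ :=
  Measure_isSigmaFinite.Build _ _ _ cons_measure cons_measure_sigma_finite.

End cons_measure.

(* Lebesgue measure on the Borel sets of R^n, see [lebesgue_rV_box]. *)
Fixpoint lebesgue_rV n : {sigma_finite_measure set 'rV[R]_n -> \bar R} :=
  if n is m.+1 then cons_measure (lebesgue_rV m)
  else dirac (0 : 'rV[R]_0).

Lemma lebesgue_rV_box n (A : 'I_n -> set R) :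
  (forall i, measurable (A i)) ->
  lebesgue_rV n [set x : 'rV[R]_n | forall i, A i (x ord0 i)] =
  (\prod_(i < n) lebesgue_measure (A i))%E.
Proof.
elim: n A => [|n ih] A mA /=.
  rewrite big_ord0 diracE mem_set//; by case.
have mB : measurable [set x : 'rV[R]_n | forall i, A (lift ord0 i) (x ord0 i)].
  rewrite (_ : mkset _ = \bigcap_(i in [set: 'I_n])
      ((fun x : 'rV[R]_n => x ord0 i) @^-1` A (lift ord0 i))).
    apply: fin_bigcap_measurable => // i _.
    by rewrite -[X in measurable X]setTI; exact: measurable_coord.
  by apply/seteqP; split=> x /= => [h i _|h i]; exact: h.
rewrite big_ord_recl -ih// -product_measure1E//; last exact: mA.
rewrite /cons_measure /pushforward; congr (_ _); apply/seteqP; split=> -[t x] /=.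
  move=> h; split => [|i]; first by have := h ord0; rewrite cons_rV0.
  by have := h (lift ord0 i); rewrite cons_rVS.
move=> [h0 h] i; have [j ->|->] := unliftP ord0 i.
  by rewrite cons_rVS; exact: h.
by rewrite cons_rV0.
Qed.

End lebesgue_rV.

Section euclidean.
Context {R : realType}.

(* The norm of the normed module ['rV[R]_n] is the sup norm, so the Euclidean
   norm has to be introduced separately. *)
Definition enorm n (x : 'rV[R]_n) : R := Num.sqrt (\sum_i x ord0 i ^+ 2).

Definition unit_sphere n : set 'rV[R]_n := [set x | enorm x = 1].

(* For A a subset of the unit sphere of R^n, its surface measure is n times the
   volume of the cone over A with apex 0. *)
Definition surface_measure n (A : set 'rV[R]_n) : R :=
  n%:R * fine (lebesgue_rV n
    [set x | exists r y, [/\ 0 < r <= 1, A y & x = r *: y]]).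

Let measure_itvD0 : lebesgue_measure (`[-1, 1]%classic `\ 0 : set R) = 2%:E.
Proof.
have mi : measurable (`[-1, 1]%classic : set R) by exact: measurable_itv.
have itvE : lebesgue_measure (`[-1, 1]%classic : set R) = 2%:E.
  have := lebesgue_measure_itv (`[-1, 1] : interval R).
  by rewrite /= lte_fin gtrN// -EFinB opprK.
rewrite measureD//; last by apply: (le_lt_trans _ (ltry 2)); rewrite -itvE.
have I0 : lebesgue_measure (`[-1, 1]%classic `&` [set 0] : set R) = 0.
  apply: (@subset_measure0 _ _ _ lebesgue_measure _ [set 0]) => //.
  - exact: measurableI.
  - exact: lebesgue_measure_set1.
rewrite -[RHS]sube0; congr (_ - _)%E; [exact: itvE|exact: I0].
Qed.

Lemma surface_measure_S0 : surface_measure (@unit_sphere 1) = 2.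
Proof.
have -> : surface_measure (@unit_sphere 1) = fine (lebesgue_rV 1
    [set x : 'rV[R]_1 | forall i, (`[-1, 1]%classic `\ 0) (x ord0 i)]).
  rewrite /surface_measure mul1r; congr (fine (lebesgue_rV 1 _)).
  have enorm1 (y : 'rV[R]_1) : enorm y = `|y ord0 ord0|.
    by rewrite /enorm big_ord1 sqrtr_sqr.
  apply/seteqP; split=> x /=.
    move=> [r [y [/andP[r0 r1]]]]; rewrite /unit_sphere /= enorm1 => y1 -> i.
    rewrite mxE (ord1 i); split.
      by rewrite in_itv/= -ler_norml normrM y1 mulr1 gtr0_norm.
    by apply/eqP; rewrite mulf_eq0 gt_eqF//= -normr_eq0 y1 oner_eq0.
  move=> /(_ ord0); rewrite in_itv/= -ler_norml => -[x1 /eqP x0].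
  exists `|x ord0 ord0|, (`|x ord0 ord0|^-1 *: x).
  split; first by rewrite normr_gt0 x0.
    rewrite /unit_sphere /= enorm1 mxE normrM normfV normr_id mulVf//.
    by rewrite normr_eq0.
  by rewrite scalerA mulfV ?scale1r// normr_eq0.
have -> := @lebesgue_rV_box R 1 (fun=> `[-1, 1]%classic `\ 0).
  by rewrite big_ord1 [X in fine X]measure_itvD0.
by move=> _; exact: measurableD.
Qed.

Section weighted_space.
Variables (d k : nat) (kd : (k <= d)%N).

Definition head_rV (x : 'rV[R]_d) : 'rV[R]_k := colsub (widen_ord kd) x.

Definition head_zero : set 'rV[R]_d := [set x | head_rV x = 0].

End weighted_space.

Definition closed_support n (u : 'rV[R]_n -> R) : set 'rV[R]_n :=
  closure [set x | u x != 0].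

(* Members of C^1_c(Omega) are extended by 0 outside Omega, which is harmless
   since their support is a compact subset of the open set Omega. *)
Definition C1c n (Omega : set 'rV[R]_n) (u : 'rV[R]_n -> R) : Prop :=
  [/\ forall x, differentiable u x,
      forall v, continuous (fun x => 'd u x v),
      compact (closed_support u) & closed_support u `<=` Omega].

End euclidean.

Section constants.
Context {R : realType}.
Local Notation leb := (@lebesgue_measure R).

Definition Gamma (z : R) : R :=
  \int[leb]_(t in `]0, +oo[) (t `^ (z - 1) * expR (- t)).

(* Only used for 1 <= n. *)
Definition Phi (n : nat) (s p r : R) : R :=
  if n == 1%N then (1 - r) `^ (- 1 - s * p) + (1 + r) `^ (- 1 - s * p)
  else surface_measure (@unit_sphere R n.-1) *
    \int[leb]_(t in `[-1, 1])
      ((1 - t ^+ 2) `^ ((n%:R - 3) / 2) /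
       (1 - 2 * t * r + r ^+ 2) `^ ((n%:R + s * p) / 2)).

Definition C1_cst (n : nat) (s p alpha beta : R) : R :=
  \int[leb]_(r in `]0, 1[)
    (r `^ (s * p - 1) * (r `^ (- alpha) + r `^ (- beta)) *
     `|1 - r `^ ((n%:R + alpha + beta - s * p) / p)| `^ p * Phi n s p r).

Definition hardy_cst (d : nat) (s p : R) (k : nat) (alpha beta : R) : R :=
  pi `^ ((d%:R - k%:R) / 2) * Gamma ((k%:R + s * p) / 2) /
  Gamma ((d%:R + s * p) / 2) * C1_cst k s p alpha beta.

Definition remainder_fun (p tau : R) : R :=
  (1 - tau) `^ p - tau `^ p + p * tau `^ (p - 1).

Definition remainder_cst (p : R) : R :=
  inf [set remainder_fun p tau | tau in `]0, 1/2[].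

End constants.

(* The library has [0 `^ a = (a == 0)%:R]. This convention affects the weights
   below only on the sets x = y, x_k = 0 and y_k = 0, which are negligible
   when 1 <= k <= d. *)

Section functionals.
Context {R : realType}.
Variables (d k : nat) (kd : (k <= d)%N) (s p : R).
Local Notation mu := (@lebesgue_rV R d).
Local Open Scope ereal_scope.

Definition energy (a b : R) (u : 'rV[R]_d -> R) : \bar R :=
  \int[mu]_x \int[mu]_y
    (`|u x - u y| `^ p / enorm (x - y) `^ (d%:R + s * p) *
     enorm (head_rV kd x) `^ a * enorm (head_rV kd y) `^ b)%:E.

Definition hardy_term (alpha beta : R) (u : 'rV[R]_d -> R) : \bar R :=
  \int[mu]_x
    (`|u x| `^ p / enorm (head_rV kd x) `^ (s * p - alpha - beta))%:E.

(* There is no test function in the critical case s p = k + alpha + beta. *)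
Definition test_function (alpha beta : R) (u : 'rV[R]_d -> R) : Prop :=
  (s * p < k%:R + alpha + beta)%R /\ C1c setT u \/
  (s * p > k%:R + alpha + beta)%R /\ C1c (~` head_zero kd) u.

Definition hardy_inequality (alpha beta C : R) : Prop :=
  forall u, test_function alpha beta u ->
    C%:E * hardy_term alpha beta u <= energy alpha beta u.

Definition ground_state (alpha beta : R) (u : 'rV[R]_d -> R)
    (x : 'rV[R]_d) : R :=
  (enorm (head_rV kd x) `^ ((k%:R + alpha + beta - s * p) / p) * u x)%R.

End functionals.

(* Main.v *)
(* Write tau = s p, gamma = (k + alpha + beta - tau) / p, w = |x_k|^(-gamma), and let
   v = u / w be the ground state transform of u.  For t in (0, 1) and real a, b one has
     |a - t b|^p >= (1 - t)^(p-1) (|a|^p - t |b|^p) + c_p t^(p/2) |a - b|^p,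
   with equality when p = 2 and c_p = 1.  Up to a factor w^p at one of the two points, it
   bounds |u(x) - u(y)|^p from below with t = w(x) / w(y) or its inverse, whichever is
   less than 1.  Restrict the double integral to |y_k| < delta |x_k| with delta < 1 and
   symmetrize the weight: the terms carrying |a|^p and |b|^p are then separately finite,
   and since |x - y|^(-d-tau) integrates over the fibres of the projection to R^k to a
   multiple of its k-dimensional analogue, each of them is a one-dimensional integral in
   |y_k| / |x_k| times the Hardy term.  Their difference tends to the constant times the
   Hardy term as delta tends to 1, while the remainder and the gap in the pointwise
   inequality, being nonnegative, converge monotonically.  This gives an identity from
   which the inequality, its remainder and the equality for p = 2 can be read off.

   For the optimality, w times a cutoff in log |x_k| / a and in |x_(d-k)| / exp (2 a) is an
   admissible test function; its energy is at most (1 - t)^(1-p) times the constant times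
   its Hardy term, plus an error O(1 / a) relative to that term, and a -> oo, t -> 0. *)

Require Import Defs.
From mathcomp Require Import all_boot all_order all_algebra.
From mathcomp Require Import all_classical all_reals all_analysis.
From mathcomp Require Import measurable_realfun.
From mathcomp Require Import zify ring lra.

Set Implicit Arguments.
Unset Strict Implicit.
Unset Printing Implicit Defensive.
Import Order.TTheory GRing.Theory Num.Theory.
Import numFieldNormedType.Exports.

Local Open Scope classical_set_scope.
Local Open Scope ring_scope.

(** * Pointwise inequalities *)

Section power_inequalities.
Context {R : realType}.
Implicit Types a b x y p q r t : R.

(** With [q ^+ 2 = t], [D = t b - a] and [N = q (b - a)] the pointwise inequality splits according
    to the sizes and relative sign of [D] and [N]. The constant is dictated by the case
    [N / D = A > 1]: there the extreme parameter is [q -> 1], and the limiting condition, divided by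
    [A ^ p], is [c <= remainder_fun p (1 - 1 / A)]. The truncation at [delta] is forced by the ratio
    [r = |y_k| / |x_k|] at 1: the separate coefficients of [|a| ^ p] and [|b| ^ p] vanish there to
    order [p - 1] only, against a kernel of size [(1 - r) ^ (- 1 - tau)], and [tau] may exceed
    [p - 1]. Their difference [|1 - r ^ gam| ^ p] has order [p > tau]. The measure on row vectors is
    an iterated product, so polar coordinates, rotations and inversion are all derived from
    Tonelli's theorem and affine substitutions. For the sharpness, the bounded increment of the
    cutoff in the last variables is dominated by any power of [|x - y|] between 0 and [p]: one above
    [tau] tames the diagonal, one below [tau] gives decay at infinity. *)

Lemma one_powR r : 1 `^ r = 1 :> R.
Proof. by rewrite powR1. Qed.

Lemma powR_le1 r x : 0 <= r -> 0 <= x <= 1 -> x `^ r <= 1.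
Proof.
move=> r0 /andP[x0 x1]; have := @ge0_ler_powR R r r0 x 1.
by rewrite one_powR !nnegrE; apply.
Qed.

Lemma powRD_gt0 x r t : 0 < x -> x `^ (r + t) = x `^ r * x `^ t.
Proof. by move=> x0; rewrite powRD// (gt_eqF x0) implybT. Qed.

Lemma powRB_gt0 x r t : 0 < x -> x `^ (r - t) = x `^ r / x `^ t.
Proof. by move=> x0; rewrite powRD_gt0// powRN. Qed.

(** Young's inequality for the conjugate exponents [r] and [r / (r - 1)], with second factor 1. *)
Lemma bernoulli_powR r x : 1 <= r -> 0 <= x -> 1 + r * (x - 1) <= x `^ r.
Proof.
rewrite le_eqVlt => /predU1P[<- x0|r1 x0]; first by rewrite powRr1// mul1r subrKC.
have r0 : 0 < r by lra.
have := @conjugate_powR R x 1 r (r / (r - 1)) x0 ler01 r0.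
rewrite divr_gt0 ?subr_gt0// => /(_ isT).
have -> : r^-1 + (r / (r - 1))^-1 = 1 by field; lra.
move=> /(_ erefl); rewrite powR1 mulr1 => h.
have : r * x <= r * (x `^ r / r + 1 / (r / (r - 1))) by rewrite ler_pM2l.
by rewrite (_ : r * (_ + _) = x `^ r + (r - 1)); [lra|field; lra].
Qed.

(** Bernoulli's inequality at [x / m], multiplied by [m ^ r]. *)
Lemma powR_tangent r x m : 1 <= r -> 0 <= x -> 0 < m ->
  m `^ r + r * m `^ (r - 1) * (x - m) <= x `^ r.
Proof.
move=> r1 x0 m0.
have -> : x `^ r = m `^ r * (x / m) `^ r.
  rewrite -powRM ?(ltW m0)// ?divr_ge0// ?(ltW m0)//.
  by rewrite mulrC divfK// gt_eqF.
have -> : m `^ (r - 1) = m `^ r / m.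
  by rewrite powRB_gt0// powRr1// ltW.
apply: le_trans (ler_wpM2l (powR_ge0 _ _)
  (bernoulli_powR r1 (divr_ge0 x0 (ltW m0)))).
by rewrite le_eqVlt; apply/orP; left; apply/eqP; field; rewrite gt_eqF.
Qed.

Lemma powR_jensen r t x y : 1 <= r -> 0 <= t <= 1 -> 0 <= x -> 0 <= y ->
  ((1 - t) * x + t * y) `^ r <= (1 - t) * x `^ r + t * y `^ r.
Proof.
move=> r1 /andP[t0 t1] x0 y0; set m := _ + _.
have : 0 <= m by rewrite addr_ge0// mulr_ge0// subr_ge0.
rewrite le_eqVlt => /predU1P[<-|m0].
  rewrite powR0; last by lra.
  by rewrite addr_ge0// mulr_ge0// ?powR_ge0// subr_ge0.
have hx := powR_tangent r1 x0 m0; have hy := powR_tangent r1 y0 m0.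
have t1' : 0 <= 1 - t by lra.
have := lerD (ler_wpM2l t1' hx) (ler_wpM2l t0 hy).
apply: le_trans; rewrite le_eqVlt; apply/orP; left; apply/eqP.
by rewrite /m; ring.
Qed.

(** Write [x ^ r = x * x ^ (r - 1)], and likewise for [y] and [x + y]; the second factors are then
    compared by monotonicity. *)
Lemma powR_superadd r x y : 1 <= r -> 0 <= x -> 0 <= y ->
  x `^ r + y `^ r <= (x + y) `^ r.
Proof.
move=> r1 x0 y0; have r0 : 0 < r by lra.
rewrite -(mulr_powRB1 x0 r0) -(mulr_powRB1 y0 r0) -(mulr_powRB1 (addr_ge0 x0 y0) r0).
rewrite mulrDl lerD// ler_wpM2l// ge0_ler_powR ?subr_ge0// ?nnegrE ?addr_ge0//; lra.
Qed.

Lemma abs_powR_sqr p x : `|x| `^ p = (x ^+ 2) `^ (p / 2).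
Proof.
rewrite -real_normK ?num_real// -powR_mulrn// -powRrM.
by congr (_ `^ _); lra.
Qed.

(** The square of [D - q N] equals [(1 - q^2) (D^2 - N^2) + q^2 (D - N / q)^2], a convex combination
    of nonnegative numbers when [|N| <= |D|]. Jensen's inequality and superadditivity for the power
    [p / 2] conclude. *)
Lemma ground_pointwise_le p c q D N : 2 <= p -> c <= 1 -> 0 < q < 1 ->
  `|N| <= `|D| ->
  `|D - q * N| `^ p <=
    (1 - q ^+ 2) * (`|D| `^ p - c * `|N| `^ p) + q ^+ 2 * `|D - N / q| `^ p.
Proof.
move=> p2 c1 /andP[q0 q1] ND.
have p21 : 1 <= p / 2 by lra.
have DN : N ^+ 2 <= D ^+ 2.
  by rewrite -(real_normK (num_real N)) -(real_normK (num_real D)) lerXn2r ?nnegrE.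
have -> : `|D - q * N| `^ p =
    ((1 - q ^+ 2) * (D ^+ 2 - N ^+ 2) + q ^+ 2 * (D - N / q) ^+ 2) `^ (p / 2).
  by rewrite abs_powR_sqr; congr (_ `^ _); field; rewrite gt_eqF.
have q2 : 0 <= q ^+ 2 <= 1 by rewrite sqr_ge0/= expr_le1// ltW.
apply: le_trans (powR_jensen p21 q2 _ (sqr_ge0 _)) _; first by lra.
rewrite -abs_powR_sqr lerD2r ler_wpM2l//; first by lra.
have := powR_superadd p21 (sqr_ge0 N) (_ : 0 <= D ^+ 2 - N ^+ 2).
rewrite subr_ge0 => /(_ DN); rewrite subrKC -!abs_powR_sqr => h.
have : c * `|N| `^ p <= 1 * `|N| `^ p by rewrite ler_wpM2r// powR_ge0.
lra.
Qed.

Lemma powR_sub_ge1 r x y : 1 <= r -> 0 <= x <= 1 -> x - x `^ r <= r - 1.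
Proof.
move=> r1 /andP[x0 x1].
have := bernoulli_powR r1 x0.
have : 0 <= (r - 1) * x by rewrite mulr_ge0// subr_ge0.
lra.
Qed.

(* Young's inequality with the slope taken at [(1 + d) ^+ 2]. *)
Lemma ground_pointwise_opp p q d : 2 <= p -> 0 < q < 1 -> 0 <= d <= 1 ->
  (d + q) `^ p <= (1 - q ^+ 2) * (d `^ p - 1) + q ^+ 2 * (d + q^-1) `^ p.
Proof.
move=> p2 /andP[q0 q1] /andP[d0 d1].
have p21 : 1 <= p / 2 by lra.
have sq (x : R) : 0 <= x -> x `^ p = (x ^+ 2) `^ (p / 2).
  by move=> x0; rewrite -abs_powR_sqr ger0_norm.
set s := (1 + d) ^+ 2; set e := (1 + d) `^ (p - 2).
have d10 : 0 < 1 + d by lra.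
have s0 : 0 < s by rewrite exprn_gt0.
have e1 : 1 <= e by rewrite -[leLHS](powRr0 (1 + d)) ler_powR; lra.
have se : s `^ (p / 2 - 1) = e.
  rewrite /s -powR_mulrn ?(ltW d10)// -powRrM /e; congr (_ `^ _); lra.
have sp : s `^ (p / 2) = e * s.
  rewrite -se -{3}(powRr1 (ltW s0)) -powRD_gt0//.
  by congr (_ `^ _); lra.
have q'0 : 0 < q^-1 by rewrite invr_gt0.
have q'1 : q * q^-1 = 1 by rewrite mulfV// gt_eqF.
have h1 := powR_tangent p21 (sqr_ge0 (d + q^-1)) s0.
rewrite -(sq (d + q^-1)) ?addr_ge0// ?(ltW q'0)// se sp in h1.
have h2 : (d + q) `^ p <= (d + q) ^+ 2 * e.
  have dq0 : 0 < d + q by lra.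
  have -> : (d + q) `^ p = (d + q) ^+ 2 * (d + q) `^ (p - 2).
    rewrite -powR_mulrn ?(ltW dq0)// -powRD_gt0//.
    by congr (_ `^ _); lra.
  rewrite ler_wpM2l ?sqr_ge0// ge0_ler_powR ?nnegrE; lra.
have h3 : d ^+ 2 - d `^ p <= p / 2 - 1.
  rewrite sq//; apply: powR_sub_ge1 => //.
  by rewrite sqr_ge0/= expr_le1.
have q20 : 0 <= q ^+ 2 by rewrite sqr_ge0.
have q21 : 0 < 1 - q ^+ 2 by rewrite subr_gt0 expr_lt1// ltW.
apply: le_trans h2 _.
have := ler_wpM2l q20 h1 => {}h1.
rewrite -lerBlDl; apply: le_trans h1.
have E : q ^+ 2 * (e * s + p / 2 * e * ((d + q^-1) ^+ 2 - s)) - (d + q) ^+ 2 * e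
   = e * ((p / 2 - 1) * ((d + q) ^+ 2 - q ^+ 2 * s)
        + p / 2 * (1 - q ^+ 2) * (1 - d ^+ 2)).
  have -> : (d + q^-1) ^+ 2 = d ^+ 2 + 2 * d * q^-1 + q^-1 ^+ 2 by ring.
  have -> : q^-1 ^+ 2 = q^-1 * q^-1 by [].
  rewrite /s.
  rewrite (_ : q ^+ 2 * _ = q ^+ 2 * e * (1 + d) ^+ 2 + p / 2 * e * (q ^+ 2 * d ^+ 2
    + 2 * d * q * (q * q^-1) + (q * q^-1) * (q * q^-1) - q ^+ 2 * (1 + d) ^+ 2)); last by ring.
  by rewrite q'1; ring.
have h4 : (1 - q ^+ 2) * d ^+ 2 <= (d + q) ^+ 2 - q ^+ 2 * s.
  rewrite -subr_ge0 (_ : _ - _ = 2 * (d * q * (1 - q)) + 0); last by rewrite /s; ring.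
  by rewrite addr0 mulr_ge0// mulr_ge0 ?mulr_ge0// ?subr_ge0 ltW.
have h5 : (1 - q ^+ 2) * (p / 2 - d ^+ 2) <=
    (p / 2 - 1) * ((d + q) ^+ 2 - q ^+ 2 * s) + p / 2 * (1 - q ^+ 2) * (1 - d ^+ 2).
  have : (p / 2 - 1) * ((1 - q ^+ 2) * d ^+ 2) <= (p / 2 - 1) * ((d + q) ^+ 2 - q ^+ 2 * s).
    by rewrite ler_wpM2l// subr_ge0.
  lra.
have d2 : d ^+ 2 <= 1 by rewrite expr_le1.
have h6 : 0 <= (1 - q ^+ 2) * (p / 2 - d ^+ 2) by rewrite mulr_ge0//; lra.
have h7 := ler_pM ler01 h6 e1 h5; rewrite mul1r -E in h7.
have h8 : (1 - q ^+ 2) * (1 - d `^ p) <= (1 - q ^+ 2) * (p / 2 - d ^+ 2).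
  by rewrite ler_pM2l//; lra.
lra.
Qed.


Lemma continuous_abs_powR r : 0 < r -> continuous (fun x : R => `|x| `^ r).
Proof.
move=> r0 x; have [->|x0] := eqVneq x 0.
  apply/cvgrPdist_lt => e e0; rewrite normr0 powR0 ?gt_eqF//.
  near=> y; rewrite sub0r normrN ger0_norm ?powR_ge0//.
  have -> : e = (e `^ r^-1) `^ r by rewrite -powRrM mulVf ?gt_eqF// powRr1// ltW.
  rewrite gt0_ltr_powR ?nnegrE ?powR_ge0//.
  near: y; have := @cvgr0_norm_lt _ _ _ _ (nbhs_filter (0 : R)) id.
  by apply; [exact: cvg_id|rewrite powR_gt0].
have cln : {for x, continuous (fun y : R => expR (r * ln `|y|))}.
  apply: continuous_comp => /=; last exact: continuous_expR.
  apply: continuousM; first exact: cvg_cst.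
  have := @continuous_comp _ _ _ (fun y : R => `|y|) (@ln R) x.
  by apply; [exact: norm_continuous|apply: continuous_ln; rewrite normr_gt0].
have E : expR (r * ln `|x|) = `|x| `^ r by rewrite /powR normr_eq0 (negbTE x0).
rewrite /continuous_at -E; apply: cvg_trans cln; apply: near_eq_cvg.
have nz : \forall y \near x, y != 0.
  by apply: (@cvgr_neq0 _ _ _ (nbhs x) _ id x) => //; exact: cvg_id.
by apply: filterS nz => y y0; rewrite /powR normr_eq0 (negbTE y0).
Unshelve. all: by end_near. Qed.

Lemma is_derive_abs_powR p x : 1 < p ->
  is_derive x 1 (fun y : R => `|y| `^ p) (p * (x * `|x| `^ (p - 2))).
Proof.
move=> p1; have [x0|x0|->] := ltgtP x 0.
- apply: (@near_eq_is_derive _ _ _ (fun y => (- y) `^ p)).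
    by near=> y; rewrite ltr0_norm//; near: y; exact: lt_nbhsl.
  have x0' : 0 < - x by lra.
  have [h1 h2] := @is_derive1_comp R (@powR R ^~ p) -%R x _ _
    (is_derive1_powR p x0') (is_deriveNid x 1).
  apply: DeriveDef => //; rewrite h2 ltr0_norm//.
  have -> : (- x) `^ (p - 1) = (- x) `^ (p - 2) * (- x).
    by rewrite -{3}[- x]powRr1 ?ltW// -powRD_gt0//; congr (_ `^ _); lra.
  by rewrite /GRing.scale/=; ring.
- apply: (@near_eq_is_derive _ _ _ (fun y => y `^ p)).
    by near=> y; rewrite gtr0_norm//; near: y; exact: lt_nbhsr.
  have [h1 h2] := is_derive1_powR p x0.
  apply: DeriveDef => //; rewrite h2 gtr0_norm//.
  have -> : x `^ (p - 1) = x `^ (p - 2) * x.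
    by rewrite -{3}[x]powRr1 ?ltW// -powRD_gt0//; congr (_ `^ _); lra.
  by ring.
rewrite mul0r mulr0.
(* At 0 the difference quotient has absolute value [|h| ^ (p - 1)], which tends to 0 because
   [p > 1]. *)
have lim0 : ((h : R)^-1 *: (`|h *: (1 : R) + 0 : R| `^ p - `|(0:R)| `^ p) : R) @[h --> (0 : R)^'] --> (0 : R).
  rewrite normr0 powR0; last by lra.
  have : (fun h : R => `|h| `^ (p - 1)) @ 0^' --> (0 : R).
    have p10 : 0 < p - 1 by lra.
    have := @continuous_abs_powR (p - 1) p10 0.
    rewrite /continuous_at normr0 powR0; last by lra.
    by move=> h; apply: cvg_within_filter; exact: h.
  move=> /cvgr0_norm_lt h; apply/cvgr0Pnorm_lt => e e0; near=> y.
  have y0 : y != 0 by near: y; exact: nbhs_dnbhs_neq.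
  rewrite subr0 addr0 /GRing.scale/= mulr1 normrM normfV.
  rewrite [`| _ `^ p|]ger0_norm ?powR_ge0//.
  have -> : `|y| `^ p = `|y| * `|y| `^ (p - 1) by rewrite mulr_powRB1//; lra.
  rewrite mulKf ?normr_eq0//.
  by rewrite -[ltLHS]ger0_norm ?powR_ge0//; near: y; exact: h.
apply: DeriveDef; first by apply/cvg_ex; exists 0.
by apply/cvg_lim.
Unshelve. all: by end_near. Qed.

(** The right-hand side is the trapezoid rule for the integral of [p y |y| ^ (p - 2)] over [[x, 1]];
    it overestimates when [x >= 0] because [y ^ (p - 1)] is convex there. A negative [x] reduces to
    [- x], since [(- x) ^ (p - 1) <= - x]. *)
Lemma trapezoid_powR p x : 2 <= p -> -1 <= x <= 1 ->
  1 - `|x| `^ p <= p / 2 * ((1 - x) * (1 + x * `|x| `^ (p - 2))).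
Proof.
move=> p2.
suff pos y : 0 <= y <= 1 -> 1 - y `^ p <= p / 2 * ((1 - y) * (1 + y * y `^ (p - 2))).
  move=> /andP[x1 x1']; have [x0|x0] := leP 0 x.
    by rewrite !ger0_norm//; apply: pos; rewrite x0.
  rewrite !ltr0_norm//; set y := - x.
  have y01 : 0 <= y <= 1 by rewrite /y; apply/andP; split; lra.
  have -> : x = - y by rewrite opprK.
  apply: le_trans (pos _ y01) _; rewrite ler_pM2l; last by lra.
  have /andP[y0 y1] := y01.
  have := ler_wpM2l y0 (_ : y `^ (p - 2) <= 1).
  have -> : y `^ (p - 2) <= 1 by apply: powR_le1 => //; lra.
  move=> /(_ isT); lra.
move=> /andP[]; rewrite le_eqVlt => /predU1P[<- _|y0].
  rewrite powR0; last by lra.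
  by rewrite mul0r subr0 addr0; lra.
rewrite le_eqVlt => /predU1P[->|y1]; first by rewrite !powR1; lra.
(* The claim reads [T y >= T 1], so it suffices that [T] has nonpositive derivative. *)
pose T := fun x : R => p / 2 * ((1 - x) * (1 + x `^ (p - 1))) + x `^ p.
pose dT := fun x : R => p / 2 * ((1 - x) * ((p - 1) * x `^ (p - 2)) - (1 + x `^ (p - 1))) + p * x `^ (p - 1).
have dTE (z : R) : 0 < z -> is_derive z 1 T (dT z).
  move=> z0; have h1 := @is_derive1_powR R p z z0.
  have h2 := @is_derive1_powR R (p - 1) z z0.
  rewrite /T; apply: is_derive_eq.
  rewrite /dT /GRing.scale/= (_ : p - 1 - 1 = p - 2); last by ring.
  by ring.
have cT : {within `[y, 1], continuous T}.
  apply: continuous_in_subspaceT => z; rewrite inE/= in_itv/= => /andP[yz _].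
  apply/differentiable_continuous/derivable1_diffP.
  by have [] := dTE z (lt_le_trans y0 yz).
have dT' : forall x, x \in `]y, 1[ -> is_derive x 1 T (dT x).
  by move=> z; rewrite in_itv/= => /andP[yz _]; apply: dTE; exact: lt_trans yz.
have [z] := MVT y1 dT' cT.
rewrite in_itv/= => /andP[yz z1] E.
have z0 : 0 < z by exact: lt_trans yz.
have dT0 : dT z <= 0.
  have zz : z `^ (p - 1) = z * z `^ (p - 2).
    by rewrite -{2}[z]powRr1 ?ltW// -powRD_gt0//; congr (_ `^ _); lra.
  (* For [p > 2] this is Bernoulli's inequality at [z ^ (p - 2)] with exponent
     [(p - 1) / (p - 2)]. *)
  suff : (p - 1) * z `^ (p - 2) <= 1 + (p - 2) * z `^ (p - 1).
    have : 0 <= p / 2 by lra.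
    rewrite /dT zz; set w := z `^ _ => hp2 hw.
    have -> : p / 2 * ((1 - z) * ((p - 1) * w) - (1 + z * w)) + p * (z * w) =
       p / 2 * ((p - 1) * w - (1 + (p - 2) * (z * w))) by lra.
    by rewrite pmulr_rle0; lra.
  have [->|p2'] := eqVneq p 2.
    by rewrite (_ : 2 - 2 = 0)// ?subrr// powRr0 mul0r; lra.
  have p2'' : 0 < p - 2 by rewrite subr_gt0 lt_neqAle eq_sym p2'.
  have r1 : 1 <= (p - 1) / (p - 2) by rewrite ler_pdivlMr//; lra.
  have := bernoulli_powR r1 (powR_ge0 z (p - 2)).
  rewrite -powRrM (_ : (p - 2) * ((p - 1) / (p - 2)) = p - 1); last by field; lra.
  move=> h; have := ler_wpM2l (ltW p2'') h.
  rewrite (_ : (p - 2) * (1 + _ * _) = p - 2 + (p - 1) * (z `^ (p - 2) - 1)); last by field; lra.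
  lra.
have : dT z * (1 - y) <= 0 by rewrite mulr_le0_ge0// subr_ge0 ltW.
rewrite -E /T !powR1 subrr mul0r mulr0 add0r.
have -> : y `^ (p - 1) = y * y `^ (p - 2).
  by rewrite -{2}[y]powRr1 ?ltW// -powRD_gt0//; congr (_ `^ _); lra.
lra.
Qed.


Lemma trapezoid_powR_hom p a b : 2 <= p -> 0 < a -> `|b| <= a ->
  a `^ p - `|b| `^ p <= p / 2 * ((a - b) * (a `^ (p - 1) + b * `|b| `^ (p - 2))).
Proof.
move=> p2 a0 ba.
have x1 : -1 <= b / a <= 1.
  by rewrite -ler_norml normrM normfV (gtr0_norm a0) ler_pdivrMr// mul1r.
have := ler_wpM2l (powR_ge0 a p) (trapezoid_powR p2 x1).
have an : `|b / a| = `|b| / a by rewrite normrM normfV (gtr0_norm a0).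
have pw r : (`|b| / a) `^ r = `|b| `^ r / a `^ r.
  by rewrite powRM// ?invr_ge0 ?ltW// -powR_inv1 ?ltW// -powRrM mulN1r powRN.
have ap r : a `^ r != 0 by rewrite gt_eqF// powR_gt0.
rewrite an !pw mulrBr mulr1 mulrCA divff ?ap// mulr1.
have -> : a `^ p = a * a * a `^ (p - 2).
  rewrite -{2 3}[a]powRr1 ?(ltW a0)// -!powRD_gt0//; congr (_ `^ _); lra.
have -> : a `^ (p - 1) = a * a `^ (p - 2).
  rewrite -{2}[a]powRr1 ?(ltW a0)// -!powRD_gt0//; congr (_ `^ _); lra.
move=> h; apply: le_trans h _; rewrite le_eqVlt; apply/orP; left; apply/eqP.
by field; rewrite ap (gt_eqF a0).
Qed.

(* [H / (1 - y ^+ 2)] is nonincreasing by the trapezoid inequality, and tends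
   to [0] at [1] since [H] and its derivative vanish there. *)
Lemma ground_pointwise_same p q A : 2 <= p -> 0 < q < 1 -> 1 < A ->
  `|1 - q * A| `^ p + (1 - q ^+ 2) * ((A - 1) `^ (p - 1) * ((p - 1) * A + 1))
   <= q ^+ 2 * (A / q - 1) `^ p.
Proof.
(* [kap = p A (A - 1)^(p - 1) - (A - 1)^p] is the only value for which the derivative of [H]
   vanishes at 1. *)
move=> p2 /andP[q0 q1] A1; set kap := _ `^ _ * _.
have p1 : 1 < p by lra.
pose H := fun y : R => y ^+ 2 * (A * y^-1 - 1) `^ p - `|1 - y * A| `^ p - kap * (1 - y ^+ 2).
pose dH := fun y : R => 2 * y * (A * y^-1 - 1) `^ p - p * A * (A * y^-1 - 1) `^ (p - 1)
   + p * A * ((1 - y * A) * `|1 - y * A| `^ (p - 2)) + 2 * kap * y.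
have a0 (y : R) : 0 < y <= 1 -> 0 < A * y^-1 - 1.
  move=> /andP[y0 y1]; rewrite subr_gt0.
  by rewrite ltr_pdivlMr// mul1r; lra.
have dHE (y : R) : 0 < y <= 1 -> is_derive y 1 H (dH y).
  move=> y01; have /andP[y0 y1] := y01.
  have d1 : is_derive y 1 (fun y : R => A * y^-1 - 1) (- A / y ^+ 2).
    have h : y != 0 by rewrite gt_eqF.
    have h' := is_deriveV h (is_derive_id y 1).
    by apply: is_derive_eq; rewrite /GRing.scale/=; field.
  have d2 := @is_derive1_comp R (@powR R ^~ p) _ y _ _ (is_derive1_powR p (a0 _ y01)) d1.
  have d3 : is_derive y 1 (fun y : R => 1 - y * A) (- A).
    by apply: is_derive_eq; rewrite /GRing.scale/=; ring.
  have d4 := @is_derive1_comp R (fun z => `|z| `^ p) _ y _ _ (is_derive_abs_powR (1 - y * A) p1) d3.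
  rewrite /comp in d2 d4.
  rewrite /H; apply: is_derive_eq.
  by rewrite /dH /GRing.scale/= /GRing.scale/=; field; rewrite gt_eqF.
(* This is the numerator of the derivative of [H / (1 - y ^+ 2)]; [kap] cancels in it, and what
   remains is [2 y] times the trapezoid inequality for the pair [A / y - 1] and [y A - 1]. The pair
   is admissible because [y + 1 / y >= 2]. *)
have key (y : R) : 0 < y < 1 -> dH y * (1 - y ^+ 2) + 2 * y * H y <= 0.
  move=> /andP[y0 y1].
  have a0' : 0 < A * y^-1 - 1 by apply: a0; rewrite y0 ltW.
  have ba : `|y * A - 1| <= A * y^-1 - 1.
    have yV1 : 1 < y^-1 by rewrite invf_gt1.
    have E1 : y * y^-1 = 1 by rewrite mulfV// gt_eqF.
    have yV2 : 2 <= y + y^-1.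
      have h0 : 0 <= (1 - y) ^+ 2 by rewrite sqr_ge0.
      have h1 : y * (y + y^-1) = y * y + 1 by rewrite mulrDr E1.
      have h2 : y * 2 <= y * (y + y^-1) by rewrite h1; lra.
      by rewrite ler_pM2l in h2.
    rewrite ler_norml; apply/andP; split.
      have : A * 2 <= A * (y + y^-1) by rewrite ler_pM2l//; lra.
      lra.
    have : A * y <= A * y^-1 by rewrite ler_pM2l; lra.
    lra.
  have := trapezoid_powR_hom p2 a0' ba.
  have -> : `|y * A - 1| = `|1 - y * A| by rewrite distrC.
  set a := A * y^-1 - 1; set B := `|1 - y * A| => h.
  have E : dH y * (1 - y ^+ 2) + 2 * y * H y =
    2 * y * (a `^ p - B `^ p - p / 2 * ((a - (y * A - 1)) * (a `^ (p - 1) + (y * A - 1) * B `^ (p - 2)))).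
    by rewrite /dH /H -/a -/B /a; field; rewrite gt_eqF.
  by rewrite E pmulr_rle0 ?mulr_gt0//; lra.
have q2 y : 0 < y < 1 -> 0 < 1 - y ^+ 2.
  by move=> /andP[y0 y1]; rewrite subr_gt0 expr_lt1// ltW.
have Q y : q < y < 1 -> H y / (1 - y ^+ 2) <= H q / (1 - q ^+ 2).
  move=> /andP[qy y1].
  pose Qf := fun y : R => H y * (1 - y ^+ 2)^-1.
  pose dQ := fun y : R => (dH y * (1 - y ^+ 2) + 2 * y * H y) / (1 - y ^+ 2) ^+ 2.
  have dQE (z : R) : 0 < z < 1 -> is_derive z 1 Qf (dQ z).
    move=> z01; have /andP[z0 z1] := z01.
    have zn0 : 1 - z ^+ 2 != 0 by rewrite gt_eqF// q2.
    have d1 : is_derive z 1 H (dH z) by apply: dHE; rewrite z0 ltW.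
    have d2 : is_derive z 1 (fun y : R => 1 - y ^+ 2) (- (2 * z)).
      by apply: is_derive_eq; rewrite /GRing.scale/=; ring.
    have d3 := @is_deriveV R (fun y : R => 1 - y ^+ 2) z _ 1 zn0 d2.
    rewrite /Qf; apply: is_derive_eq; rewrite /dQ /GRing.scale/=.
    by field.
  have dQ' : forall x, x \in `]q, y[ -> is_derive x 1 Qf (dQ x).
    by move=> x; rewrite in_itv/= => /andP[qx xy]; apply: dQE; rewrite (lt_trans q0 qx) (lt_trans xy y1).
  have cQ : {within `[q, y], continuous Qf}.
    apply: continuous_in_subspaceT => z; rewrite inE/= in_itv/= => /andP[qz zy].
    apply/differentiable_continuous/derivable1_diffP.
    by have [] := dQE z; rewrite ?(lt_le_trans q0 qz) ?(le_lt_trans zy y1).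
  have [c] := MVT qy dQ' cQ.
  rewrite in_itv/= => /andP[qc cy] E; rewrite -subr_le0 -/(Qf y) -/(Qf q) E.
  have c01 : 0 < c < 1 by rewrite (lt_trans q0 qc) (lt_trans cy y1).
  rewrite mulr_le0_ge0//; last by rewrite subr_ge0 ltW.
  by rewrite /dQ mulr_le0_ge0 ?key// invr_ge0 sqr_ge0.
have H1 : H 1 = 0.
  by rewrite /H invr1 expr1n !mulr1 !mul1r distrC gtr0_norm ?subr_gt0// !subrr mulr0 subr0.
have dH1 : dH 1 = 0.
  rewrite /dH invr1 !mulr1 !mul1r distrC gtr0_norm ?subr_gt0// /kap.
  have A10 : 0 < A - 1 by rewrite subr_gt0.
  have -> : (A - 1) `^ p = (A - 1) * (A - 1) * (A - 1) `^ (p - 2).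
    rewrite -{2 3}[A - 1]powRr1 ?(ltW A10)// -!powRD_gt0//; congr (_ `^ _); lra.
  have -> : (A - 1) `^ (p - 1) = (A - 1) * (A - 1) `^ (p - 2).
    rewrite -{2}[A - 1]powRr1 ?(ltW A10)// -!powRD_gt0//; congr (_ `^ _); lra.
  by ring.
suff : 0 <= H q by rewrite /H; lra.
rewrite leNgt; apply/negP => Hq.
set eta := - (H q / (1 - q ^+ 2)).
have eta0 : 0 < eta.
  by rewrite /eta oppr_gt0 pmulr_llt0// invr_gt0 q2// q0.
have : is_derive (1 : R) 1 H (dH 1) by apply: dHE; rewrite ltr01 lexx.
rewrite dH1 => -[/cvg_ex[l hl] der].
have l0 : l = 0 by rewrite -der; apply/esym/cvg_lim.
rewrite l0 in hl.
move/cvgr0Pnorm_lt : hl => /(_ _ eta0)[e /= e0 he].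
(* A step to the left of 1 that stays inside [(q, 1)] and inside the neighbourhood where the
   difference quotient of [H] is below [eta]. *)
pose h := - (Num.min (e / 2) ((1 - q) / 2)).
have m0 : 0 < - h by rewrite /h opprK lt_min; apply/andP; split; lra.
have h1 : - h <= e / 2 by rewrite /h opprK ge_min lexx.
have h2 : - h <= (1 - q) / 2 by rewrite /h opprK ge_min lexx orbT.
have hn : `|0 - h| < e by rewrite sub0r gtr0_norm//; lra.
have := he h hn; rewrite lt_eqF; last by lra.
move=> /(_ isT); rewrite H1 subr0 /GRing.scale/= mulr1 normrM normfV ltNge => /negP; apply.
have hq : q < h + 1 < 1 by apply/andP; split; lra.
have := Q _ hq; rewrite -[leRHS]opprK -/eta ler_pdivrMr; last first.
  by apply: q2; apply/andP; split; lra.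
move=> Hh.
have h0 : h < 0 by rewrite -oppr_gt0.
rewrite (ltr0_norm h0) ler_pdivlMl//.
have : eta * - h <= eta * (1 - (h + 1) ^+ 2).
  rewrite ler_pM2l// -subr_ge0 (_ : _ - _ = - h * (1 + h)); last by ring.
  by rewrite mulr_ge0//; lra.
have := ler_norm (- H (h + 1)); rewrite normrN.
lra.
Qed.


(** If [|N| > |D|] the inequality is homogeneous and can be divided by [|N|] when the signs differ
    or [D = 0], and by [|D|] when they agree. Only the last case uses the bound by [remainder_fun];
    the others use [c <= 1]. *)
Lemma ground_pointwise p c q D N : 2 <= p -> c <= 1 ->
  (forall s, 0 < s < 1 -> c <= remainder_fun p s) -> 0 < q < 1 ->
  `|D - q * N| `^ p <=
    (1 - q ^+ 2) * (`|D| `^ p - c * `|N| `^ p) + q ^+ 2 * `|D - N / q| `^ p.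
Proof.
move=> p2 c1 cp q01; have /andP[q0 q1] := q01.
have [ND|DN] := leP `|N| `|D|; first exact: ground_pointwise_le.
have N0 : N != 0 by rewrite -normr_gt0 (le_lt_trans _ DN).
have hom (y z : R) : `|y * z| `^ p = `|y| `^ p * `|z| `^ p by rewrite normrM powRM.
have q20 : 0 <= 1 - q ^+ 2 by rewrite subr_ge0 expr_le1// ltW.
have [h|h] := leP (D / N) 0.
  set d := - (D / N).
  have d0 : 0 <= d by rewrite oppr_ge0.
  have DE : D = N * (- d) by rewrite opprK mulrC divfK.
  have d1 : d <= 1.
    rewrite -[d]ger0_norm// normrN normrM normfV ler_pdivrMr ?normr_gt0//.
    by rewrite mul1r ltW.
  have -> : D - q * N = N * (- (d + q)) by rewrite DE; ring.
  have -> : D - N / q = N * (- (d + q^-1)) by rewrite DE; ring.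
  have Dp : `|D| `^ p = `|N| `^ p * d `^ p by rewrite DE hom normrN (ger0_norm d0).
  have n1 : `|d + q| = d + q by rewrite ger0_norm// addr_ge0// ltW.
  have n2 : `|d + q^-1| = d + q^-1 by rewrite ger0_norm// addr_ge0// invr_ge0 ltW.
  rewrite Dp !hom !normrN n1 n2.
  have := ground_pointwise_opp p2 q01 (_ : 0 <= d <= 1); rewrite d0 d1 => /(_ isT) hd.
  have Np : 0 <= `|N| `^ p by exact: powR_ge0.
  have : `|N| `^ p * (d + q) `^ p <= `|N| `^ p * ((1 - q ^+ 2) * (d `^ p - 1) + q ^+ 2 * (d + q^-1) `^ p).
    by rewrite ler_wpM2l.
  have : (1 - q ^+ 2) * (`|N| `^ p * c) <= (1 - q ^+ 2) * (`|N| `^ p * 1).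
    by rewrite ler_wpM2l// ler_wpM2l.
  lra.
have D0 : D != 0 by apply: contraTneq h => ->; rewrite mul0r ltxx.
set A := N / D.
have NE : N = D * A by rewrite mulrC divfK.
have A0 : 0 < A by rewrite /A -invf_div invr_gt0.
have A1 : 1 < A.
  rewrite -[A]gtr0_norm// normrM normfV ltr_pdivlMr ?normr_gt0//.
  by rewrite mul1r.
have -> : D - q * N = D * (1 - q * A) by rewrite NE; ring.
have -> : D - N / q = D * (- (A / q - 1)) by rewrite NE; ring.
have -> : `|N| `^ p = `|D| `^ p * A `^ p by rewrite NE hom (gtr0_norm A0).
rewrite !hom normrN (gtr0_norm (_ : 0 < A / q - 1)); last first.
  by rewrite subr_gt0 ltr_pdivlMr// mul1r; lra.
have h1 := ground_pointwise_same p2 q01 A1.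
(* This is [c <= remainder_fun p s] at [s = (A - 1) / A], multiplied by [A ^ p]; the formula for
   [remainder_fun] originates here. *)
have h2 : c * A `^ p <= 1 + (A - 1) `^ (p - 1) * ((p - 1) * A + 1).
  have s01 : 0 < (A - 1) / A < 1.
    by rewrite divr_gt0 ?subr_gt0//= ltr_pdivrMr// mul1r; lra.
  have A10 : 0 < A - 1 by lra.
  have Ap r : A `^ r != 0 by rewrite gt_eqF ?powR_gt0.
  have pw (x r : R) : 0 <= x -> (x / A) `^ r = x `^ r / A `^ r.
    by move=> x0; rewrite powRM// ?invr_ge0 ?ltW// -powR_inv1 ?ltW// -powRrM mulN1r powRN.
  have := ler_wpM2r (powR_ge0 A p) (cp _ s01).
  rewrite /remainder_fun (_ : 1 - (A - 1) / A = 1 / A); last by field; rewrite gt_eqF.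
  rewrite !pw ?ler01 ?(ltW A10)// one_powR.
  have -> : A `^ p = A * A `^ (p - 1).
    by rewrite -{2}[A]powRr1 ?(ltW A0)// -powRD_gt0//; congr (_ `^ _); lra.
  have -> : (A - 1) `^ p = (A - 1) * (A - 1) `^ (p - 1).
    by rewrite -{2}[A - 1]powRr1 ?(ltW A10)// -powRD_gt0//; congr (_ `^ _); lra.
  move=> h2; apply: le_trans h2 _; rewrite le_eqVlt; apply/orP; left; apply/eqP.
  by field; rewrite Ap (gt_eqF A0).
have Dp : 0 <= `|D| `^ p by exact: powR_ge0.
have h3 := ler_wpM2l q20 h2.
have := ler_wpM2l Dp (lerD h1 h3).
lra.
Qed.

(* Substitute [q = sqrt t], [D = t b - a], [N = q (b - a)] above. *)
Lemma ground_pointwise_t p c t a b : 2 <= p -> c <= 1 ->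
  (forall s, 0 < s < 1 -> c <= remainder_fun p s) -> 0 < t < 1 ->
  (1 - t) `^ (p - 1) * (`|a| `^ p - t * `|b| `^ p) + c * t `^ (p / 2) * `|a - b| `^ p
   <= `|a - t * b| `^ p.
Proof.
move=> p2 c1 cp /andP[t0 t1].
set q := Num.sqrt t.
have q0 : 0 < q by rewrite sqrtr_gt0.
have qt : q ^+ 2 = t by rewrite sqr_sqrtr// ltW.
have q1 : q < 1 by rewrite -(expr_lt1 (n := 2))// ?qt// ltW.
have := @ground_pointwise p c q (t * b - a) (q * (b - a)) p2 c1 cp.
rewrite q0 q1 => /(_ isT).
have -> : t * b - a - q * (q * (b - a)) = (1 - t) * (- a) by rewrite -qt; ring.
have -> : t * b - a - q * (b - a) / q = (1 - t) * (- b).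
  by field; rewrite gt_eqF.
have hom (y z : R) : `|y * z| `^ p = `|y| `^ p * `|z| `^ p by rewrite normrM powRM.
rewrite !hom !normrN (gtr0_norm (_ : 0 < 1 - t)) ?subr_gt0// (distrC _ a) (distrC _ a) qt.
have -> : `|q| `^ p = t `^ (p / 2) by rewrite abs_powR_sqr qt.
have -> : (1 - t) `^ p = (1 - t) * (1 - t) `^ (p - 1).
  have t10 : 0 < 1 - t by lra.
  by rewrite -{2}[1 - t]powRr1 ?(ltW t10)// -powRD_gt0//; congr (_ `^ _); lra.
move=> h; have t10 : 0 < 1 - t by lra.
rewrite -(ler_pM2l t10); lra.
Qed.

Lemma ground_pointwise_eq2 t a b : 0 < t < 1 ->
  (1 - t) `^ (2 - 1) * (`|a| `^ 2 - t * `|b| `^ 2) + t `^ (2 / 2) * `|a - b| `^ 2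
   = `|a - t * b| `^ 2.
Proof.
move=> /andP[t0 t1]; rewrite (_ : 2 - 1 = 1); last by lra.
rewrite divff ?pnatr_eq0// !powRr1 ?ltW ?subr_gt0//.
by rewrite !powR_mulrn// !real_normK ?num_real//; ring.
Qed.

Lemma continuous_remainder_fun p : 2 < p ->
  {within `[0, 1 / 2], continuous (remainder_fun p)}.
Proof.
move=> p2.
have c r : 0 < r -> continuous (fun x : R => `|x| `^ r) by exact: continuous_abs_powR.
have : continuous (fun x : R => `|1 - x| `^ p - `|x| `^ p + p * `|x| `^ (p - 1)).
  move=> x; apply: cvgD; first apply: cvgB.
  - apply: (@continuous_comp _ _ _ (fun x : R => 1 - x) (fun x : R => `|x| `^ p)).
      by apply: cvgB; [exact: cvg_cst|exact: cvg_id].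
    by apply: c; lra.
  - by apply: c; lra.
  - by apply: cvgM; [exact: cvg_cst|apply: c; lra].
move=> /continuous_subspaceT => /(_ `[0, 1/2]%classic) h.
apply: subspace_eq_continuous h => x; rewrite inE/= in_itv/= => /andP[x0 x1].
have E : `|1 - x| `^ p - `|x| `^ p + p * `|x| `^ (p - 1) = remainder_fun p x.
  by rewrite /remainder_fun !ger0_norm//; lra.
exact: E.
Qed.

Lemma remainder_fun2 t : 0 <= t <= 1 -> remainder_fun 2 t = 1.
Proof.
move=> /andP[t0 t1]; rewrite /remainder_fun (_ : 2 - 1 = 1); last by lra.
by rewrite !powR_mulrn ?subr_ge0// powRr1//; ring.
Qed.

(** With [t = 1 - s] the difference of the two sides is [(p - 2) (s^p - t^p) + p s t (s^(p-2) -
    t^(p-2))], a sum of nonnegative terms. It extends the lower bound from [(0, 1/2)] to all of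
    [(0, 1)], the range of [(A - 1) / A] in the pointwise inequality. *)
Lemma remainder_fun_sym p s : 2 <= p -> 1 / 2 < s < 1 ->
  remainder_fun p (1 - s) <= remainder_fun p s.
Proof.
move=> p2 /andP[s2 s1]; rewrite /remainder_fun opprB subrKC.
have s0 : 0 < s by lra.
have t0 : 0 < 1 - s by lra.
have E (x r : R) : 0 < x -> x `^ r = x * x `^ (r - 1).
  by move=> x0; rewrite -{2}[x]powRr1 ?(ltW x0)// -powRD_gt0//; congr (_ `^ _); lra.
have p1 : 0 <= p - 2 by lra.
have p0 : 0 <= p by lra.
have h1 : (1 - s) `^ p <= s `^ p by rewrite ge0_ler_powR ?nnegrE; lra.
have h2 : (1 - s) `^ (p - 2) <= s `^ (p - 2) by rewrite ge0_ler_powR ?nnegrE; lra.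
have h3 := ler_wpM2l p1 h1.
have h4 := ler_wpM2l (mulr_ge0 p0 (mulr_ge0 (ltW s0) (ltW t0))) h2.
have e1 : s `^ p = s * (s * s `^ (p - 2)).
  by rewrite (E _ p)// (E _ (p - 1))//; congr (_ * (_ * _ `^ _)); lra.
have e2 : (1 - s) `^ p = (1 - s) * ((1 - s) * (1 - s) `^ (p - 2)).
  by rewrite (E _ p)// (E _ (p - 1))//; congr (_ * (_ * _ `^ _)); lra.
have e3 : s `^ (p - 1) = s * s `^ (p - 2).
  by rewrite (E _ (p - 1))//; congr (_ * _ `^ _); lra.
have e4 : (1 - s) `^ (p - 1) = (1 - s) * (1 - s) `^ (p - 2).
  by rewrite (E _ (p - 1))//; congr (_ * _ `^ _); lra.
move: h3 h4; rewrite e1 e2 e3 e4.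
lra.
Qed.

(** The infimum is over an open interval, so attainment needs an argument. For [p > 2] a minimum
    over [[0, 1/2]] exists and is at neither end: the function equals 1 at 0 and drops below 1 to
    the right of it, and it increases towards [1/2]. *)
Lemma remainder_cst_min p : 2 <= p ->
  [/\ exists2 tau, 0 < tau < 1 / 2 & remainder_fun p tau = remainder_cst p,
      forall s, 0 < s < 1 -> remainder_cst p <= remainder_fun p s &
      0 <= remainder_cst p <= 1].
Proof.
move=> p2.
have ge0 s : 0 < s <= 1 / 2 -> 0 <= remainder_fun p s.
  move=> /andP[s0 s2]; rewrite /remainder_fun addr_ge0//.
    by rewrite subr_ge0 ge0_ler_powR ?nnegrE; lra.
  by rewrite mulr_ge0 ?powR_ge0//; lra.
suff [tau t2 tmin] : exists2 tau, 0 < tau < 1 / 2 &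
    forall s, 0 <= s <= 1 / 2 -> remainder_fun p tau <= remainder_fun p s.
  have E : remainder_fun p tau = remainder_cst p.
    apply/le_anti/andP; split.
      apply: lb_le_inf; first by exists (remainder_fun p tau), tau.
      by move=> z /= [s]; rewrite in_itv/= => /andP[s0 s1] <-; apply: tmin; rewrite !ltW.
    apply: ge_inf; last by exists tau.
    by exists (remainder_fun p tau) => z /= [s]; rewrite in_itv/= => /andP[s0 s1] <-; apply: tmin; rewrite !ltW.
  split; first by exists tau.
    move=> s /andP[s0 s1]; rewrite -E; have [s2|s2] := leP s (1 / 2).
      by apply: tmin; rewrite ltW.
    apply: le_trans (remainder_fun_sym p2 _); last by rewrite s2.
    by apply: tmin; apply/andP; split; lra.
  rewrite -E ge0/=; last by have /andP[-> /ltW] := t2.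
  apply: le_trans (tmin 0 _) _; first by apply/andP; split; lra.
  by rewrite /remainder_fun subr0 one_powR !powR0; lra.
have [p2'|p2'] := eqVneq p 2.
  (* For [p = 2] the function is constant and any interior point serves. *)
  exists (1 / 4); first by apply/andP; split; lra.
  by move=> s /andP[s0 s2]; rewrite p2' !remainder_fun2//; apply/andP; split; lra.
have {}p2' : 2 < p by rewrite lt_neqAle eq_sym p2'.
have half0 : (0 : R) <= 1 / 2 by lra.
have half1 : (0 : R) < 1 / 2 by lra.
have p00 : 0 < p by lra.
have p1 : 1 <= p by lra.
have p11 : 1 <= p - 1 by lra.
have [c cin cmin] := EVT_min half0 (continuous_remainder_fun p2').
have {}cmin s : 0 <= s <= 1 / 2 -> remainder_fun p c <= remainder_fun p s.
  by move=> s01; apply: cmin; rewrite in_itv.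
move: cin; rewrite in_itv/= => /andP[c0 c2].
exists c => //; apply/andP; split.
  rewrite lt_neqAle c0 andbT; apply/eqP => c0'.
  (* Small enough for [p s ^ (p - 2) <= 1], so that the value at [s] is at most [(1 - s)^2 + s < 1],
     the value at 0. *)
  pose s := Num.min (1 / 4) ((p^-1) `^ (p - 2)^-1).
  have p0 : 0 < p by lra.
  have s0 : 0 < s by rewrite lt_min powR_gt0 ?invr_gt0// andbT; lra.
  have s4 : s <= 1 / 4 by rewrite ge_min lexx.
  have ps : p * s `^ (p - 2) <= 1.
    have pE : p * ((p^-1) `^ (p - 2)^-1) `^ (p - 2) = 1.
      rewrite -powRrM mulVf ?gt_eqF ?subr_gt0// powRr1 ?invr_ge0 ?(ltW p0)//.
      by rewrite divff// gt_eqF.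
    rewrite -[leRHS]pE ler_pM2l// ge0_ler_powR ?nnegrE ?powR_ge0 ?(ltW s0)//; first by lra.
    by rewrite ge_min lexx orbT.
  have : remainder_fun p c <= remainder_fun p s by apply: cmin; apply/andP; split; lra.
  rewrite -c0' /remainder_fun subr0 one_powR !powR0 ?gt_eqF ?subr_gt0//; last by lra.
  rewrite mulr0 subr0 addr0 leNgt => /negP; apply.
  have h1 : (1 - s) `^ p <= (1 - s) ^+ 2.
    rewrite -powR_mulrn; last by lra.
    by apply: ger_powR => //; apply/andP; split; lra.
  have h2 : 0 <= s `^ p by exact: powR_ge0.
  have -> : s `^ (p - 1) = s * s `^ (p - 2).
    by rewrite -{2}[s]powRr1 ?(ltW s0)// -powRD_gt0//; congr (_ `^ _); lra.
  have h3 := ler_wpM2l (ltW s0) ps.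
  have h4 : s * s <= s * (1 / 4) by rewrite ler_pM2l.
  lra.
rewrite lt_neqAle c2 andbT; apply/eqP => c2'.
set m := (1 / 2 : R) `^ (p - 1).
have m0 : 0 < m by rewrite powR_gt0//; lra.
(* The tangent inequalities make [p * k x] a lower bound for the slope of the chord of
   [remainder_fun p] between [x] and [1 / 2]. It is positive at [1 / 2], hence also slightly to the
   left. *)
pose k := fun x : R => (p - 1) * `|x| `^ (p - 2) - m - `|1 - x| `^ (p - 1).
have ck : continuous k.
  move=> x; apply: cvgB; first apply: cvgB.
  - by apply: cvgM; [exact: cvg_cst|apply: continuous_abs_powR; lra].
  - exact: cvg_cst.
  - apply: (@continuous_comp _ _ _ (fun x : R => 1 - x) (fun x : R => `|x| `^ (p - 1))).
      by apply: cvgB; [exact: cvg_cst|exact: cvg_id].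
    by apply: continuous_abs_powR; lra.
have k0 : 0 < k (1 / 2).
  rewrite /k (_ : 1 - 1 / 2 = 1 / 2 :> R); last by lra.
  rewrite ger0_norm; last by lra.
  rewrite -/m (_ : (1 / 2) `^ (p - 2) = 2 * m).
    have : 0 < (p - 2) * m by rewrite mulr_gt0//; lra.
    lra.
  have mE : m = (1 / 2) `^ (p - 2) * (1 / 2).
    rewrite -{2}[1 / 2]powRr1; last by lra.
    by rewrite -powRD_gt0; [congr (_ `^ _); lra|lra].
  by rewrite mE; lra.
have := cvgr_gt _ (ck (1 / 2)) _ k0.
move=> [e /= e0 he].
pose s := 1 / 2 - Num.min (e / 2) (1 / 4).
have h1 : 0 < Num.min (e / 2) (1 / 4) by rewrite lt_min; apply/andP; split; lra.
have h2 : Num.min (e / 2) (1 / 4) <= 1 / 4 by rewrite ge_min lexx orbT.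
have h3 : Num.min (e / 2) (1 / 4) <= e / 2 by rewrite ge_min lexx.
have ks : 0 < k s.
  by apply: he; rewrite /s /= opprB addrCA subrr addr0 gtr0_norm//; lra.
have s0 : 0 < s by rewrite /s; lra.
have s1 : s < 1 / 2 by rewrite /s ltrBlDr ltrDl.
have u1 : 0 < 1 - s by lra.
have : remainder_fun p c <= remainder_fun p s by apply: cmin; rewrite !ltW.
rewrite c2' leNgt => /negP; apply.
rewrite /remainder_fun (_ : 1 - 1 / 2 = 1 / 2 :> R); last by lra.
have h : 0 < 1 / 2 - s by rewrite subr_gt0.
move: ks; rewrite /k (ger0_norm (ltW s0)) (ger0_norm (ltW u1)).
move=> /(mulr_gt0 h).
have := powR_tangent p11 half0 s0.
have := powR_tangent p1 half0 u1.
have := powR_tangent p1 (ltW s0) half1; rewrite -/m.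
rewrite (_ : p - 1 - 1 = p - 2); last by ring.
set A := s `^ p; set B := (1 - s) `^ p; set C := (1 / 2) `^ p; set E := s `^ (p - 1).
set F := s `^ (p - 2); set G := (1 - s) `^ (p - 1).
move=> t1 t2 t3 k1.
have := mulr_gt0 p00 k1.
have := ler_wpM2l (ltW p00) t3.
lra.
Qed.

End power_inequalities.

(** * Integration on R^n *)

Section lebesgue_affine.
Context {R : realType}.
Local Notation leb := (@lebesgue_measure R).
Local Open Scope ereal_scope.

Section pos_affine.
Variables (a b : R).
Hypothesis a0 : (0 < a)%R.
Let phi (t : R) : R := (a * t + b)%R.

Let mphi : measurable_fun [set: R] phi.
Proof. by apply: measurable_funD => //; exact: measurable_funM. Qed.

Let mphi' : @measurable_fun _ _ (measurableTypeR R) (measurableTypeR R) setT phi.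
Proof. exact: mphi. Qed.

Let nu := measure_function_pushforward__canonical__measure_function_Measure leb mphi'.

(** Lebesgue measure is determined by its values on half-open intervals, and an increasing affine
    map pulls such intervals back to such intervals. *)
Let lebesgue_affineE (A : set R) : measurable A ->
  leb A = mscale (NngNum (ltW a0)) nu A.
Proof.
move=> mA; apply: lebesgue_measure_unique => // _ [[x y]] _ <- /=.
rewrite /mscale /= /pushforward.
rewrite (_ : phi @^-1` _ = [set` `](x - b) / a, (y - b) / a]%R]); last first.
  apply/seteqP; split => t /=; rewrite !in_itv/= /phi;
    by rewrite ltr_pdivrMr// ler_pdivlMr// ltrBlDr lerBrDr (mulrC t).
rewrite !lebesgue_measure_itv/= !lte_fin ltr_pM2r ?invr_gt0// ltrD2r.
case: ifPn => _; last by rewrite mule0.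
rewrite -EFinB -!EFinM; congr EFin; field; exact: lt0r_neq0.
Qed.

Lemma ge0_integral_affine_pos (f : R -> \bar R) :
  measurable_fun [set: R] f -> (forall t, 0 <= f t) ->
  \int[leb]_t f (a * t + b)%R = a^-1%:E * \int[leb]_t f t.
Proof.
move=> mf f0.
have -> : \int[leb]_t f t = a%:E * \int[leb]_t f (a * t + b)%R.
  have E := @ge0_integral_pushforward _ _ (measurableTypeR R) (measurableTypeR R)
    R phi mphi' leb setT f measurableT mf (fun y _ => f0 y).
  rewrite preimage_setT in E; rewrite -[X in _ * X]E.
  have := @ge0_integral_mscale _ (measurableTypeR R) R nu setT measurableT
    (NngNum (ltW a0)) f mf (fun t _ => f0 t).
  move=> <-.
  by apply: eq_measure_integral => A mA _; exact: lebesgue_affineE.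
by rewrite muleA -EFinM mulVf ?mul1e// gt_eqF.
Qed.

End pos_affine.

Lemma ge0_integral_affine (a b : R) (f : R -> \bar R) : a != 0%R ->
  measurable_fun [set: R] f -> (forall t, 0 <= f t) ->
  \int[leb]_t f (a * t + b)%R = `|a|^-1%:E * \int[leb]_t f t.
Proof.
move=> a0 mf f0; have [a_lt0|a_gt0|/eqP] := ltgtP a 0%R; last by rewrite (negbTE a0).
  have na : (0 < - a)%R by rewrite oppr_gt0.
  rewrite ltr0_norm// -(@ge0_integral_affine_pos (- a) b na f)//.
  have mN : measurable_fun [set: R] (fun t : R => f (a * t + b)%R).
    by apply: (measurableT_comp mf); apply: measurable_funD => //; exact: measurable_funM.
  have mo : @measurable_fun _ _ (measurableTypeR R) (measurableTypeR R) setT (-%R : R -> R).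
    exact: oppr_measurable.
  pose nu := measure_function_pushforward__canonical__measure_function_Measure leb mo.
  transitivity (\int[nu]_t f (a * t + b)%R).
    by apply: eq_measure_integral => A mA _; rewrite -[LHS]lebesgue_measureN.
  have E := @ge0_integral_pushforward _ _ (measurableTypeR R) (measurableTypeR R)
    R -%R mo leb setT _ measurableT mN (fun y _ => f0 _).
  rewrite preimage_setT in E; rewrite [LHS]E.
  by apply: eq_integral => t _ /=; rewrite mulrN mulNr.
by rewrite gtr0_norm//; exact: ge0_integral_affine_pos.
Qed.

End lebesgue_affine.

Lemma measurable_fun_iint d1 d2 (T1 : measurableType d1) (T2 : measurableType d2)
    (R : realType) (m : {sigma_finite_measure set T2 -> \bar R})
    (f : T1 * T2 -> \bar R) :
  measurable_fun [set: T1 * T2] f -> (forall x, 0 <= f x)%E ->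
  measurable_fun [set: T1] (fun x => \int[m]_y f (x, y))%E.
Proof. exact: measurable_fun_fubini_tonelli_F. Qed.

(** * Tonelli, affine maps and rotations for Lebesgue measure on row vectors *)

Section lebesgue_rV_theory.
Context {R : realType}.
Local Notation leb := (@lebesgue_measure R).
Local Open Scope ereal_scope.

Lemma ge0_integral_rV0 (f : 'rV[R]_0 -> \bar R) :
  \int[lebesgue_rV 0]_x f x = f 0%R.
Proof.
rewrite /= integral_dirac//.
  by rewrite diracE mem_set// mul1e.
move=> _ Y mY; rewrite setTI.
have [h|h] := pselect (f 0%R \in Y).
  rewrite (_ : _ @^-1` _ = setT)//; apply/seteqP; split => // x _ /=.
  by have -> : x = 0%R :> 'rV[R]_0; [apply/rowP => -[]|exact: set_mem h].
rewrite (_ : _ @^-1` _ = set0)//; apply/seteqP; split => // x /=.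
by have -> : x = 0%R :> 'rV[R]_0; [apply/rowP => -[]|move=> /mem_set].
Qed.

Lemma ge0_integral_cons n (f : 'rV[R]_n.+1 -> \bar R) :
  measurable_fun [set: 'rV[R]_n.+1] f -> (forall x, 0 <= f x) ->
  \int[lebesgue_rV n.+1]_x f x =
  \int[leb]_t \int[lebesgue_rV n]_x f (cons_rV (t, x)).
Proof.
move=> mf f0; transitivity
  (\int[pushforward (leb \x (lebesgue_rV n)) (@cons_rV R n)]_x f x) => //.
have mc := @measurable_cons_rV R n.
rewrite ge0_integral_pushforward// preimage_setT fubini_tonelli1//.
  exact: measurableT_comp.
by move=> x; exact: f0.
Qed.

Lemma measurable_fun_consr n d (T : measurableType d) (t : T -> R) (x : T -> 'rV[R]_n) :
  measurable_fun setT t -> measurable_fun setT x ->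
  measurable_fun setT (fun y => cons_rV (t y, x y)).
Proof.
move=> mt mx; have := @measurable_cons_rV R n => mc.
by apply: (measurableT_comp mc); exact: measurable_fun_pair.
Qed.

Lemma measurable_rV_lin n d (T : measurableType d) (t : T -> R) (x y : T -> 'rV[R]_n) :
  measurable_fun setT t -> measurable_fun setT x -> measurable_fun setT y ->
  measurable_fun setT (fun z => t z *: x z + y z)%R.
Proof.
move=> mt mx my; apply/measurable_fun_coordP => i.
rewrite (_ : (fun _ => _) = (fun z => t z * x z ord0 i + y z ord0 i)%R); last first.
  by apply/funext => z; rewrite !mxE.
by apply: measurable_funD; [apply: measurable_funM => //|];
  apply: (measurableT_comp (measurable_coord i)).
Qed.

Lemma measurable_rV_sub n d (T : measurableType d) (x y : T -> 'rV[R]_n) :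
  measurable_fun setT x -> measurable_fun setT y ->
  measurable_fun setT (fun z => x z - y z)%R.
Proof.
move=> mx my; rewrite (_ : (fun _ => _) = (fun z => (-1) *: y z + x z)%R).
  exact: measurable_rV_lin.
by apply/funext => z; rewrite scaleN1r addrC.
Qed.

Definition sqn n (x : 'rV[R]_n) : R := (\sum_i x ord0 i ^+ 2)%R.
Definition dot n (x y : 'rV[R]_n) : R := (\sum_i x ord0 i * y ord0 i)%R.

Lemma sqn_ge0 n (x : 'rV[R]_n) : (0 <= sqn x)%R.
Proof. by apply: sumr_ge0 => i _; exact: sqr_ge0. Qed.

Lemma enormE n (x : 'rV[R]_n) : enorm x = Num.sqrt (sqn x).
Proof. by []. Qed.

Lemma enorm_ge0 n (x : 'rV[R]_n) : (0 <= enorm x)%R.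
Proof. exact: sqrtr_ge0. Qed.

Lemma sqr_enorm n (x : 'rV[R]_n) : (enorm x ^+ 2 = sqn x)%R.
Proof. by rewrite sqr_sqrtr// sqn_ge0. Qed.

Lemma enorm_eq0 n (x : 'rV[R]_n) : (enorm x == 0%R) = (x == 0%R).
Proof.
rewrite sqrtr_eq0 le_eqVlt [X in _ || X]ltNge sqn_ge0/= orbF.
rewrite psumr_eq0; last by move=> i _; exact: sqr_ge0.
apply/allP/eqP => [h|->].
  apply/rowP => i; rewrite mxE; apply/eqP; rewrite -sqrf_eq0.
  by have := h i; rewrite mem_index_enum => /(_ isT).
by move=> i _ /=; rewrite mxE expr2 mul0r eqxx.
Qed.

Lemma enorm0 n : enorm (0 : 'rV[R]_n) = 0%R.
Proof. by apply/eqP; rewrite enorm_eq0. Qed.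

Lemma enorm_gt0 n (x : 'rV[R]_n) : (0 < enorm x)%R = (x != 0%R).
Proof. by rewrite lt_neqAle enorm_ge0 andbT eq_sym enorm_eq0. Qed.

Lemma enormZ n a (x : 'rV[R]_n) : enorm (a *: x) = (`|a| * enorm x)%R.
Proof.
rewrite /enorm (_ : (\sum_i _)%R = (a ^+ 2 * sqn x)%R); last first.
  by rewrite /sqn mulr_sumr; apply: eq_bigr => i _; rewrite mxE exprMn.
by rewrite sqrtrM ?sqr_ge0// sqrtr_sqr.
Qed.

Lemma enormN n (x : 'rV[R]_n) : enorm (- x) = enorm x.
Proof. by rewrite -scaleN1r enormZ normrN1 mul1r. Qed.

Lemma enormB n (x y : 'rV[R]_n) : enorm (x - y) = enorm (y - x).
Proof. by rewrite -enormN opprB. Qed.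

Lemma sqn_cons n (t : R) (x : 'rV[R]_n) : sqn (cons_rV (t, x)) = (t ^+ 2 + sqn x)%R.
Proof.
rewrite /sqn big_ord_recl cons_rV0; congr (_ + _)%R.
by apply: eq_bigr => i _; rewrite cons_rVS.
Qed.

Lemma dot_cons n (t s : R) (x y : 'rV[R]_n) :
  dot (cons_rV (t, x)) (cons_rV (s, y)) = (t * s + dot x y)%R.
Proof.
rewrite /dot big_ord_recl !cons_rV0; congr (_ + _)%R.
by apply: eq_bigr => i _; rewrite !cons_rVS.
Qed.

Lemma sqnB n (x y : 'rV[R]_n) : sqn (x - y) = (sqn x - 2 * dot x y + sqn y)%R.
Proof.
rewrite /sqn /dot mulr_sumr -sumrB -big_split/=; apply: eq_bigr => i _.
by rewrite !mxE; ring.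
Qed.

Lemma measurable_sqn n : measurable_fun [set: 'rV[R]_n] (@sqn n).
Proof.
rewrite (_ : @sqn n = (fun x => \sum_(i <- index_enum 'I_n) x ord0 i ^+ 2)%R)//.
apply: measurable_sum => i; apply: measurable_funX; exact: measurable_coord.
Qed.

Lemma measurable_dot n d (T : measurableType d) (x y : T -> 'rV[R]_n) :
  measurable_fun setT x -> measurable_fun setT y ->
  measurable_fun setT (fun z => dot (x z) (y z)).
Proof.
move=> mx my; rewrite /dot.
apply: measurable_sum => i; apply: measurable_funM;
  exact: (measurableT_comp (measurable_coord i)).
Qed.

Lemma measurable_enorm n d (T : measurableType d) (x : T -> 'rV[R]_n) :
  measurable_fun setT x -> measurable_fun setT (fun z => enorm (x z)).
Proof.
move=> mx; have ms : measurable_fun [set: R] (@Num.sqrt R).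
  by apply: continuous_measurable_fun; exact: sqrt_continuous.
apply: (measurableT_comp ms).
exact: (measurableT_comp (@measurable_sqn n)).
Qed.

Lemma ge0_integral_rV_affine n (a : R) (b : 'rV[R]_n) (f : 'rV[R]_n -> \bar R) :
  a != 0%R -> measurable_fun [set: 'rV[R]_n] f -> (forall x, 0 <= f x) ->
  \int[lebesgue_rV n]_x f (a *: x + b)%R =
  (`|a|^-1 ^+ n)%:E * \int[lebesgue_rV n]_x f x.
Proof.
move=> a0; elim: n b f => [|n IH] b f mf f0.
  rewrite !ge0_integral_rV0 expr0 mul1e; congr f.
  by apply/rowP; case.
have ma : measurable_fun [set: 'rV[R]_n.+1] (fun x => a *: x + b)%R.
  by apply: measurable_rV_lin => //; exact: measurable_id.
rewrite ge0_integral_cons//; last exact: (measurableT_comp mf).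
pose b' : 'rV[R]_n := (\row_i b ord0 (lift ord0 i))%R.
have aE t x : (a *: cons_rV (t, x) + b = cons_rV (a * t + b ord0 ord0, a *: x + b'))%R.
  apply/rowP => i; rewrite [LHS]mxE [X in (X + _)%R]mxE.
  have [j ->|->] := unliftP ord0 i.
    by rewrite !cons_rVS !mxE.
  by rewrite !cons_rV0.
have mfc t : measurable_fun [set: 'rV[R]_n] (fun x => f (cons_rV (t, x))).
  by apply: (measurableT_comp mf); apply: measurable_fun_consr.
transitivity (\int[leb]_t (fun t => (`|a|^-1 ^+ n)%:E * \int[lebesgue_rV n]_x f (cons_rV (t, x)))
     (a * t + b ord0 ord0)%R).
  apply: eq_integral => t _ /=.
  rewrite -(IH b' (fun x => f (cons_rV (a * t + b ord0 ord0, x)%R)))//.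
  by apply: eq_integral => x _; rewrite aE.
have mI : measurable_fun [set: R] (fun t => \int[lebesgue_rV n]_x f (cons_rV (t, x))).
  have h : measurable_fun [set: R * 'rV[R]_n] (fun p => f (cons_rV (p.1, p.2))).
    by apply: (measurableT_comp mf); apply: measurable_fun_consr.
  exact: (measurable_fun_iint (lebesgue_rV n) h (fun=> f0 _)).
rewrite (@ge0_integral_affine _ _ _ (fun t => (`|a|^-1 ^+ n)%:E * \int[lebesgue_rV n]_x f (cons_rV (t, x))))//.
- rewrite ge0_integralZl_EFin ?exprn_ge0 ?invr_ge0//.
    rewrite muleA -EFinM exprS; congr (_ * _).
    by rewrite ge0_integral_cons.
  by move=> t _; exact: integral_ge0.
- exact: emeasurable_funM.
- by move=> t; rewrite mule_ge0 ?lee_fin ?exprn_ge0 ?invr_ge0//; exact: integral_ge0.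
Qed.

Lemma measurable_fun_rowmx k m d (T : measurableType d) (x : T -> 'rV[R]_k) (y : T -> 'rV[R]_m) :
  measurable_fun setT x -> measurable_fun setT y ->
  measurable_fun setT (fun z => row_mx (x z) (y z)).
Proof.
move=> mx my; apply/measurable_fun_coordP => i.
rewrite (_ : (fun _ => _) = fun z => match fintype.split i with inl j => x z ord0 j | inr j => y z ord0 j end).
  by case: splitP => j _; exact: (measurableT_comp (measurable_coord j)).
by apply/funext => z; rewrite mxE; case: splitP.
Qed.

Lemma ge0_integral_rowmx k m (f : 'rV[R]_(k + m) -> \bar R) :
  measurable_fun [set: 'rV[R]_(k + m)] f -> (forall x, 0 <= f x) ->
  \int[lebesgue_rV (k + m)]_x f x =
  \int[lebesgue_rV k]_x \int[lebesgue_rV m]_z f (row_mx x z).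
Proof.
elim: k f => [|k IH] f mf f0.
  rewrite ge0_integral_rV0; apply: eq_integral => x _; congr f.
  by apply/rowP => i; rewrite mxE; case: splitP => [[]//|j ij]; congr (x _ _); apply/val_inj.
rewrite (@ge0_integral_cons (k + m) f)//.
have mI n (g : 'rV[R]_(n + m) -> \bar R) : measurable_fun [set: 'rV[R]_(n + m)] g ->
    (forall x, 0 <= g x) ->
    measurable_fun [set: 'rV[R]_n] (fun x => \int[lebesgue_rV m]_z g (row_mx x z)).
  move=> mg g0.
  have h : measurable_fun [set: 'rV[R]_n * 'rV[R]_m] (fun p => g (row_mx p.1 p.2)).
    by apply: (measurableT_comp mg); apply: measurable_fun_rowmx.
  exact: (measurable_fun_iint (lebesgue_rV m) h (fun=> g0 _)).
rewrite (@ge0_integral_cons k); [|exact: (mI k.+1)|by move=> x; exact: integral_ge0].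
apply: eq_integral => t _; rewrite (IH (fun y => f (cons_rV (t, y)))); last 2 first.
- by apply: (measurableT_comp mf); apply: measurable_fun_consr.
- by move=> x; exact: f0.
apply: eq_integral => x _; apply: eq_integral => z _; congr f.
apply/rowP => i; have [j ->|->] := unliftP ord0 i.
  rewrite cons_rVS !mxE; case: splitP => [l jl|l jl]; case: splitP => [l' jl'|l' jl'].
  - have -> : l' = lift ord0 l by apply/val_inj; rewrite /= -jl' /= jl.
    by rewrite cons_rVS.
  - by exfalso; move: jl' (ltn_ord l); rewrite /= /bump /= jl; lia.
  - by exfalso; move: jl' (ltn_ord l'); rewrite /= /bump /= jl; lia.
  - by congr (z _ _); apply/val_inj; move: jl'; rewrite /= /bump /= jl; lia.
rewrite cons_rV0 mxE; case: splitP => [l jl|l jl] //.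
by rewrite (_ : l = ord0) ?cons_rV0//; apply/val_inj.
Qed.

(** The rotation is factored into one-variable substitutions. At fixed [t] the variable
    [X = a t + b s] costs the factor [1 / |b|]; after Tonelli the second coordinate is affine in [t]
    with slope [- 1 / b], which gives the factor back. For [b = 0] one has [|a| = 1], and each
    variable is treated alone. *)
Lemma ge0_integral_rot2 (a b : R) (G : R * R -> \bar R) : (a ^+ 2 + b ^+ 2 = 1)%R ->
  measurable_fun [set: R * R] G -> (forall x, 0 <= G x) ->
  \int[leb]_t \int[leb]_s G (a * t + b * s, a * s - b * t)%R =
  \int[leb]_t \int[leb]_s G (t, s).
Proof.
move=> ab mG G0.
have mG2 (f g : R * R -> R) : measurable_fun setT f -> measurable_fun setT g ->
   measurable_fun [set: R * R] (fun z => G (f z, g z)).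
  by move=> mf mg; apply: (measurableT_comp mG); exact: measurable_fun_pair.
have mG1 (f g : R -> R) : measurable_fun setT f -> measurable_fun setT g ->
   measurable_fun [set: R] (fun z => G (f z, g z)).
  by move=> mf mg; apply: (measurableT_comp mG); exact: measurable_fun_pair.
have mF (f g : R * R -> R) : measurable_fun setT f -> measurable_fun setT g ->
   measurable_fun [set: R] (fun t => \int[leb]_s G (f (t, s), g (t, s))).
  move=> mf mg; have h := mG2 f g mf mg.
  exact: (measurable_fun_iint leb h (fun=> G0 _)).
have [b0|b0] := eqVneq b 0%R.
  move: ab; rewrite b0 expr0n addr0 => a1.
  have an : `|a|%R = 1%R by apply/eqP; rewrite -(@eqrXn2 _ 2)// ?real_normK ?num_real// a1 expr1n.
  have a0 : a != 0%R by rewrite -normr_eq0 an oner_eq0.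
  under eq_integral => t _.
    under eq_integral do rewrite mul0r addr0 mul0r.
    rewrite (_ : (fun _ => _) = (fun s => (fun s => G (a * t, s)) (a * s + 0))%R); last first.
      by apply/funext => s; rewrite addr0 subr0.
    rewrite (@ge0_integral_affine _ a 0 (fun s => G (a * t, s)%R))//; last exact: mG1.
    rewrite an invr1 mul1e; over.
  rewrite (_ : (fun t => _) = (fun t => (fun t => \int[leb]_s G (t, s)) (a * t + 0)%R)); last first.
    by apply/funext => t; rewrite addr0.
  rewrite (@ge0_integral_affine _ a 0 (fun t => \int[leb]_s G (t, s)))//; last first.
  - by move=> t; exact: integral_ge0.
  - exact: (mF fst snd).
  by rewrite an invr1 mul1e.
have bi : (`|b|^-1 * `|b| = 1)%R by rewrite mulVf// normr_eq0.
have st1 t : \int[leb]_s G (a * t + b * s, a * s - b * t)%R =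
    `|b|^-1%:E * \int[leb]_X G (X, - b^-1 * t + a * X / b)%R.
  rewrite -(@ge0_integral_affine _ b (a * t) (fun X => G (X, - b^-1 * t + a * X / b)%R))//; last first.
    by apply: mG1 => //; apply: measurable_funD => //; apply: measurable_funM => //; exact: measurable_funM.
  apply: eq_integral => s _; congr (G (_, _)); first by rewrite addrC.
  have -> : (a * s - b * t = a * s - (1 - a ^+ 2) / b * t)%R.
    by rewrite -ab addrAC subrr add0r expr2 mulfK.
  by field.
under eq_integral do rewrite st1.
rewrite ge0_integralZl_EFin//; last 2 first.
- by move=> t _; exact: integral_ge0.
- apply: (mF snd (fun p => - b^-1 * p.1 + a * p.2 / b)%R) => //.
  by apply: measurable_funD; apply: measurable_funM => //; exact: measurable_funM.
rewrite (@fubini_tonelli _ _ _ _ _ leb leb (fun p => G (p.2, - b^-1 * p.1 + a * p.2 / b)%R))//; last first.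
  apply: mG2 => //.
  by apply: measurable_funD; apply: measurable_funM => //; exact: measurable_funM.
under eq_integral => X _.
  rewrite (@ge0_integral_affine _ (- b^-1) (a * X / b) (fun s => G (X, s)))//; last first.
  - exact: mG1.
  - by rewrite oppr_eq0 invr_eq0.
  rewrite normrN normfV invrK; over.
rewrite ge0_integralZl_EFin//; last 2 first.
- by move=> t _; exact: integral_ge0.
- exact: (mF fst snd).
by rewrite muleA -EFinM bi mul1e.
Qed.

(** Rotation invariance in the only form that is needed, replacing [x] by [|x|] times the first
    basis vector. By induction the tail of [x] may be aligned with its own first axis; a rotation of
    the plane of the first two coordinates then aligns [x]. *)
Lemma ge0_integral_rot n (f : R * R -> \bar R) (x : 'rV[R]_n.+1) :
  measurable_fun [set: R * R] f -> (forall z, 0 <= f z) ->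
  \int[lebesgue_rV n.+1]_y f (sqn y, dot x y) =
  \int[lebesgue_rV n.+1]_y f (sqn y, enorm x * y ord0 ord0)%R.
Proof.
move=> mf f0.
have mS m : measurable_fun [set: 'rV[R]_m] (@sqn m) by exact: measurable_sqn.
have m1 : forall m (z : 'rV[R]_m) (g : R * R -> \bar R), measurable_fun [set: R * R] g ->
    measurable_fun [set: 'rV[R]_m] (fun y => g (sqn y, dot z y)).
  move=> m z g mg.
  apply: (measurableT_comp mg); apply: measurable_fun_pair; first exact: mS.
  by apply: measurable_dot; [exact: measurable_cst|exact: measurable_id].
have m2 : forall m (z : R) (g : R * R -> \bar R), measurable_fun [set: R * R] g ->
    measurable_fun [set: 'rV[R]_m.+1] (fun y => g (sqn y, z * y ord0 ord0)%R).
  move=> m z g mg.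
  apply: (measurableT_comp mg); apply: measurable_fun_pair; first exact: mS.
  by apply: measurable_funM; [exact: measurable_cst|exact: (measurable_coord ord0)].
elim: n x f mf f0 => [|n IH] x f mf f0.
  rewrite ge0_integral_cons; [|exact: m1|by []].
  rewrite [RHS]ge0_integral_cons; [|exact: m2|by []].
  under eq_integral do rewrite ge0_integral_rV0.
  under [RHS]eq_integral do rewrite ge0_integral_rV0.
  have h (t : R) : sqn (cons_rV (t, 0%R : 'rV[R]_0)) = (t ^+ 2)%R.
    by rewrite sqn_cons /sqn big_ord0 addr0.
  have hd (t : R) : dot x (cons_rV (t, 0%R : 'rV[R]_0)) = (x ord0 ord0 * t)%R.
    by rewrite /dot big_ord1 cons_rV0.
  have hx : enorm x = `|x ord0 ord0|%R.
    by rewrite /enorm big_ord1 sqrtr_sqr.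
  under eq_integral do rewrite h hd.
  under [RHS]eq_integral do rewrite h cons_rV0 hx.
  have [x0|x0] := leP 0%R (x ord0 ord0); first by rewrite ger0_norm.
  rewrite ltr0_norm//.
  have mg : measurable_fun [set: R] (fun t => f (t ^+ 2, - x ord0 ord0 * t)%R).
    apply: (measurableT_comp mf); apply: measurable_fun_pair => //.
  have n1 : (-1 : R)%R != 0%R by rewrite oppr_eq0 oner_eq0.
  have := @ge0_integral_affine R (-1)%R 0%R _ n1 mg (fun=> f0 _).
  rewrite normrN1 invr1 mul1e => E.
  rewrite -[RHS]E; apply: eq_integral => t _; congr (f (_, _)); ring.
set N := enorm x; set x0 := x ord0 ord0.
set x' : 'rV[R]_n.+1 := (\row_i x ord0 (lift ord0 i))%R.
have xE : x = cons_rV (x0, x') by rewrite -[LHS]uncons_rVK.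
have N2 : (N ^+ 2 = x0 ^+ 2 + enorm x' ^+ 2)%R.
  by rewrite !sqr_enorm {1}xE sqn_cons.
(* Cosine and sine of the angle of the plane rotation; for [x = 0] any angle will do. *)
have [a [b [ab xa xb]]] : exists a b, [/\ a ^+ 2 + b ^+ 2 = 1, x0 = N * a & enorm x' = N * b]%R.
  have [N0|N0] := eqVneq N 0%R.
    exists 1%R, 0%R; rewrite expr1n expr0n addr0 N0 !mul0r.
    move: N2; rewrite N0 expr0n/= => /esym/eqP.
    by rewrite paddr_eq0 ?sqr_ge0// !sqrf_eq0 => /andP[/eqP -> /eqP ->].
  exists (x0 / N)%R, (enorm x' / N)%R; split; [|by field|by field].
  by rewrite !expr_div_n -mulrDl -N2 divff// sqrf_eq0.
have E1 (t s : R) : (x0 * t + enorm x' * s = N * (a * t + b * s))%R.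
  by rewrite xa xb; ring.
have E2 (t s : R) : (t ^+ 2 + s ^+ 2 = (a * t + b * s) ^+ 2 + (a * s - b * t) ^+ 2)%R.
  by rewrite -[LHS]mul1r -ab; ring.
pose G (p : R * R) := \int[lebesgue_rV n]_z f (p.1 ^+ 2 + p.2 ^+ 2 + sqn z, N * p.1)%R.
have mf2 d (T : measurableType d) (g h : T -> R) : measurable_fun setT g ->
    measurable_fun setT h -> measurable_fun [set: T] (fun p => f (g p, h p)).
  by move=> mg mh; apply: (measurableT_comp mf); exact: measurable_fun_pair.
have mG : measurable_fun [set: R * R] G.
  apply: (@measurable_fun_iint _ _ (R * R)%type 'rV[R]_n R (lebesgue_rV n)
    (fun q => f (q.1.1 ^+ 2 + q.1.2 ^+ 2 + sqn q.2, N * q.1.1)%R)) => //.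
  have h1 : measurable_fun [set: (R * R) * 'rV[R]_n] (fun q => q.1.1).
    exact: (measurableT_comp measurable_fst measurable_fst).
  have h2 : measurable_fun [set: (R * R) * 'rV[R]_n] (fun q => q.1.2).
    exact: (measurableT_comp measurable_snd measurable_fst).
  apply: mf2; last exact: measurable_funM.
  apply: measurable_funD; first by apply: measurable_funD; exact: measurable_funX.
  exact: (measurableT_comp (mS n) measurable_snd).
have G0 p : 0 <= G p by exact: integral_ge0.
transitivity (\int[leb]_t \int[leb]_s G (a * t + b * s, a * s - b * t)%R).
  rewrite (@ge0_integral_cons n.+1)//; last exact: m1.
  apply: eq_integral => t _.
  have mt : measurable_fun [set: R * R] (fun p => f (t ^+ 2 + p.1, x0 * t + p.2)%R).
    by apply: mf2; apply: measurable_funD.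
  transitivity (\int[lebesgue_rV n.+1]_y f (t ^+ 2 + sqn y, x0 * t + enorm x' * y ord0 ord0)%R).
    rewrite -(IH x' _ mt)//; apply: eq_integral => y _.
    by rewrite sqn_cons {1}xE dot_cons.
  rewrite (@ge0_integral_cons n); last 2 first.
  - exact: (m2 n (enorm x') (fun p => f (t ^+ 2 + p.1, x0 * t + p.2)%R)).
  - by move=> y; exact: f0.
  apply: eq_integral => s _; apply: eq_integral => z _ /=.
  rewrite sqn_cons cons_rV0 /= addrA -(E1 t s).
  by have <- := E2 t s.
rewrite ge0_integral_rot2//.
rewrite [RHS](@ge0_integral_cons n.+1)//; last exact: m2.
apply: eq_integral => t _; rewrite [RHS](@ge0_integral_cons n); last 2 first.
- apply: (measurableT_comp (m2 _ N f mf)); exact: measurable_fun_consr.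
- by move=> y; exact: f0.
apply: eq_integral => s _; apply: eq_integral => z _ /=.
by rewrite cons_rV0 !sqn_cons addrA.
Qed.

End lebesgue_rV_theory.

(** * Polar coordinates *)

Section radial.
Context {R : realType}.
Local Notation leb := (@lebesgue_measure R).
Local Open Scope ereal_scope.

(** The centre is removed, as it is from the cone over the sphere in [surface_measure]. *)
Definition unit_ball n : set 'rV[R]_n := [set x | (0 < enorm x <= 1)%R].

Lemma surface_unit_sphereE n :
  surface_measure (@unit_sphere R n) = (n%:R * fine (lebesgue_rV n (@unit_ball n)))%R.
Proof.
congr (_ * fine (lebesgue_rV n _))%R; apply/seteqP; split => x /=.
  move=> [r [y [/andP[r0 r1] y1 ->]]].
  by rewrite /unit_ball /= enormZ y1 mulr1 gtr0_norm// r0.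
move=> /andP[x0 x1]; exists (enorm x), ((enorm x)^-1 *: x)%R; split.
- by rewrite x0.
- by rewrite /unit_sphere /= enormZ gtr0_norm ?invr_gt0// mulVf// gt_eqF.
- by rewrite scalerA mulfV ?scale1r// gt_eqF.
Qed.

Lemma measurable_unit_ball n : measurable (@unit_ball n).
Proof.
have me : measurable_fun [set: 'rV[R]_n] (@enorm R n).
  by apply: measurable_enorm; exact: measurable_id.
have -> : @unit_ball n = (@enorm R n) @^-1` [set` `]0%R, 1%R]].
  by apply/seteqP; split => x; rewrite /unit_ball /= in_itv.
by rewrite -[X in measurable X]setTI; apply: me => //; exact: measurable_itv.
Qed.

Lemma coord_le_enorm n (x : 'rV[R]_n) i : (`|x ord0 i| <= enorm x)%R.
Proof.
rewrite -(@ler_pXn2r _ 2) ?nnegrE ?enorm_ge0// sqr_enorm real_normK ?num_real//.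
rewrite /sqn (bigD1 i)//= lerDl; apply: sumr_ge0 => j _; exact: sqr_ge0.
Qed.

Lemma lebesgue_unit_ball_fin n : lebesgue_rV n (@unit_ball n) < +oo.
Proof.
have mI : measurable (`[(-1)%R, 1%R]%classic : set R) by exact: measurable_itv.
have h := @lebesgue_rV_box R n (fun=> `[(-1)%R, 1%R]%classic) (fun=> mI).
apply: (@le_lt_trans _ _ (\prod_(i < n) lebesgue_measure (`[(-1)%R, 1%R]%classic : set R))).
  rewrite -h; apply: le_measure; rewrite ?inE.
  - exact: measurable_unit_ball.
  - rewrite (_ : mkset _ = \bigcap_(i in [set: 'I_n])
      ((fun x : 'rV[R]_n => x ord0 i) @^-1` `[(-1)%R, 1%R]%classic)).
      apply: fin_bigcap_measurable => // i _.
      by rewrite -[X in measurable X]setTI; exact: measurable_coord.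
    by apply/seteqP; split=> x /= => [h' i _|h' i]; exact: h'.
  - move=> x /andP[_ x1] i /=; rewrite in_itv/= -ler_norml.
    exact: le_trans (coord_le_enorm x i) x1.
rewrite lebesgue_measure_itv/= lte_fin gtrN//.
by rewrite -EFinB prodEFin ltry.
Qed.

Lemma measurable_rV_set0 n : measurable [set (0 : 'rV[R]_n)%R].
Proof.
have me : measurable_fun [set: 'rV[R]_n] (@enorm R n).
  by apply: measurable_enorm; exact: measurable_id.
have -> : [set (0 : 'rV[R]_n)%R] = (@enorm R n) @^-1` [set 0%R].
  by apply/seteqP; split => x /= => [->|/eqP]; [exact: enorm0|rewrite enorm_eq0 => /eqP].
by rewrite -[X in measurable X]setTI; apply: me => //; exact: measurable_set1.
Qed.

Lemma lebesgue_rV_set0 n : (0 < n)%N -> lebesgue_rV n [set (0 : 'rV[R]_n)%R] = 0.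
Proof.
move=> n0.
have mI : measurable ([set 0%R] : set R) by exact: measurable_set1.
have h := @lebesgue_rV_box R n (fun=> [set 0%R]) (fun=> mI).
transitivity (lebesgue_rV n [set x : 'rV[R]_n | forall i, x ord0 i = 0%R]).
  congr (lebesgue_rV n _); apply/seteqP; split => x /= => [->|h0]; first by move=> i; rewrite mxE.
  by apply/rowP => i; rewrite mxE.
rewrite h lebesgue_measure_set1; case: n n0 {h} => // n _.
by rewrite big_ord_recl mul0e.
Qed.

(** Domains of integration are traded for conditional integrands throughout, so that substitutions
    and Tonelli's theorem are applied on the whole space. *)
Lemma integral_if d (T : measurableType d) (mu : {measure set T -> \bar R})
    (b : T -> bool) (f : T -> \bar R) :
  \int[mu]_(x in [set x | b x]) f x = \int[mu]_x (if b x then f x else 0).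
Proof.
rewrite integral_mkcond; apply: eq_integral => x _; rewrite /patch.
by rewrite (_ : (x \in [set x | b x]) = b x)//; apply/idP/idP; rewrite inE.
Qed.

Lemma integral_pos_if (f : R -> \bar R) :
  \int[leb]_(r in `]0%R, +oo[) f r = \int[leb]_r (if (0 < r)%R then f r else 0).
Proof.
rewrite -integral_if; congr (integral _ _ _).
by apply/seteqP; split => x /=; rewrite in_itv/= andbT.
Qed.

Lemma integral_pow_tail n (a : R) : (0 < n)%N -> (0 < a)%R ->
  \int[leb]_(r in `[a, +oo[) (n%:R * r^-1 ^+ n.+1)%:E = (a^-1 ^+ n)%:E.
Proof.
case: n => // n _ a0.
have d (r : R) : (0 < r)%R ->
    is_derive r 1%R (fun r : R => - r^-1 ^+ n.+1)%R (n.+1%:R * r^-1 ^+ n.+2)%R.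
  move=> r0; have h : (r != 0)%R by rewrite gt_eqF.
  have d1 := @is_deriveV R id r 1%R 1%R h (is_derive_id _ _).
  have d2 := @is_deriveX R R (fun r : R => r^-1)%R n.+1 r 1%R _ d1.
  have -> : (fun r : R => - r^-1 ^+ n.+1)%R = (- (@GRing.inv R : R -> R) ^+ n.+1)%R.
    apply/funext => x; have E (m : nat) : (((@GRing.inv R : R -> R) ^+ m) x = x^-1 ^+ m)%R.
      by elim: m => // m IH; rewrite !exprS -IH.
    by rewrite -E.
  apply: (is_derive_eq (is_deriveN d2)); rewrite /GRing.scale/= mulr1 mulrN opprK -exprVn -mulrA -exprD.
  by rewrite addnC.
have dv (r : R) : (a <= r)%R -> (0 < r)%R by exact: lt_le_trans.
have cv (r : R) : (0 < r)%R -> {for r, continuous (fun r : R => r^-1)%R}.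
  by move=> r0; apply: inv_continuous; rewrite gt_eqF.
rewrite (@ge0_continuous_FTC2y _ (fun r => n.+1%:R * r^-1 ^+ n.+2)%R (fun r => - r^-1 ^+ n.+1)%R a 0%R).
- by rewrite -EFinB sub0r opprK.
- by move=> r /dv r0; rewrite mulr_ge0// exprn_ge0// invr_ge0 ltW.
- apply: continuous_in_subspaceT => r; rewrite inE/= in_itv/= andbT => /dv r0.
  apply: cvgM; first exact: cvg_cst.
  apply: (@continuous_comp _ _ _ (fun r : R => r^-1)%R (fun r => r ^+ n.+2)%R); first exact: cv.
  exact: exprn_continuous.
- rewrite -[X in _ --> X]oppr0; apply: cvgN.
  have : (fun r : R => r^-1)%R @ +oo%R --> (0 : R)%R.
    by apply/gtr0_cvgV0; [exact: nbhs_pinfty_gt|exact: cvg_id].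
  move=> h; have := @cvg_comp _ _ _ (fun r : R => r^-1)%R (fun r : R => r ^+ n.+1)%R _ _ _ h (@exprn_continuous _ n.+1 0%R).
  by rewrite expr0n.
- by move=> r ar; have [] := d r (dv r (ltW ar)).
- apply: cvg_at_right_filter; apply: cvgN.
  apply: (@continuous_comp _ _ _ (fun r : R => r^-1)%R (fun r => r ^+ n.+1)%R); first exact: cv.
  exact: exprn_continuous.
- move=> r; rewrite in_itv/= andbT => ar; rewrite derive1E.
  by have [_ ->] := d r (dv r (ltW ar)).
Qed.

Let mulE3 (a b c : R) (F : \bar R) :
  a%:E * (b%:E * (F * c%:E)) = (a * b * c)%:E * F.
Proof. by rewrite (muleC F) !muleA -!EFinM. Qed.

(* Polar coordinates from scaling and Tonelli alone: insert
   [1 = e ^+ n * \int_(r >= e) n r ^- n.+1] with [e = enorm x], swap, rescale [x] by [r]. *)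
Lemma ge0_integral_radial n (f : R -> \bar R) : (0 < n)%N ->
  measurable_fun [set: R] f -> (forall t, 0 <= f t) ->
  \int[lebesgue_rV n]_x f (enorm x) =
  (surface_measure (@unit_sphere R n))%:E *
    \int[leb]_(r in `]0%R, +oo[) (f r * (r ^+ n.-1)%:E).
Proof.
move=> n0 mf f0.
pose e (x : 'rV[R]_n) : R := enorm x.
have e0 x : (0 <= e x)%R by exact: enorm_ge0.
have me : measurable_fun [set: 'rV[R]_n] e by apply: measurable_enorm; exact: measurable_id.
have me1 : measurable_fun [set: 'rV[R]_n * R] (fun p => e p.1) by exact: (measurableT_comp me).
have me2 : measurable_fun [set: R * 'rV[R]_n] (fun p => e p.2) by exact: (measurableT_comp me).
pose I := \int[leb]_r (if (0 < r)%R then n%:R%:E * (f r * (r ^+ n.-1)%:E) else 0).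
pose g (r : R) := if (0 < r)%R then n%:R%:E * (f r * (r ^+ n.-1)%:E) else 0.
have g0 r : 0 <= g r.
  by rewrite /g; case: ifPn => // r0; rewrite !mule_ge0// lee_fin ?exprn_ge0// ltW.
have mg : measurable_fun [set: R] g.
  apply: measurable_fun_ifT => //; first exact: measurable_fun_ltr.
  apply: emeasurable_funM => //; apply: emeasurable_funM => //.
  by apply/measurable_EFinP; exact: measurable_funX.
(* [F] and [K] are the integrand before and after the rescaling of [x] by [r]. Integrating [F] in
   [r] first gives the volume of the ball times [I]; integrating [K] in [r] first gives [f] back. *)
pose F (p : 'rV[R]_n * R) : \bar R :=
  if ((0 < e p.1) && (e p.1 <= 1))%R then (e p.1)%:E * g (e p.1 * p.2)%R else 0.
have F0 p : 0 <= F p by rewrite /F; case: ifPn => // _; rewrite mule_ge0// lee_fin.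
have mF : measurable_fun [set: 'rV[R]_n * R] F.
  apply: measurable_fun_ifT => //.
    by apply: measurable_and; [exact: measurable_fun_ltr|exact: measurable_fun_ler].
  apply: emeasurable_funM; first by apply/measurable_EFinP.
  by apply: (measurableT_comp mg); exact: measurable_funM.
have A : \int[lebesgue_rV n]_x \int[leb]_r F (x, r) = lebesgue_rV n (@unit_ball n) * I.
  transitivity (\int[lebesgue_rV n]_x (if ((0 < e x) && (e x <= 1))%R then I else 0)).
    apply: eq_integral => x _; rewrite /F /=; case: ifPn => [/andP[ex0 ex1]|_]; last exact: integral0.
    rewrite ge0_integralZl_EFin//; last first.
      by apply: (measurableT_comp mg); exact: measurable_funM.
    under eq_integral => r _ do rewrite -[(e x * r)%R]addr0.
    rewrite (@ge0_integral_affine R (e x) 0%R g)// ?gt_eqF//.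
    by rewrite muleA -EFinM gtr0_norm// divff ?gt_eqF// mul1e.
  rewrite -integral_if integral_cst; last exact: measurable_unit_ball.
  by rewrite muleC.
pose K (p : R * 'rV[R]_n) : \bar R :=
  if ((0 < p.1) && ((0 < e p.2) && (e p.2 <= p.1)))%R then
    (n%:R * p.1^-1 ^+ n.+1)%:E * (f (e p.2) * (e p.2 ^+ n)%:E) else 0.
have K0 p : 0 <= K p.
  rewrite /K; case: ifPn => // /andP[p0 _]; rewrite !mule_ge0// lee_fin ?exprn_ge0//.
  by rewrite mulr_ge0// exprn_ge0// invr_ge0 ltW.
have mV : measurable_fun [set: R] (fun r : R => r `^ (-1))%R by exact: measurable_powR.
have mK : measurable_fun [set: R * 'rV[R]_n] K.
  have -> : K = fun p => if ((0 < p.1) && ((0 < e p.2) && (e p.2 <= p.1)))%R then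
    (n%:R * (p.1 `^ (-1)) ^+ n.+1)%:E * (f (e p.2) * (e p.2 ^+ n)%:E) else 0.
    apply/funext => p; rewrite /K; case: ifPn => // /andP[p0 _].
    by rewrite powR_inv1// ltW.
  apply: measurable_fun_ifT => //.
    apply: measurable_and; first exact: measurable_fun_ltr.
    by apply: measurable_and; [exact: measurable_fun_ltr|exact: measurable_fun_ler].
  apply: emeasurable_funM.
    apply/measurable_EFinP; apply: measurable_funM => //; apply: measurable_funX.
    exact: (measurableT_comp mV).
  apply: emeasurable_funM; first exact: (measurableT_comp mf).
  by apply/measurable_EFinP; exact: measurable_funX.
have B r : \int[lebesgue_rV n]_x F (x, r) = \int[lebesgue_rV n]_z K (r, z).
  have [r0|r0] := ltP 0%R r; last first.
    rewrite !integral0_eq// => x _.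
      by rewrite /K /= ltNge r0.
    rewrite /F /g /=; case: ifPn => // /andP[ex0 _].
    by rewrite pmulr_rgt0// ltNge r0/= mule0.
  have rn0 : (r != 0)%R by rewrite gt_eqF.
  have -> : \int[lebesgue_rV n]_z K (r, z) = (r^-1 ^+ n)%:E *
      \int[lebesgue_rV n]_z ((r ^+ n)%:E * K (r, z)).
    rewrite ge0_integralZl_EFin ?exprn_ge0// ?ltW//; last first.
      by apply: (measurableT_comp mK); exact: measurable_fun_pair.
    by rewrite muleA -EFinM -exprMn mulVf// expr1n mul1e.
  rewrite -[X in (X^-1 ^+ n)%R](gtr0_norm r0).
  rewrite -(@ge0_integral_rV_affine R n r 0%R (fun z => (r ^+ n)%:E * K (r, z)) rn0); last 2 first.
  - apply: emeasurable_funM => //.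
    by apply: (measurableT_comp mK); exact: measurable_fun_pair.
  - by move=> z; rewrite mule_ge0// lee_fin exprn_ge0// ltW.
  apply: eq_integral => x _; rewrite addr0 /F /K /= r0/=.
  rewrite /e enormZ gtr0_norm// pmulr_rgt0// -/(e x).
  have -> : (r * e x <= r)%R = (e x <= 1)%R by rewrite -{2}[r]mulr1 ler_pM2l.
  case: ifPn => [/andP[ex0 ex1]|_]; last by rewrite mule0.
  rewrite /g mulr_gt0// mulE3 mulE3 (mulrC (e x) r); congr (_%:E * _).
  have h : (r ^+ n * r^-1 ^+ n.+1 = r^-1)%R.
    by rewrite exprS mulrCA -exprMn divff// expr1n mulr1.
  have -> : ((r * e x) ^+ n = (r * e x) * (r * e x) ^+ n.-1)%R by rewrite -exprS prednK.
  have -> : (r ^+ n * (n%:R * r^-1 ^+ n.+1) = n%:R * r^-1)%R by rewrite mulrCA h.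
  set P := (_ ^+ n.-1)%R; field; exact: rn0.
have C z : \int[leb]_r K (r, z) = if (0 < e z)%R then f (e z) else 0.
  case: ifPn => [ez0|ez0]; last first.
    by rewrite integral0_eq// => r _; rewrite /K /= (negbTE ez0) andbF.
  transitivity (\int[leb]_(r in `[e z, +oo[) ((n%:R * r^-1 ^+ n.+1)%:E * (f (e z) * (e z ^+ n)%:E))).
    rewrite (_ : `[e z, +oo[%classic = [set r | e z <= r]%R); last first.
      by apply/seteqP; split => r /=; rewrite in_itv/= andbT.
    rewrite integral_if; apply: eq_integral => r _; rewrite /K /= ez0/=.
    by case: (leP (e z) r) => [er|]; rewrite ?andbF// (lt_le_trans ez0 er).
  rewrite ge0_integralZr//; last 3 first.
  - have -> : (fun r : R => (n%:R * r^-1 ^+ n.+1)%:E) = EFin \o (fun r : R => n%:R * r^-1 ^+ n.+1)%R by [].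
    apply/measurable_EFinP; apply: measurable_funM => //; apply: measurable_funX.
    apply: (@eq_measurable_fun _ _ _ _ _ (fun r : R => r `^ (-1))%R); last exact: measurable_funTS.
    move=> r; rewrite inE/= in_itv/= andbT => er; rewrite powR_inv1//.
    by rewrite ltW// (lt_le_trans ez0).
  - move=> r; rewrite /= in_itv/= andbT => er; rewrite lee_fin mulr_ge0// exprn_ge0// invr_ge0.
    by rewrite ltW// (lt_le_trans ez0).
  - by rewrite mule_ge0// lee_fin exprn_ge0.
  rewrite integral_pow_tail// muleCA -EFinM -exprMn mulVf ?gt_eqF// expr1n mule1.
  by [].
have E : n%:R%:E * \int[leb]_(r in `]0%R, +oo[) (f r * (r ^+ n.-1)%:E) = I.
  rewrite -ge0_integralZl_EFin//; last 2 first.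
  - move=> r; rewrite /= in_itv/= andbT => r0; rewrite mule_ge0// lee_fin exprn_ge0//.
    exact: ltW.
  - apply: measurable_funTS; apply: emeasurable_funM => //.
    by apply/measurable_EFinP; exact: measurable_funX.
  by rewrite integral_pos_if.
transitivity (\int[lebesgue_rV n]_z (if (0 < e z)%R then f (e z) else 0)).
  apply: ge0_ae_eq_integral => //.
  - exact: (measurableT_comp mf).
  - apply: measurable_fun_ifT => //; first exact: measurable_fun_ltr.
    exact: (measurableT_comp mf).
  - by move=> x _; case: ifPn.
  - exists [set 0%R]; split; [|exact: lebesgue_rV_set0|].
    + exact: measurable_rV_set0.
    + move=> x /= /not_implyP[_]; case: ifPn => // h _.
      by apply/eqP; move: h; rewrite enorm_gt0 negbK.
under eq_integral do rewrite -C.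
rewrite -(@fubini_tonelli _ _ _ _ _ leb (lebesgue_rV n) K)//.
under eq_integral do rewrite -B.
rewrite -(@fubini_tonelli _ _ _ _ _ (lebesgue_rV n) leb F)// A.
rewrite surface_unit_sphereE EFinM -muleA -E muleCA fineK//.
by rewrite ge0_fin_numE//; exact: lebesgue_unit_ball_fin.
Qed.

End radial.

(** * Half-line, Gamma and zonal integrals *)

Section half_line.
Context {R : realType}.
Local Notation leb := (@lebesgue_measure R).
Local Open Scope ereal_scope.

(** The half-line is encoded in the integrand, so that scalings and exchanges of integrals need no
    change of domain. *)
Definition ipos (f : R -> \bar R) : \bar R :=
  \int[leb]_r (if (0 < r)%R then f r else 0).

Lemma eq_ipos (f g : R -> \bar R) : (forall r, (0 < r)%R -> f r = g r) -> ipos f = ipos g.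
Proof. by move=> fg; apply: eq_integral => r _; case: ifPn => // /fg. Qed.

Lemma ipos_ge0 (f : R -> \bar R) : (forall r, (0 < r)%R -> 0 <= f r) -> 0 <= ipos f.
Proof. by move=> f0; apply: integral_ge0 => r _; case: ifPn => // /f0. Qed.

Lemma measurable_pos_if d (T : measurableType d) (g : T -> R) (f : T -> \bar R) :
  measurable_fun setT g -> measurable_fun setT f ->
  measurable_fun [set: T] (fun r => if (0 < g r)%R then f r else 0).
Proof.
by move=> mg mf; apply: measurable_fun_ifT => //; exact: measurable_fun_ltr.
Qed.

Lemma iposZ (c : R) (f : R -> \bar R) : (0 <= c)%R -> measurable_fun [set: R] f ->
  (forall r, 0 <= f r) -> ipos (fun r => c%:E * f r) = c%:E * ipos f.
Proof.
move=> c0 mf f0; rewrite /ipos -ge0_integralZl_EFin//.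
- by apply: eq_integral => r _; case: ifPn; rewrite ?mule0.
- by move=> r _; case: ifPn.
- exact: measurable_pos_if.
Qed.

Lemma iposD (f g : R -> \bar R) : measurable_fun [set: R] f -> measurable_fun [set: R] g ->
  (forall r, 0 <= f r) -> (forall r, 0 <= g r) ->
  ipos (fun r => f r + g r) = ipos f + ipos g.
Proof.
move=> mf mg f0 g0; rewrite /ipos -ge0_integralD//.
- by apply: eq_integral => r _; case: ifPn; rewrite ?adde0.
- by move=> r _; case: ifPn.
- exact: measurable_pos_if.
- by move=> r _; case: ifPn.
- exact: measurable_pos_if.
Qed.

Lemma le_ipos (f g : R -> \bar R) : measurable_fun [set: R] f -> measurable_fun [set: R] g ->
  (forall r, (0 < r)%R -> 0 <= f r) -> (forall r, (0 < r)%R -> f r <= g r) -> ipos f <= ipos g.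
Proof.
move=> mf mg f0 fg; apply: ge0_le_integral => //.
- by move=> r _; case: ifPn => // /f0.
- exact: measurable_pos_if.
- exact: measurable_pos_if.
- by move=> r _; case: ifPn => // /fg.
Qed.

Lemma ipos_scale (c : R) (f : R -> \bar R) : (0 < c)%R -> measurable_fun [set: R] f ->
  (forall r, 0 <= f r) -> ipos (fun r => f (c * r)%R) = c^-1%:E * ipos f.
Proof.
move=> c0 mf f0.
have := @ge0_integral_affine R c 0%R (fun r => if (0 < r)%R then f r else 0) (lt0r_neq0 c0).
rewrite (gtr0_norm c0) => <-; last 2 first.
- exact: measurable_pos_if.
- by move=> r; case: ifPn.
by apply: eq_integral => r _; rewrite addr0 pmulr_rgt0.
Qed.

Lemma iposT (f : R -> \bar R) : measurable_fun [set: R] f -> (forall r, 0 <= f r) ->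
  \int[leb]_r f r = ipos (fun r => f r + f (- r)%R).
Proof.
move=> mf f0.
have mN : measurable_fun [set: R] (fun r : R => f (- r)%R).
  by apply: (measurableT_comp mf); exact: oppr_measurable.
have n1 : (-1 : R)%R != 0%R by rewrite oppr_eq0 oner_eq0.
have E : ipos (fun r => f (- r)%R) = \int[leb]_r (if (r < 0)%R then f r else 0).
  have mg : measurable_fun [set: R] (fun r : R => if (r < 0)%R then f r else 0).
    by apply: measurable_fun_ifT => //; exact: measurable_fun_ltr.
  have := @ge0_integral_affine R (-1)%R 0%R _ n1 mg.
  rewrite normrN1 invr1 mul1e => <-; last by move=> r; case: ifPn.
  by apply: eq_integral => r _; rewrite addr0 mulN1r oppr_lt0.
rewrite iposD// E -ge0_integralD//.
- have mi : measurable_fun [set: R] (fun r => (if (0 < r)%R then f r else 0) + (if (r < 0)%R then f r else 0)).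
    apply: emeasurable_funD; first exact: measurable_pos_if.
    by apply: measurable_fun_ifT => //; exact: measurable_fun_ltr.
  apply: ge0_ae_eq_integral => //.
    by move=> r _; rewrite adde_ge0//; case: ifPn.
  exists [set 0%R]; split; [exact: measurable_set1|exact: lebesgue_measure_set1|].
  move=> r /= /not_implyP[_]; case: ltgtP => //; first by rewrite adde0.
  by rewrite add0e.
- by move=> r _; case: ifPn.
- exact: measurable_pos_if.
- by move=> r _; case: ifPn.
- by apply: measurable_fun_ifT => //; exact: measurable_fun_ltr.
Qed.

Lemma ipos_swap d (T : measurableType d) (mu : {sigma_finite_measure set T -> \bar R})
    (f : R * T -> \bar R) : measurable_fun [set: R * T] f -> (forall p, 0 <= f p) ->
  ipos (fun r => \int[mu]_x f (r, x)) = \int[mu]_x ipos (fun r => f (r, x)).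
Proof.
move=> mf f0; rewrite /ipos.
have mg : measurable_fun [set: R * T] (fun p => if (0 < p.1)%R then f p else 0).
  exact: measurable_pos_if.
rewrite -(@fubini_tonelli _ _ _ _ _ leb mu (fun p => if (0 < p.1)%R then f p else 0))//; last first.
  by move=> p; case: ifPn.
by apply: eq_integral => r _ /=; case: ifPn => // _; rewrite integral0.
Qed.

Lemma ipos_swap2 (f : R * R -> \bar R) : measurable_fun [set: R * R] f -> (forall p, 0 <= f p) ->
  ipos (fun r => ipos (fun x => f (r, x))) = ipos (fun x => ipos (fun r => f (r, x))).
Proof.
move=> mf f0.
have mg : measurable_fun [set: R * R] (fun p => if (0 < p.2)%R then f p else 0).
  by apply: measurable_pos_if.
rewrite [LHS](@ipos_swap _ _ leb (fun p => if (0 < p.2)%R then f p else 0))//; last first.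
  by move=> p; case: ifPn.
apply: eq_integral => x _ /=; case: ifPn => // _.
by rewrite /ipos; under eq_integral do rewrite if_same; rewrite integral0.
Qed.

Lemma measurable_ipos d (T : measurableType d) (f : T * R -> \bar R) :
  measurable_fun [set: T * R] f -> (forall p, 0 <= f p) ->
  measurable_fun [set: T] (fun x => ipos (fun r => f (x, r))).
Proof.
move=> mf f0.
have mg : measurable_fun [set: T * R] (fun p => if (0 < p.2)%R then f p else 0).
  by apply: measurable_pos_if.
by apply: (measurable_fun_iint leb mg) => p; case: ifPn.
Qed.

Lemma is_derive_powR_pos (a r : R) : (0 < r)%R ->
  is_derive r 1%R (fun r : R => a^-1 * r `^ a)%R (if a == 0 then 0 else r `^ (a - 1))%R.
Proof.
move=> r0; have h := @is_derive1_powR R a r r0.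
apply: is_derive_eq; rewrite /GRing.scale/=; case: eqVneq => [->|a0].
  by rewrite invr0 mul0r.
by rewrite mulrA mulVf// mul1r.
Qed.

Lemma continuous_powR_pos (a r : R) : (0 < r)%R -> {for r, continuous (fun r : R => r `^ a)}%R.
Proof.
move=> r0; apply/differentiable_continuous/derivable1_diffP.
by have [] := @is_derive1_powR R a r r0.
Qed.

Lemma integral_powR_tail (a c : R) : (0 < a)%R -> (0 < c)%R ->
  \int[leb]_(r in `[c, +oo[) (r `^ (- a - 1))%:E = (a^-1 * c `^ (- a))%:E.
Proof.
move=> a0 c0; have dv (r : R) : (c <= r)%R -> (0 < r)%R by exact: lt_le_trans.
have na0 : (- a != 0)%R by rewrite oppr_eq0 gt_eqF.
have d (r : R) : (0 < r)%R -> is_derive r 1%R (fun r : R => (- a)^-1 * r `^ (- a))%R (r `^ (- a - 1))%R.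
  by move=> r0; have := @is_derive_powR_pos (- a) r r0; rewrite (negbTE na0).
rewrite (@ge0_continuous_FTC2y _ (fun r => r `^ (- a - 1))%R (fun r => (- a)^-1 * r `^ (- a))%R c 0%R).
- by rewrite -EFinB sub0r invrN mulNr opprK.
- by move=> r _; exact: powR_ge0.
- apply: continuous_in_subspaceT => r; rewrite inE/= in_itv/= andbT => /dv r0.
  exact: continuous_powR_pos.
- rewrite -[X in _ --> X](mulr0 ((- a)^-1)%R); apply: cvgM; first exact: cvg_cst.
  have h : (fun r : R => r `^ a)%R @ +oo%R --> +oo%R.
    apply/cvgryPge => A; near=> r.
    have r0 : (0 <= r)%R by near: r; exact: nbhs_pinfty_ge.
    apply: (@le_trans _ _ ((`|A| `^ a^-1) `^ a)%R).
      by rewrite -powRrM mulVf ?gt_eqF// powRr1// ler_norm.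
    rewrite ge0_ler_powR ?nnegrE ?powR_ge0// ?ltW//.
  have -> : (fun r : R => r `^ (- a))%R = (fun r : R => (r `^ a)^-1)%R.
    by apply/funext => r; rewrite powRN.
  by apply/gtr0_cvgV0 => //; near=> r; rewrite powR_gt0//; near: r; exact: nbhs_pinfty_gt.
- by move=> r cr; have [] := d r (dv r (ltW cr)).
- apply: cvg_at_right_filter; apply: cvgM; first exact: cvg_cst.
  exact: continuous_powR_pos.
- move=> r; rewrite in_itv/= andbT => cr; rewrite derive1E.
  by have [_ ->] := d r (dv r (ltW cr)).
Unshelve. all: by end_near. Qed.

Lemma bigcup_itv_inv (c : R) : (0 < c)%R ->
  \bigcup_n [set` `[c / n.+1%:R, c]%R] = [set` `]0, c]%R] :> set R.
Proof.
move=> c0; apply/seteqP; split => [r [n _]/=|r /=]; rewrite !in_itv/= => /andP[r1 r2].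
  by rewrite r2 andbT (lt_le_trans _ r1)// divr_gt0.
exists (Num.bound (c / r)) => //=; rewrite in_itv/= r2 andbT.
have := archi_boundP (divr_ge0 (ltW c0) (ltW r1)).
rewrite ltr_pdivrMr// => h; rewrite ler_pdivrMr//.
by rewrite (le_trans (ltW h))// mulrC ler_pM2l// ler_nat.
Qed.

(** The integrand may blow up at 0, so the fundamental theorem of calculus is applied on
    [[c / (n + 1), c]] and followed by monotone convergence. *)
Lemma integral_powR_bounded (a c : R) : (0 < a)%R -> (0 < c)%R ->
  \int[leb]_(r in `]0%R, c]) (r `^ (a - 1))%:E = (a^-1 * c `^ a)%:E.
Proof.
move=> a0 c0; rewrite -bigcup_itv_inv//.
have mf : measurable_fun [set: R] (fun r : R => (r `^ (a - 1))%:E).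
  by apply/measurable_EFinP; exact: measurable_powR.
pose B n : set R := [set` `[c / n.+1%:R, c]%R].
have ndB : nondecreasing_seq B.
  apply/nondecreasing_seqP => n; apply/subsetPset => r; rewrite /B /= !in_itv/= => /andP[h ->].
  rewrite andbT (le_trans _ h)// ler_pM2l// lef_pV2 ?posrE//.
  by rewrite ler_nat.
have mB n : measurable (B n) by exact: measurable_itv.
have mfB n : measurable_fun (B n) (fun r : R => (r `^ (a - 1))%:E) by exact: measurable_funTS.
have f0 n r : B n r -> 0 <= (r `^ (a - 1))%:E by move=> _; rewrite lee_fin powR_ge0.
have /cvg_lim <- // := @ge0_nondecreasing_set_cvg_integral _ (measurableTypeR R) R B
  (fun r : R => (r `^ (a - 1))%:E) leb ndB mB mfB f0.
(* The index is shifted by one because the first interval is a single point. *)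
have E n : \int[leb]_(r in [set` `[c / n.+2%:R, c]%R]) (r `^ (a - 1))%:E =
    (a^-1 * c `^ a)%:E - (a^-1 * (c / n.+2%:R) `^ a)%:E.
  have cn0 : (0 < c / n.+2%:R)%R by rewrite divr_gt0.
  have d (r : R) : (0 < r)%R -> is_derive r 1%R (fun r : R => a^-1 * r `^ a)%R (r `^ (a - 1))%R.
    by move=> r0; have := @is_derive_powR_pos a r r0; rewrite gt_eqF.
  apply: (@continuous_FTC2 R (fun r : R => r `^ (a - 1))%R (fun r : R => a^-1 * r `^ a)%R).
  - by rewrite ltr_pdivrMr// ltr_pMr// ltr1n.
  - apply: continuous_in_subspaceT => r; rewrite inE/= in_itv/= => /andP[r1 _].
    by apply: continuous_powR_pos; exact: lt_le_trans r1.
  - split.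
    + by move=> r; rewrite in_itv/= => /andP[r1 _]; have [] := d r (lt_trans cn0 r1).
    + apply: cvg_at_right_filter; apply: cvgM; first exact: cvg_cst.
      exact: continuous_powR_pos.
    + apply: cvg_at_left_filter; apply: cvgM; first exact: cvg_cst.
      exact: continuous_powR_pos.
  - move=> r; rewrite in_itv/= => /andP[r1 _]; rewrite derive1E.
    by have [_ ->] := d r (lt_trans cn0 r1).
apply/cvg_lim => //; rewrite -(cvg_shiftS (fun n => \int[leb]_(r in B n) (r `^ (a - 1))%:E)).
rewrite (_ : (fun _ => _) = (fun n => (a^-1 * c `^ a - a^-1 * (c / n.+2%:R) `^ a)%:E)); last first.
  by apply/funext => n; rewrite E EFinB.
apply: cvg_EFin; first by near=> n.
rewrite -[X in _ --> X]subr0; apply: cvgB; first exact: cvg_cst.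
rewrite -[X in _ --> X](mulr0 (a^-1)%R); apply: cvgM; first exact: cvg_cst.
have h : (fun n => c / n.+2%:R)%R @ \oo --> 0%R.
  rewrite -[X in _ --> X](mulr0 c); apply: cvgM; first exact: cvg_cst.
  by have := @cvg_harmonic R; rewrite -(cvg_shiftS (@harmonic R)).
have := @continuous_abs_powR R a a0 0%R; rewrite /continuous_at normr0 powR0 ?gt_eqF// => h2.
have := cvg_comp _ _ h h2; apply: cvg_trans; apply: near_eq_cvg; near=> n.
by rewrite /= ger0_norm// divr_ge0// ltW.
Unshelve. all: by end_near. Qed.

End half_line.

(** * Gamma and Gaussian integrals *)

Section gamma_integrals.
Context {R : realType}.
Local Notation leb := (@lebesgue_measure R).
Local Open Scope ereal_scope.

Lemma integral_bounded_ipos (f : R -> \bar R) (c : R) :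
  \int[leb]_(r in [set` `]0, c]%R]) f r = ipos (fun r => if (r <= c)%R then f r else 0).
Proof.
rewrite /ipos (_ : [set` `]0, c]%R] = [set r | (0 < r) && (r <= c)]%R); last first.
  by apply/seteqP; split => r /=; rewrite in_itv.
by rewrite integral_if; apply: eq_integral => r _; case: (0 < r)%R.
Qed.

Lemma integral_tail_ipos (f : R -> \bar R) (c : R) : (0 < c)%R ->
  \int[leb]_(r in [set` `[c, +oo[%R]) f r = ipos (fun r => if (c <= r)%R then f r else 0).
Proof.
move=> c0; rewrite /ipos (_ : [set` `[c, +oo[%R] = [set r | c <= r]%R); last first.
  by apply/seteqP; split => r /=; rewrite in_itv/= andbT.
rewrite integral_if; apply: eq_integral => r _; case: (ltP 0%R r) => // r0.
by rewrite leNgt (le_lt_trans r0 c0).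
Qed.

Lemma ipos_powR_tail (a c : R) : (0 < a)%R -> (0 < c)%R ->
  ipos (fun r => if (c <= r)%R then (r `^ (- a - 1))%:E else 0) = (a^-1 * c `^ (- a))%:E.
Proof. by move=> a0 c0; rewrite -integral_tail_ipos// integral_powR_tail. Qed.

Lemma ipos_powR_bounded (a c : R) : (0 < a)%R -> (0 < c)%R ->
  ipos (fun r => if (r <= c)%R then (r `^ (a - 1))%:E else 0) = (a^-1 * c `^ a)%:E.
Proof. by move=> a0 c0; rewrite -integral_bounded_ipos// integral_powR_bounded. Qed.

Lemma ipos_gt0 (f : R -> \bar R) (a b : R) : (0 <= a < b)%R ->
  measurable_fun [set: R] f -> (forall r, 0 <= f r) ->
  (forall r, (a < r < b)%R -> 0 < f r) -> 0 < ipos f.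
Proof.
move=> /andP[a0 ab] mf f0 fp; rewrite lt_neqAle ipos_ge0// andbT; apply/eqP => I0.
have mg : measurable_fun [set: R] (fun r => if (0 < r)%R then f r else 0).
  exact: measurable_pos_if.
have g0 r : 0 <= (if (0 < r)%R then f r else 0) by case: ifPn.
have : \int[leb]_r `|(if (0 < r)%R then f r else 0)| = 0.
  by transitivity (ipos f) => //; apply: eq_integral => r _; rewrite gee0_abs.
move=> /(ae_eq_integral_abs leb measurableT mg)[N [mN N0 subN]].
have : leb [set` `]a, b[%R] <= leb N.
  apply: le_measure; rewrite ?inE; [exact: measurable_itv|exact: mN|].
  move=> r; rewrite /= in_itv/= => rab; apply: subN => /= /(_ I).
  rewrite (le_lt_trans a0 (proj1 (andP rab))) => /eqP; apply/negP.
  by rewrite gt_eqF// fp.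
by rewrite N0 lebesgue_measure_itv/= lte_fin ab -EFinB lee_fin leNgt subr_gt0 ab.
Qed.

(** [Gamma] is the [fine] part of this integral, so identities are proved here and transferred once
    finiteness is known. *)
Definition GammaE (q : R) : \bar R := ipos (fun t => (t `^ (q - 1) * expR (- t))%:E).

Let measurable_Gamma_fun (a b : R) :
  measurable_fun [set: R] (fun t => (t `^ a * expR (- (b * t)))%:E).
Proof.
apply/measurable_EFinP; apply: measurable_funM; first exact: measurable_powR.
apply: (measurableT_comp (@measurable_expR R)).
by apply: (measurableT_comp (@oppr_measurable R _)); exact: measurable_funM.
Qed.

Lemma GammaE_Gamma (q : R) : Gamma q = fine (GammaE q).
Proof. by rewrite /Gamma /Rintegral integral_pos_if. Qed.

Lemma GammaE_gt0 (q : R) : 0 < GammaE q.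
Proof.
apply: (@ipos_gt0 _ 0%R 1%R); first by rewrite lexx ltr01.
- by have := measurable_Gamma_fun (q - 1) 1; under eq_fun do rewrite mul1r.
- by move=> r; rewrite lee_fin mulr_ge0// ?powR_ge0// expR_ge0.
- by move=> r /andP[r0 _]; rewrite lte_fin mulr_gt0// ?powR_gt0// expR_gt0.
Qed.

(** The inequality [x <= expR x] at [x = t / a], raised to the power [a]. *)
Lemma powR_le_expR (a t : R) : (0 < a)%R -> (0 < t)%R -> (t `^ a <= a `^ a * expR t)%R.
Proof.
move=> a0 t0.
have -> : (t `^ a = a `^ a * (t / a) `^ a)%R.
  rewrite -powRM ?(ltW a0)// ?divr_ge0 ?ltW//; congr (_ `^ _)%R.
  by rewrite mulrC divfK// gt_eqF.
have -> : expR t = ((expR (t / a)) `^ a)%R.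
  by rewrite /powR gt_eqF ?expR_gt0// expRK mulrC divfK// gt_eqF.
rewrite ler_pM2l ?powR_gt0// ge0_ler_powR ?nnegrE ?expR_ge0 ?divr_ge0 ?(ltW a0) ?(ltW t0)//.
by apply: le_trans (expR_ge1Dx _); rewrite lerDr.
Qed.

(** The integrand is compared with [t ^ (q - 1)] below 1 and, by the exponential bound on
    [t ^ (q + 1)], with a multiple of [t ^ (- 2)] above 1. *)
Lemma GammaE_fin (q : R) : (0 < q)%R -> GammaE q < +oo.
Proof.
move=> q0; pose a := (q + 1)%R.
have a0 : (0 < a)%R by rewrite addr_gt0.
have mp (b : R) : measurable_fun [set: R] (fun r : R => (r `^ b)%:E).
  by apply/measurable_EFinP; exact: measurable_powR.
have m1 : measurable_fun [set: R] (fun r : R => if (r <= 1)%R then (r `^ (q - 1))%:E else 0).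
  by apply: measurable_fun_ifT => //; exact: measurable_fun_ler.
have m2 : measurable_fun [set: R] (fun r : R => if (1 <= r)%R then (r `^ (- 1 - 1))%:E else 0).
  by apply: measurable_fun_ifT => //; exact: measurable_fun_ler.
have p1 (r : R) : 0 <= (if (r <= 1)%R then (r `^ (q - 1))%:E else 0).
  by case: ifPn => // _; rewrite lee_fin powR_ge0.
have p2 (r : R) : 0 <= (if (1 <= r)%R then (r `^ (- 1 - 1))%:E else 0).
  by case: ifPn => // _; rewrite lee_fin powR_ge0.
apply: (@le_lt_trans _ _ (ipos (fun r : R => (if (r <= 1)%R then (r `^ (q - 1))%:E else 0) +
    (a `^ a)%:E * (if (1 <= r)%R then (r `^ (- 1 - 1))%:E else 0)))).
  apply: le_ipos.
  - by have := measurable_Gamma_fun (q - 1) 1; under eq_fun do rewrite mul1r.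
  - by apply: emeasurable_funD => //; exact: emeasurable_funM.
  - by move=> r _; rewrite lee_fin mulr_ge0// ?powR_ge0// expR_ge0.
  - move=> r r0; have [r1|r1] := leP r 1%R.
      rewrite -[leLHS]adde0; apply: leeD; last by rewrite mule_ge0// lee_fin powR_ge0.
      by rewrite lee_fin ler_piMr ?powR_ge0// -expR0 ler_expR lerNl oppr0 ltW.
    rewrite add0e (ltW r1) -EFinM lee_fin.
    have -> : (r `^ (q - 1) = r `^ (- 1 - 1) * r `^ a)%R.
      by rewrite -powRD_gt0//; congr (_ `^ _)%R; rewrite /a; ring.
    rewrite -mulrA mulrC ler_pM2r ?powR_gt0// expRN ler_pdivrMr ?expR_gt0//.
    exact: powR_le_expR.
rewrite iposD//; last 2 first.
- exact: emeasurable_funM.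
- by move=> r; rewrite mule_ge0// lee_fin powR_ge0.
by rewrite iposZ ?powR_ge0// ipos_powR_bounded// ipos_powR_tail// -EFinM -EFinD ltry.
Qed.

Lemma Gamma_gt0 (q : R) : (0 < q)%R -> (0 < Gamma q)%R.
Proof. by move=> q0; rewrite GammaE_Gamma fine_gt0// GammaE_gt0 GammaE_fin. Qed.

Lemma EFin_Gamma (q : R) : (0 < q)%R -> (Gamma q)%:E = GammaE q.
Proof.
by move=> q0; rewrite GammaE_Gamma fineK// ge0_fin_numE ?GammaE_fin// ltW// GammaE_gt0.
Qed.

Lemma GammaE_scale (q A : R) : (0 < A)%R ->
  ipos (fun t => (t `^ (q - 1) * expR (- (A * t)))%:E) = (A `^ (- q))%:E * GammaE q.
Proof.
move=> A0; pose g (t : R) : \bar R := (t `^ (q - 1) * expR (- t))%:E.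
have mg : measurable_fun [set: R] g.
  have := measurable_Gamma_fun (q - 1) 1.
  by rewrite (_ : (fun t => _) = g)//; apply/funext => t; rewrite /g mul1r.
have g0 t : 0 <= g t by rewrite lee_fin; exact: mulr_ge0 (powR_ge0 _ _) (expR_ge0 _).
have mA : measurable_fun [set: R] (fun t => g (A * t)%R).
  by apply: (measurableT_comp mg); exact: measurable_funM.
have e1 : (A `^ (1 - q) * A `^ (q - 1) = 1)%R.
  by rewrite -powRD_gt0// -(opprB q 1%R) addNr powRr0.
have e2 : (A `^ (1 - q) * A^-1 = A `^ (- q))%R.
  by rewrite -(powR_inv1 (ltW A0)) -powRD_gt0//; congr (_ `^ _)%R; ring.
transitivity ((A `^ (1 - q))%:E * ipos (fun t => g (A * t)%R)).
  rewrite -(iposZ (powR_ge0 A (1 - q)) mA (fun t => g0 (A * t)%R)).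
  apply: eq_ipos => r r0; rewrite -EFinM (powRM _ (ltW A0) (ltW r0)); congr EFin.
  move: (r `^ (q - 1))%R (expR _) => v w; rewrite 2!mulrA e1 mul1r//.
by rewrite (ipos_scale A0 mg g0) muleA -EFinM e2.
Qed.

Lemma integral_gauss_scale (t : R) : (0 < t)%R ->
  \int[leb]_z (expR (- (t * z ^+ 2)))%:E = (Num.sqrt pi * t `^ (- 2^-1))%:E.
Proof.
move=> t0; have st : (0 < Num.sqrt t)%R by rewrite sqrtr_gt0.
have mg : measurable_fun [set: R] (fun x : R => (gauss_fun x)%:E).
  by apply/measurable_EFinP; exact: measurable_gauss_fun.
have := @ge0_integral_affine R (Num.sqrt t) 0%R (fun x => (gauss_fun x)%:E) (lt0r_neq0 st) mg.
rewrite integralT_gauss gtr0_norm// => E.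
transitivity (\int[leb]_z (gauss_fun (Num.sqrt t * z + 0))%:E).
  apply: eq_integral => z _; rewrite /gauss_fun addr0 exprMn sqr_sqrtr ?ltW//.
rewrite E; last by move=> x; rewrite lee_fin gauss_fun_ge0.
by rewrite -EFinM mulrC powRN powR12_sqrt// ltW.
Qed.

Lemma integral_gauss_rV m (t : R) : (0 < t)%R ->
  \int[lebesgue_rV m]_z (expR (- (t * sqn z)))%:E = ((Num.sqrt pi * t `^ (- 2^-1)) ^+ m)%:E.
Proof.
move=> t0; have mE n : measurable_fun [set: 'rV[R]_n] (fun z => (expR (- (t * sqn z)))%:E).
  apply/measurable_EFinP; apply: (measurableT_comp (@measurable_expR R)).
  apply: (measurableT_comp (@oppr_measurable R _)); apply: measurable_funM => //.
  exact: measurable_sqn.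
have p0 n (z : 'rV[R]_n) : 0 <= (expR (- (t * sqn z)))%:E by rewrite lee_fin expR_ge0.
elim: m => [|m IH].
  by rewrite ge0_integral_rV0 /sqn big_ord0 mulr0 oppr0 expR0 expr0.
rewrite (@ge0_integral_cons _ m)//.
transitivity (\int[leb]_s ((expR (- (t * s ^+ 2)))%:E * ((Num.sqrt pi * t `^ (- 2^-1)) ^+ m)%:E)).
  apply: eq_integral => s _.
  rewrite -IH -ge0_integralZl_EFin ?expR_ge0//; last exact: mE.
  by apply: eq_integral => z _; rewrite sqn_cons mulrDr opprD expRD EFinM.
have mS : measurable_fun [set: R] (fun s => (expR (- (t * s ^+ 2)))%:E).
  apply/measurable_EFinP; apply: (measurableT_comp (@measurable_expR R)).
  apply: (measurableT_comp (@oppr_measurable R _)); apply: measurable_funM => //.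
have c0 : 0 <= ((Num.sqrt pi * t `^ (- 2^-1)) ^+ m)%:E.
  by rewrite lee_fin exprn_ge0// mulr_ge0 ?powR_ge0// sqrtr_ge0.
have s0 (s : R) : setT s -> 0 <= (expR (- (t * s ^+ 2)))%:E by rewrite lee_fin expR_ge0.
have -> := @ge0_integralZr _ (measurableTypeR R) R leb setT measurableT _ mS _ s0 c0.
by rewrite integral_gauss_scale// -EFinM -exprS.
Qed.

(* Write [(A + |z|^2) ^ -q] as a Gamma integral and integrate the Gaussian in [z]. *)
Lemma integral_inv_sqn m (q A : R) : (0 < A)%R -> (m%:R / 2 < q)%R ->
  \int[lebesgue_rV m]_z ((A + sqn z) `^ (- q))%:E =
  (pi `^ (m%:R / 2) * Gamma (q - m%:R / 2) / Gamma q * A `^ (- (q - m%:R / 2)))%:E.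
Proof.
move=> A0 qm; have q0 : (0 < q)%R by apply: le_lt_trans qm; rewrite divr_ge0.
have q'0 : (0 < q - m%:R / 2)%R by rewrite subr_gt0.
have G0 := Gamma_gt0 q0.
have B0 (z : 'rV[R]_m) : (0 < A + sqn z)%R by rewrite ltr_wpDr// sqn_ge0.
pose F (p : R * 'rV[R]_m) : \bar R := (p.1 `^ (q - 1) * expR (- ((A + sqn p.2) * p.1)))%:E.
have F0 p : 0 <= F p by rewrite lee_fin mulr_ge0// ?powR_ge0// expR_ge0.
have ms : measurable_fun [set: R * 'rV[R]_m] (fun p => A + sqn p.2)%R.
  by apply: measurable_funD => //; exact: (measurableT_comp (@measurable_sqn R m)).
have mF : measurable_fun [set: R * 'rV[R]_m] F.
  apply/measurable_EFinP; apply: measurable_funM.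
    exact: (measurableT_comp (@measurable_powR R _)).
  apply: (measurableT_comp (@measurable_expR R)).
  by apply: (measurableT_comp (@oppr_measurable R _)); exact: measurable_funM.
have mB : measurable_fun [set: 'rV[R]_m] (fun z => ((A + sqn z) `^ (- q))%:E).
  apply/measurable_EFinP; apply: (measurableT_comp (@measurable_powR R _)).
  by apply: measurable_funD => //; exact: measurable_sqn.
have E : (Gamma q)%:E * \int[lebesgue_rV m]_z ((A + sqn z) `^ (- q))%:E =
    (pi `^ (m%:R / 2) * Gamma (q - m%:R / 2) * A `^ (- (q - m%:R / 2)))%:E.
  rewrite -ge0_integralZl_EFin ?(ltW G0)//; last by move=> z _; rewrite lee_fin powR_ge0.
  transitivity (\int[lebesgue_rV m]_z ipos (fun t => F (t, z))).
    apply: eq_integral => z _; rewrite muleC EFin_Gamma// -GammaE_scale//.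
  rewrite -ipos_swap//.
  transitivity (ipos (fun t => (pi `^ (m%:R / 2))%:E *
      (t `^ (q - m%:R / 2 - 1) * expR (- (A * t)))%:E)).
    apply: eq_ipos => t t0; rewrite /F /=.
    transitivity (\int[lebesgue_rV m]_x ((t `^ (q - 1) * expR (- (A * t)))%:E * (expR (- (t * sqn x)))%:E)).
      apply: eq_integral => x _; rewrite -EFinM -mulrA -expRD; congr (_ * expR _)%:E.
      by rewrite mulrDl (mulrC t) opprD.
    rewrite ge0_integralZl_EFin ?mulr_ge0 ?powR_ge0 ?expR_ge0//; last first.
      apply/measurable_EFinP; apply: (measurableT_comp (@measurable_expR R)).
      apply: (measurableT_comp (@oppr_measurable R _)); apply: measurable_funM => //.
      exact: measurable_sqn.
    rewrite integral_gauss_rV// -!EFinM; congr EFin.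
    have -> : (pi `^ (m%:R / 2) = Num.sqrt pi ^+ m :> R)%R.
      by rewrite -powR12_sqrt ?pi_ge0// -powR_mulrn ?powR_ge0// -powRrM mulrC.
    have -> : (t `^ (q - m%:R / 2 - 1) = t `^ (q - 1) * (t `^ (- 2^-1)) ^+ m)%R.
      have -> : ((t `^ (- 2^-1)) ^+ m = t `^ (- 2^-1 * m%:R))%R.
        by rewrite powRrM powR_mulrn// powR_ge0.
      by rewrite -powRD_gt0//; congr (_ `^ _)%R; ring.
    by rewrite exprMn; ring.
  rewrite iposZ ?powR_ge0//.
    rewrite GammaE_scale// -EFin_Gamma// -!EFinM; congr EFin; ring.
  by move=> t; rewrite lee_fin mulr_ge0// ?powR_ge0// expR_ge0.
have -> : \int[lebesgue_rV m]_z ((A + sqn z) `^ (- q))%:E =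
   (Gamma q)^-1%:E * ((Gamma q)%:E * \int[lebesgue_rV m]_z ((A + sqn z) `^ (- q))%:E).
  by rewrite muleA -EFinM mulVf ?gt_eqF// mul1e.
by rewrite E -EFinM; congr EFin; ring.
Qed.

End gamma_integrals.

(** * Functions of the norm and of the first coordinate *)

Section zonal.
Context {R : realType}.
Local Notation leb := (@lebesgue_measure R).
Local Open Scope ereal_scope.

(** The cosine of the arctangent in algebraic form: if [y_0 > 0] and [|y'| = x y_0], then
    [y_0 = |y| cos_atan x]. *)
Definition cos_atan (x : R) : R := ((1 + x ^+ 2) `^ (- 2^-1))%R.

Let phi := cos_atan.
Let dphi (x : R) : R := (- (x * (1 + x ^+ 2) `^ (- 2^-1 - 1)))%R.

Let x21 (x : R) : (0 < 1 + x ^+ 2)%R.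
Proof. by rewrite ltr_pwDl// sqr_ge0. Qed.

Let is_derive_phi (x : R) : is_derive x 1%R phi (dphi x).
Proof.
have d1 : is_derive x 1%R (fun x : R => 1 + x ^+ 2)%R (2 * x)%R.
  by apply: is_derive_eq; rewrite /GRing.scale/=; ring.
have d2 := @is_derive1_comp R (@powR R ^~ (- 2^-1)%R) _ x _ _ (is_derive1_powR _ (x21 x)) d1.
by apply: is_derive_eq; rewrite /dphi; field.
Qed.

Let derive_phi : derive1 phi = dphi.
Proof. by apply/funext => x; rewrite derive1E; have [_ ->] := is_derive_phi x. Qed.

Let continuous_phi : continuous phi.
Proof.
move=> x; apply/differentiable_continuous/derivable1_diffP.
by have [] := is_derive_phi x.
Qed.

Let continuous_dphi : continuous dphi.
Proof.
move=> x; apply: cvgN; apply: cvgM; first exact: cvg_id.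
apply: (@continuous_comp _ _ _ (fun x : R => 1 + x ^+ 2)%R (fun y => y `^ (- 2^-1 - 1))%R).
  by apply: cvgD; [exact: cvg_cst|exact: exprn_continuous].
exact: continuous_powR_pos.
Qed.

Let phi_gt0 x : (0 < phi x)%R. Proof. by rewrite powR_gt0. Qed.

Let phi_decr (x y : R) : (0 <= x)%R -> (x < y)%R -> (phi y < phi x)%R.
Proof.
move=> x0 xy; rewrite /phi /cos_atan !powRN ltf_pV2 ?posrE ?powR_gt0//.
rewrite gt0_ltr_powR ?nnegrE ?(ltW (x21 _))// ?invr_gt0// ltrD2l.
by rewrite ltrXn2r// ?nnegrE// ?(le_trans x0)// ltW.
Qed.

Let phi_inv (t : R) : (0 < t < 1)%R -> phi (Num.sqrt (1 - t ^+ 2) / t)%R = t.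
Proof.
move=> /andP[t0 t1]; have h : (0 <= 1 - t ^+ 2)%R by rewrite subr_ge0 expr_le1// ltW.
rewrite /phi /cos_atan expr_div_n sqr_sqrtr//.
have -> : (1 + (1 - t ^+ 2) / t ^+ 2 = (t ^+ 2)^-1)%R by field; rewrite gt_eqF.
rewrite -powR_inv1 ?sqr_ge0// -powR_mulrn ?(ltW t0)// -!powRrM.
by rewrite (_ : _ * _ = 1)%R ?powRr1 ?(ltW t0)//; field.
Qed.

Let phi_lt1 x : (0 < x)%R -> (phi x < 1)%R.
Proof.
move=> x0; have := phi_decr (lexx 0%R) x0.
by rewrite {2}/phi /cos_atan expr0n addr0 one_powR.
Qed.

(** The substitution [t = cos_atan x] decreases from [(0, oo)] onto [(0, 1)]. As [f] may blow up at
    0 and 1, it is made on the compact intervals [[1 / (n + 1), n + 2]], which exhaust the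
    half-line. *)
Lemma integral_subst_phi (f : R -> R) :
  (forall t, (0 < t < 1)%R -> (0 <= f t)%R /\ {for t, continuous f}) ->
  ipos (fun x => (f (phi x) * - dphi x)%:E) =
  \int[leb]_t (if ((0 < t) && (t < 1))%R then (f t)%:E else 0).
Proof.
move=> hf.
have p01 x : (0 < x)%R -> (0 < phi x < 1)%R by move=> x0; rewrite phi_gt0 phi_lt1.
pose a (n : nat) : R := (n.+1%:R^-1)%R; pose b (n : nat) : R := (n.+2%:R)%R.
have a0 n : (0 < a n)%R by rewrite invr_gt0.
have a1 n : (a n <= 1)%R by rewrite invf_le1// ler1n.
have b1 n : (1 < b n)%R by rewrite ltr1n.
have ab n : (a n < b n)%R by exact: le_lt_trans (a1 n) (b1 n).
have b0 n : (0 < b n)%R by rewrite (lt_trans _ (b1 n)).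
pose A n : set R := [set` `[a n, b n]%R].
pose B n : set R := [set` `[phi (b n), phi (a n)]%R].
pose h x : \bar R := (f (phi x) * - dphi x)%:E.
have step n : \int[leb]_(t in B n) (f t)%:E = \int[leb]_(x in A n) h x.
  rewrite (@integration_by_substitution_decreasing R phi f (a n) (b n))//.
  - by rewrite derive_phi.
  - exact: ltW.
  - move=> x y; rewrite !in_itv/= => _ /andP[ay _] xy; apply: phi_decr => //.
    exact: le_trans (ltW (a0 n)) ay.
  - by rewrite derive_phi => x _; exact: continuous_dphi.
  - by rewrite derive_phi; apply/cvg_ex; exists (dphi (a n)); apply: cvg_at_right_filter; exact: continuous_dphi.
  - by rewrite derive_phi; apply/cvg_ex; exists (dphi (b n)); apply: cvg_at_left_filter; exact: continuous_dphi.
  - split; first by move=> x _; have [] := is_derive_phi x.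
    + by apply: cvg_at_right_filter; exact: continuous_phi.
    + by apply: cvg_at_left_filter; exact: continuous_phi.
  - apply: continuous_in_subspaceT => t; rewrite inE/= in_itv/= => /andP[bt ta].
    have [] // := hf t.
    by rewrite (lt_le_trans (phi_gt0 _) bt) (le_lt_trans ta (phi_lt1 (a0 n))).
have aD m n : (m <= n)%N -> (a n <= a m)%R.
  by move=> mn; rewrite lef_pV2 ?posrE// ler_nat.
have bD m n : (m <= n)%N -> (b m <= b n)%R by move=> mn; rewrite ler_nat.
have phi_le x y : (0 <= x)%R -> (x <= y)%R -> (phi y <= phi x)%R.
  by move=> x0; rewrite le_eqVlt => /predU1P[->//|xy]; rewrite ltW// phi_decr.
have ndA : nondecreasing_seq A.
  move=> m n mn; apply/subsetPset => x; rewrite /A /= !in_itv/= => /andP[h1 h2].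
  by rewrite (le_trans (aD _ _ mn) h1) (le_trans h2 (bD _ _ mn)).
have ndB : nondecreasing_seq B.
  move=> m n mn; apply/subsetPset => x; rewrite /B /= !in_itv/= => /andP[h1 h2].
  rewrite (le_trans _ h1) ?(le_trans h2)//; apply: phi_le; rewrite ?(ltW (a0 _)) ?(ltW (b0 _))//.
  - exact: aD.
  - exact: bD.
have bound (x : R) : (0 < x)%R -> exists n, (a n <= x <= b n)%R.
  move=> x0; exists (Num.bound x + Num.bound x^-1)%N; apply/andP; split.
    rewrite -[leRHS]invrK lef_pV2 ?posrE ?invr_gt0//.
    have := archi_boundP (_ : 0 <= x^-1)%R; rewrite invr_ge0 (ltW x0) => /(_ isT) /ltW h1.
    by apply: le_trans h1 _; rewrite ler_nat; lia.
  have := archi_boundP (ltW x0) => /ltW h1.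
  by apply: le_trans h1 _; rewrite ler_nat; lia.
have UA : \bigcup_n A n = [set` `]0%R, +oo[%R].
  apply/seteqP; split => [x [n _]|x]; rewrite /A /= !in_itv/= andbT.
    by move=> /andP[h1 _]; exact: lt_le_trans h1.
  by move=> /bound[n abx]; exists n => //=; rewrite in_itv.
have UB : \bigcup_n B n = [set t | (0 < t) && (t < 1)]%R.
  apply/seteqP; split => [x [n _]|t]; rewrite /B /= ?in_itv/=.
    move=> /andP[h1 h2].
    by rewrite (lt_le_trans (phi_gt0 _) h1) (le_lt_trans h2 (phi_lt1 (a0 n))).
  move=> t01; have /andP[t0 t1] := t01.
  have x0 : (0 < Num.sqrt (1 - t ^+ 2) / t)%R.
    by rewrite divr_gt0// sqrtr_gt0 subr_gt0 expr_lt1// ltW.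
  have [n /andP[h1 h2]] := bound _ x0.
  exists n => //=; rewrite in_itv/= -(phi_inv t01).
  by rewrite !phi_le// ?(ltW (a0 _))// ltW.
have cA : \int[leb]_(x in A n) h x @[n --> \oo] --> ipos h.
  rewrite /ipos -integral_pos_if -UA.
  apply: (@ge0_nondecreasing_set_cvg_integral _ (measurableTypeR R) R A h leb) => //.
  - by move=> n; exact: measurable_itv.
  - move=> n; have mh : @measurable_fun _ _ (measurableTypeR R) _ [set` `]0%R, +oo[%R] h.
      apply/measurable_EFinP; apply: open_continuous_measurable_fun; first exact: interval_open.
      move=> x; rewrite inE/= in_itv/= andbT => x0.
      apply: cvgM; last by apply: cvgN; exact: continuous_dphi.
      apply: (@continuous_comp _ _ _ phi f); first exact: continuous_phi.
      by have [] := hf _ (p01 x x0).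
    apply: (measurable_funS _ _ mh); first exact: measurable_itv.
    by rewrite -UA => x Ax; exists n.
  - move=> n x; rewrite /A /= in_itv/= => /andP[h1 _].
    have x0 : (0 < x)%R by exact: lt_le_trans h1.
    rewrite lee_fin mulr_ge0//; first by have [] := hf _ (p01 x x0).
    by rewrite /dphi opprK mulr_ge0 ?powR_ge0// ltW.
have cB : \int[leb]_(x in A n) h x @[n --> \oo] -->
    \int[leb]_t (if ((0 < t) && (t < 1))%R then (f t)%:E else 0).
  under eq_fun do rewrite -step.
  rewrite -integral_if -UB.
  apply: (@ge0_nondecreasing_set_cvg_integral _ (measurableTypeR R) R B (EFin \o f) leb) => //.
  - by move=> n; exact: measurable_itv.
  - move=> n; have mh : @measurable_fun _ _ (measurableTypeR R) _ [set` `]0%R, 1%R[%R] (EFin \o f).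
      apply/measurable_EFinP; apply: open_continuous_measurable_fun; first exact: interval_open.
      by move=> t; rewrite inE/= in_itv/= => t01; have [] := hf _ t01.
    apply: (measurable_funS _ _ mh); first exact: measurable_itv.
    move=> x Bx; have : (\bigcup_n B n) x by exists n.
    by rewrite UB /= in_itv.
  - move=> n t Bt; have : (\bigcup_n B n) t by exists n.
    by rewrite UB lee_fin => /= t01; have [] := hf _ t01.
exact: (cvg_unique _ cA cB).
Qed.


Let measurable_cos_atan : measurable_fun [set: R] cos_atan.
Proof.
apply: (measurableT_comp (@measurable_powR R _)).
by apply: measurable_funD => //; exact: measurable_funX.
Qed.

Let sqrt_cos_atan (x : R) : Num.sqrt (1 + x ^+ 2) = (cos_atan x)^-1%R.
Proof. by rewrite /cos_atan powRN invrK powR12_sqrt// ltW. Qed.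

(* The half-plane coordinates [(y_0, |y'|)] are replaced by [r = |y|] and the slope
   [x = |y'| / y_0] by two linear substitutions. *)
Lemma ge0_integral_zonal_slope m (F : R * R -> \bar R) : (0 < m)%N ->
  measurable_fun [set: R * R] F -> (forall p, 0 <= F p) ->
  \int[lebesgue_rV m.+1]_y F (enorm y, y ord0 ord0) =
  (surface_measure (@unit_sphere R m))%:E *
  ipos (fun r => (r ^+ m)%:E * ipos (fun x =>
    (F (r, r * cos_atan x) + F (r, - (r * cos_atan x)))%R *
    (cos_atan x ^+ m.+1 * x ^+ m.-1)%:E)).
Proof.
move=> m0 mF F0.
set sg := surface_measure _.
have sg0 : (0 <= sg)%R.
  by rewrite /sg surface_unit_sphereE mulr_ge0// fine_ge0.
pose F2 (p : R * R) : \bar R := F p + F (p.1, - p.2)%R.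
have F20 p : 0 <= F2 p by rewrite adde_ge0.
have mFc d (T : measurableType d) (g h : T -> R) : measurable_fun setT g ->
    measurable_fun setT h -> measurable_fun [set: T] (fun p => F (g p, h p)).
  by move=> mg mh; apply: (measurableT_comp mF); exact: measurable_fun_pair.
have mF2 d (T : measurableType d) (g h : T -> R) : measurable_fun setT g ->
    measurable_fun setT h -> measurable_fun [set: T] (fun p => F2 (g p, h p)).
  move=> mg mh; apply: emeasurable_funD; apply: mFc => //.
  exact: (measurableT_comp (@oppr_measurable R _)).
have msq : measurable_fun [set: R * R] (fun p : R * R => Num.sqrt (p.1 ^+ 2 + p.2 ^+ 2)).
  have ms : measurable_fun [set: R] (@Num.sqrt R).
    by apply: continuous_measurable_fun; exact: sqrt_continuous.
  by apply: (measurableT_comp ms); apply: measurable_funD; exact: measurable_funX.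
have mXn d (T : measurableType d) (g : T -> R) n : measurable_fun setT g ->
    measurable_fun [set: T] (fun p => (g p ^+ n)%:E).
  by move=> mg; apply/measurable_EFinP; exact: measurable_funX.
have e1 (t : R) (x : 'rV[R]_m) : enorm (cons_rV (t, x)) = Num.sqrt (t ^+ 2 + enorm x ^+ 2).
  by rewrite enormE sqn_cons sqr_enorm.
have mE : measurable_fun [set: 'rV[R]_m.+1] (fun y => F (enorm y, y ord0 ord0)).
  apply: mFc; last exact: (measurable_coord ord0).
  by apply: measurable_enorm; exact: measurable_id.
pose J (p : R * R) : \bar R := F (Num.sqrt (p.1 ^+ 2 + p.2 ^+ 2), p.1).
have mJ : measurable_fun [set: R * R] J by exact: mFc.
have J0 p : 0 <= J p by exact: F0.
pose Wa (p : R * R) : \bar R := J p * (`|p.2| ^+ m.-1)%:E.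
have Wa0 p : 0 <= Wa p by rewrite mule_ge0// lee_fin exprn_ge0.
have mWa : measurable_fun [set: R * R] Wa.
  apply: emeasurable_funM => //; apply: mXn.
  by apply: (measurableT_comp (@normr_measurable R _)).
have st1 (t : R) : \int[lebesgue_rV m]_x F (enorm (cons_rV (t, x)), cons_rV (t, x) ord0 ord0) =
    sg%:E * ipos (fun x => Wa (t, x)).
  have mJt : measurable_fun [set: R] (fun x : R => J (t, x)).
    by apply: (measurableT_comp mJ); exact: measurable_fun_pair.
  transitivity (\int[lebesgue_rV m]_x J (t, enorm x)).
    by apply: eq_integral => x _; rewrite e1 cons_rV0.
  rewrite (@ge0_integral_radial R m (fun x => J (t, x)) m0 mJt)//.
  rewrite integral_pos_if; congr (_ * _); apply: eq_ipos => x x0.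
  by rewrite /Wa /= gtr0_norm.
have mI : measurable_fun [set: R] (fun t => ipos (fun x => Wa (t, x))).
  exact: (@measurable_ipos R _ R Wa).
have I0 t : 0 <= ipos (fun x => Wa (t, x)) by exact: ipos_ge0.
rewrite (@ge0_integral_cons _ m)//.
under eq_integral do rewrite st1.
rewrite ge0_integralZl_EFin//; congr (_ * _).
rewrite iposT//.
pose W2 (p : R * R) : \bar R := F2 (Num.sqrt (p.1 ^+ 2 + p.2 ^+ 2), p.1) * (`|p.2| ^+ m.-1)%:E.
have W20 p : 0 <= W2 p by rewrite mule_ge0// lee_fin exprn_ge0.
have mW2 : measurable_fun [set: R * R] W2.
  apply: emeasurable_funM; first exact: mF2.
  by apply: mXn; exact: (measurableT_comp (@normr_measurable R _)).
transitivity (ipos (fun t => ipos (fun x => W2 (t, x)))).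
  apply: eq_ipos => t t0.
  have mt (u : R) : measurable_fun [set: R] (fun x : R => Wa (u, x)).
    by apply: (measurableT_comp mWa); exact: measurable_fun_pair.
  rewrite -(@iposD R (fun x => Wa (t, x)) (fun x => Wa (- t, x)%R))//.
  apply: eq_ipos => x x0; rewrite /Wa /W2 /F2 /J /= sqrrN ge0_muleDl//.
pose V (p : R * R) : \bar R :=
  F2 (p.1 * (cos_atan p.2)^-1, p.1)%R * (`|p.1| ^+ m * `|p.2| ^+ m.-1)%:E.
have V0 p : 0 <= V p by rewrite mule_ge0// lee_fin mulr_ge0// exprn_ge0.
have mci : measurable_fun [set: R] (fun x => (cos_atan x)^-1)%R.
  under eq_fun do rewrite -sqrt_cos_atan.
  apply: (measurableT_comp (_ : measurable_fun [set: R] (@Num.sqrt R))).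
    by apply: continuous_measurable_fun; exact: sqrt_continuous.
  by apply: measurable_funD => //; exact: measurable_funX.
have mV : measurable_fun [set: R * R] V.
  apply: emeasurable_funM.
    apply: mF2 => //; apply: measurable_funM => //.
    exact: (measurableT_comp mci).
  apply/measurable_EFinP; apply: measurable_funM; apply: measurable_funX;
    exact: (measurableT_comp (@normr_measurable R _)).
transitivity (ipos (fun t => ipos (fun x => V (t, x)))).
  apply: eq_ipos => t t0.
  have mt : measurable_fun [set: R] (fun x : R => t%:E * W2 (t, x)).
    by apply: emeasurable_funM => //; apply: (measurableT_comp mW2); exact: measurable_fun_pair.
  have pt (x : R) : 0 <= t%:E * W2 (t, x) by rewrite mule_ge0// lee_fin ltW.
  transitivity (ipos (fun x => t%:E * W2 (t, t * x)%R)).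
    rewrite (@ipos_scale R t (fun x => t%:E * W2 (t, x)) t0 mt pt).
    rewrite iposZ ?(ltW t0)//; last first.
      by apply: (measurableT_comp mW2); exact: measurable_fun_pair.
    by rewrite muleA -EFinM mulVf ?gt_eqF// mul1e.
  apply: eq_ipos => x x0; rewrite /W2 /V /=.
  have -> : (t ^+ 2 + (t * x) ^+ 2 = t ^+ 2 * (1 + x ^+ 2))%R by ring.
  rewrite sqrtrM ?sqr_ge0// sqrtr_sqr gtr0_norm// sqrt_cos_atan.
  rewrite muleCA -EFinM; congr (_ * _%:E).
  by rewrite normrM (gtr0_norm t0) exprMn mulrA -exprS prednK.
rewrite ipos_swap2//.
pose U (p : R * R) : \bar R :=
  F2 (p.1, p.1 * cos_atan p.2)%R * (`|p.1| ^+ m * (cos_atan p.2 ^+ m.+1 * `|p.2| ^+ m.-1))%:E.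
have U0 p : 0 <= U p.
  by rewrite mule_ge0// lee_fin mulr_ge0// ?exprn_ge0// mulr_ge0// exprn_ge0// ltW// phi_gt0.
have mU : measurable_fun [set: R * R] U.
  have mc2 : measurable_fun [set: R * R] (fun p => cos_atan p.2).
    exact: (measurableT_comp measurable_cos_atan).
  apply: emeasurable_funM.
    by apply: mF2 => //; exact: measurable_funM.
  apply/measurable_EFinP; apply: measurable_funM.
    by apply: measurable_funX; exact: (measurableT_comp (@normr_measurable R _)).
  apply: measurable_funM; apply: measurable_funX => //.
  exact: (measurableT_comp (@normr_measurable R _)).
transitivity (ipos (fun x => ipos (fun r => U (r, x)))).
  apply: eq_ipos => x x0.
  have c0 : (0 < (cos_atan x)^-1)%R by rewrite invr_gt0 phi_gt0.
  have cn0 : (cos_atan x != 0)%R by rewrite gt_eqF// phi_gt0.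
  have mt : measurable_fun [set: R] (fun r : R => (cos_atan x)^-1%:E * U (r, x)).
    by apply: emeasurable_funM => //; apply: (measurableT_comp mU); exact: measurable_fun_pair.
  have pt (r : R) : 0 <= (cos_atan x)^-1%:E * U (r, x) by rewrite mule_ge0// lee_fin ltW.
  have mt' : measurable_fun [set: R] (fun r : R => U (r, x)).
    by apply: (measurableT_comp mU); exact: measurable_fun_pair.
  transitivity (ipos (fun r => (fun r => (cos_atan x)^-1%:E * U (r, x)) ((cos_atan x)^-1 * r)%R)).
    apply: eq_ipos => r r0; rewrite /V /U /=.
    rewrite (mulrC (cos_atan x)^-1%R r) divfK// muleCA -EFinM; congr (_ * _%:E).
    rewrite normrM (gtr0_norm c0) exprMn exprS.
    have h : ((cos_atan x)^-1 ^+ m * cos_atan x ^+ m = 1)%R.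
      by rewrite -exprMn mulVf// expr1n.
    rewrite [RHS](_ : _ = `|r| ^+ m * `|x| ^+ m.-1 * ((cos_atan x)^-1 ^+ m * cos_atan x ^+ m))%R.
      by rewrite h mulr1.
    by field.
  rewrite (@ipos_scale R _ (fun r => (cos_atan x)^-1%:E * U (r, x)) c0 mt pt) invrK.
  rewrite iposZ ?(ltW c0)//.
  by rewrite muleA -EFinM mulfV// mul1e.
rewrite -ipos_swap2//; apply: eq_ipos => r r0.
have mUr : measurable_fun [set: R] (fun x : R =>
    F2 (r, r * cos_atan x)%R * (cos_atan x ^+ m.+1 * `|x| ^+ m.-1)%:E).
  apply: emeasurable_funM.
    by apply: mF2 => //; exact: measurable_funM.
  apply/measurable_EFinP; apply: measurable_funM; apply: measurable_funX => //.
transitivity ((r ^+ m)%:E * ipos (fun x =>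
    F2 (r, r * cos_atan x)%R * (cos_atan x ^+ m.+1 * `|x| ^+ m.-1)%:E)).
  rewrite -iposZ ?exprn_ge0 ?(ltW r0)//.
    apply: eq_ipos => x x0; rewrite /U /= (gtr0_norm r0) EFinM muleCA.
    by [].
  by move=> x; rewrite mule_ge0// lee_fin mulr_ge0 ?exprn_ge0// ltW// phi_gt0.
by congr (_ * _); apply: eq_ipos => x x0; rewrite gtr0_norm.
Qed.

End zonal.

(** * Integrals against |e_1 - y|^(-n-tau) *)

Section measurable_real.
Context {R : realType}.

Lemma measurable_sqrt d (T : measurableType d) (f : T -> R) :
  measurable_fun setT f -> measurable_fun [set: T] (fun x => Num.sqrt (f x)).
Proof.
move=> mf; have ms : measurable_fun [set: R] (@Num.sqrt R).
  by apply: continuous_measurable_fun; exact: sqrt_continuous.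
exact: (measurableT_comp ms).
Qed.

Lemma measurable_invr d (T : measurableType d) (f : T -> R) :
  measurable_fun setT f -> measurable_fun [set: T] (fun x => (f x)^-1)%R.
Proof.
move=> mf; have h : measurable_fun [set: R] (@GRing.inv R).
  have -> : @GRing.inv R = (fun x : R => if (x < 0)%R then (- (- x) `^ (-1)) else x `^ (-1))%R.
    apply/funext => x; case: ltP => x0; last by rewrite powR_inv1.
    by rewrite powR_inv1 ?oppr_ge0 1?ltW// invrN opprK.
  apply: measurable_fun_ifT; first exact: measurable_fun_ltr.
    apply: (measurableT_comp (@oppr_measurable R _)).
    by apply: (measurableT_comp (measurable_powR (-1)%R)); exact: oppr_measurable.
  exact: measurable_powR.
exact: (measurableT_comp h).
Qed.

End measurable_real.

(** Measurability is read off the structure of the integrand; composition with a function known to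
    be measurable from the context comes last, after all operations have been tried. *)
Ltac meas_step :=
  match goal with
  | H : measurable_fun _ ?f |- measurable_fun _ ?f => exact: H
  | |- measurable_fun _ (fun x => x) => exact: measurable_id
  | |- measurable_fun _ (fun _ => ?c) => exact: measurable_cst
  | |- measurable_fun _ (fun x => mule (@?f x) (@?g x)) => apply: emeasurable_funM
  | |- measurable_fun _ (fun x => EFin (@?f x)) => apply/measurable_EFinP
  | |- measurable_fun _ (fun x => powR (@?f x) ?a) => apply: (measurableT_comp (measurable_powR a))
  | |- measurable_fun _ (fun x => Num.norm (@?f x)) => apply: (measurableT_comp (@normr_measurable _ _))
  | |- measurable_fun _ (fun x => Num.sqrt (@?f x)) => apply: measurable_sqrt
  | |- measurable_fun _ (fun x => GRing.inv (@?f x)) => apply: measurable_invr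
  | |- measurable_fun _ (fun x => GRing.exp (@?f x) _) => apply: measurable_funX
  | |- measurable_fun _ (fun x => enorm (@?f x)) => apply: measurable_enorm
  | |- measurable_fun _ (fun x => GRing.mul (@?f x) (@?g x)) => apply: measurable_funM
  | |- measurable_fun _ (fun x => GRing.add (@?f x) (GRing.opp (@?g x))) =>
      first [apply: measurable_rV_sub | apply: measurable_funB]
  | |- measurable_fun _ (fun x => GRing.add (@?f x) (@?g x)) =>
      first [apply: measurable_funD | apply: emeasurable_funD]
  | |- measurable_fun _ (fun x => GRing.opp (@?f x)) => apply: (measurableT_comp (@oppr_measurable _ _))
  | |- measurable_fun _ (fun x => pair (@?f x) (@?g x)) => apply: measurable_fun_pair
  | |- measurable_fun _ (fun x => adde (@?f x) (@?g x)) => apply: emeasurable_funD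
  | |- measurable_fun _ (@enorm _ _) => by apply: measurable_enorm; exact: measurable_id
  | |- measurable_fun _ fst => exact: measurable_fst
  | |- measurable_fun _ snd => exact: measurable_snd
  | |- measurable_fun _ (fun x => fst x) => exact: measurable_fst
  | |- measurable_fun _ (fun x => snd x) => exact: measurable_snd
  | |- measurable_fun _ (fun x => fst (@?f x)) => apply: (measurableT_comp measurable_fst)
  | |- measurable_fun _ (fun x => snd (@?f x)) => apply: (measurableT_comp measurable_snd)
  | H : measurable_fun _ ?F |- measurable_fun _ (fun x => ?F (@?f x)) => apply: (measurableT_comp H)
  end.
Ltac meas := repeat meas_step.

Section mass.
Context {R : realType}.
Local Notation leb := (@lebesgue_measure R).
Local Open Scope ereal_scope.

Lemma ge0_integralZlT d (T : measurableType d) (mu : {measure set T -> \bar R}) (c : R)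
    (f : T -> \bar R) : (0 <= c)%R -> (forall x, 0 <= f x) -> measurable_fun [set: T] f ->
  \int[mu]_x (c%:E * f x) = c%:E * \int[mu]_x f x.
Proof. by move=> c0 f0 mf; rewrite ge0_integralZl_EFin. Qed.

Lemma ge0_integralZrT d (T : measurableType d) (mu : {measure set T -> \bar R}) (c : \bar R)
    (f : T -> \bar R) : 0 <= c -> (forall x, 0 <= f x) -> measurable_fun [set: T] f ->
  \int[mu]_x (f x * c) = (\int[mu]_x f x) * c.
Proof. by move=> c0 f0 mf; rewrite ge0_integralZr. Qed.

Lemma eq_integral_neq0 n (f g : 'rV[R]_n.+1 -> \bar R) :
  measurable_fun [set: 'rV[R]_n.+1] f -> measurable_fun [set: 'rV[R]_n.+1] g ->
  (forall x, 0 <= f x) -> (forall x, 0 <= g x) -> (forall x, x != 0%R -> f x = g x) ->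
  \int[lebesgue_rV n.+1]_x f x = \int[lebesgue_rV n.+1]_x g x.
Proof.
move=> mf mg f0 g0 fg; apply: ge0_ae_eq_integral => //.
exists [set 0%R]; split; [exact: measurable_rV_set0|exact: lebesgue_rV_set0|].
move=> x /= /not_implyP[_ fgx]; have [//|x0] := eqVneq x 0%R.
by exfalso; apply: fgx; exact: fg.
Qed.

Definition e1 n : 'rV[R]_n.+1 := cons_rV (1%R, 0%R).

Lemma sqn_e1B n (y : 'rV[R]_n.+1) : sqn (e1 n - y) = (1 - 2 * y ord0 ord0 + sqn y)%R.
Proof.
rewrite sqnB; congr (_ - _ * _ + _)%R.
  by rewrite sqn_cons expr1n -sqr_enorm enorm0 expr0n addr0.
rewrite -[y]uncons_rVK /e1 dot_cons mul1r /dot cons_rV0 big1 ?addr0// => i _.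
by rewrite mxE mul0r.
Qed.

(** Rotate [x] to the first axis and scale by [|x|]. Rotation applies because [|x - y|] depends on
    [y] through [|y|] and the inner product with [x] only. *)
Lemma ge0_integral_pair n (g : R * R -> \bar R) (x : 'rV[R]_n.+1) : x != 0%R ->
  measurable_fun [set: R * R] g -> (forall p, 0 <= g p) ->
  \int[lebesgue_rV n.+1]_y g (enorm y, enorm (x - y)) =
  (enorm x ^+ n.+1)%:E *
  \int[lebesgue_rV n.+1]_y g (enorm x * enorm y, enorm x * enorm (e1 n - y))%R.
Proof.
move=> x0 mg g0; set X := enorm x.
have X0 : (0 < X)%R by rewrite enorm_gt0.
pose f (p : R * R) := g (Num.sqrt p.1, Num.sqrt (X ^+ 2 - 2 * p.2 + p.1))%R.
have mf : measurable_fun [set: R * R] f.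
  apply: (measurableT_comp mg); apply: measurable_fun_pair.
    by apply: measurable_sqrt; meas.
  by apply: measurable_sqrt; meas.
pose h (y : 'rV[R]_n.+1) := f (sqn y, X * y ord0 ord0)%R.
have mh : measurable_fun [set: 'rV[R]_n.+1] h.
  apply: (measurableT_comp mf); apply: measurable_fun_pair; first exact: measurable_sqn.
  by apply: measurable_funM => //; exact: (measurable_coord ord0).
transitivity (\int[lebesgue_rV n.+1]_y f (sqn y, dot x y)).
  by apply: eq_integral => y _; rewrite /f /= !enormE sqnB -(sqr_enorm x).
rewrite ge0_integral_rot//; last by move=> ?; exact: g0.
have := @ge0_integral_rV_affine R n.+1 X 0%R h (lt0r_neq0 X0) mh (fun=> g0 _).
rewrite (gtr0_norm X0) => /(congr1 (fun z => (X ^+ n.+1)%:E * z)).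
rewrite muleA -EFinM -exprMn mulfV ?gt_eqF// expr1n mul1e => <-.
congr (_ * _); apply: eq_integral => y _; rewrite /h /f addr0 /=.
have -> : sqn (X *: y) = (X ^+ 2 * sqn y)%R by rewrite -!sqr_enorm enormZ gtr0_norm// exprMn.
have sX (z : R) : Num.sqrt (X ^+ 2 * z) = (X * Num.sqrt z)%R.
  by rewrite sqrtrM ?sqr_ge0// sqrtr_sqr gtr0_norm.
rewrite sX !enormE; congr (g (_, _)); rewrite -sX; congr Num.sqrt.
by rewrite sqn_e1B mxE; ring.
Qed.

(** The dimension is [n.+1], so that the unit vector [e1] exists. The one-variable integrals of the
    proof are kept in this spatial form, in which finiteness and inversion are proved without any
    asymptotics of [Phi]. *)
Definition mass n (tau : R) (G : R -> \bar R) : \bar R :=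
  \int[lebesgue_rV n.+1]_y (G (enorm y) * (enorm (e1 n - y) `^ (- (n.+1%:R + tau)))%:E).

Lemma mass_ge0 n tau (G : R -> \bar R) : (forall r, 0 <= G r) -> 0 <= mass n tau G.
Proof. by move=> G0; apply: integral_ge0 => y _; rewrite mule_ge0// lee_fin powR_ge0. Qed.

Lemma eq_mass n tau (G H : R -> \bar R) : measurable_fun [set: R] G -> measurable_fun [set: R] H ->
  (forall r, 0 <= G r) -> (forall r, 0 <= H r) ->
  (forall r, (0 < r)%R -> G r = H r) -> mass n tau G = mass n tau H.
Proof.
move=> mG mH G0 H0 GH; apply: eq_integral_neq0.
- by meas.
- by meas.
- by move=> y; rewrite mule_ge0// lee_fin powR_ge0.
- by move=> y; rewrite mule_ge0// lee_fin powR_ge0.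
- by move=> y y0; rewrite GH// enorm_gt0.
Qed.

Lemma massD n tau (G H : R -> \bar R) : measurable_fun [set: R] G -> measurable_fun [set: R] H ->
  (forall r, 0 <= G r) -> (forall r, 0 <= H r) ->
  mass n tau (fun r => G r + H r) = mass n tau G + mass n tau H.
Proof.
move=> mG mH G0 H0; rewrite /mass -ge0_integralD//.
- by apply: eq_integral => y _; rewrite ge0_muleDl.
- by move=> y _; rewrite mule_ge0// lee_fin powR_ge0.
- by meas.
- by move=> y _; rewrite mule_ge0// lee_fin powR_ge0.
- by meas.
Qed.

Lemma mass_scale n tau (G : R -> \bar R) (x : 'rV[R]_n.+1) : x != 0%R ->
  measurable_fun [set: R] G -> (forall r, 0 <= G r) ->
  \int[lebesgue_rV n.+1]_y (G (enorm y) * (enorm (x - y) `^ (- (n.+1%:R + tau)))%:E) =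
  (enorm x `^ (- tau))%:E * mass n tau (fun r => G (enorm x * r)%R).
Proof.
move=> x0 mG G0; have X0 : (0 < enorm x)%R by rewrite enorm_gt0.
rewrite (@ge0_integral_pair n (fun p => G p.1 * (p.2 `^ (- (n.+1%:R + tau)))%:E) x x0); last 2 first.
- by meas.
- by move=> p; rewrite mule_ge0// lee_fin powR_ge0.
have -> : (enorm x `^ (- tau) = enorm x ^+ n.+1 * enorm x `^ (- (n.+1%:R + tau)))%R.
  by rewrite -powR_mulrn ?enorm_ge0// -powRD_gt0//; congr (_ `^ _)%R; ring.
rewrite EFinM -muleA; congr (_ * _).
rewrite -ge0_integralZlT ?powR_ge0//.
- by apply: eq_integral => y _; rewrite /= powRM ?enorm_ge0// EFinM muleCA.
- by move=> y; rewrite mule_ge0// lee_fin powR_ge0.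
- by meas.
Qed.

(* Tonelli for [|y|^-tau e^(-|x|^2) G (|y| / |x|) |x - y|^-(n+1+tau) |x|^tau], both ways. *)
Lemma mass_inv n tau (G : R -> \bar R) :
  measurable_fun [set: R] G -> (forall r, 0 <= G r) ->
  mass n tau G = mass n tau (fun r => G r^-1%R * (r `^ (tau - n.+1%:R))%:E).
Proof.
move=> mG G0; set k := n.+1; set N := (- (k%:R + tau))%R.
(* With this weight both iterated integrals are a mass times the same finite positive Gaussian
   constant [c], which is cancelled at the end. *)
pose a (r : R) : R := (r `^ tau * expR (- (1 * r ^+ 2)))%R.
have a0 r : (0 <= a r)%R by rewrite mulr_ge0 ?powR_ge0 ?expR_ge0.
have mexp : measurable_fun [set: R] (@expR R) by exact: measurable_expR.
have ma : measurable_fun [set: R] a by apply: measurable_funM; meas.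
have mGi : measurable_fun [set: R] (fun r : R => G r^-1%R).
  by apply: (measurableT_comp mG); apply: measurable_invr; meas.
have ie d (T : measurableType d) (f : T -> 'rV[R]_k) : measurable_fun setT f ->
    measurable_fun [set: T] (fun x => (enorm (f x))^-1)%R.
  by move=> mf; apply: measurable_invr; meas.
pose A := \int[lebesgue_rV k]_y (enorm y `^ (- tau) * a (enorm y))%:E.
have [c [c0 AE]] : exists c : R, (0 < c)%R /\ A = c%:E.
  exists ((Num.sqrt pi * 1 `^ (- 2^-1)) ^+ k)%R; split.
    by rewrite exprn_gt0// mulr_gt0// ?powR_gt0// sqrtr_gt0 pi_gt0.
  rewrite -(@integral_gauss_rV R k 1%R ltr01); apply: eq_integral_neq0.
  - by meas.
  - apply/measurable_EFinP; apply: (measurableT_comp mexp).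
    apply: (measurableT_comp (@oppr_measurable R _)); apply: measurable_funM => //.
    exact: measurable_sqn.
  - by move=> y; rewrite lee_fin mulr_ge0// powR_ge0.
  - by move=> y; rewrite lee_fin expR_ge0.
  - move=> y y0; rewrite /a mulrA -powRD_gt0 ?enorm_gt0// addNr powRr0 mul1r.
    by rewrite sqr_enorm.
pose F (p : 'rV[R]_k * 'rV[R]_k) : \bar R :=
  (a (enorm p.1))%:E * (G (enorm p.2 / enorm p.1)%R * (enorm (p.1 - p.2) `^ N)%:E).
have F0 p : 0 <= F p by rewrite !mule_ge0// lee_fin ?powR_ge0.
have mF : measurable_fun [set: 'rV[R]_k * 'rV[R]_k] F.
  apply: emeasurable_funM; first by meas.
  apply: emeasurable_funM; last by meas.
  apply: (measurableT_comp mG); apply: measurable_funM; first by meas.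
  by apply: ie; meas.
have L : \int[lebesgue_rV k]_x \int[lebesgue_rV k]_y F (x, y) = mass n tau G * c%:E.
  rewrite -AE /A muleC -ge0_integralZrT; last 3 first.
  - exact: mass_ge0.
  - by move=> y; rewrite lee_fin mulr_ge0// powR_ge0.
  - by meas.
  apply: eq_integral_neq0.
  - exact: (measurable_fun_iint (lebesgue_rV k) mF).
  - by meas.
  - by move=> x; apply: integral_ge0 => y _; exact: F0.
  - by move=> x; rewrite mule_ge0 ?mass_ge0// lee_fin mulr_ge0// powR_ge0.
  move=> x x0; have X0 : (0 < enorm x)%R by rewrite enorm_gt0.
  have mGx : measurable_fun [set: R] (fun r : R => G (r / enorm x)%R).
    by apply: (measurableT_comp mG); meas.
  rewrite (@ge0_integralZlT _ _ (lebesgue_rV k) (a (enorm x))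
    (fun y => G (enorm y / enorm x)%R * (enorm (x - y) `^ N)%:E)); last 3 first.
  - exact: a0.
  - by move=> y; rewrite mule_ge0// lee_fin powR_ge0.
  - by meas.
  rewrite (@mass_scale n tau (fun r => G (r / enorm x)%R) x x0 mGx)//.
  rewrite muleA -EFinM mulrC; congr (_ * mass _ _ _); apply/funext => r.
  by rewrite mulrAC divff ?mul1r// gt_eqF.
have Rr : \int[lebesgue_rV k]_y \int[lebesgue_rV k]_x F (x, y) =
    mass n tau (fun r => G r^-1%R * (r `^ (tau - k%:R))%:E) * c%:E.
  pose H (p : 'rV[R]_k * 'rV[R]_k) : \bar R :=
    (enorm p.1 `^ (- tau) * a (enorm p.1 * enorm p.2))%:E *
      (G (enorm p.2)^-1%R * (enorm (e1 n - p.2) `^ N)%:E).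
  have mHG d (T : measurableType d) (f : T -> 'rV[R]_k) : measurable_fun setT f ->
      measurable_fun [set: T] (fun p => G (enorm (f p))^-1%R * (enorm (e1 n - f p) `^ N)%:E).
    by move=> mf; apply: emeasurable_funM; [apply: (measurableT_comp mG); exact: ie|meas].
  have H0 p : 0 <= H p by rewrite !mule_ge0// lee_fin ?powR_ge0// mulr_ge0// powR_ge0.
  have mH : measurable_fun [set: 'rV[R]_k * 'rV[R]_k] H.
    by apply: emeasurable_funM; [meas|apply: mHG; meas].
  transitivity (\int[lebesgue_rV k]_y \int[lebesgue_rV k]_z H (y, z)).
    apply: eq_integral_neq0.
    - have mF' : measurable_fun [set: 'rV[R]_k * 'rV[R]_k] (fun p => F (p.2, p.1)).
        by apply: (measurableT_comp mF); meas.
      exact: (measurable_fun_iint (lebesgue_rV k) mF' (fun=> F0 _)).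
    - exact: (measurable_fun_iint (lebesgue_rV k) mH).
    - by move=> y; apply: integral_ge0 => x _; exact: F0.
    - by move=> y; apply: integral_ge0 => z _; exact: H0.
    move=> y y0; have Y0 : (0 < enorm y)%R by rewrite enorm_gt0.
    have mGy : measurable_fun [set: R] (fun r : R => (a r)%:E * G (enorm y / r)%R).
      apply: emeasurable_funM; first by meas.
      apply: (measurableT_comp mG); apply: measurable_funM => //.
      by apply: measurable_invr; meas.
    have Gy0 r : 0 <= (a r)%:E * G (enorm y / r)%R by rewrite mule_ge0// lee_fin.
    transitivity ((enorm y `^ (- tau))%:E * mass n tau
        (fun r => (a (enorm y * r))%:E * G (enorm y / (enorm y * r))%R)).
      rewrite -(@mass_scale n tau _ y y0 mGy Gy0); apply: eq_integral => x _.
      by rewrite (enormB y x) -muleA.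
    rewrite /mass -/k -/N.
    rewrite -(@ge0_integralZlT _ _ (lebesgue_rV k) (enorm y `^ (- tau)) (fun z =>
      (a (enorm y * enorm z))%:E * G (enorm y / (enorm y * enorm z))%R *
      (enorm (e1 n - z) `^ N)%:E)); last 3 first.
    - exact: powR_ge0.
    - by move=> z; rewrite mule_ge0// ?lee_fin ?powR_ge0// mule_ge0// lee_fin.
    - have mg2 := measurableT_comp mGy (measurable_funM (measurable_cst (enorm y)) (@measurable_id _ R setT)).
      apply: emeasurable_funM; last by meas.
      by apply: (measurableT_comp mg2); meas.
    apply: eq_integral => z _; rewrite /H.
    have -> : (enorm y / (enorm y * enorm z) = (enorm z)^-1)%R.
      by rewrite invfM mulrA divff ?mul1r// gt_eqF.
    have E (u v : R) (s t : \bar R) : u%:E * (v%:E * s * t) = (u * v)%:E * (s * t).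
      by rewrite EFinM !muleA.
    exact: E.
  rewrite (@fubini_tonelli _ _ _ _ _ (lebesgue_rV k) (lebesgue_rV k) H)//.
  rewrite /mass -ge0_integralZrT; last 3 first.
  - by rewrite lee_fin ltW.
  - by move=> y; rewrite !mule_ge0// lee_fin powR_ge0.
  - by meas.
  apply: eq_integral_neq0.
  - have mH' : measurable_fun [set: 'rV[R]_k * 'rV[R]_k] (fun p => H (p.2, p.1)).
      by apply: (measurableT_comp mH); meas.
    exact: (measurable_fun_iint (lebesgue_rV k) mH' (fun=> H0 _)).
  - by meas.
  - by move=> z; apply: integral_ge0 => y _; exact: H0.
  - by move=> y; rewrite !mule_ge0// lee_fin ?powR_ge0// ltW.
  move=> z z0; have Z0 : (0 < enorm z)%R by rewrite enorm_gt0.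
  pose h (y : 'rV[R]_k) : \bar R := (enorm y `^ (- tau) * a (enorm y))%:E.
  have mh : measurable_fun [set: 'rV[R]_k] h by rewrite /h; meas.
  have h0 y : 0 <= h y by rewrite lee_fin mulr_ge0// powR_ge0.
  rewrite (@ge0_integralZrT _ _ (lebesgue_rV k) (G (enorm z)^-1%R * (enorm (e1 n - z) `^ N)%:E)
    (fun y => (enorm y `^ (- tau) * a (enorm y * enorm z))%:E)); last 3 first.
  - by rewrite mule_ge0// lee_fin powR_ge0.
  - by move=> y; rewrite lee_fin mulr_ge0// powR_ge0.
  - by meas.
  have -> : \int[lebesgue_rV k]_y (enorm y `^ (- tau) * a (enorm y * enorm z))%:E =
      (enorm z `^ (tau - k%:R) * c)%:E.
    transitivity (\int[lebesgue_rV k]_y ((enorm z `^ tau)%:E * h (enorm z *: y + 0)%R)).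
      apply: eq_integral => y _; rewrite /h addr0 enormZ gtr0_norm//.
      rewrite powRM ?enorm_ge0// -[RHS]EFinM (mulrC (enorm z) (enorm y)); congr EFin.
      move: (a _) => b; rewrite !mulrA.
      by rewrite -powRD_gt0// subrr powRr0 mul1r.
    rewrite ge0_integralZlT; last 3 first.
    - exact: powR_ge0.
    - by move=> ?; exact: h0.
    - by apply: (measurableT_comp mh); apply: measurable_rV_lin; meas.
    rewrite ge0_integral_rV_affine ?gt_eqF// gtr0_norm// -/A AE -!EFinM mulrA.
    by rewrite powRB_gt0// exprVn powR_mulrn// ltW.
  have E (u v : R) (s t : \bar R) : (u * v)%:E * (s * t) = s * u%:E * t * v%:E.
    by rewrite EFinM muleC !muleA; congr (_ * _); rewrite -!muleA (muleC t).
  exact: E.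
have := @fubini_tonelli _ _ _ _ _ (lebesgue_rV k) (lebesgue_rV k) F mF F0.
rewrite [in LHS]L Rr => /(congr1 (fun z => z * c^-1%:E)).
by rewrite -!muleA -EFinM mulfV ?gt_eqF// !mule1.
Qed.

End mass.

(** * The kernel integral in one variable and the function [Phi] *)

Section mass_zonal.
Context {R : realType}.
Local Notation leb := (@lebesgue_measure R).
Local Open Scope ereal_scope.

Lemma enorm_powRN n (x : 'rV[R]_n) (a : R) : (enorm x `^ (- a) = sqn x `^ (- (a / 2)))%R.
Proof.
rewrite enormE -powR12_sqrt ?sqn_ge0// -powRrM; congr (_ `^ _)%R.
by field.
Qed.

Lemma enorm_rV1 (t : R) (x : 'rV[R]_0) : enorm (cons_rV (t, x)) = `|t|%R.
Proof. by rewrite enormE sqn_cons /sqn big_ord0 addr0 sqrtr_sqr. Qed.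

Lemma surface_unit_sphere_gt0 n : (0 < surface_measure (@unit_sphere R n.+1))%R.
Proof.
have s0 : (0 <= surface_measure (@unit_sphere R n.+1))%R.
  by rewrite surface_unit_sphereE mulr_ge0// fine_ge0.
rewrite lt_neqAle s0 andbT eq_sym; apply/eqP => sE.
have me : measurable_fun [set: R] (fun r : R => (expR (- (1 * r ^+ 2)))%:E).
  apply/measurable_EFinP; apply: (measurableT_comp (@measurable_expR R)); meas.
have := @ge0_integral_radial R n.+1 _ (ltn0Sn n) me (fun=> expR_ge0 _).
rewrite sE mul0e; under eq_integral do rewrite sqr_enorm.
rewrite integral_gauss_rV// => /eqP; rewrite eqe => /eqP h.
have : (0 < (Num.sqrt pi * 1 `^ (- 2^-1)) ^+ n.+1 :> R)%R.
  by rewrite exprn_gt0// mulr_gt0 ?powR_gt0 ?sqrtr_gt0 ?pi_gt0.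
by rewrite h ltxx.
Qed.

Let ipos_inv1sqr : ipos (fun x : R => ((1 + x ^+ 2) `^ (- 1))%:E) < +oo.
Proof.
have h2 : ((1%N)%:R / 2 < (1 : R))%R by rewrite ltr_pdivrMr// mul1r ltr1n.
have mf : measurable_fun [set: R] (fun x : R => ((1 + x ^+ 2) `^ (- 1))%:E) by meas.
have f0 (x : R) : 0 <= ((1 + x ^+ 2) `^ (- 1))%:E by rewrite lee_fin powR_ge0.
apply: (@le_lt_trans _ _ (\int[leb]_x ((1 + x ^+ 2) `^ (- 1))%:E)).
  apply: ge0_le_integral => //; first by move=> x _; case: ifPn.
    exact: measurable_pos_if.
  by move=> x _; case: ifPn => // _; exact: f0.
have := @integral_inv_sqn R 1 1%R 1%R ltr01 h2.
rewrite ge0_integral_cons; last 2 first.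
- apply/measurable_EFinP; apply: (measurableT_comp (@measurable_powR R _)).
  by apply: measurable_funD; [exact: measurable_cst|exact: measurable_sqn].
- by move=> x; rewrite lee_fin powR_ge0.
under eq_integral do rewrite ge0_integral_rV0 sqn_cons {1}/sqn big_ord0 addr0.
by move=> ->; exact: ltry.
Qed.

Lemma iposZr (c : \bar R) (f : R -> \bar R) : 0 <= c -> measurable_fun [set: R] f ->
  (forall r, (0 < r)%R -> 0 <= f r) -> ipos (fun r => f r * c) = ipos f * c.
Proof.
move=> c0 mf f0; rewrite /ipos -ge0_integralZrT//.
- by apply: eq_integral => r _; case: ifPn; rewrite ?mul0e.
- by move=> r; case: ifPn => // /f0.
- exact: measurable_pos_if.
Qed.

(** Polar coordinates: the angular integral of the kernel is the one that defines [Phi]. On the line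
    the sphere consists of the two points [1] and [- 1], hence the separate formula. For [r < 1] the
    angular integral must be shown finite, because [Phi] is a real-valued integral. *)
Lemma mass_lt1 n (s p : R) (G : R -> \bar R) : (0 <= s * p)%R ->
  measurable_fun [set: R] G -> (forall r, 0 <= G r) -> (forall r, (1 <= r)%R -> G r = 0) ->
  mass n (s * p) G =
  ipos (fun r => if (r < 1)%R then G r * (r ^+ n * Phi n.+1 s p r)%:E else 0).
Proof.
set tau := (s * p)%R => tau0 mG G0 G1.
rewrite /mass; case: n => [|m].
  rewrite ge0_integral_cons; last 2 first.
  - by meas.
  - by move=> y; rewrite mule_ge0// lee_fin powR_ge0.
  transitivity (\int[leb]_t (G `|t|%R * (`|1 - t| `^ (- (1%:R + tau)))%:E)).
    apply: eq_integral => t _; rewrite ge0_integral_rV0 enorm_rV1; congr (G _ * (_ `^ _)%:E).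
    rewrite enormE sqn_e1B sqn_cons cons_rV0 /sqn big_ord0 addr0 -sqrtr_sqr.
    have E (u : R) : (1 - 2 * u + u ^+ 2 = (1 - u) ^+ 2)%R by ring.
    by congr Num.sqrt; exact: E.
  rewrite iposT; last 2 first.
  - by meas.
  - by move=> y; rewrite mule_ge0// lee_fin powR_ge0.
  apply: eq_ipos => r r0; rewrite normrN opprK (gtr0_norm r0).
  case: ltP => r1; last by rewrite G1// !mul0e adde0.
  rewrite -ge0_muleDr ?lee_fin ?powR_ge0// expr0 mul1r /Phi eqxx -EFinD opprD.
  by rewrite !gtr0_norm ?subr_gt0// addr_gt0.
set q := ((m.+2%:R + tau) / 2)%R.
pose K (r t : R) : R := ((1 - 2 * t + r ^+ 2) `^ (- q))%R.
have K0 r t : (0 <= K r t)%R by exact: powR_ge0.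
pose F (pt : R * R) := G pt.1 * (K pt.1 pt.2)%:E.
transitivity (\int[lebesgue_rV m.+2]_y F (enorm y, y ord0 ord0)).
  apply: eq_integral => y _; rewrite enorm_powRN sqn_e1B -/q /F /K.
  by rewrite sqr_enorm.
rewrite (@ge0_integral_zonal_slope R m.+1 F); last 3 first.
- by [].
- by rewrite /F /K; meas.
- by move=> pt; rewrite mule_ge0// lee_fin.
pose A (r x : R) := (G r * (K r (r * cos_atan x))%:E + G r * (K r (- (r * cos_atan x)))%:E) *
  (cos_atan x ^+ m.+2 * x ^+ m)%:E.
have A0 r x : (0 < x)%R -> 0 <= A r x.
  move=> x0; rewrite /A mule_ge0 ?adde_ge0 ?mule_ge0 ?lee_fin//.
  by rewrite mulr_ge0// ?exprn_ge0 ?powR_ge0// ltW.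
have mca : measurable_fun [set: R] (@cos_atan R) by rewrite /cos_atan; meas.
have mA : measurable_fun [set: R] (fun r => (r ^+ m.+1)%:E * ipos (A r)).
  apply: emeasurable_funM; first by meas.
  rewrite (_ : (fun r => _) = fun r => ipos (fun x => (G r * (K r (r * cos_atan x))%:E +
      G r * (K r (- (r * cos_atan x)))%:E) * (cos_atan x ^+ m.+2 * `|x| ^+ m)%:E)); last first.
    by apply/funext => r; apply: eq_ipos => x x0; rewrite gtr0_norm.
  apply: (@measurable_ipos R _ R (fun p => (G p.1 * (K p.1 (p.1 * cos_atan p.2))%:E +
    G p.1 * (K p.1 (- (p.1 * cos_atan p.2)))%:E) * (cos_atan p.2 ^+ m.+2 * `|p.2| ^+ m)%:E)).
    by rewrite /K; meas.
  move=> pt; rewrite mule_ge0 ?adde_ge0 ?mule_ge0 ?lee_fin//.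
  by rewrite mulr_ge0// ?exprn_ge0 ?powR_ge0.
rewrite muleC -iposZr//; last 2 first.
- by rewrite lee_fin (ltW (surface_unit_sphere_gt0 m)).
- by move=> r r0; rewrite mule_ge0 ?lee_fin ?exprn_ge0 ?(ltW r0)//; apply: ipos_ge0 => x; exact: A0.
apply: eq_ipos => r r0; rewrite [ipos _](_ : _ = ipos (A r)); last by [].
case: ltP => r1; last first.
  rewrite (_ : ipos _ = 0) ?mule0 ?mul0e//; rewrite -[RHS](@integral0 _ _ _ leb setT).
  by apply: eq_integral => x _; rewrite /A G1// !mul0e adde0 mul0e if_same.
(* The integrand of [Phi] at [t] and at [- t], added; the substitution [t = cos_atan x] turns the
   slope integral into the integral of [f] over [(0, 1)]. *)
pose f (t : R) := ((K r (r * t) + K r (r * - t)) * (1 - t ^+ 2) `^ ((m.+2%:R - 3) / 2))%R.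
have Kpos (t : R) : (-1 <= t <= 1)%R -> ((1 - r) ^+ 2 <= 1 - 2 * (r * t) + r ^+ 2)%R.
  move=> /andP[t1 t2]; rewrite -subr_ge0.
  rewrite [X in (0 <= X)%R](_ : _ = (2 * (r * (1 - t)))%R); last by ring.
  by rewrite mulr_ge0// mulr_ge0 ?subr_ge0// ltW.
have r10 : (0 < (1 - r) ^+ 2)%R by rewrite exprn_gt0// subr_gt0.
have fcont (t : R) : (0 < t < 1)%R -> (0 <= f t)%R /\ {for t, continuous f}.
  move=> /andP[t0 t1]; split; first by rewrite mulr_ge0 ?addr_ge0 ?powR_ge0.
  have cK (u : R) : (-1 <= u <= 1)%R -> {for u, continuous (fun t => K r (r * t))}%R.
    move=> ut; apply: (@continuous_comp _ _ _ (fun t : R => 1 - 2 * (r * t) + r ^+ 2)%R (fun x => x `^ (- q))%R).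
      apply: cvgD; last exact: cvg_cst.
      apply: cvgB; first exact: cvg_cst.
      apply: cvgM; first exact: cvg_cst.
      by apply: cvgM; [exact: cvg_cst|exact: cvg_id].
    apply: continuous_powR_pos; exact: lt_le_trans r10 (Kpos _ ut).
  apply: cvgM.
    apply: cvgD.
      by apply: cK; rewrite (ltW t1) andbT (le_trans _ (ltW t0))// lerN10.
    apply: (@continuous_comp _ _ _ (fun t : R => - t)%R (fun t => K r (r * t))%R).
      by apply: cvgN; exact: cvg_id.
    by apply: cK; rewrite lerN2 (ltW t1)/= (le_trans _ ler01)// oppr_le0 ltW.
  apply: (@continuous_comp _ _ _ (fun t : R => 1 - t ^+ 2)%R (fun x => x `^ ((m.+2%:R - 3) / 2))%R).
    by apply: cvgB; [exact: cvg_cst|exact: exprn_continuous].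
  apply: continuous_powR_pos; rewrite subr_gt0 expr_lt1// ltW//.
pose B (x : R) : \bar R := (f (cos_atan x) * (x * (1 + x ^+ 2) `^ (- 2^-1 - 1)))%:E.
have x21 (x : R) : (0 < 1 + x ^+ 2)%R by rewrite ltr_pwDl// sqr_ge0.
have phi2 (x : R) : (cos_atan x ^+ 2 = (1 + x ^+ 2)^-1)%R.
  rewrite -powR_mulrn ?powR_ge0// /cos_atan -powRrM mulNr mulVf// powR_inv1//.
  exact: ltW.
have BE (x : R) : (0 < x)%R -> B x =
    ((K r (r * cos_atan x) + K r (- (r * cos_atan x))) * (cos_atan x ^+ m.+2 * x ^+ m))%:E.
  move=> x0; rewrite /B /f mulrN -mulrA; congr ((_ * _)%:E).
  have xp : (0 < x * cos_atan x)%R by rewrite mulr_gt0// powR_gt0.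
  have -> : (1 - cos_atan x ^+ 2 = (x * cos_atan x) ^+ 2)%R.
    by rewrite exprMn phi2; field; rewrite gt_eqF.
  rewrite -powR_mulrn ?(ltW xp)// -powRrM.
  have -> : (x * (1 + x ^+ 2) `^ (- 2^-1 - 1) = x * cos_atan x * cos_atan x ^+ 2)%R.
    by rewrite powRD_gt0// powR_inv1 ?(ltW (x21 x))// phi2 mulrA.
  rewrite mulrA -{2}(@powRr1 _ (x * cos_atan x)%R) ?(ltW xp)// -powRD_gt0//.
  have -> : (2%:R * ((m.+2%:R - 3) / 2) + 1 = m%:R :> R)%R.
    by rewrite -[m.+2]addn2 natrD; field.
  by rewrite powR_mulrn ?(ltW xp)// exprMn -mulrA -exprD addn2 mulrC.
have B0 (x : R) : (0 < x)%R -> 0 <= B x.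
  move=> x0; rewrite BE// lee_fin mulr_ge0 ?addr_ge0 ?powR_ge0//.
  by rewrite mulr_ge0 ?exprn_ge0 ?(ltW x0)//; exact: powR_ge0.
have -> : ipos (A r) = ipos B * G r.
  rewrite -iposZr//; last by rewrite /B /f /K; meas.
  apply: eq_ipos => x x0; rewrite BE// /A -ge0_muleDr ?lee_fin// -EFinD.
  by rewrite -muleA -EFinM muleC.
have q0 : (0 <= q)%R by rewrite divr_ge0// addr_ge0.
have Kle (u : R) : (-1 <= u <= 1)%R -> (K r (r * u) <= ((1 - r) ^+ 2) `^ (- q))%R.
  move=> u1; have h := Kpos _ u1; have h0 := lt_le_trans r10 h.
  rewrite /K !powRN lef_pV2 ?posrE ?powR_gt0// ge0_ler_powR ?nnegrE//.
  - exact: ltW r10.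
  - exact: ltW h0.
(* For fixed [r < 1] the kernel is bounded by a power of [1 - r], and the remaining factor in [x] is
   at most [1 / (1 + x ^+ 2)]. *)
have Bfin : ipos B < +oo.
  pose c : R := (2 * ((1 - r) ^+ 2) `^ (- q))%R.
  have c0 : (0 <= c)%R by rewrite mulr_ge0// powR_ge0.
  have m1 : measurable_fun [set: R] (fun x : R => ((1 + x ^+ 2) `^ (- 1))%:E) by meas.
  apply: (@le_lt_trans _ _ (c%:E * ipos (fun x : R => ((1 + x ^+ 2) `^ (- 1))%:E))).
    rewrite -iposZ//; last by move=> x; rewrite lee_fin powR_ge0.
    apply: le_ipos.
    - by rewrite /B /f /K; meas.
    - by meas.
    - exact: B0.
    move=> x x0; rewrite BE// lee_fin.
    have c01 : (0 < cos_atan x <= 1)%R.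
      rewrite powR_gt0// -(@expr_le1 _ 2) ?powR_ge0// phi2 invf_le1// lerDl sqr_ge0//.
    have /andP[c0' c1'] := c01.
    have cN : (- 1 <= cos_atan x <= 1)%R by rewrite c1' andbT (le_trans _ (ltW c0'))// lerN10.
    have cN' : (- 1 <= - cos_atan x <= 1)%R by rewrite lerN2 c1'/= (le_trans _ ler01)// oppr_le0 ltW.
    apply: ler_pM.
    - by rewrite addr_ge0// powR_ge0.
    - by rewrite mulr_ge0// exprn_ge0// ltW.
    - by rewrite /c mulr_natl mulr2n lerD ?Kle// -mulrN Kle.
    rewrite powR_inv1 ?(ltW (x21 x))// -phi2 -addn2 exprD mulrAC -exprMn.
    rewrite ler_piMl ?sqr_ge0// exprn_ile1//.
      by rewrite mulr_ge0// ltW.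
    rewrite -(@expr_le1 _ 2)//; last by rewrite mulr_ge0// ltW.
    by rewrite exprMn phi2 mulrC ler_pdivrMr// mul1r lerDr.
  by rewrite lte_mul_pinfty ?lee_fin//; exact: ipos_inv1sqr.
have BI : ipos B = \int[leb]_(t in `[(-1)%R, 1%R])
    ((1 - t ^+ 2) `^ ((m.+2%:R - 3) / 2) / (1 - 2 * t * r + r ^+ 2) `^ q)%:E.
  transitivity (\int[leb]_t (if ((0 < t) && (t < 1))%R then (f t)%:E else 0)).
    rewrite -(integral_subst_phi fcont); apply: eq_ipos => x x0.
    by rewrite opprK.
  pose g (t : R) : \bar R := ((1 - t ^+ 2) `^ ((m.+2%:R - 3) / 2) / (1 - 2 * t * r + r ^+ 2) `^ q)%:E.
  have mg : measurable_fun [set: R] g by rewrite /g; meas.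
  have g0 t : 0 <= g t by rewrite lee_fin mulr_ge0 ?invr_ge0 ?powR_ge0.
  rewrite integral_itv_bndoo; last exact: measurable_funTS.
  rewrite (_ : [set` `](-1)%R, 1%R[%R] = [set t | (-1 < t) && (t < 1)]%R); last first.
    by apply/seteqP; split => t /=; rewrite in_itv.
  rewrite integral_if [RHS]iposT; last 2 first.
  - apply: measurable_fun_ifT => //.
    by apply: measurable_and; exact: measurable_fun_ltr.
  - by move=> t; case: ifPn => // _; exact: g0.
  rewrite /ipos; apply: eq_integral => t _; case: (ltP 0%R t) => //= t0.
  rewrite ltrN2 (_ : (-1 < t)%R = true); last by rewrite (lt_trans _ t0)// ltrN10.
  rewrite (_ : (- t < 1)%R = true) ?andbT; last by rewrite (lt_trans _ ltr01)// oppr_lt0.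
  case: ltP => //=; last by rewrite adde0.
  move=> t1; rewrite -EFinD /f /K sqrrN mulrC mulrDr !powRN; congr (_ / _ `^ _ + _ / _ `^ _)%:E; ring.
rewrite muleC !muleA -EFinM /Phi /=.
rewrite /Rintegral -BI.
have -> : ipos B = (fine (ipos B))%:E.
  rewrite fineK// ge0_fin_numE//; exact: ipos_ge0 B0.
rewrite -EFinM muleC; congr (_ * _%:E).
ring.
Qed.

End mass_zonal.

(** * Finiteness of kernel integrals *)

Section mass_finite.
Context {R : realType}.
Local Notation leb := (@lebesgue_measure R).
Local Open Scope ereal_scope.

Lemma abs_1Benorm_le n (y : 'rV[R]_n.+1) : (`|1 - enorm y| <= enorm (e1 n - y))%R.
Proof.
rewrite -sqrtr_sqr [leRHS]enormE ler_wsqrtr// sqn_e1B -sqr_enorm -subr_ge0.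
have -> : (1 - 2 * y ord0 ord0 + enorm y ^+ 2 - (1 - enorm y) ^+ 2 =
  2 * (enorm y - y ord0 ord0))%R by ring.
by rewrite mulr_ge0// subr_ge0 (le_trans (ler_norm _) (coord_le_enorm _ _)).
Qed.

Lemma enorm_e1B_le n (y : 'rV[R]_n.+1) : (enorm (e1 n - y) <= 1 + enorm y)%R.
Proof.
rewrite -[leRHS]ger0_norm ?addr_ge0 ?enorm_ge0// -sqrtr_sqr [leLHS]enormE ler_wsqrtr//.
rewrite sqn_e1B -sqr_enorm -subr_ge0.
have -> : ((1 + enorm y) ^+ 2 - (1 - 2 * y ord0 ord0 + enorm y ^+ 2) =
  2 * (enorm y + y ord0 ord0))%R by ring.
rewrite mulr_ge0// -[y ord0 ord0]opprK subr_ge0 (le_trans (ler_norm _))//.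
by rewrite normrN coord_le_enorm.
Qed.

Lemma integral_ball_powR_fin n (a c : R) : (- n.+1%:R < a)%R -> (0 < c)%R ->
  \int[lebesgue_rV n.+1]_y (if (enorm y <= c)%R then (enorm y `^ a)%:E else 0) < +oo.
Proof.
move=> an c0; pose f (r : R) := if (r <= c)%R then (r `^ a)%:E else 0.
have mf : measurable_fun [set: R] f.
  by apply: measurable_fun_ifT => //; [exact: measurable_fun_ler|meas].
have f0 r : 0 <= f r by rewrite /f; case: ifPn => // _; rewrite lee_fin powR_ge0.
rewrite (@ge0_integral_radial R n.+1 f)// integral_pos_if.
have -> : \int[leb]_r (if (0 < r)%R then f r * (r ^+ n)%:E else 0) =
    ipos (fun r => if (r <= c)%R then (r `^ (a + n.+1%:R - 1))%:E else 0).
  apply: eq_ipos => r r0; rewrite /f; case: ifPn => _; last by rewrite mul0e.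
  rewrite -EFinM; congr (_%:E); rewrite -powR_mulrn ?(ltW r0)// -powRD_gt0//.
  by congr (_ `^ _)%R; rewrite -addn1 natrD; ring.
rewrite ipos_powR_bounded//; first by rewrite -EFinM ltry.
by rewrite -(ltrD2r (- n.+1%:R)) addrK add0r.
Qed.

Lemma integral_tail_powR_fin n (a c : R) : (a < - n.+1%:R)%R -> (0 < c)%R ->
  \int[lebesgue_rV n.+1]_y (if (c <= enorm y)%R then (enorm y `^ a)%:E else 0) < +oo.
Proof.
move=> an c0; pose f (r : R) := if (c <= r)%R then (r `^ a)%:E else 0.
have mf : measurable_fun [set: R] f.
  by apply: measurable_fun_ifT => //; [exact: measurable_fun_ler|meas].
have f0 r : 0 <= f r by rewrite /f; case: ifPn => // _; rewrite lee_fin powR_ge0.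
rewrite (@ge0_integral_radial R n.+1 f)// integral_pos_if.
have -> : \int[leb]_r (if (0 < r)%R then f r * (r ^+ n)%:E else 0) =
    ipos (fun r => if (c <= r)%R then (r `^ (- (- a - n.+1%:R) - 1))%:E else 0).
  apply: eq_ipos => r r0; rewrite /f; case: ifPn => _; last by rewrite mul0e.
  rewrite -EFinM; congr (_%:E); rewrite -powR_mulrn ?(ltW r0)// -powRD_gt0//.
  by congr (_ `^ _)%R; rewrite -addn1 natrD; ring.
rewrite ipos_powR_tail//; first by rewrite -EFinM ltry.
by rewrite subr_gt0 ltrNr.
Qed.

Lemma integral_translate n (f : 'rV[R]_n -> \bar R) (x : 'rV[R]_n) :
  measurable_fun [set: 'rV[R]_n] f -> (forall y, 0 <= f y) ->
  \int[lebesgue_rV n]_y f (x - y)%R = \int[lebesgue_rV n]_y f y.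
Proof.
move=> mf f0; have n1 : (-1 : R)%R != 0%R by rewrite oppr_eq0 oner_eq0.
have := @ge0_integral_rV_affine R n (-1)%R x f n1 mf f0.
rewrite normrN1 invr1 expr1n mul1e => <-; apply: eq_integral => y _.
by rewrite scaleN1r addrC.
Qed.

Lemma ge0_integralDT d (T : measurableType d) (mu : {measure set T -> \bar R})
    (f g : T -> \bar R) : (forall x, 0 <= f x) -> measurable_fun [set: T] f ->
  (forall x, 0 <= g x) -> measurable_fun [set: T] g ->
  \int[mu]_x (f x + g x) = \int[mu]_x f x + \int[mu]_x g x.
Proof. by move=> f0 mf g0 mg; rewrite ge0_integralD. Qed.

Lemma integralZ3_lty d (T : measurableType d) (mu : {measure set T -> \bar R})
    (c : R) (f g h : T -> \bar R) : (0 <= c)%R ->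
  (forall x, 0 <= f x) -> measurable_fun [set: T] f -> \int[mu]_x f x < +oo ->
  (forall x, 0 <= g x) -> measurable_fun [set: T] g -> \int[mu]_x g x < +oo ->
  (forall x, 0 <= h x) -> measurable_fun [set: T] h -> \int[mu]_x h x < +oo ->
  \int[mu]_x (c%:E * (f x + g x + h x)) < +oo.
Proof.
move=> c0 f0 mf fF g0 mg gF h0 mh hF; have mfg := emeasurable_funD mf mg.
have fg0 x : 0 <= f x + g x by rewrite adde_ge0.
rewrite ge0_integralZlT//; last exact: (emeasurable_funD mfg mh).
  rewrite ge0_integralDT// ge0_integralDT//; apply: lte_mul_pinfty; rewrite ?lee_fin//.
  by apply: lte_add_pinfty => //; exact: lte_add_pinfty.
by move=> x; rewrite adde_ge0.
Qed.

(** The three bounds on [G] answer the three possible divergences: at the origin, at the unit sphere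
    and at infinity. Near the sphere the kernel is singular at [e1] only, and
    [|1 - |y|| <= |e1 - y|] turns the factor [|1 - r| ^ q] into a power of [|e1 - y|] that makes the
    product integrable because [q > tau]. *)
Lemma mass_fin n (tau q a b A : R) (G : R -> \bar R) :
  (- n.+1%:R < tau < q)%R -> (0 <= q)%R -> (- n.+1%:R < a)%R -> (b < tau)%R -> (0 <= A)%R ->
  measurable_fun [set: R] G -> (forall r, 0 <= G r) ->
  (forall r, (0 < r <= 2^-1)%R -> G r <= (A * r `^ a)%:E) ->
  (forall r, (2^-1 < r < 2)%R -> G r <= (A * `|1 - r| `^ q)%:E) ->
  (forall r, (2 <= r)%R -> G r <= (A * r `^ b)%:E) ->
  mass n tau G < +oo.
Proof.
move=> /andP[tn tq] q0 an bt A0 mG G0 G1 G2 G3; set N := (n.+1%:R + tau)%R.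
have N0 : (0 < N)%R by rewrite /N addrC -[n.+1%:R]opprK subr_gt0.
pose f1 (y : 'rV[R]_n.+1) := if (enorm y <= 2^-1)%R then (enorm y `^ a)%:E else 0.
pose f2 (y : 'rV[R]_n.+1) := if (enorm y <= 3)%R then (enorm y `^ (q - N))%:E else 0.
pose f3 (y : 'rV[R]_n.+1) := if (2 <= enorm y)%R then (enorm y `^ (b - N))%:E else 0.
have F1 : \int[lebesgue_rV n.+1]_y f1 y < +oo by apply: integral_ball_powR_fin.
have F2 : \int[lebesgue_rV n.+1]_y f2 (e1 n - y)%R < +oo.
  rewrite (@integral_translate _ f2).
  - by apply: integral_ball_powR_fin => //; rewrite /N opprD addrCA -[ltLHS]addr0 ltrD2l subr_gt0.
  - apply: measurable_fun_ifT; [|by meas|exact: measurable_cst].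
    by apply: measurable_fun_ler; meas.
  - by move=> y; rewrite /f2; case: ifPn => // _; rewrite lee_fin powR_ge0.
have F3 : \int[lebesgue_rV n.+1]_y f3 y < +oo.
  by apply: integral_tail_powR_fin => //; rewrite /N opprD addrCA -[ltRHS]addr0 ltrD2l subr_lt0.
have m1 : measurable_fun [set: 'rV[R]_n.+1] f1.
  apply: measurable_fun_ifT => //; last by meas.
  by apply: measurable_fun_ler => //; meas.
have m2 : measurable_fun [set: 'rV[R]_n.+1] (fun y => f2 (e1 n - y)%R).
  apply: measurable_fun_ifT => //; last by meas.
  by apply: measurable_fun_ler => //; meas.
have m3 : measurable_fun [set: 'rV[R]_n.+1] f3.
  apply: measurable_fun_ifT => //; last by meas.
  by apply: measurable_fun_ler => //; meas.
have p1 y : 0 <= f1 y by rewrite /f1; case: ifPn => // _; rewrite lee_fin powR_ge0.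
have p2 y : 0 <= f2 (e1 n - y)%R by rewrite /f2; case: ifPn => // _; rewrite lee_fin powR_ge0.
have p3 y : 0 <= f3 y by rewrite /f3; case: ifPn => // _; rewrite lee_fin powR_ge0.
have m12 := emeasurable_funD m1 m2; have m123 := emeasurable_funD m12 m3.
(* Away from the shell, [|e1 - y|] is at least half of 1 or half of [|y|], whence the factor
   [2 ^ N]. *)
pose c := (A * 2 `^ N)%R.
have c0 : (0 <= c)%R by rewrite mulr_ge0// powR_ge0.
have cA : (A <= c)%R.
  rewrite /c ler_peMr//; have := @ge0_ler_powR R N (ltW N0) 1%R 2%R.
  by rewrite one_powR !nnegrE; apply => //; rewrite ler1n.
apply: (@le_lt_trans _ _ (\int[lebesgue_rV n.+1]_y (c%:E * (f1 y + f2 (e1 n - y)%R + f3 y)))).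
  have -> : mass n tau G = \int[lebesgue_rV n.+1]_y
      (if (0 < enorm y)%R then G (enorm y) * (enorm (e1 n - y) `^ (- N))%:E else 0).
    apply: eq_integral_neq0.
    - by meas.
    - apply: measurable_fun_ifT => //; last by meas.
      by apply: measurable_fun_ltr => //; meas.
    - by move=> y; rewrite mule_ge0// lee_fin powR_ge0.
    - by move=> y; case: ifPn => // _; rewrite mule_ge0// lee_fin powR_ge0.
    - by move=> y; rewrite enorm_gt0 => ->.
  apply: ge0_le_integral => //.
  - by move=> y _; case: ifPn => // _; rewrite mule_ge0// lee_fin powR_ge0.
  - apply: measurable_fun_ifT => //; last by meas.
    by apply: measurable_fun_ltr => //; meas.
  - exact: (emeasurable_funM (measurable_cst c%:E) m123).
  move=> y _; case: ifPn => [y0|_]; last by rewrite mule_ge0 ?adde_ge0.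
  have h1 := abs_1Benorm_le y; have h2 := enorm_e1B_le y.
  have le0 (u : \bar R) v w : 0 <= v -> 0 <= w -> u <= u + v + w.
    by move=> v0 w0; rewrite -addeA leeDl// adde_ge0.
  have kerle (z : R) : (0 < z)%R -> (z / 2 <= enorm (e1 n - y))%R ->
      (enorm (e1 n - y) `^ (- N) <= 2 `^ N * z `^ (- N))%R.
    move=> z0 hz; have z20 : (0 < z / 2)%R by rewrite divr_gt0.
    have -> : (2 `^ N * z `^ (- N) = (z / 2) `^ (- N))%R.
      rewrite !powRN powRM ?(ltW z0)// invfM mulrC; congr (_ * _)%R.
      by rewrite -powR_inv1// -powRrM mulN1r powRN invrK.
    rewrite !powRN lef_pV2 ?posrE ?powR_gt0//; last exact: lt_le_trans hz.
    by rewrite ge0_ler_powR ?nnegrE ?(ltW N0) ?(ltW z20)// enorm_ge0.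
  have [y1|y1] := leP (enorm y) 2^-1%R.
    apply: (@le_trans _ _ (c%:E * f1 y)).
      rewrite /f1 y1; apply: (@le_trans _ _ ((A * enorm y `^ a)%:E * (2 `^ N)%:E)).
        apply: lee_pmul => //; rewrite ?lee_fin ?powR_ge0//; first by apply: G1; rewrite y0.
        have := kerle 1%R ltr01; rewrite one_powR mulr1; apply.
        apply: le_trans h1; apply: le_trans (ler_norm _).
        by move: y1; move: (enorm y) => e; lra.
      by rewrite -!EFinM lee_fin /c mulrAC.
    by rewrite lee_wpmul2l// ?lee_fin// le0.
  have [y2|y2] := ltP (enorm y) 2%R.
    apply: (@le_trans _ _ (c%:E * f2 (e1 n - y)%R)); last first.
      rewrite lee_wpmul2l ?lee_fin//.
      by rewrite addeAC addeC leeDl// adde_ge0.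
    rewrite /f2 ifT; last by apply: le_trans h2 _; move: y2; move: (enorm y) => e; lra.
    have [e0|e0] := ltP 0%R (enorm (e1 n - y)); last first.
      have e00 : enorm (e1 n - y) = 0%R by apply/eqP; rewrite eq_le e0 enorm_ge0.
      by rewrite e00 [X in _ * X%:E]powR0 ?oppr_eq0 ?gt_eqF// mule0 -EFinM lee_fin mulr_ge0// powR_ge0.
    apply: (@le_trans _ _ ((A * `|1 - enorm y| `^ q)%:E * (enorm (e1 n - y) `^ (- N))%:E)).
      by rewrite lee_wpmul2r ?lee_fin ?powR_ge0// G2// y1.
    rewrite -!EFinM lee_fin powRD_gt0// mulrA ler_wpM2r ?powR_ge0//.
    apply: ler_pM => //; rewrite ?powR_ge0//.
    by rewrite ge0_ler_powR ?nnegrE ?enorm_ge0.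
  apply: (@le_trans _ _ (c%:E * f3 y)); last first.
    by rewrite lee_wpmul2l ?lee_fin// addeC leeDl// adde_ge0.
  rewrite /f3 y2; apply: (@le_trans _ _ ((A * enorm y `^ b)%:E * (2 `^ N * enorm y `^ (- N))%:E)).
    apply: lee_pmul => //; rewrite ?lee_fin ?powR_ge0//; first exact: G3.
    apply: kerle => //; apply: le_trans h1; rewrite distrC; apply: le_trans (ler_norm _).
    by move: y2; move: (enorm y) => e; lra.
  by rewrite -!EFinM lee_fin powRD_gt0// /c !mulrA ler_wpM2r ?powR_ge0// mulrAC.
exact: (integralZ3_lty c0 p1 m1 F1 p2 m2 F2 p3 m3).
Qed.

End mass_finite.

Section mass_constants.
Context {R : realType}.
Local Notation leb := (@lebesgue_measure R).

Lemma ln_near1_le (r : R) : 2^-1 < r < 2 -> `|ln r| <= 2 * `|1 - r|.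
Proof.
move=> /andP[r1 r2]; have r0 : 0 < r by rewrite (lt_trans _ r1)// invr_gt0.
have l (x : R) : 0 < x -> ln x <= x - 1.
  by move=> x0; have := @le_ln1Dx R (x - 1); rewrite subrKC; apply; lra.
have h1 := l _ r0; have ir : 0 < r^-1 by rewrite invr_gt0.
have h2 := l _ ir; rewrite lnV ?posrE// in h2.
have h3 : r^-1 - 1 <= 2 * `|1 - r|.
  have -> : r^-1 - 1 = r^-1 * (1 - r) by field; rewrite gt_eqF.
  apply: (@le_trans _ _ (r^-1 * `|1 - r|)); first by rewrite ler_wpM2l ?(ltW ir)// ler_norm.
  by rewrite ler_wpM2r// -(invrK 2) lef_pV2 ?posrE// ltW.
rewrite ler_norml; apply/andP; split; first by rewrite lerNl (le_trans h2).
apply: (le_trans h1); apply: (@le_trans _ _ `|1 - r|); first by rewrite distrC ler_norm.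
by rewrite ler_peMl// ler1n.
Qed.

Lemma abs_1Bexp_le (x : R) : `|1 - expR x| <= `|x| * expR `|x|.
Proof.
have [x0|x0] := leP 0 x.
  rewrite distrC ger0_norm ?subr_ge0 -?expR0 ?ler_expR// (ger0_norm x0).
  have := expR_ge1Dx (- x); rewrite -(ler_pM2r (expR_gt0 x)) -expRD addNr expR0.
  lra.
rewrite ger0_norm; last by rewrite subr_ge0 -expR0 ler_expR ltW.
rewrite (ltr0_norm x0); have := expR_ge1Dx x.
have : 1 <= expR (- x) by rewrite -expR0 ler_expR oppr_ge0 ltW.
have : 0 < - x by rewrite oppr_gt0.
move: (expR (- x)) => e x1 e1 h; nra.
Qed.

(** Apply [|1 - exp x| <= |x| exp |x|] at [x = g ln r]. It shows that [|1 - r ^ g| ^ p] vanishes at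
    1 to the order [p] required by [mass_fin]. *)
Lemma abs_1BpowR_near1 (g : R) :
  exists2 A : R, 0 <= A & forall r, 2^-1 < r < 2 -> `|1 - r `^ g| <= A * `|1 - r|.
Proof.
exists (2 * `|g| * expR (2 * `|g|)); first by rewrite !mulr_ge0// expR_ge0.
move=> r r12; have h := ln_near1_le r12; have /andP[r1 r2] := r12.
have r0 : 0 < r by rewrite (lt_trans _ r1)// invr_gt0.
have -> : r `^ g = expR (g * ln r) by rewrite /powR gt_eqF.
apply: (le_trans (abs_1Bexp_le _)); rewrite normrM.
have h1 : `|1 - r| <= 1 by rewrite ler_norml; lra.
have h2 : `|ln r| <= 2 by apply: (le_trans h); rewrite -[leRHS]mulr1 ler_wpM2l.
have h3 : `|g| * `|ln r| <= 2 * `|g| by rewrite mulrC ler_wpM2r.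
apply: (@le_trans _ _ (`|g| * `|ln r| * expR (2 * `|g|))).
  by rewrite ler_wpM2l ?mulr_ge0// ler_expR.
rewrite [leRHS]mulrAC ler_wpM2r ?expR_ge0//.
have : `|g| * `|ln r| <= `|g| * (2 * `|1 - r|) by rewrite ler_wpM2l.
lra.
Qed.

(* [x ^ e >= 1 + e ln x] *)
Lemma ln_le_powR (e r : R) : 0 < e -> 0 < r -> ln r <= e^-1 * r `^ e.
Proof.
move=> e0 r0; rewrite ler_pdivlMl// /powR gt_eqF//.
by apply: le_trans (expR_ge1Dx _); rewrite lerDr.
Qed.

Local Open Scope ereal_scope.

Variables (n : nat) (tau : R).
Local Notation k := (n.+1%:R : R).

(** The logarithm costs an arbitrarily small power at 0 and at infinity, here half of the room left
    on each side of [a]; at 1 it vanishes to order [p > tau]. This mass and the next two bound the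
    energy of the cutoff. *)
Lemma mass_ln_fin (p a : R) : (0 <= tau < p)%R -> (- k < a < tau)%R ->
  mass n tau (fun r => (`|ln r| `^ p * r `^ a)%:E) < +oo.
Proof.
move=> /andP[t0 tp] /andP[ka at_]; have p0 : (0 < p)%R by exact: le_lt_trans tp.
pose e1 := ((a + k) / 2)%R; pose e2 := ((tau - a) / 2)%R.
have e10 : (0 < e1)%R by rewrite divr_gt0// -[k]opprK subr_gt0.
have e20 : (0 < e2)%R by rewrite divr_gt0// subr_gt0.
pose A := ((e1 / p)^-1 `^ p + (e2 / p)^-1 `^ p + 2 `^ p * 2 `^ `|a|)%R.
have A0 : (0 <= A)%R by rewrite !addr_ge0 ?mulr_ge0 ?powR_ge0.
have key (e r : R) : (0 < e)%R -> (1 <= r)%R -> (`|ln r| `^ p <= (e / p)^-1 `^ p * r `^ e)%R.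
  move=> e0 r1; have r0 : (0 < r)%R by exact: lt_le_trans r1.
  rewrite ger0_norm ?ln_ge0//.
  have ep0 : (0 < e / p)%R by rewrite divr_gt0.
  have -> : (r `^ e = (r `^ (e / p)) `^ p)%R by rewrite -powRrM divfK// gt_eqF.
  rewrite -powRM ?invr_ge0 ?powR_ge0 ?(ltW ep0)//.
  rewrite ge0_ler_powR ?nnegrE ?(ltW p0) ?ln_ge0//; last exact: ln_le_powR.
  by rewrite mulr_ge0// ?powR_ge0// invr_ge0 ltW.
apply: (@mass_fin R n tau p (a - e1)%R (a + e2)%R A) => //.
- by rewrite tp andbT (lt_le_trans _ t0)// oppr_lt0.
- exact: ltW.
- by rewrite /e1; lra.
- by rewrite /e2; lra.
- apply/measurable_EFinP; apply: measurable_funM; last exact: measurable_powR.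
  apply: (measurableT_comp (@measurable_powR R p)).
  by apply: (measurableT_comp (@normr_measurable R _)); exact: measurable_ln.
- by move=> r; rewrite lee_fin mulr_ge0// powR_ge0.
- move=> r /andP[r0 r1]; have ri : (1 <= r^-1)%R.
    by rewrite invf_ge1// (le_trans r1)// invf_le1// ler1n.
  have := key e1 _ e10 ri; rewrite lnV ?posrE// normrN => h.
  rewrite -(powR_inv1 (ltW r0)) -powRrM mulN1r in h.
  rewrite lee_fin addrC powRD_gt0// mulrA ler_wpM2r ?powR_ge0//.
  apply: (le_trans h); rewrite ler_wpM2r ?powR_ge0// /A -addrA lerDl addr_ge0 ?mulr_ge0 ?powR_ge0//.
- move=> r r12; have /andP[r1 r2] := r12.
  have r0 : (0 < r)%R by rewrite (lt_trans _ r1)// invr_gt0.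
  have ra : (r `^ a <= 2 `^ `|a|)%R.
    rewrite /powR !gt_eqF// ler_expR (le_trans (ler_norm _))// normrM ler_wpM2l//.
    have l2 : (0 < ln 2 :> R)%R by rewrite ln_gt0// ltr1n.
    rewrite ler_norml -lnV ?posrE// !ler_ln ?posrE ?invr_gt0// (ltW r1) (ltW r2)//.
  rewrite lee_fin; apply: (@le_trans _ _ ((2 * `|1 - r|) `^ p * 2 `^ `|a|)%R).
    have m0 : (0 <= 2 * `|1 - r|)%R by rewrite mulr_ge0.
    apply: ler_pM; rewrite ?powR_ge0// ge0_ler_powR ?nnegrE ?(ltW p0)//.
    exact: ln_near1_le.
  by rewrite powRM// mulrAC ler_wpM2r ?powR_ge0// /A lerDr addr_ge0// powR_ge0.
- move=> r r2; have r0 : (0 < r)%R by rewrite (lt_le_trans _ r2).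
  have r1 : (1 <= r)%R by rewrite (le_trans _ r2)// ler1n.
  have h := key e2 r e20 r1; rewrite lee_fin powRD_gt0// (mulrC (r `^ a)%R) mulrA ler_wpM2r ?powR_ge0//.
  apply: (le_trans h); rewrite ler_wpM2r ?powR_ge0// /A addrAC lerDr addr_ge0 ?mulr_ge0 ?powR_ge0//.
Qed.

(** For negative [tau] the kernel is locally integrable, so nothing has to vanish on the unit
    sphere; restriction to the shell replaces decay at infinity. *)
Lemma mass_shell_fin (a : R) : (- k < tau)%R -> (tau < 0)%R ->
  mass n tau (fun r => if (2^-1 < r < 2)%R then (r `^ a)%:E else 0) < +oo.
Proof.
move=> kt t0; apply: (@mass_fin R n tau 0%R 0%R (tau - 1)%R (2 `^ `|a|)%R).
- by rewrite kt.
- exact: lexx.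
- by rewrite oppr_lt0.
- by rewrite gtrBl.
- exact: powR_ge0.
- apply: measurable_fun_ifT; [|by meas|exact: measurable_cst].
  by apply: measurable_and; exact: measurable_fun_ltr.
- by move=> r; case: ifPn => // _; rewrite lee_fin powR_ge0.
- by move=> r /andP[r0 r1]; rewrite ltNge r1 lee_fin mulr_ge0 ?powR_ge0.
- move=> r r12; have /andP[r1 r2] := r12; rewrite r12 lee_fin powRr0 mulr1.
  have r0 : (0 < r)%R by rewrite (lt_trans _ r1)// invr_gt0.
  rewrite /powR !gt_eqF// ler_expR (le_trans (ler_norm _))// normrM ler_wpM2l//.
  rewrite ler_norml -lnV ?posrE// !ler_ln ?posrE ?invr_gt0// (ltW r1) (ltW r2)//.
- by move=> r r2; rewrite [(r < 2)%R]ltNge r2 andbF lee_fin mulr_ge0 ?powR_ge0.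
Qed.

Lemma mass_off_shell_fin (a : R) : (0 < tau)%R -> (- k < a < tau)%R ->
  mass n tau (fun r => if (2^-1 < r < 2)%R then 0 else (r `^ a)%:E) < +oo.
Proof.
move=> t0 /andP[ka at_]; apply: (@mass_fin R n tau (tau + 1)%R a a 1%R) => //.
- by rewrite (lt_trans _ t0) ?oppr_lt0//= ltrDl.
- by rewrite addr_ge0 ?(ltW t0).
- apply: measurable_fun_ifT; [|exact: measurable_cst|by meas].
  by apply: measurable_and; exact: measurable_fun_ltr.
- by move=> r; case: ifPn => // _; rewrite lee_fin powR_ge0.
- by move=> r /andP[r0 r1]; rewrite ltNge r1 mul1r.
- by move=> r ->; rewrite lee_fin mul1r powR_ge0.
- by move=> r r2; rewrite [(r < 2)%R]ltNge r2 andbF mul1r.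
Qed.

End mass_constants.

(** * The Hardy constant *)

Section hardy_constant.
Context {R : realType}.
Local Notation leb := (@lebesgue_measure R).
Local Open Scope ereal_scope.

Variables (n : nat) (s p alpha beta : R).
Local Notation k := (n.+1%:R : R).
Local Notation tau := (s * p)%R.
Hypotheses (p2 : (2 <= p)%R) (s01 : (0 < s < 1)%R).
Hypotheses (ha : (- k < alpha < tau)%R) (hb : (- k < beta < tau)%R).

Definition hardy_gamma : R := ((k + alpha + beta - tau) / p)%R.
Local Notation gam := hardy_gamma.

(** The factor [r^(tau - 1) (r^(- alpha) + r^(- beta))] of the one-dimensional constant, divided by
    the polar Jacobian [r ^ n]. *)
Definition pair_weight (r : R) : R := (r `^ (tau - k - alpha) + r `^ (tau - k - beta))%R.

Definition inner_mass (delta : R) (h : R -> R) : \bar R :=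
  mass n tau (fun r => if (0 < r < delta)%R then (h r * pair_weight r)%:E else 0).

Let p0 : (0 < p)%R. Proof. by rewrite (lt_le_trans _ p2). Qed.
Let tau0 : (0 < tau)%R. Proof. by case/andP: s01 => s0 _; rewrite mulr_gt0. Qed.
Let taup : (tau < p)%R.
Proof. by case/andP: s01 => _ s1; rewrite -[ltRHS]mul1r ltr_pM2r. Qed.

Let gamp : (gam * p = k + alpha + beta - tau)%R.
Proof. by rewrite divfK// gt_eqF. Qed.

Lemma pair_weight_ge0 r : (0 <= pair_weight r)%R.
Proof. by rewrite addr_ge0// powR_ge0. Qed.

Lemma measurable_pair_weight : measurable_fun [set: R] pair_weight.
Proof. by rewrite /pair_weight; meas. Qed.

Lemma measurable_inner delta (h : R -> R) : measurable_fun [set: R] h ->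
  measurable_fun [set: R] (fun r => if (0 < r < delta)%R then (h r * pair_weight r)%:E else 0).
Proof.
move=> mh; apply: measurable_fun_ifT; [|by have mw := measurable_pair_weight; meas|exact: measurable_cst].
by apply: measurable_and; exact: measurable_fun_ltr.
Qed.

Lemma inner_ge0 delta (h : R -> R) r : (forall r, (0 <= h r)%R) ->
  0 <= (if (0 < r < delta)%R then (h r * pair_weight r)%:E else 0).
Proof. by move=> h0; case: ifPn => // _; rewrite lee_fin mulr_ge0 ?pair_weight_ge0. Qed.

(* The smaller of the two ground-state weights, so that the terms to be subtracted in
   the energy inequality are finite whatever the sign of [gam]. *)
Definition small_weight (r : R) : R := (if (0 < gam)%R then 1 else r `^ (gam * p))%R.

Lemma inner_mass_fin (delta A : R) (h : R -> R) : (delta <= 1)%R -> (0 <= A)%R ->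
  measurable_fun [set: R] h -> (forall r, (0 <= h r)%R) ->
  (forall r, (0 < r < delta)%R -> (h r <= small_weight r)%R) ->
  (forall r, (2^-1 < r < delta)%R -> (h r <= A * `|1 - r| `^ p)%R) ->
  inner_mass delta h < +oo.
Proof.
move=> d1 A0 mh h0 h1 h2; have /andP[ka at_] := ha; have /andP[kb bt] := hb.
(* The exponent at the origin after multiplication by [small_weight]. It exceeds [- k] by [x < tau]
   if [gam > 0]; otherwise it is [y], because [gam * p = k + x + y - tau]. *)
pose ex (x y : R) : R := (if (0 < gam)%R then tau - k - x else y)%R.
have E : inner_mass delta h =
    mass n tau (fun r => if (0 < r < delta)%R then (h r * r `^ (tau - k - alpha))%:E else 0) +
    mass n tau (fun r => if (0 < r < delta)%R then (h r * r `^ (tau - k - beta))%:E else 0).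
  have mif x : measurable_fun [set: R]
      (fun r => if (0 < r < delta)%R then (h r * r `^ (tau - k - x))%:E else 0).
    apply: measurable_fun_ifT; [|by meas|exact: measurable_cst].
    by apply: measurable_and; exact: measurable_fun_ltr.
  rewrite -massD//.
  - congr (mass _ _ _); apply/funext => r; case: ifPn => _; last by rewrite adde0.
    by rewrite -EFinD mulrDr.
  - by move=> r; case: ifPn => // _; rewrite lee_fin mulr_ge0 ?powR_ge0.
  - by move=> r; case: ifPn => // _; rewrite lee_fin mulr_ge0 ?powR_ge0.
suff key x y : (- k < x < tau)%R -> (- k < y < tau)%R -> (gam * p = k + x + y - tau)%R ->
    mass n tau (fun r => if (0 < r < delta)%R then (h r * r `^ (tau - k - x))%:E else 0) < +oo.
  rewrite E lte_add_pinfty//; first exact: (key alpha beta).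
  by apply: (key beta alpha) => //; rewrite gamp; ring.
move=> /andP[kx xt] /andP[ky yt] gE.
pose B := (2 `^ `|tau - k - x|)%R.
have B1 : (1 <= B)%R.
  rewrite /B /powR gt_eqF// -{1}expR0 ler_expR mulr_ge0//.
  by rewrite ln_ge0// ler1n.
apply: (@mass_fin R n tau p (ex x y) (tau - 1)%R (1 + A * B)%R).
- by rewrite taup andbT (lt_trans _ tau0)// oppr_lt0.
- exact: ltW.
- by rewrite /ex; case: ifPn => // _; lra.
- by rewrite gtrBl.
- by rewrite addr_ge0// mulr_ge0// powR_ge0.
- apply: measurable_fun_ifT; [|by meas|exact: measurable_cst].
  by apply: measurable_and; exact: measurable_fun_ltr.
- by move=> r; case: ifPn => // _; rewrite lee_fin mulr_ge0 ?powR_ge0.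
- move=> r /andP[r0 _]; case: ifPn => [rd|_]; last first.
    by rewrite lee_fin mulr_ge0 ?powR_ge0// addr_ge0// mulr_ge0// powR_ge0.
  rewrite lee_fin; apply: (@le_trans _ _ (small_weight r * r `^ (tau - k - x))%R).
    by rewrite ler_wpM2r ?powR_ge0// h1.
  have -> : (small_weight r * r `^ (tau - k - x) = r `^ (ex x y))%R.
    rewrite /small_weight /ex; case: ifPn => _; first by rewrite mul1r.
    by rewrite -powRD_gt0// gE; congr (_ `^ _)%R; ring.
  by rewrite ler_peMl ?powR_ge0// lerDl mulr_ge0// powR_ge0.
- move=> r /andP[r1 r2]; have r0 : (0 < r)%R by rewrite (lt_trans _ r1)// invr_gt0.
  case: ifPn => [/andP[_ rd]|_]; last first.
    by rewrite lee_fin mulr_ge0 ?powR_ge0// addr_ge0// mulr_ge0// powR_ge0.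
  rewrite lee_fin; apply: (@le_trans _ _ (A * `|1 - r| `^ p * B)%R).
    apply: ler_pM; rewrite ?powR_ge0//; first by apply: h2; rewrite r1.
    rewrite /B /powR !gt_eqF// ler_expR (le_trans (ler_norm _))// normrM ler_wpM2l//.
    rewrite ler_norml -lnV ?posrE// !ler_ln ?posrE ?invr_gt0// (ltW r1) (ltW r2)//.
  by rewrite mulrAC ler_wpM2r ?powR_ge0// lerDr.
- move=> r r2; rewrite [(r < delta)%R]ltNge (le_trans d1) ?andbF; last by rewrite (le_trans _ r2)// ler1n.
  by rewrite lee_fin mulr_ge0 ?powR_ge0// addr_ge0// mulr_ge0// powR_ge0.
Qed.

Let abs_le_small (r : R) : (0 < r < 1)%R -> (`|1 - r `^ gam| `^ p <= small_weight r)%R.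
Proof.
move=> /andP[r0 r1]; rewrite /small_weight; case: ifPn => g0.
  apply: powR_le1; first exact: ltW.
  rewrite normr_ge0 ler_norml; have := powR_ge0 r gam.
  have : (r `^ gam <= 1)%R by apply: powR_le1; rewrite (ltW g0, ltW r0)//= ltW.
  lra.
rewrite powRrM ge0_ler_powR ?nnegrE ?(ltW p0) ?powR_ge0//.
have : (1 <= r `^ gam)%R.
  rewrite -leNgt in g0.
  rewrite -[gam]opprK powRN invf_ge1 ?powR_gt0//; apply: powR_le1; first by rewrite oppr_ge0.
  by rewrite (ltW r0) ltW.
by rewrite distrC => h; rewrite ger0_norm ?subr_ge0// gerBl.
Qed.

Lemma measurable_abs_gam (q : R) : measurable_fun [set: R] (fun r => (`|1 - r `^ gam| `^ q)%R).
Proof. by meas. Qed.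

Lemma inner_mass_hardy_fin (delta : R) : (delta <= 1)%R ->
  inner_mass delta (fun r => (`|1 - r `^ gam| `^ p)%R) < +oo.
Proof.
move=> d1; have [A A0 hA] := abs_1BpowR_near1 gam.
apply: (@inner_mass_fin delta (A `^ p)) => //.
- exact: powR_ge0.
- exact: measurable_abs_gam.
- by move=> r /andP[r0 rd]; apply: abs_le_small; rewrite r0 (lt_le_trans rd).
- move=> r /andP[r1 rd]; rewrite -powRM//; apply: ge0_ler_powR; rewrite ?nnegrE ?mulr_ge0 ?(ltW p0)//.
  by apply: hA; rewrite r1 (lt_le_trans rd)// (le_trans d1)// ler1n.
Qed.

(** Together with [large_power], the coefficients that the symmetrized pointwise identity puts on
    [|u(x)| ^ p] and [|u(y)| ^ p]. The sign of [gam] decides which point carries which; for [r] in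
    [(0, 1)] they differ by the factor [|1 - r ^ gam| ^ p] of the Hardy constant. *)
Definition small_power (r : R) : R :=
  (`|1 - r `^ gam| `^ (p - 1) * (if 0 < gam then r `^ gam else 1))%R.

Definition large_power (r : R) : R :=
  (`|1 - r `^ gam| `^ (p - 1) * (if 0 < gam then 1 else r `^ gam))%R.

Lemma small_power_ge0 r : (0 <= small_power r)%R.
Proof. by rewrite mulr_ge0 ?powR_ge0//; case: ifP => // _; rewrite powR_ge0. Qed.

Lemma measurable_small_power : measurable_fun [set: R] small_power.
Proof. by rewrite /small_power; case: (0 < gam)%R; meas. Qed.

Lemma large_powerE r : (0 < r < 1)%R ->
  (large_power r = small_power r + `|1 - r `^ gam| `^ p)%R.
Proof.
move=> /andP[r0 r1].
have E (x : R) : (0 <= x)%R -> (x `^ p = x `^ (p - 1) * x)%R.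
  by move=> x0; rewrite -[RHS]mulrC mulr_powRB1.
rewrite E// /large_power /small_power -mulrDr; congr (_ * _)%R.
case: ifPn => g0.
  have h : (0 <= 1 - r `^ gam)%R.
    by rewrite subr_ge0; apply: powR_le1; rewrite ?(ltW g0)// (ltW r0) ltW.
  by rewrite (ger0_norm h) subrKC.
have h : (0 <= r `^ gam - 1)%R.
  rewrite -leNgt in g0.
  rewrite subr_ge0 -[gam]opprK powRN invf_ge1 ?powR_gt0//.
  by apply: powR_le1; rewrite ?oppr_ge0// (ltW r0) ltW.
by rewrite distrC (ger0_norm h) subrKC.
Qed.

(** At [r = 1] the function vanishes to order [p - 1] only, which is too little against the kernel
    when [tau >= p - 1]. For [r < delta < 1] it is bounded by a multiple of [|1 - r| ^ p], with a
    constant that depends on [delta]. *)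
Lemma inner_mass_small_fin (delta : R) : (delta < 1)%R -> inner_mass delta small_power < +oo.
Proof.
move=> d1.
have sle (r : R) : (0 < r < 1)%R -> (small_power r <= small_weight r)%R.
  move=> /andP[r0 r1].
  have r01 : (0 <= r <= 1)%R by rewrite (ltW r0) ltW.
  have p11 : (0 <= p - 1)%R by rewrite subr_ge0 (le_trans _ p2)// ler1n.
  rewrite /small_power /small_weight; case: ifPn => g0.
    have gle1 : (r `^ gam <= 1)%R by apply: powR_le1 => //; exact: ltW.
    rewrite -[leRHS]mulr1; apply: ler_pM; rewrite ?powR_ge0//.
    apply: powR_le1 => //; rewrite normr_ge0 ler_norml; have := powR_ge0 r gam; lra.
  rewrite mulr1 powRrM.
  have g1 : (1 <= r `^ gam)%R.
    rewrite -leNgt in g0.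
    by rewrite -[gam]opprK powRN invf_ge1 ?powR_gt0//; apply: powR_le1; rewrite ?oppr_ge0.
  apply: (@le_trans _ _ ((r `^ gam) `^ (p - 1))%R).
    rewrite ge0_ler_powR ?nnegrE ?powR_ge0//.
    by rewrite distrC ger0_norm ?subr_ge0// gerBl.
  by apply: ler_powR => //; rewrite gerBl.
have [A0|d0] := leP delta 0%R.
  apply: (@inner_mass_fin delta 0%R) => //.
  - exact: ltW.
  - exact: measurable_small_power.
  - exact: small_power_ge0.
  - by move=> r /andP[r0 rd]; apply: sle; rewrite r0 (lt_trans rd).
  - by move=> r /andP[r0 rd]; have := lt_le_trans rd A0; rewrite ltNge (ltW (lt_trans _ r0))// invr_gt0.
pose A := ((1 - delta) `^ (- p) * (1 + 2 `^ `|gam * p|))%R.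
have d10 : (0 < 1 - delta)%R by rewrite subr_gt0.
apply: (@inner_mass_fin delta A) => //.
- exact: ltW.
- by rewrite mulr_ge0 ?powR_ge0// addr_ge0// powR_ge0.
- exact: measurable_small_power.
- exact: small_power_ge0.
- by move=> r /andP[r0 rd]; apply: sle; rewrite r0 (lt_trans rd).
- move=> r /andP[r1 rd]; have r0 : (0 < r)%R by rewrite (lt_trans _ r1)// invr_gt0.
  have r11 : (r < 1)%R by rewrite (lt_trans rd).
  apply: (@le_trans _ _ (1 + 2 `^ `|gam * p|)%R).
    apply: (le_trans (sle _ _)); first by rewrite r0.
    rewrite /small_weight; case: ifP => _; first by rewrite lerDl powR_ge0.
    apply: (@le_trans _ _ (2 `^ `|gam * p|)%R); last by rewrite lerDr.
    rewrite /powR !gt_eqF// ler_expR (le_trans (ler_norm _))// normrM ler_wpM2l//.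
    rewrite ler_norml -lnV ?posrE// !ler_ln ?posrE ?invr_gt0// (ltW r1)/=.
    by rewrite (le_trans (ltW r11))// ler1n.
  rewrite /A [leRHS]mulrAC ler_peMl ?addr_ge0 ?powR_ge0//.
  rewrite powRN mulrC ler_pdivlMr ?powR_gt0// mul1r ge0_ler_powR ?nnegrE ?(ltW p0) ?(ltW d10)//.
  by apply: le_trans (ler_norm _); rewrite lerD2l lerN2 ltW.
Qed.

Lemma inner_massD delta (f g h : R -> R) : measurable_fun [set: R] g -> measurable_fun [set: R] h ->
  (forall r, (0 <= g r)%R) -> (forall r, (0 <= h r)%R) ->
  (forall r, (0 < r < delta)%R -> f r = g r + h r)%R ->
  inner_mass delta f = inner_mass delta g + inner_mass delta h.
Proof.
move=> mg mh g0 h0 E; rewrite /inner_mass -massD.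
- congr (mass _ _ _); apply/funext => r; case: ifPn => [rd|_]; last by rewrite adde0.
  by rewrite -EFinD -mulrDl E.
- exact: measurable_inner.
- exact: measurable_inner.
- by move=> r; exact: inner_ge0.
- by move=> r; exact: inner_ge0.
Qed.

Lemma inner_mass_large (delta : R) : (delta <= 1)%R ->
  inner_mass delta large_power =
  inner_mass delta small_power + inner_mass delta (fun r => (`|1 - r `^ gam| `^ p)%R).
Proof.
move=> d1; apply: inner_massD.
- exact: measurable_small_power.
- exact: measurable_abs_gam.
- exact: small_power_ge0.
- by move=> r; exact: powR_ge0.
- by move=> r /andP[r0 rd]; rewrite large_powerE// r0 (lt_le_trans rd).
Qed.

Local Notation hardy_fun := (fun r => (`|1 - r `^ gam| `^ p)%R).

(** Polar coordinates rewrite the spatial integral as the defining one; finiteness is what makes its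
    real value faithful. *)
Lemma EFin_C1_cst : (C1_cst n.+1 s p alpha beta)%:E = inner_mass 1 hardy_fun.
Proof.
have mh := measurable_inner 1%R (measurable_abs_gam p).
have h0 r : 0 <= (if (0 < r < 1)%R then (hardy_fun r * pair_weight r)%:E else 0).
  by case: ifP => // _; rewrite lee_fin mulr_ge0 ?powR_ge0 ?pair_weight_ge0.
rewrite /C1_cst /Rintegral.
set I := integral _ _ _.
have -> : I = inner_mass 1 hardy_fun.
  rewrite /inner_mass mass_lt1//; last 2 first.
  - exact: ltW.
  - by move=> r r1; rewrite [(r < 1)%R]ltNge r1 andbF.
  rewrite /I (_ : [set` _] = [set r | (0 < r) && (r < 1)]%R); last first.
    by apply/seteqP; split => r /=; rewrite in_itv.
  rewrite integral_if /ipos; apply: eq_integral => r _.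
  case: (ltP 0%R r) => //= r0; case: ltP => //= r1.
  rewrite -EFinM; congr (_%:E); rewrite [RHS]mulrA; congr (_ * _)%R.
  rewrite -/hardy_gamma [LHS]mulrC -mulrA; congr (_ * _)%R.
  rewrite /pair_weight mulrDr mulrDl -!powR_mulrn ?(ltW r0)// -!powRD_gt0//.
  congr (_ `^ _ + _ `^ _)%R; rewrite -[n.+1]addn1 natrD; ring.
by rewrite fineK// ge0_fin_numE ?inner_mass_hardy_fin//; exact: mass_ge0.
Qed.

(** In the unit ball [|e1 - y| <= 2], so the kernel is bounded below by a constant, and a positive
    radial integrand remains. *)
Lemma C1_cst_gt0 : gam != 0%R -> (0 < C1_cst n.+1 s p alpha beta)%R.
Proof.
move=> g0; rewrite -lte_fin EFin_C1_cst.
have mh := measurable_inner 1%R (measurable_abs_gam p).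
pose f (r : R) := if (0 < r < 1)%R then (hardy_fun r * pair_weight r)%:E else 0.
have f0 r : 0 <= f r.
  by rewrite /f; case: ifP => // _; rewrite lee_fin mulr_ge0 ?powR_ge0 ?pair_weight_ge0.
have N0 : (0 <= k + tau)%R by rewrite addr_ge0// ltW.
pose c := (2 `^ (- (k + tau)))%R.
have c0 : (0 < c)%R by rewrite powR_gt0.
apply: (@lt_le_trans _ _ (\int[lebesgue_rV n.+1]_y (c%:E * f (enorm y)))).
  rewrite (@ge0_integral_radial R n.+1 (fun r => c%:E * f r))//; last 2 first.
  - by apply: emeasurable_funM => //; exact: measurable_cst.
  - by move=> r; rewrite mule_ge0// lee_fin ltW.
  rewrite integral_pos_if mule_gt0// ?lte_fin ?surface_unit_sphere_gt0//.
  rewrite -/(ipos (fun r => c%:E * f r * (r ^+ n)%:E)).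
  rewrite (_ : ipos _ = ipos (fun r => c%:E * f r * (`|r| ^+ n)%:E)); last first.
    by apply: eq_ipos => r r0; rewrite gtr0_norm.
  apply: (@ipos_gt0 _ _ 0%R 1%R); first by rewrite lexx ltr01.
  - by apply: emeasurable_funM; [apply: emeasurable_funM => //; exact: measurable_cst|meas].
  - by move=> r; rewrite !mule_ge0// ?lee_fin ?exprn_ge0// ltW.
  - move=> r /andP[r0 r1]; rewrite !mule_gt0// ?lte_fin ?exprn_gt0 ?normr_gt0 ?gt_eqF//.
    rewrite /f r0 r1 lte_fin mulr_gt0//.
      rewrite powR_gt0// normr_gt0 subr_eq0 eq_sym.
      apply/eqP => /(congr1 (@ln R)); rewrite ln_powR ln1 => /eqP.
      by rewrite mulf_eq0 (negbTE g0)/= lt_eqF// ln_lt0// r0.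
    by rewrite addr_gt0// powR_gt0.
apply: ge0_le_integral => //.
- by move=> y _; rewrite mule_ge0// lee_fin ltW.
- by apply: emeasurable_funM; [exact: measurable_cst|apply: (measurableT_comp mh); meas].
- by apply: emeasurable_funM; [apply: (measurableT_comp mh); meas|meas].
move=> y _; rewrite muleC; have [/andP[y0 y1]|h] := boolP (0 < enorm y < 1)%R; last first.
  by rewrite /f (negbTE h) !mul0e.
have -> : (hardy_fun (enorm y) * pair_weight (enorm y))%:E = f (enorm y).
  by rewrite /f y0 y1.
rewrite lee_wpmul2l// lee_fin /c !powRN lef_pV2 ?posrE ?powR_gt0//; last first.
  apply: (@lt_le_trans _ _ `|1 - enorm y|%R); last exact: abs_1Benorm_le.
  by rewrite normr_gt0 subr_eq0 gt_eqF.
rewrite ge0_ler_powR ?nnegrE ?enorm_ge0//.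
by apply: (le_trans (enorm_e1B_le _)); move: y1; move: (enorm y) => e; lra.
Qed.

(* Split at [r = 1] and apply [mass_inv] on the outer part. *)
Lemma mass_inv_gam :
  mass n tau (fun r => (`|1 - r `^ (- gam)| `^ p * r `^ beta)%:E) = inner_mass 1 hardy_fun.
Proof.
pose F r := (`|1 - r `^ (- gam)| `^ p * r `^ beta)%R.
have F0 r : (0 <= F r)%R by rewrite mulr_ge0 ?powR_ge0.
have mF : measurable_fun [set: R] F by rewrite /F; meas.
pose Fi (r : R) := if (0 < r < 1)%R then (F r)%:E else 0.
pose Fo (r : R) := if (1 < r)%R then (F r)%:E else 0.
have Fi0 r : 0 <= Fi r by rewrite /Fi; case: ifP => // _; rewrite lee_fin.
have Fo0 r : 0 <= Fo r by rewrite /Fo; case: ifP => // _; rewrite lee_fin.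
have mFE : measurable_fun [set: R] (fun r => (F r)%:E) by apply/measurable_EFinP.
have mFi : measurable_fun [set: R] Fi.
  apply: measurable_fun_ifT; [|exact: mFE|exact: measurable_cst].
  by apply: measurable_and; exact: measurable_fun_ltr.
have mFo : measurable_fun [set: R] Fo.
  by apply: measurable_fun_ifT; [exact: measurable_fun_ltr|exact: mFE|exact: measurable_cst].
transitivity (mass n tau (fun r => Fi r + Fo r)).
  apply: eq_mass => //.
  - exact: emeasurable_funD.
  - by move=> r; rewrite adde_ge0.
  - move=> r r0; rewrite /Fi /Fo r0/=; case: ltgtP => [r1|r1|->].
    + by rewrite adde0.
    + by rewrite add0e.
    + by rewrite adde0 one_powR subrr normr0 powR0 ?gt_eqF// mul0r.
rewrite massD// (mass_inv _ _ mFo)//.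
pose G x (r : R) := if (0 < r < 1)%R then (hardy_fun r * r `^ (tau - k - x))%:E else 0.
have G0 x r : 0 <= G x r by rewrite /G; case: ifP => // _; rewrite lee_fin mulr_ge0 ?powR_ge0.
have mG x : measurable_fun [set: R] (G x).
  apply: measurable_fun_ifT; [|by meas|exact: measurable_cst].
  by apply: measurable_and; exact: measurable_fun_ltr.
have absV (g r : R) : (0 < r)%R ->
    (`|1 - r `^ (- g)| `^ p = `|1 - r `^ g| `^ p * r `^ (- (g * p)))%R.
  move=> r0; rewrite -mulNr powRrM -powRM ?powR_ge0//.
  have h := powR_gt0 (- g) r0.
  have -> : (1 - r `^ (- g) = - ((1 - r `^ g) * r `^ (- g)))%R.
    by rewrite mulrBl mul1r -powRD_gt0// addrN powRr0 opprB.
  by rewrite normrN normrM (gtr0_norm h).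
rewrite /inner_mass.
have Ei : mass n tau Fi = mass n tau (G alpha).
  apply: eq_mass => // r r0; rewrite /Fi /G; case: ifP => // _; rewrite /F absV//.
  rewrite -mulrA -powRD_gt0//; congr (_ * _ `^ _)%:E.
  by rewrite gamp; ring.
have Eo : mass n tau (fun r => Fo r^-1%R * (r `^ (tau - k))%:E) = mass n tau (G beta).
  apply: eq_mass.
  - apply: emeasurable_funM; last by meas.
    by apply: (measurableT_comp mFo); apply: measurable_invr; exact: measurable_id.
  - exact: mG.
  - by move=> r; apply: mule_ge0; rewrite ?lee_fin ?powR_ge0.
  - exact: G0.
  - move=> r r0; rewrite /Fo /G r0 /=.
    have -> : (1 < r^-1)%R = (r < 1)%R by rewrite invf_gt1.
    case: ifP => _; last by rewrite mul0e.
    rewrite -EFinM /F; congr (_%:E).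
    have rV b : (r^-1 `^ b = r `^ (- b))%R by rewrite -(powR_inv1 (ltW r0)) -powRrM mulN1r.
    rewrite !rV opprK -mulrA -(powRD_gt0 _ _ r0).
    by congr (_ * _ `^ _)%R; ring.
rewrite Ei Eo.
rewrite -(massD n tau (mG alpha) (mG beta) (G0 alpha) (G0 beta)).
congr (mass _ _ _); apply/funext => r; rewrite /G.
by case: ifP => _; [rewrite -EFinD -mulrDr|rewrite adde0].
Qed.

End hardy_constant.

(** * The projection to R^k *)

Section space_split.
Context {R : realType}.
Local Open Scope ereal_scope.

Lemma eq_integral_neq n (c : 'rV[R]_n.+1) (f g : 'rV[R]_n.+1 -> \bar R) :
  measurable_fun [set: 'rV[R]_n.+1] f -> measurable_fun [set: 'rV[R]_n.+1] g ->
  (forall x, 0 <= f x) -> (forall x, 0 <= g x) -> (forall x, x != c -> f x = g x) ->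
  \int[lebesgue_rV n.+1]_x f x = \int[lebesgue_rV n.+1]_x g x.
Proof.
move=> mf mg f0 g0 fg; rewrite -(integral_translate c mf f0) -(integral_translate c mg g0).
have mc (h : 'rV[R]_n.+1 -> \bar R) : measurable_fun [set: 'rV[R]_n.+1] h ->
    measurable_fun [set: 'rV[R]_n.+1] (fun x => h (c - x)%R).
  by move=> mh; apply: (measurableT_comp mh); meas.
apply: eq_integral_neq0 => //; [exact: mc|exact: mc|].
move=> x x0; apply: fg; apply: contra x0 => /eqP h.
by rewrite -oppr_eq0 -[X in X == _](addKr c) h addNr.
Qed.

Lemma sqn_row_mx n m (x : 'rV[R]_n) (z : 'rV[R]_m) : sqn (row_mx x z) = (sqn x + sqn z)%R.
Proof.
rewrite /sqn big_split_ord/=; congr (_ + _)%R; apply: eq_bigr => i _.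
  by rewrite row_mxEl.
by rewrite row_mxEr.
Qed.

Variables (n m : nat) (kd : (n.+1 <= n.+1 + m)%N).
Local Notation d := (n.+1 + m)%N.
Local Notation k := (n.+1%:R : R).
Local Notation mu := (@lebesgue_rV R d).
Local Notation ax := (fun x => enorm (head_rV kd x)).

Lemma head_rVE (x : 'rV[R]_d) : head_rV kd x = lsubmx x.
Proof. by apply/rowP => i; rewrite !mxE; congr (x _ _); exact/val_inj. Qed.

Lemma head_row_mx (x : 'rV[R]_n.+1) (z : 'rV[R]_m) : head_rV kd (row_mx x z) = x.
Proof. by rewrite head_rVE row_mxKl. Qed.

Lemma measurable_head e (T : measurableType e) (f : T -> 'rV[R]_d) :
  measurable_fun setT f -> measurable_fun [set: T] (fun x => head_rV kd (f x)).
Proof.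
move=> mf; apply/measurable_fun_coordP => i; under eq_fun do rewrite mxE.
exact: (measurableT_comp (measurable_coord _) mf).
Qed.

Lemma measurable_ax e (T : measurableType e) (f : T -> 'rV[R]_d) :
  measurable_fun setT f -> measurable_fun [set: T] (fun x => enorm (head_rV kd (f x))).
Proof. by move=> mf; apply: measurable_enorm; exact: measurable_head. Qed.

(* The factor produced by integrating [|x - y|^(-(d + tau))] over the last [m]
   coordinates of [y]. *)
Definition fiber_cst (tau : R) : R :=
  (pi `^ (m%:R / 2) * Gamma ((k + tau) / 2) / Gamma ((d%:R + tau) / 2))%R.

Lemma fiber_cst_gt0 tau : (- k < tau)%R -> (0 < fiber_cst tau)%R.
Proof.
move=> kt; have h1 : (0 < k + tau)%R by rewrite addrC -[k]opprK subr_gt0.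
have h2 : (0 < d%:R + tau)%R by rewrite natrD addrAC ltr_pwDl.
by rewrite !mulr_gt0 ?powR_gt0 ?pi_gt0 ?invr_gt0 ?Gamma_gt0// divr_gt0.
Qed.

(** Integrating out the last [m] coordinates leaves the kernel of the same order [tau] in the first
    [n.+1] ones; scaling then moves its singularity to [e1]. The fibre formula needs [y_k] different
    from [x_k], which excludes a null set. *)
Lemma integral_radial_kernel tau (G : R -> \bar R) (x : 'rV[R]_d) :
  (- k < tau)%R -> (0 < ax x)%R ->
  measurable_fun [set: R] G -> (forall r, 0 <= G r) ->
  \int[mu]_y (G (ax y) * (enorm (x - y) `^ (- (d%:R + tau)))%:E) =
  (fiber_cst tau * ax x `^ (- tau))%:E * mass n tau (fun r => G (ax x * r)%R).
Proof.
move=> kt x0 mG G0; set q := ((d%:R + tau) / 2)%R.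
have c0 := fiber_cst_gt0 kt.
have qm : (m%:R / 2 < q)%R.
  rewrite ltr_pM2r ?invr_gt0// natrD addrAC -[ltLHS]add0r ltrD2r.
  by rewrite addrC -[k]opprK subr_gt0.
have qE : (q - m%:R / 2 = (k + tau) / 2)%R by rewrite /q natrD; field.
have max e (T : measurableType e) (f : T -> 'rV[R]_d) := @measurable_ax e T f.
rewrite ge0_integral_rowmx; last 2 first.
- apply: emeasurable_funM; last by meas.
  by apply: (measurableT_comp mG); apply: max; exact: measurable_id.
- by move=> y; rewrite mule_ge0// lee_fin powR_ge0.
set x1 := lsubmx x; set x2 := rsubmx x.
have xE : x = row_mx x1 x2 by rewrite hsubmxK.
have ax1 : ax x = enorm x1 by rewrite head_rVE.
pose f (y : 'rV[R]_n.+1) := G (enorm y) * (fiber_cst tau * enorm (x1 - y) `^ (- (k + tau)))%:E.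
transitivity (\int[lebesgue_rV n.+1]_y f y).
  have kerE (y : 'rV[R]_n.+1) (z : 'rV[R]_m) :
      (enorm (x - row_mx y z) `^ (- (d%:R + tau)) = (sqn (x1 - y) + sqn (x2 - z)) `^ (- q))%R.
    by rewrite enorm_powRN {1}xE opp_row_mx add_row_mx sqn_row_mx.
  pose F (p : 'rV[R]_n.+1 * 'rV[R]_m) := G (ax (row_mx p.1 p.2)) *
    (enorm (x - row_mx p.1 p.2) `^ (- (d%:R + tau)))%:E.
  have mrow : measurable_fun [set: 'rV[R]_n.+1 * 'rV[R]_m] (fun p => row_mx p.1 p.2).
    by apply: measurable_fun_rowmx; meas.
  have F0 p : 0 <= F p by rewrite mule_ge0// lee_fin powR_ge0.
  apply: (@eq_integral_neq _ x1).
  - apply: (@measurable_fun_iint _ _ _ _ R (lebesgue_rV m) F) => //.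
    apply: emeasurable_funM; last by meas.
    by apply: (measurableT_comp mG); exact: max.
  - by rewrite /f; meas.
  - by move=> y; apply: integral_ge0 => z _; exact: (F0 (y, z)).
  - by move=> y; rewrite /f mule_ge0// lee_fin mulr_ge0 ?powR_ge0// ltW.
  move=> y yx1; rewrite /f.
  have A0 : (0 < sqn (x1 - y))%R.
    by rewrite -sqr_enorm exprn_gt0// enorm_gt0 subr_eq0 eq_sym.
  have mz : measurable_fun [set: 'rV[R]_m] (fun z => ((sqn (x1 - y) + sqn z) `^ (- q))%:E).
    apply/measurable_EFinP; apply: (measurableT_comp (measurable_powR (- q)%R)).
    by apply: measurable_funD; [exact: measurable_cst|exact: measurable_sqn].
  have mz' : measurable_fun [set: 'rV[R]_m] (fun z => ((sqn (x1 - y) + sqn (x2 - z)) `^ (- q))%:E).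
    by apply: (measurableT_comp mz); meas.
  transitivity (\int[lebesgue_rV m]_z (((sqn (x1 - y) + sqn (x2 - z)) `^ (- q))%:E * G (enorm y))).
    by apply: eq_integral => z _; rewrite head_row_mx kerE muleC.
  rewrite (ge0_integralZrT _ (G0 _) _ mz'); last by move=> z; rewrite lee_fin powR_ge0.
  rewrite muleC; congr (_ * _).
  rewrite (@integral_translate _ m (fun z => ((sqn (x1 - y) + sqn z) `^ (- q))%:E)) //; last first.
    by move=> z; rewrite lee_fin powR_ge0.
  by rewrite integral_inv_sqn// qE enorm_powRN.
have x10 : x1 != 0%R by rewrite -enorm_gt0 -ax1.
rewrite /f; transitivity ((fiber_cst tau)%:E *
    \int[lebesgue_rV n.+1]_y (G (enorm y) * (enorm (x1 - y) `^ (- (k + tau)))%:E)).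
  rewrite -ge0_integralZlT.
  - by apply: eq_integral => y _; rewrite EFinM muleCA.
  - exact: ltW.
  - by move=> y; rewrite mule_ge0// lee_fin powR_ge0.
  - by meas.
by rewrite mass_scale// muleA -EFinM ax1.
Qed.

Lemma lebesgue_sphere n' (c : R) : lebesgue_rV n'.+1 [set y : 'rV[R]_n'.+1 | enorm y = c] = 0.
Proof.
pose f (r : R) : \bar R := (\1_[set c] r)%:E.
have mf : measurable_fun [set: R] f.
  by apply/measurable_EFinP; apply: measurable_indic; exact: measurable_set1.
have f0 r : 0 <= f r by rewrite lee_fin.
have ms : measurable [set y : 'rV[R]_n'.+1 | enorm y = c].
  have me : measurable_fun [set: 'rV[R]_n'.+1] (@enorm R n'.+1) by meas.
  rewrite (_ : [set _ | _] = (@enorm R n'.+1) @^-1` [set c]); last by apply/seteqP; split.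
  by rewrite -[X in measurable X]setTI; apply: me => //; exact: measurable_set1.
transitivity (\int[lebesgue_rV n'.+1]_y f (enorm y)).
  rewrite -[LHS]mul1e -[X in X%:E * _]/(1%R) -integral_cst// integral_mkcond.
  apply: eq_integral => y _; rewrite /f /patch indicE.
  by have [h|h] := pselect (enorm y = c); [rewrite !mem_set|rewrite !memNset].
rewrite (ge0_integral_radial (ltn0Sn n') mf f0) integral_pos_if.
rewrite (_ : \int[_]_r _ = 0) ?mule0//.
rewrite -[RHS](@integral0 _ _ _ (@lebesgue_measure R) setT).
apply: ge0_ae_eq_integral => //.
- apply: measurable_pos_if; [exact: measurable_id|by meas].
- by move=> r _; case: ifP => // r0; rewrite mule_ge0// lee_fin exprn_ge0// ltW.
- exists [set c]; split; [exact: measurable_set1|exact: lebesgue_measure_set1|].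
  move=> r /= /not_implyP[_ h]; apply/not_notP => rc; apply: h; case: ifP => // _.
  by rewrite /f indicE memNset// mul0e.
Qed.

(** Used with [c = 0] for the singular subspace and with [c = |x_k|] for the boundary between the
    two halves of the double integral. *)
Lemma ae_ax_neq (c : R) : {ae mu, forall y, ax y != c}.
Proof.
have ms : measurable [set y : 'rV[R]_d | ax y = c].
  have me : measurable_fun [set: 'rV[R]_d] ax by apply: measurable_ax; exact: measurable_id.
  rewrite (_ : [set _ | _] = ax @^-1` [set c]); last by apply/seteqP; split.
  by rewrite -[X in measurable X]setTI; apply: me => //; exact: measurable_set1.
exists [set y | ax y = c]; split => //; last by move=> y /= /negP; rewrite negbK => /eqP.
pose f (y : 'rV[R]_d) : \bar R := (\1_[set y | ax y = c] y)%:E.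
have mf : measurable_fun [set: 'rV[R]_d] f by apply/measurable_EFinP; exact: measurable_indic.
have f0 y : 0 <= f y by rewrite lee_fin.
transitivity (\int[mu]_y f y); first by rewrite integral_indic// setIT.
rewrite ge0_integral_rowmx// -[RHS](@integral0 _ _ _ (@lebesgue_rV R n.+1) setT).
have mrow : measurable_fun [set: 'rV[R]_n.+1 * 'rV[R]_m] (fun p => row_mx p.1 p.2).
  by apply: measurable_fun_rowmx; meas.
apply: ge0_ae_eq_integral => //.
- apply: (@measurable_fun_iint _ _ _ _ R (lebesgue_rV m) (fun p => f (row_mx p.1 p.2))) => //.
  exact: (measurableT_comp mf).
- by move=> y _; apply: integral_ge0.
- exists [set y | enorm y = c]; split; [|exact: lebesgue_sphere|].
    have me : measurable_fun [set: 'rV[R]_n.+1] (@enorm R n.+1) by meas.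
    rewrite (_ : [set _ | _] = (@enorm R n.+1) @^-1` [set c]); last by apply/seteqP; split.
    by rewrite -[X in measurable X]setTI; apply: me => //; exact: measurable_set1.
  move=> y /= /not_implyP[_ h]; apply/not_notP => yc; apply: h.
  rewrite -[RHS](@integral0 _ _ _ (@lebesgue_rV R m) setT); apply: eq_integral => z _.
  by rewrite /f indicE memNset//= head_row_mx.
Qed.

(* [X] is symmetrized over the two halves [|y_k| < |x_k|] and [|x_k| < |y_k|]. *)
Lemma integral_sym_split (X : 'rV[R]_d * 'rV[R]_d -> \bar R) :
  measurable_fun [set: 'rV[R]_d * 'rV[R]_d] X -> (forall p, 0 <= X p) ->
  \int[mu]_x \int[mu]_y X (x, y) =
  \int[mu]_x \int[mu]_y
    (if (0 < ax y < ax x)%R then X (x, y) + X (y, x) else 0).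
Proof.
move=> mX X0.
have max e (T : measurableType e) (f : T -> 'rV[R]_d) := @measurable_ax e T f.
pose A (p : 'rV[R]_d * 'rV[R]_d) := if (0 < ax p.2 < ax p.1)%R then X p else 0.
pose B (p : 'rV[R]_d * 'rV[R]_d) := if (0 < ax p.1 < ax p.2)%R then X p else 0.
have mA : measurable_fun [set: 'rV[R]_d * 'rV[R]_d] A.
  apply: measurable_fun_ifT; [|exact: mX|exact: measurable_cst].
  by apply: measurable_and; apply: measurable_fun_ltr; first [exact: measurable_cst|apply: max; meas].
have mB : measurable_fun [set: 'rV[R]_d * 'rV[R]_d] B.
  apply: measurable_fun_ifT; [|exact: mX|exact: measurable_cst].
  by apply: measurable_and; apply: measurable_fun_ltr; first [exact: measurable_cst|apply: max; meas].
have mC : measurable_fun [set: 'rV[R]_d * 'rV[R]_d] (fun p => B (p.2, p.1)).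
  by apply: (measurableT_comp mB); meas.
have A0 p : 0 <= A p by rewrite /A; case: ifP.
have B0 p : 0 <= B p by rewrite /B; case: ifP.
have sec (F : 'rV[R]_d * 'rV[R]_d -> \bar R) x : measurable_fun [set: 'rV[R]_d * 'rV[R]_d] F ->
    measurable_fun [set: 'rV[R]_d] (fun y => F (x, y)).
  by move=> mF; apply: (measurableT_comp mF); meas.
have iint (F : 'rV[R]_d * 'rV[R]_d -> \bar R) := @measurable_fun_iint _ _ _ _ R mu F.
have i0 (F : 'rV[R]_d * 'rV[R]_d -> \bar R) x : (forall p, 0 <= F p) -> 0 <= \int[mu]_y F (x, y).
  by move=> F0; apply: integral_ge0.
have h0 := ae_ax_neq 0%R.
transitivity (\int[mu]_x (\int[mu]_y A (x, y) + \int[mu]_y B (x, y))).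
  apply: ge0_ae_eq_integral => //.
  - exact: iint.
  - by apply: emeasurable_funD; exact: iint.
  - by move=> x _; exact: i0.
  - by move=> x _; apply: adde_ge0; exact: i0.
  apply: filterS h0 => x x0 _.
  rewrite -ge0_integralDT; [|by []|exact: sec|by []|exact: sec].
  apply: ge0_ae_eq_integral => //; [exact: sec|by apply: emeasurable_funD; exact: sec|by move=> y _; exact: adde_ge0|].
  apply: filterS2 (ae_ax_neq 0%R) (ae_ax_neq (ax x)) => y y0 yx _.
  have xp : (0 < ax x)%R by rewrite lt_neqAle eq_sym x0 enorm_ge0.
  have yp : (0 < ax y)%R by rewrite lt_neqAle eq_sym y0 enorm_ge0.
  rewrite /A /B /= xp yp/=; move: yx; case: ltgtP => // _ _; first by rewrite adde0.
  by rewrite add0e.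
rewrite ge0_integralDT; [|by move=> x; exact: i0|exact: iint|by move=> x; exact: i0|exact: iint].
rewrite [X in _ + X = _](@fubini_tonelli _ _ _ _ _ mu mu B)//.
rewrite -ge0_integralDT; [|by move=> x; exact: i0|exact: iint|by move=> y; exact: (i0 (fun p => B (p.2, p.1)))|exact: (iint (fun p => B (p.2, p.1)))].
apply: eq_integral => x _.
rewrite -ge0_integralDT; [|by []|exact: sec|by []|exact: (sec (fun p => B (p.2, p.1)))].
by apply: eq_integral => y _; rewrite /A /B/=; case: ifP => // _; rewrite adde0.
Qed.

End space_split.

(** * The ground state identity *)

Section ground_pair.
Context {R : realType}.
Variables (p k tau alpha beta : R).
Let gam : R := (k + alpha + beta - tau) / p.

(** The slack of the pointwise inequality, carried along as a term so that the energy formula is an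
    equality. *)
Definition ground_gap (c t a b : R) : R :=
  `|a - t * b| `^ p - (1 - t) `^ (p - 1) * (`|a| `^ p - t * `|b| `^ p)
    - c * t `^ (p / 2) * `|a - b| `^ p.

Let absZ (a b : R) : 0 < a -> `|a * b| `^ p = a `^ p * `|b| `^ p.
Proof. by move=> a0; rewrite normrM (gtr0_norm a0) powRM// ltW. Qed.

Let alg_pos (c h V A U2 t U1 D a b d e f : R) : a * b = 1 -> a * d = f -> a * e = h ->
  c * (h * V) + A * U2 + a * (b * D - A * (b * U2 - t * (d * U1)) - c * e * V) =
  D + A * t * f * U1.
Proof.
move=> ab <- <-; transitivity (a * b * D + A * U2 * (1 - a * b) + A * t * (a * d) * U1); first ring.
by rewrite ab; ring.
Qed.

Let alg_neg (c h V A U2 t U1 D a b d e f q rg rm : R) : a * b = 1 -> a * d = f -> a * e = h ->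
  t * f = q -> q * rg * rm = 1 ->
  c * (h * V) + A * q * rg * rm * U1 + a * (b * D - A * (b * U1 - t * (d * U2)) - c * e * V) =
  D + A * q * U2.
Proof.
move=> ab <- <- <- E; transitivity (a * b * D + A * U1 * (t * (a * d) * rg * rm - a * b) +
  A * (t * (a * d)) * U2); first ring.
by rewrite ab E; ring.
Qed.

(** Here [X = |x_k|], [Y = |y_k|], and [u1], [u2] are the values of [u] at [x] and [y]. It is the
    definition of [ground_gap] at [t = (Y / X) ^ g], multiplied by [Y ^ (- g p)] and rearranged so
    that each term enters with a plus sign, as addition of possibly infinite integrals requires. For
    [g < 0] the inverse ratio is the one below 1, and the two points exchange roles. *)
Lemma ground_gap_pos (c g X Y u1 u2 : R) : p != 0 -> 0 < g -> 0 < Y -> Y < X ->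
  c * ((X * Y) `^ (- (g * p / 2)) * `|X `^ g * u1 - Y `^ g * u2| `^ p)
    + `|1 - (Y / X) `^ g| `^ (p - 1) * `|u2| `^ p
    + Y `^ (- (g * p)) * ground_gap c ((Y / X) `^ g) (Y `^ g * u2) (X `^ g * u1) =
  `|u1 - u2| `^ p
    + `|1 - (Y / X) `^ g| `^ (p - 1) * (Y / X) `^ g * (Y / X) `^ (- (g * p)) * `|u1| `^ p.
Proof.
move=> pn0 g0 Y0 YX; have X0 : 0 < X by exact: lt_trans YX.
have r0 : 0 < Y / X by rewrite divr_gt0.
have r1 : Y / X < 1 by rewrite ltr_pdivrMr// mul1r.
set t := (Y / X) `^ g; have t0 : 0 < t by rewrite powR_gt0.
have t1 : 0 <= 1 - t by rewrite subr_ge0; apply: powR_le1; rewrite ?(ltW g0)// !ltW.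
have tE : t * X `^ g = Y `^ g by rewrite /t -powRM ?ltW// divfK// gt_eqF.
rewrite /ground_gap (mulrA t) tE -mulrBr !absZ ?powR_gt0// -!powRrM.
have YE : Y `^ (- (g * p)) * Y `^ (g * p) = 1 by rewrite -powRD_gt0// addNr powRr0.
have XE : Y `^ (- (g * p)) * X `^ (g * p) = (Y / X) `^ (- (g * p)).
  rewrite -powR_inv1 ?(ltW X0)// powRM ?powR_ge0 ?(ltW Y0)// -powRrM.
  by rewrite mulN1r opprK.
have tp : Y `^ (- (g * p)) * (Y / X) `^ (g * (p / 2)) = (X * Y) `^ (- (g * p / 2)).
  rewrite -powR_inv1 ?(ltW X0)// !powRM ?powR_ge0 ?(ltW Y0) ?(ltW X0)// -powRrM.
  rewrite mulrA -powRD_gt0// mulrC; by congr (_ `^ _ * _ `^ _); field.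
rewrite (distrC u1) (distrC (X `^ g * u1)) (ger0_norm t1).
exact: alg_pos YE XE tp.
Qed.

Lemma ground_gap_neg (c g X Y u1 u2 : R) : p != 0 -> g < 0 -> 0 < Y -> Y < X ->
  c * ((X * Y) `^ (- (g * p / 2)) * `|X `^ g * u1 - Y `^ g * u2| `^ p)
    + `|1 - (Y / X) `^ g| `^ (p - 1) * (Y / X) `^ g * (Y / X) `^ (- (g * p)) * `|u1| `^ p
    + X `^ (- (g * p)) * ground_gap c ((Y / X) `^ (- g)) (X `^ g * u1) (Y `^ g * u2) =
  `|u1 - u2| `^ p + `|1 - (Y / X) `^ g| `^ (p - 1) * `|u2| `^ p.
Proof.
move=> pn0 g0 Y0 YX; have X0 : 0 < X by exact: lt_trans YX.
have r0 : 0 < Y / X by rewrite divr_gt0.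
have r1 : Y / X < 1 by rewrite ltr_pdivrMr// mul1r.
set t := (Y / X) `^ (- g); have t0 : 0 < t by rewrite powR_gt0.
have g'0 : 0 <= - g by rewrite oppr_ge0 ltW.
have t1 : 0 <= 1 - t by rewrite subr_ge0; apply: powR_le1; rewrite // !ltW.
have rt : (Y / X) `^ g = t^-1 by rewrite /t powRN invrK.
have tE : t * Y `^ g = X `^ g.
  rewrite /t -{2}[Y](@divfK _ X) ?gt_eqF// (powRM g (ltW r0) (ltW X0)) mulrA.
  by rewrite -powRD_gt0// addNr powRr0 mul1r.
rewrite /ground_gap (mulrA t) tE -mulrBr !absZ ?powR_gt0// -!powRrM.
have XE : X `^ (- (g * p)) * X `^ (g * p) = 1 by rewrite -powRD_gt0// addNr powRr0.
have YE : X `^ (- (g * p)) * Y `^ (g * p) = (Y / X) `^ (g * p).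
  by rewrite powRM ?invr_ge0 ?ltW// mulrC; congr (_ * _); rewrite -powR_inv1 ?ltW// -powRrM mulN1r.
have tp : X `^ (- (g * p)) * (Y / X) `^ (- g * (p / 2)) = (X * Y) `^ (- (g * p / 2)).
  rewrite -powR_inv1 ?(ltW X0)// !powRM ?powR_ge0 ?(ltW Y0) ?(ltW X0)// -powRrM.
  rewrite mulrCA -powRD_gt0// mulrC; by congr (_ `^ _ * _ `^ _); field.
have E1 : `|1 - (Y / X) `^ g| `^ (p - 1) = (1 - t) `^ (p - 1) * (Y / X) `^ (g * (p - 1)).
  have -> : 1 - (Y / X) `^ g = - ((1 - t) * (Y / X) `^ g).
    by rewrite rt; field; rewrite gt_eqF.
  by rewrite normrN normrM (ger0_norm t1) (gtr0_norm (powR_gt0 _ r0)) (powRM _ t1 (powR_ge0 _ _)) -powRrM.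
have E2 : (Y / X) `^ (g * (p - 1)) * (Y / X) `^ g * (Y / X) `^ (- (g * p)) = 1.
  by rewrite -!powRD_gt0// (_ : _ + _ = 0) ?powRr0//; ring.
have E3 : t * (Y / X) `^ (g * p) = (Y / X) `^ (g * (p - 1)).
  by rewrite -powRD_gt0//; congr (_ `^ _); ring.
rewrite E1; exact: alg_neg XE YE tp E3 E2.
Qed.

End ground_pair.

Ltac meas2 := repeat first [meas_step | apply: measurable_head].

Section region_integrals.
Context {R : realType}.
Local Open Scope ereal_scope.

Variables (n m : nat) (kd : (n.+1 <= n.+1 + m)%N).
Local Notation d := (n.+1 + m)%N.
Local Notation k := (n.+1%:R : R).
Local Notation mu := (@lebesgue_rV R d).
Local Notation ax := (fun x => enorm (head_rV kd x)).

Definition region_int (delta : R) (F : 'rV[R]_d * 'rV[R]_d -> R) : \bar R :=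
  \int[mu]_x \int[mu]_y (if (0 < ax y < delta * ax x)%R then (F (x, y))%:E else 0).

Let measurable_region delta (F : 'rV[R]_d * 'rV[R]_d -> R) :
  measurable_fun [set: 'rV[R]_d * 'rV[R]_d] F ->
  measurable_fun [set: 'rV[R]_d * 'rV[R]_d]
    (fun p => if (0 < ax p.2 < delta * ax p.1)%R then (F p)%:E else 0).
Proof.
move=> mF; apply: measurable_fun_ifT; [|by meas|exact: measurable_cst].
by apply: measurable_and; apply: measurable_fun_ltr; meas2.
Qed.

Lemma eq_region_int delta (F G : 'rV[R]_d * 'rV[R]_d -> R) : (forall x y, (0 < ax y < delta * ax x)%R -> F (x, y) = G (x, y)) ->
  region_int delta F = region_int delta G.
Proof.
by move=> FG; apply: eq_integral => x _; apply: eq_integral => y _; case: ifP => // /FG ->.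
Qed.

Lemma region_int_ge0 delta (F : 'rV[R]_d * 'rV[R]_d -> R) : (forall x y, (0 < ax y < delta * ax x)%R -> (0 <= F (x, y))%R) ->
  0 <= region_int delta F.
Proof.
move=> F0; apply: integral_ge0 => x _; apply: integral_ge0 => y _; case: ifP => // /F0.
by rewrite lee_fin.
Qed.

Lemma region_intD delta (F G : 'rV[R]_d * 'rV[R]_d -> R) :
  measurable_fun [set: 'rV[R]_d * 'rV[R]_d] F -> measurable_fun [set: 'rV[R]_d * 'rV[R]_d] G ->
  (forall x y, (0 < ax y < delta * ax x)%R -> (0 <= F (x, y))%R) ->
  (forall x y, (0 < ax y < delta * ax x)%R -> (0 <= G (x, y))%R) ->
  region_int delta (fun p => F p + G p)%R = region_int delta F + region_int delta G.
Proof.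
move=> mF mG F0 G0.
have sec (H : 'rV[R]_d * 'rV[R]_d -> R) x : measurable_fun [set: 'rV[R]_d * 'rV[R]_d] H ->
    measurable_fun [set: 'rV[R]_d] (fun y => if (0 < ax y < delta * ax x)%R then (H (x, y))%:E else 0).
  move=> mH; apply: (@measurableT_comp _ _ _ _ _ _ _ _ (fun y => (x, y)) (measurable_region delta mH)).
  by meas.
have pos (H : 'rV[R]_d * 'rV[R]_d -> R) x y :
    (forall x y, (0 < ax y < delta * ax x)%R -> (0 <= H (x, y))%R) ->
    0 <= (if (0 < ax y < delta * ax x)%R then (H (x, y))%:E else 0).
  by move=> H0; case: ifP => // /H0; rewrite lee_fin.
have iint (H : 'rV[R]_d * 'rV[R]_d -> R) (mH : measurable_fun [set: 'rV[R]_d * 'rV[R]_d] H) :=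
  @measurable_fun_iint _ _ _ _ R mu _ (measurable_region delta mH).
rewrite /region_int -ge0_integralDT.
- apply: eq_integral => x _; rewrite -ge0_integralDT.
  + by apply: eq_integral => y _; case: ifP => // _; rewrite adde0.
  + by move=> y; exact: pos.
  + exact: sec.
  + by move=> y; exact: pos.
  + exact: sec.
- by move=> x; apply: integral_ge0 => y _; exact: pos.
- by apply: (iint F mF) => -[x y]; exact: pos.
- by move=> x; apply: integral_ge0 => y _; exact: pos.
- by apply: (iint G mG) => -[x y]; exact: pos.
Qed.

Lemma region_intZ delta (c : R) (F : 'rV[R]_d * 'rV[R]_d -> R) : (0 <= c)%R ->
  measurable_fun [set: 'rV[R]_d * 'rV[R]_d] F ->
  (forall x y, (0 < ax y < delta * ax x)%R -> (0 <= F (x, y))%R) ->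
  region_int delta (fun p => c * F p)%R = c%:E * region_int delta F.
Proof.
move=> c0 mF F0.
have pos x y : 0 <= (if (0 < ax y < delta * ax x)%R then (F (x, y))%:E else 0).
  by case: ifP => // /F0; rewrite lee_fin.
rewrite /region_int -ge0_integralZlT//.
- apply: eq_integral => x _; rewrite -ge0_integralZlT//.
    by apply: eq_integral => y _; case: ifP => // _; rewrite mule0.
  apply: (@measurableT_comp _ _ _ _ _ _ _ _ (fun y => (x, y)) (measurable_region delta mF)).
  by meas.
- by move=> x; apply: integral_ge0 => y _.
- by apply: (@measurable_fun_iint _ _ _ _ R mu _ (measurable_region delta mF)) => -[x y].
Qed.

(** The shift by two makes every term positive, starting from one half. *)
Definition delta_seq (j : nat) : R := (1 - j.+2%:R^-1)%R.

Lemma delta_seq_lt1 j : (delta_seq j < 1)%R.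
Proof. by rewrite /delta_seq gtrBl invr_gt0. Qed.

Lemma delta_seq_gt0 j : (0 < delta_seq j)%R.
Proof. by rewrite /delta_seq subr_gt0 invf_lt1// ltr1n. Qed.

Lemma delta_seq_nd i j : (i <= j)%N -> (delta_seq i <= delta_seq j)%R.
Proof. by move=> ij; rewrite /delta_seq lerD2l lerN2 lef_pV2 ?posrE// ler_nat. Qed.

Lemma delta_seq_sup (x y : R) : (0 < x)%R -> (y < x)%R -> exists j, (y < delta_seq j * x)%R.
Proof.
move=> x0 yx; have xy : (0 < x - y)%R by rewrite subr_gt0.
exists (Num.bound (x / (x - y))); set j := Num.bound _.
have := archi_boundP (divr_ge0 (ltW x0) (ltW xy)); rewrite -/j => h.
rewrite /delta_seq mulrBl mul1r ltrBrDr -ltrBrDl.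
rewrite mulrC ltr_pdivrMr// -ltr_pdivrMl// mulrC (lt_trans h)// ltr_nat.
by rewrite ltnS leqnSn.
Qed.

Lemma region_int_cvg (F : 'rV[R]_d * 'rV[R]_d -> R) : measurable_fun [set: 'rV[R]_d * 'rV[R]_d] F ->
  (forall x y, (0 < ax y < ax x)%R -> (0 <= F (x, y))%R) ->
  region_int (delta_seq j) F @[j --> \oo] --> region_int 1 F.
Proof.
move=> mF F0.
pose f (p : 'rV[R]_d * 'rV[R]_d) := if (0 < ax p.2 < 1 * ax p.1)%R then (F p)%:E else 0.
have mf : measurable_fun [set: 'rV[R]_d * 'rV[R]_d] f by exact: measurable_region.
have f0 p : 0 <= f p.
  by rewrite /f mul1r; case: p => x y /=; case: ifP => // /F0; rewrite lee_fin.
pose S j := [set p : 'rV[R]_d * 'rV[R]_d | 0 < ax p.2 < delta_seq j * ax p.1]%R.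
have lt1 j x : (delta_seq j * ax x <= ax x)%R.
  by rewrite ler_piMl ?enorm_ge0// ltW// delta_seq_lt1.
have mS j : measurable (S j).
  have mb : measurable_fun [set: 'rV[R]_d * 'rV[R]_d] (fun p => (0 < ax p.2 < delta_seq j * ax p.1)%R).
    by apply: measurable_and; apply: measurable_fun_ltr; meas2.
  by have := mb measurableT [set true] I; rewrite setTI.
pose g (c : R) (p : 'rV[R]_d * 'rV[R]_d) := if (0 < ax p.2 < c * ax p.1)%R then f p else 0.
have mg c : measurable_fun [set: 'rV[R]_d * 'rV[R]_d] (g c).
  apply: measurable_fun_ifT; [|exact: mf|exact: measurable_cst].
  by apply: measurable_and; apply: measurable_fun_ltr; meas2.
have g0 c p : 0 <= g c p by rewrite /g; case: ifP.
have E j : region_int (delta_seq j) F = \int[mu \x mu]_(p in S j) f p.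
  rewrite /S integral_if -/(g _).
  rewrite (@fubini_tonelli1 _ _ _ _ R mu mu (g (delta_seq j)) (mg _) (g0 _)).
  apply: eq_integral => x _; apply: eq_integral => y _; rewrite /g /f /= mul1r.
  by case: ifP => [/andP[y0 yx]|//]; rewrite y0 (lt_le_trans yx).
have E1 : region_int 1 F = \int[mu \x mu]_(p in \bigcup_j S j) f p.
  have -> : \bigcup_j S j = [set p | 0 < ax p.2 < 1 * ax p.1]%R.
    apply/seteqP; split => -[x y]; rewrite /S /= mul1r.
      by move=> [j _ /= /andP[-> yx]] /=; exact: lt_le_trans yx (lt1 _ _).
    move=> /andP[y0 yx]; have [j jyx] := delta_seq_sup (lt_trans y0 yx) yx.
    by exists j => //=; rewrite y0.
  rewrite integral_if -/(g _).
  rewrite (@fubini_tonelli1 _ _ _ _ R mu mu (g 1%R) (mg _) (g0 _)).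
  apply: eq_integral => x _; apply: eq_integral => y _; rewrite /g /f /=.
  by case: ifP.
rewrite E1; under eq_fun do rewrite E.
apply: ge0_nondecreasing_set_cvg_integral => //.
- move=> i j ij; apply/subsetPset => -[x y]; rewrite /S /= => /andP[-> yx] /=.
  by apply: (lt_le_trans yx); rewrite ler_wpM2r ?enorm_ge0// delta_seq_nd.
- by move=> j; exact: measurable_funTS.
Qed.

End region_integrals.

Section inner_limit.
Context {R : realType}.
Local Open Scope ereal_scope.
Variables (n : nat) (s p alpha beta : R).

Lemma adde_cancel (a b c x : \bar R) : x \is a fin_num -> a + x = b + (x + c) -> a = b + c.
Proof. by move=> xf E; rewrite -[LHS](addeK _ xf) E addeCA [X in X - _]addeC addeK. Qed.

Lemma inner_mass_cvg (f : R -> R) : measurable_fun [set: R] f -> (forall r, (0 <= f r)%R) ->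
  inner_mass n s p alpha beta (delta_seq j) f @[j --> \oo] --> inner_mass n s p alpha beta 1%R f.
Proof.
move=> mf f0; have mpw := @measurable_pair_weight R n s p alpha beta.
pose h (y : 'rV[R]_n.+1) : \bar R := (f (enorm y) * pair_weight n s p alpha beta (enorm y) *
  enorm (e1 n - y) `^ (- (n.+1%:R + s * p)))%:E.
have mh : measurable_fun [set: 'rV[R]_n.+1] h by rewrite /h; meas.
have h0 y : 0 <= h y by rewrite lee_fin !mulr_ge0 ?powR_ge0 ?pair_weight_ge0.
pose S j := [set y : 'rV[R]_n.+1 | 0 < enorm y < delta_seq j]%R.
have E b : inner_mass n s p alpha beta b f =
    \int[lebesgue_rV n.+1]_(y in [set y | 0 < enorm y < b]%R) h y.
  rewrite integral_if; apply: eq_integral => y _; case: ifP => _; last by rewrite mul0e.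
  by rewrite -EFinM.
rewrite (E 1%R) (_ : [set y | _] = \bigcup_j S j); last first.
  apply/seteqP; split => y; rewrite /S /=.
    move=> /andP[y0 y1]; have [j] := @delta_seq_sup R 1%R (enorm y) ltr01 y1.
    by rewrite mulr1 => yj; exists j => //=; rewrite y0.
  by move=> [j _ /= /andP[-> yj]]/=; exact: lt_trans yj (delta_seq_lt1 _).
under eq_fun do rewrite E.
apply: ge0_nondecreasing_set_cvg_integral => //.
- move=> i j ij; apply/subsetPset => y; rewrite /S /= => /andP[-> yx] /=.
  by apply: (lt_le_trans yx); exact: delta_seq_nd.
- move=> j.
  have mb : measurable_fun [set: 'rV[R]_n.+1] (fun y => (0 < enorm y < delta_seq j)%R).
    by apply: measurable_and; apply: measurable_fun_ltr; meas.
  by have := mb measurableT [set true] I; rewrite setTI.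
- by move=> j; exact: measurable_funTS.
Qed.

End inner_limit.

(** * From the pointwise identity to the energy identity *)

Section ground_identity.
Context {R : realType}.
Local Open Scope ereal_scope.

Variables (n m : nat) (kd : (n.+1 <= n.+1 + m)%N) (s p alpha beta : R).
Local Notation d := (n.+1 + m)%N.
Local Notation k := (n.+1%:R : R).
Local Notation mu := (@lebesgue_rV R d).
Local Notation ax := (fun x => enorm (head_rV kd x)).
Local Notation tau := (s * p)%R.
Hypotheses (p2 : (2 <= p)%R) (s01 : (0 < s < 1)%R).
Hypotheses (ha : (- k < alpha < tau)%R) (hb : (- k < beta < tau)%R).
Hypotheses (hab : (- k < alpha + beta < tau)%R).

Local Notation gam := (hardy_gamma n s p alpha beta).
Local Notation pw := (pair_weight n s p alpha beta).
Local Notation kap := (fiber_cst n m tau : R).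

Let p0 : (0 < p)%R. Proof. by rewrite (lt_le_trans _ p2). Qed.
Let tau0 : (0 < tau)%R. Proof. by case/andP: s01 => s0 _; rewrite mulr_gt0. Qed.
Let ktau : (- k < tau)%R. Proof. by rewrite (lt_trans _ tau0)// oppr_lt0. Qed.

Lemma hardy_cstE : hardy_cst d s p n.+1 alpha beta = (kap * C1_cst n.+1 s p alpha beta)%R.
Proof.
rewrite /hardy_cst /fiber_cst; congr (_ `^ _ * _ / _ * _)%R.
by congr (_ / _)%R; rewrite natrD addrC addKr.
Qed.

Variable u : 'rV[R]_d -> R.
Hypothesis mu_ : measurable_fun [set: 'rV[R]_d] u.
Local Notation H := (hardy_term kd s p alpha beta u).

Let NN (x y : 'rV[R]_d) : R := (enorm (x - y) `^ (- (d%:R + tau)))%R.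

Let measurable_term1 (g : R -> R) : measurable_fun [set: R] g ->
  measurable_fun [set: 'rV[R]_d * 'rV[R]_d] (fun q =>
    `|u q.1| `^ p * g (ax q.2 / ax q.1) * ax q.1 `^ (alpha + beta) * NN q.1 q.2)%R.
Proof. by move=> mg; rewrite /NN; meas2. Qed.

Let measurable_term2 (g : R -> R) : measurable_fun [set: R] g ->
  measurable_fun [set: 'rV[R]_d * 'rV[R]_d] (fun q =>
    `|u q.2| `^ p * g (ax q.2 / ax q.1) * ax q.2 `^ (alpha + beta) * NN q.1 q.2)%R.
Proof. by move=> mg; rewrite /NN; meas2. Qed.

Let H_ge0 x : 0 <= (`|u x| `^ p / enorm (head_rV kd x) `^ (tau - alpha - beta))%:E.
Proof. by rewrite lee_fin divr_ge0 ?powR_ge0. Qed.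

Let measurable_H : measurable_fun [set: 'rV[R]_d]
  (fun x => (`|u x| `^ p / enorm (head_rV kd x) `^ (tau - alpha - beta))%:E).
Proof. by meas2. Qed.

(** On [x_k = 0] the Hardy integrand is then a quotient by 0, hence 0, and agrees with the empty
    inner region; the exponent is positive because [alpha + beta < tau]. *)
Let weight0 : ((0 : R) `^ (tau - alpha - beta) = 0)%R.
Proof.
rewrite powR0// gt_eqF// -addrA -opprD subr_gt0.
by case/andP: hab.
Qed.

Let weightE (x : 'rV[R]_d) : (0 < ax x)%R ->
  (`|u x| `^ p * ax x `^ (alpha + beta) * ax x `^ (- tau) =
   `|u x| `^ p / ax x `^ (tau - alpha - beta))%R.
Proof.
by move=> x0; rewrite -mulrA -powRD_gt0// -powRN; congr (_ * _ `^ _)%R; ring.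
Qed.

(** The inner integral in [y] involves only the ratio [|y_k| / |x_k|] and the kernel, so by scaling
    it is a constant times [|x_k| ^ (- tau)]. *)
Lemma region_int_first (delta : R) (g : R -> R) : measurable_fun [set: R] g ->
  (forall r, (0 <= g r)%R) ->
  region_int kd delta (fun q =>
    `|u q.1| `^ p * g (ax q.2 / ax q.1) * ax q.1 `^ (alpha + beta) * NN q.1 q.2)%R =
  H * (kap%:E * mass n tau (fun r => if (0 < r < delta)%R then (g r)%:E else 0)).
Proof.
move=> mg g0; have c0 := fiber_cst_gt0 m ktau.
have mif : measurable_fun [set: R] (fun r => if (0 < r < delta)%R then (g r)%:E else 0).
  apply: measurable_fun_ifT; [|by meas|exact: measurable_cst].
  by apply: measurable_and; exact: measurable_fun_ltr.
rewrite /hardy_term -ge0_integralZrT//; last first.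
  by rewrite mule_ge0 ?lee_fin ?(ltW c0)//; apply: mass_ge0 => r; case: ifP; rewrite ?lee_fin.
apply: eq_integral => x _.
have [x0|x0] := ltP 0%R (ax x); last first.
  have ->: enorm (head_rV kd x) = 0%R by apply/eqP; rewrite eq_le x0 enorm_ge0.
  rewrite weight0 invr0 (mulr0 (`|u x| `^ p)%R) mul0e; apply: integral0_eq => y _.
  by rewrite mulr0; case: ltP => //= y0; rewrite ltNge (ltW y0).
pose G (t : R) := if (0 < t < delta * ax x)%R then (g (t / ax x))%:E else 0.
have mi : measurable_fun [set: R] (@GRing.inv R) by apply: measurable_invr; exact: measurable_id.
have mG : measurable_fun [set: R] G.
  apply: measurable_fun_ifT; [|by meas|exact: measurable_cst].
  by apply: measurable_and; exact: measurable_fun_ltr.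
have G0 t : 0 <= G t by rewrite /G; case: ifP => // _; rewrite lee_fin.
transitivity (\int[mu]_y ((`|u x| `^ p * ax x `^ (alpha + beta))%:E *
    (G (ax y) * (enorm (x - y) `^ (- (d%:R + tau)))%:E))).
  apply: eq_integral => y _; rewrite /G; case: ifP => _; last by rewrite mul0e mule0.
  rewrite -!EFinM; congr (_%:E); rewrite /NN /=; ring.
rewrite ge0_integralZlT; last 3 first.
- by rewrite mulr_ge0 ?powR_ge0.
- by move=> y; rewrite mule_ge0// lee_fin powR_ge0.
- apply: emeasurable_funM; last by meas.
  by apply: (measurableT_comp mG); meas2.
rewrite (integral_radial_kernel ktau x0 mG G0).
rewrite (_ : (fun r => G (ax x * r)%R) = fun r => if (0 < r < delta)%R then (g r)%:E else 0); last first.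
  apply/funext => r; rewrite /G pmulr_rgt0// (mulrC delta) ltr_pM2l// mulrAC divff ?gt_eqF//.
  by rewrite mul1r.
rewrite -weightE// muleA -EFinM muleA -EFinM; congr (_%:E * _).
by ring.
Qed.

(** Now [|u| ^ p] sits at the inner point, so the order of integration is exchanged and [x] ranges
    over [|x_k| > |y_k| / delta]. Inversion brings this outer region back to [r < delta] and
    produces the factor [r ^ (tau - k)]. *)
Lemma region_int_second (delta : R) (g : R -> R) : (0 < delta)%R ->
  measurable_fun [set: R] g -> (forall r, (0 <= g r)%R) ->
  region_int kd delta (fun q =>
    `|u q.2| `^ p * g (ax q.2 / ax q.1) * ax q.2 `^ (alpha + beta) * NN q.1 q.2)%R =
  H * (kap%:E * mass n tau (fun r => if (0 < r < delta)%R then (g r * r `^ (tau - k))%:E else 0)).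
Proof.
move=> delta0 mg g0; have c0 := fiber_cst_gt0 m ktau.
have mif : measurable_fun [set: R] (fun r => if (0 < r < delta)%R then (g r * r `^ (tau - k))%:E else 0).
  apply: measurable_fun_ifT; [|by meas|exact: measurable_cst].
  by apply: measurable_and; exact: measurable_fun_ltr.
have if0 r : 0 <= (if (0 < r < delta)%R then (g r * r `^ (tau - k))%:E else 0).
  by case: ifP => // _; rewrite lee_fin mulr_ge0 ?powR_ge0.
rewrite /hardy_term -ge0_integralZrT//; last first.
  by rewrite mule_ge0 ?lee_fin ?(ltW c0)//; exact: mass_ge0.
pose F (q : 'rV[R]_d * 'rV[R]_d) : \bar R := if (0 < ax q.2 < delta * ax q.1)%R then
  (`|u q.2| `^ p * g (ax q.2 / ax q.1) * ax q.2 `^ (alpha + beta) * NN q.1 q.2)%:E else 0.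
have mF : measurable_fun [set: 'rV[R]_d * 'rV[R]_d] F.
  apply: measurable_fun_ifT; [|by rewrite /NN; meas2|exact: measurable_cst].
  by apply: measurable_and; apply: measurable_fun_ltr; meas2.
have F0 q : 0 <= F q.
  by rewrite /F; case: ifP => // _; rewrite lee_fin !mulr_ge0 ?powR_ge0.
transitivity (\int[mu]_y \int[mu]_x F (x, y)).
  by rewrite -(@fubini_tonelli _ _ _ _ _ mu mu F).
apply: eq_integral => y _.
have [y0|y0] := ltP 0%R (ax y); last first.
  have ye : enorm (head_rV kd y) = 0%R by apply/eqP; rewrite eq_le y0 enorm_ge0.
  rewrite ye weight0 invr0 mulr0 mul0e; apply: integral0_eq => x _.
  by rewrite /F /= ye ltxx.
pose G (t : R) := if (0 < t)%R && (ax y < delta * t)%R then (g (ax y / t))%:E else 0.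
have mi : measurable_fun [set: R] (@GRing.inv R) by apply: measurable_invr; exact: measurable_id.
have mG : measurable_fun [set: R] G.
  apply: measurable_fun_ifT; [|by meas|exact: measurable_cst].
  by apply: measurable_and; apply: measurable_fun_ltr; meas.
have G0 t : 0 <= G t by rewrite /G; case: ifP => // _; rewrite lee_fin.
transitivity (\int[mu]_x ((`|u y| `^ p * ax y `^ (alpha + beta))%:E *
    (G (ax x) * (enorm (y - x) `^ (- (d%:R + tau)))%:E))).
  apply: eq_integral => x _; rewrite /G /F /= y0 /=.
  case: (ltP (ax y) (delta * ax x)%R) => h; last by rewrite andbF mul0e mule0.
  rewrite -(pmulr_rgt0 _ delta0) (lt_trans y0 h)/=.
  rewrite -!EFinM; congr (_%:E); rewrite /NN (enormB y x) /=; ring.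
rewrite ge0_integralZlT; last 3 first.
- by rewrite mulr_ge0 ?powR_ge0.
- by move=> x; rewrite mule_ge0// lee_fin powR_ge0.
- apply: emeasurable_funM; last by meas.
  by apply: (measurableT_comp mG); meas2.
rewrite (integral_radial_kernel ktau y0 mG G0).
have mGy : measurable_fun [set: R] (fun r => G (ax y * r)%R).
  by apply: (measurableT_comp mG); meas.
rewrite (mass_inv _ _ mGy)//.
rewrite (@eq_mass _ _ _ _ (fun r => if (0 < r < delta)%R then (g r * r `^ (tau - k))%:E else 0)).
- rewrite -weightE// muleA -EFinM muleA -EFinM; congr (_%:E * _).
  by ring.
- apply: emeasurable_funM; last by meas.
  by apply: (measurableT_comp mGy); apply: measurable_invr; exact: measurable_id.
- exact: mif.
- by move=> r; rewrite mule_ge0// lee_fin powR_ge0.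
- exact: if0.
move=> r r0; rewrite /G r0 pmulr_rgt0// invr_gt0 r0 /=.
have -> : (ax y < delta * (ax y / r))%R = (r < delta)%R.
  by rewrite mulrCA -ltr_pdivrMl// mulVf ?gt_eqF// ltr_pdivlMr// mul1r.
case: ifP => _; last by rewrite mul0e.
rewrite -EFinM; congr (g _ * _)%:E.
by field; rewrite !gt_eqF.
Qed.

Local Notation v := (ground_state kd s p alpha beta u).
Local Notation a' := (- ((k - alpha + beta - tau) / 2))%R.
Local Notation b' := (- ((k + alpha - beta - tau) / 2))%R.

Let W (q : 'rV[R]_d * 'rV[R]_d) : R :=
  (ax q.1 `^ alpha * ax q.2 `^ beta + ax q.1 `^ beta * ax q.2 `^ alpha)%R.

Let D (q : 'rV[R]_d * 'rV[R]_d) : R := (`|u q.1 - u q.2| `^ p * W q * NN q.1 q.2)%R.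

Let Q (q : 'rV[R]_d * 'rV[R]_d) : R :=
  (`|v q.1 - v q.2| `^ p *
   (ax q.1 `^ a' * ax q.2 `^ b' + ax q.1 `^ b' * ax q.2 `^ a') * NN q.1 q.2)%R.

(** The exponents and the function are arbitrary, because the formula serves both the energy of [u]
    and the remainder in [v]. *)
Lemma energy_region a b (w : 'rV[R]_d -> R) : measurable_fun [set: 'rV[R]_d] w ->
  energy kd s p a b w = region_int kd 1 (fun q => `|w q.1 - w q.2| `^ p *
    (ax q.1 `^ a * ax q.2 `^ b + ax q.1 `^ b * ax q.2 `^ a) * NN q.1 q.2)%R.
Proof.
move=> mw.
pose X (q : 'rV[R]_d * 'rV[R]_d) : \bar R :=
  (`|w q.1 - w q.2| `^ p / enorm (q.1 - q.2) `^ (d%:R + s * p) *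
     enorm (head_rV kd q.1) `^ a * enorm (head_rV kd q.2) `^ b)%:E.
rewrite /energy (@integral_sym_split R n m kd X); last 2 first.
- by rewrite /X; meas2.
- by move=> q; rewrite lee_fin !mulr_ge0 ?invr_ge0 ?powR_ge0.
rewrite /region_int; apply: eq_integral => x _; apply: eq_integral => y _; rewrite mul1r.
case: ifP => // _; rewrite /X /= -EFinD /NN powRN (distrC (w y)) (enormB y x).
congr (_%:E).
have E (c h a1 b1 a2 b2 : R) : (c * h * a1 * b1 + c * h * a2 * b2 = c * (a1 * b1 + b2 * a2) * h)%R.
  by ring.
exact: E.
Qed.

(* The roles of the two points are chosen by the sign of [gam], so that the
   parameter of [ground_gap] is less than 1 on [|y_k| < |x_k|]. *)
Definition ground_defect (c : R) (q : 'rV[R]_d * 'rV[R]_d) : R :=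
  ((if 0 < gam then ax q.2 `^ (- (gam * p)) *
       ground_gap p c ((ax q.2 / ax q.1) `^ gam) (v q.2) (v q.1)
    else ax q.1 `^ (- (gam * p)) *
       ground_gap p c ((ax q.2 / ax q.1) `^ (- gam)) (v q.1) (v q.2)) *
   (W q * NN q.1 q.2))%R.

Let measurable_v : measurable_fun [set: 'rV[R]_d] v.
Proof. by rewrite /ground_state; meas2. Qed.

Let measurable_defect c : measurable_fun [set: 'rV[R]_d * 'rV[R]_d] (ground_defect c).
Proof.
have mv := measurable_v; rewrite /ground_defect /ground_gap /W /NN.
by case: (0 < gam)%R; meas2.
Qed.

Let measurable_D : measurable_fun [set: 'rV[R]_d * 'rV[R]_d] D.
Proof. by rewrite /D /W /NN; meas2. Qed.

Let measurable_Q : measurable_fun [set: 'rV[R]_d * 'rV[R]_d] Q.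
Proof. by have mv := measurable_v; rewrite /Q /NN; meas2. Qed.

Let W0 q : (0 <= W q)%R. Proof. by rewrite addr_ge0 ?mulr_ge0 ?powR_ge0. Qed.
Let NN0 x y : (0 <= NN x y)%R. Proof. exact: powR_ge0. Qed.
Let D0 q : (0 <= D q)%R. Proof. by rewrite !mulr_ge0 ?powR_ge0. Qed.
Let Q0 q : (0 <= Q q)%R.
Proof. by rewrite !mulr_ge0 ?addr_ge0 ?mulr_ge0 ?powR_ge0. Qed.

Let A (r : R) : R := (`|1 - r `^ gam| `^ (p - 1))%R.
(** [TX] and [TY] are the terms of the pointwise identity with [|u| ^ p] at [x] alone and at [y]
    alone. The factor [r ^ (k - tau)] in [TY] cancels the one that inversion produces. *)
Let TX (q : 'rV[R]_d * 'rV[R]_d) : R := (`|u q.1| `^ p *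
  (fun r => A r * r `^ gam * pw r) (ax q.2 / ax q.1) * ax q.1 `^ (alpha + beta) * NN q.1 q.2)%R.
Let TY (q : 'rV[R]_d * 'rV[R]_d) : R := (`|u q.2| `^ p *
  (fun r => A r * pw r * r `^ (k - tau)) (ax q.2 / ax q.1) * ax q.2 `^ (alpha + beta) * NN q.1 q.2)%R.

Let gamp : (gam * p = k + alpha + beta - tau)%R.
Proof. by rewrite divfK// gt_eqF. Qed.

(** The symmetrized weight is homogeneous of degree [alpha + beta], hence a power of one norm times
    a function of the ratio; [weight_Y] factors out the other norm, and [weight_Q] the geometric
    mean. *)
Let weight_X (X Y : R) : (0 < Y)%R -> (0 < X)%R ->
  (pw (Y / X) * X `^ (alpha + beta) =
   (Y / X) `^ (- (gam * p)) * (X `^ alpha * Y `^ beta + X `^ beta * Y `^ alpha))%R.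
Proof.
move=> Y0 X0; have r0 : (0 < Y / X)%R by rewrite divr_gt0.
have YE z : (Y `^ z = (Y / X) `^ z * X `^ z)%R.
  by rewrite -(powRM _ (ltW r0) (ltW X0)) divfK// gt_eqF.
rewrite !YE /pair_weight powRD_gt0// mulrDl.
have -> : (tau - k - alpha = - (gam * p) + beta)%R by rewrite gamp; ring.
have -> : (tau - k - beta = - (gam * p) + alpha)%R by rewrite gamp; ring.
by rewrite !powRD_gt0//; ring.
Qed.

Let weight_Y (X Y : R) : (0 < Y)%R -> (0 < X)%R ->
  (pw (Y / X) * (Y / X) `^ (k - tau) * Y `^ (alpha + beta) =
   X `^ alpha * Y `^ beta + X `^ beta * Y `^ alpha)%R.
Proof.
move=> Y0 X0; have r0 : (0 < Y / X)%R by rewrite divr_gt0.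
have XE z : (X `^ z = (Y / X) `^ (- z) * Y `^ z)%R.
  have := powRM z (ltW r0) (ltW X0); rewrite divfK ?gt_eqF// => ->.
  by rewrite mulrA -powRD_gt0// addNr powRr0 mul1r.
rewrite !XE /pair_weight powRD_gt0// mulrDl -!powRD_gt0//.
have -> : (tau - k - alpha + (k - tau) = - alpha)%R by ring.
have -> : (tau - k - beta + (k - tau) = - beta)%R by ring.
by rewrite powRD_gt0//; ring.
Qed.

Let weight_Q (X Y : R) : (0 < Y)%R -> (0 < X)%R ->
  (X `^ a' * Y `^ b' + X `^ b' * Y `^ a' =
   (X * Y) `^ (- (gam * p / 2)) * (X `^ alpha * Y `^ beta + X `^ beta * Y `^ alpha))%R.
Proof.
move=> Y0 X0.
have -> : (a' = - (gam * p / 2) + alpha)%R by rewrite gamp; field.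
have -> : (b' = - (gam * p / 2) + beta)%R by rewrite gamp; field.
rewrite (powRM _ (ltW X0) (ltW Y0)) !powRD_gt0//.
by move: (_ `^ _)%R (Y `^ (- (gam * p / 2)))%R => x y; ring.
Qed.

Let pn0 : p != 0%R. Proof. by rewrite gt_eqF. Qed.

Let alg (c h V A1 U2 G D1 rg rm U1 W1 N1 : R) :
  (c * (h * V) + A1 * U2 + G = D1 + A1 * rg * rm * U1)%R ->
  (c * (V * (h * W1) * N1) + U2 * (A1 * W1) * N1 + G * (W1 * N1) =
   D1 * W1 * N1 + U1 * (A1 * rg * (rm * W1)) * N1)%R.
Proof. 
move=> E; rewrite (_ : _ + _ + _ = (c * (h * V) + A1 * U2 + G) * (W1 * N1))%R.
  by rewrite E; ring.
by ring.
Qed.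

Let pointwise_pos c x y : (0 < gam)%R -> (0 < ax y < ax x)%R ->
  (c * Q (x, y) + TY (x, y) + ground_defect c (x, y) = D (x, y) + TX (x, y))%R.
Proof.
move=> g0 /andP[y0 yx]; have x0 := lt_trans y0 yx.
have := ground_gap_pos c (u x) (u y) pn0 g0 y0 yx => E.
rewrite /Q /TY /ground_defect g0 /D /TX /W /=.
rewrite weight_Q//.
have -> : (`|u y| `^ p * (A (ax y / ax x) * pw (ax y / ax x) * (ax y / ax x) `^ (k - tau)) *
    ax y `^ (alpha + beta) = `|u y| `^ p * (A (ax y / ax x) *
    (ax x `^ alpha * ax y `^ beta + ax x `^ beta * ax y `^ alpha)))%R.
  by rewrite -(weight_Y y0 x0) !mulrA.
have -> : (`|u x| `^ p * (A (ax y / ax x) * (ax y / ax x) `^ gam * pw (ax y / ax x)) *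
    ax x `^ (alpha + beta) = `|u x| `^ p * (A (ax y / ax x) * (ax y / ax x) `^ gam *
    ((ax y / ax x) `^ (- (gam * p)) *
    (ax x `^ alpha * ax y `^ beta + ax x `^ beta * ax y `^ alpha))))%R.
  by rewrite -(weight_X y0 x0) !mulrA.
exact: alg E.
Qed.

Let alg2 (c h V A1 U2 G D1 rg rm U1 W1 N1 : R) :
  (c * (h * V) + A1 * rg * rm * U1 + G = D1 + A1 * U2)%R ->
  (c * (V * (h * W1) * N1) + U1 * (A1 * rg * (rm * W1)) * N1 + G * (W1 * N1) =
   D1 * W1 * N1 + U2 * (A1 * W1) * N1)%R.
Proof.
move=> E; rewrite (_ : _ + _ + _ = (c * (h * V) + A1 * rg * rm * U1 + G) * (W1 * N1))%R.
  by rewrite E; ring.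
by ring.
Qed.

Let pointwise_neg c x y : (gam < 0)%R -> (0 < ax y < ax x)%R ->
  (c * Q (x, y) + TX (x, y) + ground_defect c (x, y) = D (x, y) + TY (x, y))%R.
Proof.
move=> g0 /andP[y0 yx]; have x0 := lt_trans y0 yx.
have := ground_gap_neg c (u x) (u y) pn0 g0 y0 yx => E.
rewrite /Q /TY /ground_defect [(0 < gam)%R]ltNge (ltW g0) /D /TX /W /=.
rewrite weight_Q//.
have -> : (`|u y| `^ p * (A (ax y / ax x) * pw (ax y / ax x) * (ax y / ax x) `^ (k - tau)) *
    ax y `^ (alpha + beta) = `|u y| `^ p * (A (ax y / ax x) *
    (ax x `^ alpha * ax y `^ beta + ax x `^ beta * ax y `^ alpha)))%R.
  by rewrite -(weight_Y y0 x0) !mulrA.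
have -> : (`|u x| `^ p * (A (ax y / ax x) * (ax y / ax x) `^ gam * pw (ax y / ax x)) *
    ax x `^ (alpha + beta) = `|u x| `^ p * (A (ax y / ax x) * (ax y / ax x) `^ gam *
    ((ax y / ax x) `^ (- (gam * p)) *
    (ax x `^ alpha * ax y `^ beta + ax x `^ beta * ax y `^ alpha))))%R.
  by rewrite -(weight_X y0 x0) !mulrA.
exact: alg2 E.
Qed.

Let measurable_A : measurable_fun [set: R] A.
Proof. by rewrite /A; meas. Qed.

Let measurable_pw : measurable_fun [set: R] pw.
Proof. exact: measurable_pair_weight. Qed.

Let A0 r : (0 <= A r)%R. Proof. exact: powR_ge0. Qed.
Let pw0 r : (0 <= pw r)%R. Proof. exact: pair_weight_ge0. Qed.

Let inner delta h := inner_mass n s p alpha beta delta h.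

Let TX_int delta : region_int kd delta TX = H * (kap%:E * inner delta (fun r => A r * r `^ gam)%R).
Proof.
rewrite region_int_first//; first by meas.
by move=> r; rewrite !mulr_ge0 ?powR_ge0.
Qed.

Let TY_int delta : (0 < delta)%R -> region_int kd delta TY = H * (kap%:E * inner delta A).
Proof.
move=> d0; rewrite (@region_int_second delta (fun r => A r * pw r * r `^ (k - tau))%R)//.
- congr (_ * (_ * mass _ _ _)); apply/funext => r; case: ifP => // /andP[r0 _].
  have E : (r `^ (k - tau) * r `^ (tau - k) = 1)%R.
    by rewrite -powRD_gt0// (_ : _ + _ = 0)%R ?powRr0//; ring.
  by rewrite -(mulrA (A r * pw r)%R) E mulr1.
- by meas.
- by move=> r; rewrite !mulr_ge0 ?powR_ge0.
Qed.

Let TX0 q : (0 <= TX q)%R.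
Proof. by rewrite /TX !mulr_ge0 ?powR_ge0 ?pw0. Qed.

Let TY0 q : (0 <= TY q)%R.
Proof. by rewrite /TY !mulr_ge0 ?powR_ge0 ?pw0. Qed.

Let measurable_TX : measurable_fun [set: 'rV[R]_d * 'rV[R]_d] TX.
Proof. by apply: (measurable_term1 (_ : measurable_fun _ (fun r => A r * r `^ gam * pw r)%R)); meas. Qed.

Let measurable_TY : measurable_fun [set: 'rV[R]_d * 'rV[R]_d] TY.
Proof. by apply: (measurable_term2 (_ : measurable_fun _ (fun r => A r * pw r * r `^ (k - tau))%R)); meas. Qed.

Let hardy_fun (r : R) : R := (`|1 - r `^ gam| `^ p)%R.

Hypothesis gam0 : gam != 0%R.
Hypothesis H_fin : H < +oo.

Let H0 : 0 <= H. Proof. exact: integral_ge0. Qed.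
Let Hfin : H \is a fin_num. Proof. by rewrite ge0_fin_numE. Qed.

Variable c : R.
Hypothesis c0 : (0 <= c)%R.
Hypothesis gap0 : forall t a b, (0 < t < 1)%R -> (0 <= ground_gap p c t a b)%R.

Let defect0 delta x y : (delta <= 1)%R -> (0 < ax y < delta * ax x)%R -> (0 <= ground_defect c (x, y))%R.
Proof.
move=> d1 /andP[y0 yx].
have {}yx : (ax y < ax x)%R by rewrite (lt_le_trans yx)// ler_piMl// enorm_ge0.
have x0 := lt_trans y0 yx.
have r0 : (0 < ax y / ax x)%R by rewrite divr_gt0.
have r1 : (ax y / ax x < 1)%R by rewrite ltr_pdivrMr// mul1r.
have tlt1 g : (0 < g)%R -> (0 < (ax y / ax x) `^ g < 1)%R.
  move=> g0; rewrite powR_gt0//= -[ltRHS](one_powR g).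
  by rewrite gt0_ltr_powR ?nnegrE ?(ltW r0).
rewrite /ground_defect /= mulr_ge0 ?mulr_ge0//.
case: ifPn => g0; rewrite mulr_ge0 ?powR_ge0//; apply: gap0; apply: tlt1 => //.
by rewrite oppr_gt0 lt_neqAle gam0 leNgt.
Qed.

Let fc0 := fiber_cst_gt0 m ktau.

Let inner_ge0 delta h : (forall r, 0 <= h r)%R -> 0 <= inner delta h.
Proof.
move=> h0; apply: mass_ge0 => r; case: ifP => // _.
by rewrite lee_fin mulr_ge0// pair_weight_ge0.
Qed.

Let QG (q : 'rV[R]_d * 'rV[R]_d) : R := (c * Q q + ground_defect c q)%R.

Let measurable_QG : measurable_fun [set: 'rV[R]_d * 'rV[R]_d] QG.
Proof. by have mQ := measurable_Q; have md := measurable_defect c; rewrite /QG; meas. Qed.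

Let QG0 delta x y : (delta <= 1)%R -> (0 < ax y < delta * ax x)%R -> (0 <= QG (x, y))%R.
Proof. by move=> d1 xy; apply: addr_ge0; [rewrite mulr_ge0|exact: defect0 d1 xy]. Qed.

(** The integrated pointwise identity has the shape [D + small = QG + large]. Since [large] is
    [small] plus the integral of [|1 - r ^ gam| ^ p], and [small] is finite for [delta < 1], the
    latter cancels. *)
Let step delta : (0 < delta < 1)%R ->
  region_int kd delta D = region_int kd delta QG + H * (kap%:E * inner delta hardy_fun).
Proof.
move=> /andP[d0 d1]; have d1' := ltW d1.
have Sfin := @inner_mass_small_fin _ n s p alpha beta p2 s01 ha hb delta d1.
have S0 : 0 <= inner delta (small_power n s p alpha beta) by apply: inner_ge0; exact: small_power_ge0.
have Lge := @inner_mass_large _ n s p alpha beta p2 delta d1'.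
pose S := H * (kap%:E * inner delta (small_power n s p alpha beta)).
have SF : S \is a fin_num.
  rewrite ge0_fin_numE; last by rewrite !mule_ge0// lee_fin ltW.
  rewrite lte_mul_pinfty// ?lte_mul_pinfty// ?lee_fin; exact: ltW.
have LE : H * (kap%:E * inner delta (large_power n s p alpha beta)) =
    S + H * (kap%:E * inner delta hardy_fun).
  rewrite /inner Lge ge0_muleDr//; last by apply: inner_ge0 => r; exact: powR_ge0.
  rewrite ge0_muleDr// mule_ge0// ?lee_fin ?(ltW fc0)//.
  by apply: inner_ge0 => r; exact: powR_ge0.
suff E : region_int kd delta D + S =
    region_int kd delta QG + H * (kap%:E * inner delta (large_power n s p alpha beta)).
  by rewrite LE in E; exact: adde_cancel SF E.
have hD x y : (0 < ax y < delta * ax x)%R -> (0 <= D (x, y))%R by move=> _; exact: D0.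
have hX x y : (0 < ax y < delta * ax x)%R -> (0 <= TX (x, y))%R by move=> _; exact: TX0.
have hY x y : (0 < ax y < delta * ax x)%R -> (0 <= TY (x, y))%R by move=> _; exact: TY0.
have DX := @region_intD R n m kd delta D TX measurable_D measurable_TX hD hX.
have DY := @region_intD R n m kd delta D TY measurable_D measurable_TY hD hY.
have ad F G := @region_intD R n m kd delta F G.
have QGd x y := @QG0 delta x y d1'.
have [g0|g0] := ltP 0%R gam.
  have -> : S = region_int kd delta TX.
    rewrite TX_int /S; congr (_ * (_ * mass _ _ _)); apply/funext => r.
    by rewrite /small_power g0.
  have -> : H * (kap%:E * inner delta (large_power n s p alpha beta)) = region_int kd delta TY.
    rewrite TY_int//; congr (_ * (_ * mass _ _ _)); apply/funext => r.
    by rewrite /large_power g0 mulr1.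
  apply: (etrans (esym DX)).
  apply: (etrans _ (ad QG TY measurable_QG measurable_TY QGd hY)).
  apply: eq_region_int => x y /andP[y0 yx].
  have xy : (0 < ax y < ax x)%R by rewrite y0 (lt_le_trans yx)// ler_piMl// enorm_ge0.
  by rewrite -(pointwise_pos c g0 xy) /QG addrAC.
have {}g0 : (gam < 0)%R by rewrite lt_neqAle gam0.
have gN : (0 < gam)%R = false by apply/negbTE; rewrite -leNgt ltW.
have -> : S = region_int kd delta TY.
  rewrite TY_int// /S; congr (_ * (_ * mass _ _ _)); apply/funext => r.
  by rewrite /small_power gN mulr1.
have -> : H * (kap%:E * inner delta (large_power n s p alpha beta)) = region_int kd delta TX.
  rewrite TX_int//; congr (_ * (_ * mass _ _ _)); apply/funext => r.
  by rewrite /large_power gN.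
apply: (etrans (esym DY)).
apply: (etrans _ (ad QG TX measurable_QG measurable_TX QGd hX)).
apply: eq_region_int => x y /andP[y0 yx].
have xy : (0 < ax y < ax x)%R by rewrite y0 (lt_le_trans yx)// ler_piMl// enorm_ge0.
by rewrite -(pointwise_neg c g0 xy) /QG addrAC.
Qed.

Let inner_cvg : inner (delta_seq j) hardy_fun @[j --> \oo] --> inner 1%R hardy_fun.
Proof.
apply: inner_mass_cvg; first exact: measurable_abs_gam.
by move=> r; exact: powR_ge0.
Qed.

(** [step] along [delta_seq]: finiteness of the Hardy term lets its coefficient pass to the limit,
    and nonnegativity of the gap makes [QG] nonnegative. The constant [c] stays a parameter subject
    only to this condition and to [c >= 0]. *)
Lemma ground_identity :
  energy kd s p alpha beta u = (hardy_cst d s p n.+1 alpha beta)%:E * H +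
    (c%:E * energy kd s p a' b' v + region_int kd 1 (ground_defect c)).
Proof.
rewrite (energy_region _ _ mu_) (energy_region _ _ measurable_v).
rewrite -/D -/Q.
have lt1 x y : (0 < ax y < 1 * ax x)%R -> (0 < ax y < ax x)%R by rewrite mul1r.
have -> : c%:E * region_int kd 1 Q + region_int kd 1 (ground_defect c) = region_int kd 1 QG.
  have mcQ : measurable_fun [set: 'rV[R]_d * 'rV[R]_d] (fun q => c * Q q)%R.
    by apply: measurable_funM; [exact: measurable_cst|exact: measurable_Q].
  rewrite -(region_intZ c0 measurable_Q (fun x y _ => Q0 (x, y))).
  rewrite -(@region_intD R n m kd 1 _ _ mcQ (measurable_defect c)) //.
  - by move=> x y _; rewrite mulr_ge0.
  - by move=> x y; exact: defect0.
have -> : (hardy_cst d s p n.+1 alpha beta)%:E * H = H * (kap%:E * inner 1 hardy_fun).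
  by rewrite hardy_cstE EFinM (EFin_C1_cst p2 s01 ha hb) muleC.
have cD := region_int_cvg measurable_D (fun x y _ => D0 (x, y)).
have cQG : region_int kd (delta_seq j) QG @[j --> \oo] --> region_int kd 1 QG.
  apply: region_int_cvg => // x y xy; apply: (@QG0 1%R) => //.
  by rewrite mul1r.
have cI : H * (kap%:E * inner (delta_seq j) hardy_fun) @[j --> \oo] -->
    H * (kap%:E * inner 1 hardy_fun).
  by apply: cvgeZl => //; apply: cvgeZl => //; exact: inner_cvg.
have cR : region_int kd (delta_seq j) D @[j --> \oo] -->
    H * (kap%:E * inner 1 hardy_fun) + region_int kd 1 QG.
  rewrite addeC; under eq_fun do rewrite step ?delta_seq_gt0 ?delta_seq_lt1//.
  apply: cvgeD => //; apply: ge0_adde_def; rewrite inE.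
    by apply: region_int_ge0 => x y; exact: QG0.
  rewrite !mule_ge0// ?lee_fin ?(ltW fc0)//.
  by apply: inner_ge0 => r; exact: powR_ge0.
exact: (cvg_unique _ (cD kd) cR).
Qed.

End ground_identity.

(** * Test functions *)

Section test_functions.
Context {R : realType}.

(** Measurability on row vectors is generated by the coordinates, so an open set is written as a
    countable union of boxes with rational centres and sides [2 / (j + 1)]. *)
Lemma open_measurable_rV n (U : set 'rV[R]_n) : open U -> measurable U.
Proof.
move=> oU.
pose B (q : 'rV[rat]_n * nat) : set 'rV[R]_n :=
  [set x | forall i, `|ratr (q.1 ord0 i) - x ord0 i| < q.2.+1%:R^-1].
have mB q : measurable (B q).
  rewrite (_ : B q = \bigcap_(i in [set: 'I_n]) ((fun x : 'rV[R]_n => x ord0 i) @^-1`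
      [set` `](ratr (q.1 ord0 i) - q.2.+1%:R^-1), (ratr (q.1 ord0 i) + q.2.+1%:R^-1)[ ])).
    apply: fin_bigcap_measurable => // i _.
    by rewrite -[X in measurable X]setTI; exact: measurable_coord.
  apply/seteqP; split => x /=.
    by move=> h i _ /=; rewrite in_itv/= -ltr_distlC; exact: h.
  by move=> h i; have := h i I; rewrite /= in_itv/= -ltr_distlC.
have -> : U = \bigcup_q [set x | B q `<=` U /\ B q x].
  apply/seteqP; split => x; last first.
    by move=> [q _ [BU /BU]].
  move=> Ux; have /nbhs_ballP[e /= e0 xe] : nbhs x U by exact: open_nbhs_nbhs.
  have e20 : 0 < e / 2 by rewrite divr_gt0.
  have [j je] : exists j, j.+1%:R^-1 < e / 2 :> R.
    exists (Num.bound (e / 2)^-1).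
    have := archi_boundP (_ : 0 <= (e / 2)^-1); rewrite invr_ge0 => /(_ (ltW e20)) h.
    by rewrite invf_plt ?posrE// (lt_trans h)// ltr_nat.
  have j0 : 0 < j.+1%:R^-1 :> R by rewrite invr_gt0.
  have /choice[q qP] : forall i, exists q : rat, `|ratr q - x ord0 i| < j.+1%:R^-1.
    move=> i; have /rat_in_itvoo[q] : x ord0 i - j.+1%:R^-1 < x ord0 i + j.+1%:R^-1.
      by rewrite ltrBlDr -addrA ltrDl addr_gt0.
    by rewrite in_itv/= -ltr_distl => h; exists q.
  exists (\row_i q i, j) => //=.
  suff BU : B (\row_i q i, j) `<=` U.
    by split => // i /=; rewrite mxE.
  move=> y /= By; apply: xe; split => // a i; rewrite (ord1 a) /ball/=.
  have h1 := By i; rewrite mxE in h1.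
  rewrite -(subrKA (ratr (q i))) (le_lt_trans (ler_normD _ _))//.
  rewrite (splitr e) ltrD// (lt_trans _ je)//.
  by rewrite distrC.
apply: countable_bigcupT_measurable; first exact: countableP.
move=> q; have [BU|BU] := pselect (B q `<=` U).
  by rewrite (_ : [set x | _] = B q)//; apply/seteqP; split => // x [].
by rewrite (_ : [set x | _] = set0)//; apply/seteqP; split => // x [].
Qed.

Lemma continuous_measurable_rV n (u : 'rV[R]_n -> R) :
  continuous u -> measurable_fun [set: 'rV[R]_n] u.
Proof.
move=> /continuousP cu; apply: (measurability _ (RGenOpens.measurableE R)).
move=> _ [_ [a [b ->] <-]]; rewrite setTI; apply: open_measurable_rV.
by apply: cu; exact: interval_open.
Qed.

Lemma C1c_continuous n (O : set 'rV[R]_n) u : C1c O u -> continuous u.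
Proof. by move=> [du _ _ _] x; exact: differentiable_continuous. Qed.

Lemma C1c_measurable n (O : set 'rV[R]_n) u : C1c O u -> measurable_fun [set: 'rV[R]_n] u.
Proof. by move=> /C1c_continuous/continuous_measurable_rV. Qed.

Lemma C1c_bounded n (O : set 'rV[R]_n) u : C1c O u ->
  exists M, 0 <= M /\ forall x, `|u x| <= M.
Proof.
move=> Cu; have cu := C1c_continuous Cu; have [_ _ cK _] := Cu.
have cuK : compact (u @` closed_support u).
  by apply: continuous_compact => //; exact: continuous_subspaceT.
have [M [_ /(_ (`|M| + 1))]] := compact_bounded cuK.
rewrite (le_lt_trans (ler_norm _)) ?ltrDl// => /(_ isT) h.
exists (`|M| + 1); split => [|x]; first by rewrite addr_ge0.
have [->|ux] := eqVneq (u x) 0; first by rewrite normr0 addr_ge0.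
by apply: h; exists x => //; exact: subset_closure.
Qed.

Lemma C1c_support_box n (O : set 'rV[R]_n) u : C1c O u ->
  exists L, 0 < L /\ forall x, u x != 0 -> forall i, `|x ord0 i| <= L.
Proof.
move=> [_ _ cK _].
have [M [_ /(_ (`|M| + 1))]] := compact_bounded cK.
rewrite (le_lt_trans (ler_norm _)) ?ltrDl// => /(_ isT) h.
exists (`|M| + 1); split; first by rewrite ltr_wpDl.
move=> x ux i.
have xs : closed_support u x by exact: subset_closure.
have := h x xs; apply: le_trans.
have /mapP[j Hj ->] : `|x ord0 i| \in [seq `|x q.1 q.2| | q : 'I_1 * 'I_n].
  by apply/mapP; exists (ord0, i) => //=; rewrite mem_enum.
by rewrite [leRHS]/Num.norm /= mx_normrE; apply/bigmax_geP; right => /=; exists j.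
Qed.

Lemma is_diff_coord n (x : 'rV[R]_n) j :
  is_diff x (fun y : 'rV[R]_n => y ord0 j : R) (fun v : 'rV[R]_n => v ord0 j : R).
Proof.
have @f : {linear 'rV[R]_n -> R}.
  by exists (fun N : 'rV[R]_n => N ord0 j); do 2![eexists]; do ?[constructor];
     rewrite ?mxE// => ? *; rewrite ?mxE//; move=> ?; rewrite !mxE.
have cf : continuous f by exact: coord_continuous.
apply: DiffDef; first exact: differentiable_coord.
by rewrite (diff_lin _ cf : 'd f x = f :> (_ -> _)).
Qed.

Lemma is_diff_sum_sqr n (I : Type) (r : seq I) (f : I -> 'I_n) (x : 'rV[R]_n) :
  is_diff x (fun y : 'rV[R]_n => \sum_(i <- r) y ord0 (f i) ^+ 2 : R)
    (fun v : 'rV[R]_n => \sum_(i <- r) 2 * x ord0 (f i) * v ord0 (f i) : R).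
Proof.
elim: r => [|i r IH].
  rewrite (_ : (fun y : 'rV[R]_n => _) = cst (0 : R)); last by apply/funext => y; rewrite big_nil.
  rewrite (_ : (fun v : 'rV[R]_n => _) = 0); first exact: is_diff_cst.
  by apply/funext => v; rewrite big_nil.
have d1 := @is_diffX R _ _ _ 1 x (is_diff_coord x (f i)).
have d2 := is_diffD d1 IH.
rewrite (_ : (fun y : 'rV[R]_n => _) = (fun y : 'rV[R]_n => y ord0 (f i) : R) ^+ 2 +
    (fun y : 'rV[R]_n => \sum_(i <- r) y ord0 (f i) ^+ 2 : R)); last first.
  by apply/funext => y; rewrite big_cons.
apply: is_diff_eq d2 _; apply/funext => v; rewrite big_cons.
by rewrite /= /GRing.scale /= expr1.
Qed.

Lemma continuous_sum_sqr n (I : Type) (r : seq I) (f : I -> 'I_n) :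
  continuous (fun y : 'rV[R]_n => \sum_(i <- r) y ord0 (f i) ^+ 2 : R).
Proof.
move=> x; apply: differentiable_continuous.
by have [] := is_diff_sum_sqr r f x.
Qed.

Lemma enorm_box n (x : 'rV[R]_n) (L : R) : 0 <= L -> (forall i, `|x ord0 i| <= L) ->
  enorm x <= Num.sqrt n%:R * L.
Proof.
move=> L0 h; rewrite -[X in _ * X](ger0_norm L0) -sqrtr_sqr -sqrtrM// enormE ler_wsqrtr//.
have -> : n%:R * L ^+ 2 = \sum_(i < n) L ^+ 2 by rewrite sumr_const card_ord mulr_natl.
apply: ler_sum => i _; rewrite -real_normK ?num_real//.
by rewrite lerXn2r ?nnegrE.
Qed.

End test_functions.

(** * Finiteness of the Hardy term *)

Section hardy_term_finite.
Context {R : realType}.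
Local Open Scope ereal_scope.

Lemma measurable_rV_box n (A : 'I_n -> set R) : (forall i, measurable (A i)) ->
  measurable [set x : 'rV[R]_n | forall i, A i (x ord0 i)].
Proof.
move=> mA; rewrite (_ : [set x | _] = \bigcap_(i in [set: 'I_n])
    ((fun x : 'rV[R]_n => x ord0 i) @^-1` A i)).
  apply: fin_bigcap_measurable => // i _.
  by rewrite -[X in measurable X]setTI; exact: measurable_coord.
by apply/seteqP; split=> x /= => [h' i _|h' i]; exact: h'.
Qed.

Lemma integral_ball_fin n (c : R) :
  \int[lebesgue_rV n]_z (if (enorm z <= c)%R then 1 else 0) < +oo :> \bar R.
Proof.
have mI : measurable (`[(- c)%R, c]%classic : set R) by exact: measurable_itv.
have h := @lebesgue_rV_box R n (fun=> `[(- c)%R, c]%classic) (fun=> mI).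
have mS : measurable [set z : 'rV[R]_n | enorm z <= c]%R.
  have me : measurable_fun [set: 'rV[R]_n] (@enorm R n) by meas.
  have -> : [set z : 'rV[R]_n | enorm z <= c]%R = (@enorm R n) @^-1` [set` `]-oo, c]%R].
    by apply/seteqP; split => x /=; rewrite in_itv.
  by rewrite -[X in measurable X]setTI; apply: me => //; exact: measurable_itv.
rewrite -integral_if integral_cst// mul1e.
apply: (@le_lt_trans _ _ (\prod_(i < n) lebesgue_measure (`[(- c)%R, c]%classic : set R))).
  have mB := @measurable_rV_box n _ (fun=> mI).
  rewrite -h; apply: le_measure; rewrite ?inE//.
  move=> z /= zc i /=; rewrite in_itv/= -ler_norml.
  exact: le_trans (coord_le_enorm z i) zc.
set b := lebesgue_measure _; have [r ->] : exists r : R, b = r%:E.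
  rewrite /b lebesgue_measure_itv/=; case: ifP => _; last by exists 0%R.
  by rewrite -EFinB; eexists.
by rewrite prodEFin ltry.
Qed.

Variables (n m : nat) (kd : (n.+1 <= n.+1 + m)%N).
Local Notation d := (n.+1 + m)%N.
Local Notation k := (n.+1%:R : R).
Local Notation ax := (fun x => enorm (head_rV kd x)).

Lemma measurable_tail e (T : measurableType e) (f : T -> 'rV[R]_d) :
  measurable_fun setT f -> measurable_fun [set: T] (fun x => rsubmx (f x)).
Proof.
move=> mf; apply/measurable_fun_coordP => i; under eq_fun do rewrite mxE.
exact: (measurableT_comp (measurable_coord _) mf).
Qed.

Lemma integral_cylinder_fin (a c : R) : (- k < a)%R -> (0 < c)%R ->
  \int[lebesgue_rV d]_x (if (ax x <= c)%R && (enorm (rsubmx x) <= c)%R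
    then (ax x `^ a)%:E else 0) < +oo.
Proof.
move=> ka c0.
have mx (T := 'rV[R]_d) : measurable_fun [set: T] (fun x : T => rsubmx x).
  by apply: measurable_tail; exact: measurable_id.
have mh (T := 'rV[R]_d) : measurable_fun [set: T] (fun x : T => head_rV kd x).
  by apply: measurable_head; exact: measurable_id.
rewrite ge0_integral_rowmx; last 2 first.
- apply: measurable_fun_ifT; [|by meas2|exact: measurable_cst].
  by apply: measurable_and; apply: measurable_fun_ler; meas.
- by move=> x; case: ifP => // _; rewrite lee_fin powR_ge0.
have E (x : 'rV[R]_n.+1) (z : 'rV[R]_m) :
    (if (ax (row_mx x z) <= c)%R && (enorm (rsubmx (row_mx x z)) <= c)%R
     then (ax (row_mx x z) `^ a)%:E else 0) =
    (if (enorm z <= c)%R then 1 else 0) * (if (enorm x <= c)%R then (enorm x `^ a)%:E else 0).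
  rewrite head_row_mx row_mxKr; case: (_ <= c)%R => /=; last by rewrite mule0.
  by case: ifP => _; rewrite ?mul1e ?mul0e.
have mz : measurable_fun [set: 'rV[R]_m] (fun z => if (enorm z <= c)%R then 1 else 0 : \bar R).
  apply: measurable_fun_ifT; [|exact: measurable_cst|exact: measurable_cst].
  by apply: measurable_fun_ler; meas.
have mxx : measurable_fun [set: 'rV[R]_n.+1] (fun x => if (enorm x <= c)%R then (enorm x `^ a)%:E else 0).
  apply: measurable_fun_ifT; [|by meas|exact: measurable_cst].
  by apply: measurable_fun_ler; meas.
under eq_integral => x _ do (under eq_integral => z _ do rewrite E).
pose I := \int[lebesgue_rV m]_z (if (enorm z <= c)%R then 1 else 0 : \bar R).
have I0 : 0 <= I by apply: integral_ge0 => z _; case: ifP.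
have If : I \is a fin_num by rewrite ge0_fin_numE//; exact: integral_ball_fin.
rewrite (_ : \int[_]_x _ = \int[lebesgue_rV n.+1]_x
    (I * (if (enorm x <= c)%R then (enorm x `^ a)%:E else 0))).
  rewrite -(fineK If) ge0_integralZlT//.
  - by rewrite lte_mul_pinfty ?lee_fin ?fine_ge0//; exact: integral_ball_powR_fin.
  - exact: fine_ge0.
  - by move=> x; case: ifP => // _; rewrite lee_fin powR_ge0.
apply: eq_integral => x _; rewrite ge0_integralZrT//.
- by case: ifP => // _; rewrite lee_fin powR_ge0.
- by move=> z; case: ifP.
Qed.

Variables (s p alpha beta : R).
Local Notation tau := (s * p)%R.
Hypotheses (p2 : (2 <= p)%R) (hab : (alpha + beta < tau)%R).

Let mt : measurable_fun [set: 'rV[R]_d] (fun x : 'rV[R]_d => rsubmx x).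
Proof. by apply: measurable_tail; exact: measurable_id. Qed.

Let p0 : (0 < p)%R. Proof. by rewrite (lt_le_trans _ p2). Qed.

Let hardy_term_fin_aux (u : 'rV[R]_d -> R) (a c A : R) : (- k < a)%R -> (0 < c)%R -> (0 <= A)%R ->
  measurable_fun [set: 'rV[R]_d] u ->
  (forall x, u x != 0%R -> [/\ (ax x <= c)%R, (enorm (rsubmx x) <= c)%R &
     (`|u x| `^ p / ax x `^ (tau - alpha - beta) <= A * ax x `^ a)%R]) ->
  hardy_term kd s p alpha beta u < +oo.
Proof.
move=> ka c0 A0 mu h.
pose F x := if (ax x <= c)%R && (enorm (rsubmx x) <= c)%R then (ax x `^ a)%:E else 0.
have F0 x : 0 <= F x by rewrite /F; case: ifP => // _; rewrite lee_fin powR_ge0.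
have mF : measurable_fun [set: 'rV[R]_d] F.
  apply: measurable_fun_ifT; [|by meas2|exact: measurable_cst].
  by apply: measurable_and; apply: measurable_fun_ler; meas2.
apply: (@le_lt_trans _ _ (\int[lebesgue_rV d]_x (A%:E * F x))).
  apply: ge0_le_integral => //.
  - by move=> x _; rewrite lee_fin divr_ge0 ?powR_ge0.
  - by meas2.
  - by apply: emeasurable_funM => //; exact: measurable_cst.
  move=> x _; have [->|/h[h1 h2 h3]] := eqVneq (u x) 0%R.
    by rewrite normr0 powR0 ?gt_eqF// mul0r mule_ge0.
  by rewrite /F h1 h2 -EFinM lee_fin.
rewrite ge0_integralZlT// lte_mul_pinfty ?lee_fin//.
exact: integral_cylinder_fin.
Qed.

(** Below the critical exponent the weight is locally integrable, as [tau - alpha - beta < k]. Above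
    it the support of [u] is a compact set that misses [x_k = 0], and the weight is bounded
    there. *)
Lemma hardy_term_fin u : test_function kd s p alpha beta u ->
  hardy_term kd s p alpha beta u < +oo.
Proof.
have ab0 : (0 < tau - alpha - beta)%R by rewrite -addrA -opprD subr_gt0.
have common (O : set 'rV[R]_d) : C1c O u -> exists M c, [/\ (0 <= M)%R, (0 < c)%R,
    (forall x, `|u x| <= M)%R & forall x, u x != 0%R -> (ax x <= c)%R /\ (enorm (rsubmx x) <= c)%R].
  move=> Cu; have [M [M0 uM]] := C1c_bounded Cu; have [L [L0 uL]] := C1c_support_box Cu.
  pose c := (Num.sqrt n.+1%:R * L + Num.sqrt m%:R * L)%R.
  exists M, c; split => //; first by rewrite ltr_wpDr ?mulr_ge0 ?sqrtr_ge0 ?(ltW L0)// mulr_gt0// sqrtr_gt0.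
  move=> x /uL xL; split.
    apply: (@le_trans _ _ (Num.sqrt n.+1%:R * L)%R); last by rewrite lerDl mulr_ge0 ?sqrtr_ge0 ?(ltW L0).
    by apply: enorm_box; [exact: ltW|move=> i; rewrite mxE].
  apply: (@le_trans _ _ (Num.sqrt m%:R * L)%R); last by rewrite lerDr mulr_ge0 ?sqrtr_ge0 ?(ltW L0).
  by apply: enorm_box; [exact: ltW|move=> i; rewrite mxE].
case=> -[crit Cu]; have [M [c [M0 c0 uM uc]]] := common _ Cu; have mu := C1c_measurable Cu.
  apply: (@hardy_term_fin_aux u (- (tau - alpha - beta))%R c (M `^ p)) => //.
  - by rewrite ltrN2; lra.
  - exact: powR_ge0.
  move=> x /uc[h1 h2]; split => //; rewrite powRN ler_wpM2r ?invr_ge0 ?powR_ge0//.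
  by rewrite ge0_ler_powR ?nnegrE ?(ltW p0).
have [_ _ cK sK] := Cu.
have [e [e0 he]] : exists e : R, (0 < e)%R /\ forall x, u x != 0%R -> (e <= ax x)%R.
  (* The square of [|x_k|] is a polynomial in the coordinates, hence continuous; the image of the
     support under it is a compact set that does not contain 0. *)
  pose S (x : 'rV[R]_d) : R := (\sum_(i <- index_enum 'I_n.+1) x ord0 (widen_ord kd i) ^+ 2)%R.
  have cS : continuous S by exact: continuous_sum_sqr.
  have SE x : S x = (ax x ^+ 2)%R.
    by rewrite sqr_enorm; apply: eq_bigr => i _; rewrite mxE.
  have cSK : compact (S @` closed_support u).
    by apply: continuous_compact => //; exact: continuous_subspaceT.
  have clSK : closed (S @` closed_support u).
    by apply: compact_closed => //; exact: Rhausdorff.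
  have o0 : nbhs (0%R : R) (~` (S @` closed_support u)).
    apply: open_nbhs_nbhs; split; first exact: closed_openC.
    move=> [x Kx Sx]; apply: (sK _ Kx).
    by apply/eqP; rewrite -enorm_eq0 -sqrf_eq0 -SE Sx.
  have [e /= e0 he] := o0.
  exists (Num.sqrt e); split; first by rewrite sqrtr_gt0.
  move=> x ux; rewrite leNgt; apply/negP => xe.
  have : (~` (S @` closed_support u)) (S x).
    apply: he => /=; rewrite sub0r normrN SE ger0_norm ?sqr_ge0//.
    by rewrite -(sqr_sqrtr (ltW e0)) ltrXn2r ?nnegrE ?enorm_ge0 ?sqrtr_ge0.
  apply; exists x => //; exact: subset_closure.
apply: (@hardy_term_fin_aux u 0%R c (M `^ p / e `^ (tau - alpha - beta))) => //.
- by rewrite divr_ge0 ?powR_ge0.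
move=> x ux; have [h1 h2] := uc x ux; split => //; rewrite powRr0 mulr1.
apply: ler_pM; rewrite ?invr_ge0 ?powR_ge0//.
  by rewrite ge0_ler_powR ?nnegrE ?(ltW p0).
have hx := he x ux.
rewrite lef_pV2 ?posrE ?powR_gt0 ?(lt_le_trans e0)//.
by rewrite ge0_ler_powR ?nnegrE ?(ltW e0) ?enorm_ge0// ltW.
Qed.

End hardy_term_finite.

(** * Optimality of the constant *)

Section cutoff.
Context {R : realType}.

(** The cube of the positive part of [1 - y], written without case distinction so that the
    derivative of [|x| ^ p] applies across [y = 1]. *)
Definition eta (y : R) : R := (`|1 - y| `^ 3 + (1 - y) ^+ 3) / 2.
Definition eta' (y : R) : R := - (3 * ((1 - y) * `|1 - y| `^ (3 - 2)) + 3 * (1 - y) ^+ 2) / 2.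

Lemma etaE y : eta y = if y < 1 then (1 - y) ^+ 3 else 0.
Proof.
rewrite /eta powR_mulrn//; case: ltP => y1.
  by rewrite gtr0_norm ?subr_gt0//; field.
by rewrite ler0_norm ?subr_le0//; field.
Qed.

Lemma is_derive_eta (y : R) : is_derive y 1 eta (eta' y).
Proof.
have d0 : is_derive y 1 (fun y : R => 1 - y) (-1).
  by apply: is_derive_eq; first [by []|ring].
have d1 := @is_derive1_comp R (fun z : R => `|z| `^ 3) _ y _ _ (@is_derive_abs_powR R 3 (1 - y) (ltr1n _ 3)) d0.
have d2 := @is_deriveX R R (fun y : R => 1 - y) 3 y 1 _ d0.
have -> : eta = (2^-1 : R) *: ((fun z : R => `|z| `^ 3) \o (fun y : R => 1 - y) + (fun y : R => 1 - y) ^+ 3).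
  by apply/funext => z; rewrite /eta /= mulrC.
apply: (is_derive_eq (is_deriveZ (2^-1 : R) (is_deriveD d1 d2))).
rewrite /GRing.scale /= /eta'; move: (`|1 - y| `^ (3 - 2)) => e.
by field.
Qed.

Lemma continuous_eta' : continuous eta'.
Proof.
move=> y; have c1 : {for y, continuous (fun y : R => 1 - y)}.
  by apply: cvgB; [exact: cvg_cst|exact: cvg_id].
apply: cvgM; last exact: cvg_cst.
apply: cvgN; apply: cvgD.
  apply: cvgM; first exact: cvg_cst.
  apply: cvgM; first exact: c1.
  apply: (@continuous_comp _ _ _ (fun y : R => 1 - y) (fun z : R => `|z| `^ (3 - 2))) => //.
  by apply: continuous_abs_powR; rewrite subr_gt0 ltr_nat.
apply: cvgM; first exact: cvg_cst.
by apply: (@continuous_comp _ _ _ (fun y : R => 1 - y) (fun z : R => z ^+ 2)) => //; exact: exprn_continuous.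
Qed.

Definition cut (t : R) : R := eta (t ^+ 2).

Lemma cutE t : cut t = if `|t| < 1 then (1 - t ^+ 2) ^+ 3 else 0.
Proof.
by rewrite /cut etaE -[in X in X < 1]real_normK ?num_real// expr_lt1.
Qed.

Lemma cut_ge0 t : 0 <= cut t.
Proof.
rewrite cutE; case: ifP => // t1; rewrite exprn_ge0// subr_ge0.
by rewrite -real_normK ?num_real// expr_le1// ltW.
Qed.

Lemma cut_le1 t : cut t <= 1.
Proof.
rewrite cutE; case: ifP => // t1; rewrite exprn_ile1//.
  by rewrite subr_ge0 -real_normK ?num_real// expr_le1// ltW.
by rewrite gerBl sqr_ge0.
Qed.

Lemma cut0 t : 1 <= `|t| -> cut t = 0.
Proof. by rewrite cutE ltNge => ->. Qed.

Lemma cut_half t : `|t| <= 2^-1 -> 4^-1 <= cut t.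
Proof.
move=> t1; rewrite cutE ifT; last by lra.
have t2 : t ^+ 2 <= 4^-1.
  rewrite -real_normK ?num_real// (_ : 4^-1 = 2^-1 ^+ 2); last by field.
  by rewrite lerXn2r ?nnegrE.
have : (3 / 4) ^+ 3 <= (1 - t ^+ 2) ^+ 3 by rewrite lerXn2r ?nnegrE; lra.
apply: le_trans; lra.
Qed.

(** [6 = 3 * 2]: the positive part of [1 - x ^+ 2] is 2-Lipschitz, and the cube is 3-Lipschitz on
    [[0, 1]]. *)
Lemma cut_lipschitz t r : `|cut t - cut r| <= 6 * `|t - r|.
Proof.
pose A (x : R) : R := if `|x| < 1 then 1 - x ^+ 2 else 0.
have cA x : cut x = A x ^+ 3 by rewrite cutE /A; case: ifP => // _; rewrite expr0n.
have A01 x : 0 <= A x <= 1.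
  rewrite /A; case: ifP => [x1|_]; last by rewrite lexx ler01.
  by rewrite subr_ge0 -real_normK ?num_real// expr_le1 ?(ltW x1)//= gerBl sqr_ge0.
have key x y : `|x| <= `|y| -> `|A x - A y| <= 2 * `|x - y|.
  move=> xy; have h : `|y| - `|x| <= `|x - y| by rewrite distrC lerB_dist.
  have x0 := normr_ge0 x.
  have E (z : R) : z ^+ 2 = `|z| ^+ 2 by rewrite real_normK ?num_real.
  have h0 := normr_ge0 (x - y).
  rewrite /A (E x) (E y); move: h0 h x0 xy; move: `|x| `|y| `|x - y| => a b c.
  case: (ltP a 1) => a1; case: (ltP b 1) => b1 c0 h a0 ab.
  - by rewrite ger0_norm; nra.
  - by rewrite subr0 ger0_norm; nra.
  - by exfalso; lra.
  - by rewrite subr0 normr0 mulr_ge0.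
have {key} AL : `|A t - A r| <= 2 * `|t - r|.
  have [tr|/ltW rt] := leP `|t| `|r|; first exact: key.
  by rewrite distrC (distrC t); exact: key.
rewrite !cA (_ : A t ^+ 3 - A r ^+ 3 = (A t - A r) * (A t ^+ 2 + A t * A r + A r ^+ 2)); last by ring.
rewrite normrM.
have : `|A t ^+ 2 + A t * A r + A r ^+ 2| <= 3.
  have := A01 t; have := A01 r; move: (A t) (A r) => a b /andP[? ?] /andP[? ?].
  rewrite ger0_norm; nra.
move=> h; have := ler_pM (normr_ge0 _) (normr_ge0 _) AL h; lra.
Qed.

(** Working with sums of squares instead of norms keeps the inner functions polynomial, so the
    differential is explicit and no norm is differentiated at 0. *)
Lemma C1c_product n (I J : Type) (r1 : seq I) (f1 : I -> 'I_n) (r2 : seq J) (f2 : J -> 'I_n)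
    (F F' G G' : R -> R) (O : set 'rV[R]_n) :
  (forall t : R, is_derive t 1 F (F' t)) -> continuous F' ->
  (forall t : R, is_derive t 1 G (G' t)) -> continuous G' ->
  let u := fun x : 'rV[R]_n => F (\sum_(i <- r1) x ord0 (f1 i) ^+ 2) *
                               G (\sum_(i <- r2) x ord0 (f2 i) ^+ 2) in
  compact (closed_support u) -> closed_support u `<=` O -> C1c O u.
Proof.
move=> dF cF dG cG u cK sK.
pose S1 (x : 'rV[R]_n) : R := \sum_(i <- r1) x ord0 (f1 i) ^+ 2.
pose S2 (x : 'rV[R]_n) : R := \sum_(i <- r2) x ord0 (f2 i) ^+ 2.
pose D1 (x v : 'rV[R]_n) : R := \sum_(i <- r1) 2 * x ord0 (f1 i) * v ord0 (f1 i).
pose D2 (x v : 'rV[R]_n) : R := \sum_(i <- r2) 2 * x ord0 (f2 i) * v ord0 (f2 i).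
have dif (H H' : R -> R) (t : R) : (forall t : R, is_derive t 1 H (H' t)) ->
    is_diff t H (fun h : R => h *: H' t).
  move=> dH; have [d e] := dH t.
  have df : differentiable H t by apply/derivable1_diffP.
  by apply: DiffDef => //; rewrite diff1E// derive1E e.
have du x : is_diff x u (fun v => F (S1 x) *: (D2 x v *: G' (S2 x)) + G (S2 x) *: (D1 x v *: F' (S1 x))).
  have dS1 := is_diff_sum_sqr r1 f1 x; have dS2 := is_diff_sum_sqr r2 f2 x.
  have d1 := @is_diff_comp _ _ _ _ _ _ _ _ _ dS1 (dif F F' (S1 x) dF).
  have d2 := @is_diff_comp _ _ _ _ _ _ _ _ _ dS2 (dif G G' (S2 x) dG).
  exact: (is_diffM d1 d2).
have S1c : continuous S1 := @continuous_sum_sqr R n I r1 f1.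
have S2c : continuous S2 := @continuous_sum_sqr R n J r2 f2.
have cD (I' : Type) (r : seq I') (f : I' -> 'I_n) (v : 'rV[R]_n) :
    continuous (fun x : 'rV[R]_n => \sum_(i <- r) 2 * x ord0 (f i) * v ord0 (f i) : R).
  move=> x; apply: differentiable_continuous; elim: r => [|i r IH].
    rewrite (_ : (fun y : 'rV[R]_n => _) = cst (0 : R)); first exact: differentiable_cst.
    by apply/funext => y; rewrite big_nil.
  rewrite (_ : (fun y : 'rV[R]_n => _) = (2 * v ord0 (f i)) *: (fun y : 'rV[R]_n => y ord0 (f i) : R) +
      (fun y : 'rV[R]_n => \sum_(i <- r) 2 * y ord0 (f i) * v ord0 (f i) : R)); last first.
    by apply/funext => y; rewrite big_cons mulrAC.
  apply: differentiableD; last exact: IH.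
  apply: differentiableZ.
  by have [] := is_diff_coord x (f i).
have cH (H H' : R -> R) : (forall t : R, is_derive t 1 H (H' t)) -> continuous H.
  by move=> dH t; apply/differentiable_continuous/derivable1_diffP; have [] := dH t.
split; [by move=> x; have [] := du x| |exact: cK|exact: sK].
move=> v; rewrite (_ : (fun x => _) = (fun x => F (S1 x) * (D2 x v * G' (S2 x)) + G (S2 x) * (D1 x v * F' (S1 x)))); last first.
  by apply/funext => x; have [_ ->] := du x.
have cM (f g : 'rV[R]_n -> R) : continuous f -> continuous g -> continuous (fun x => f x * g x).
  by move=> cf cg x; exact: (continuousM (cf x) (cg x)).
have cA (f g : 'rV[R]_n -> R) : continuous f -> continuous g -> continuous (fun x => f x + g x).
  by move=> cf cg x; exact: (continuousD (cf x) (cg x)).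
apply: (cA); apply: (cM).
- by move=> x; apply: (@continuous_comp _ _ _ S1 F); [exact: S1c|exact: (cH _ _ dF)].
- apply: (cM); first exact: (cD).
  by move=> x; apply: (@continuous_comp _ _ _ S2 G'); [exact: S2c|exact: cG].
- by move=> x; apply: (@continuous_comp _ _ _ S2 G); [exact: S2c|exact: (cH _ _ dG)].
- apply: (cM); first exact: (cD).
  by move=> x; apply: (@continuous_comp _ _ _ S1 F'); [exact: S1c|exact: cF].
Qed.

End cutoff.

(** * Admissibility of the truncated ground states *)

Section test_functions.
Context {R : realType}.

(** As [E] vanishes below [- L], the composite is 0 for all [t < expR (- L)], so its extension by 0
    is differentiable across the origin. *)
Lemma is_derive_comp_ln (E E' : R -> R) (L : R) :
  (forall l : R, is_derive l 1 E (E' l)) -> (forall l, l <= - L -> E l = 0) ->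
  forall t : R, is_derive t 1 (fun t => if 0 < t then E (ln t) else 0)
                              (if 0 < t then E' (ln t) / t else 0).
Proof.
move=> dE E0 t; case: ltP => t0.
  apply: (@near_eq_is_derive _ _ _ (fun y => E (ln y))).
    by near=> y; rewrite ifT//; near: y; exact: lt_nbhsr.
  exact: (is_derive_eq (is_derive1_comp (dE (ln t)) (is_derive1_ln t0))).
have h : is_derive t 1 (fun _ : R => 0 : R) 0 by exact: is_derive_cst.
apply: (near_eq_is_derive _ h).
near=> y; case: ltP => // y0; rewrite E0//.
rewrite -[- L]expRK ler_ln ?posrE ?expR_gt0// ltW//; near: y.
by apply: lt_nbhsl; rewrite (le_lt_trans t0)// expR_gt0.
Unshelve. all: by end_near. Qed.

Lemma continuous_comp_ln (E' : R -> R) (L : R) :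
  continuous E' -> (forall l, l <= - L -> E' l = 0) ->
  continuous (fun t : R => if 0 < t then E' (ln t) / t else 0).
Proof.
move=> cE E0 t; have [t0|t0] := ltP 0 t.
  have h : {for t, continuous (fun y => E' (ln y) * y^-1)}.
    have h1 : {for t, continuous (fun y : R => E' (ln y))}.
      by apply: (@continuous_comp _ _ _ (fun y : R => ln y) E'); [exact: continuous_ln|exact: cE].
    by apply: (cvgM h1); apply: cvgV; [exact: lt0r_neq0|exact: cvg_id].
  rewrite /continuous_at ifT//; apply: cvg_trans h; apply: near_eq_cvg.
  by near=> y; rewrite ifT//; near: y; exact: lt_nbhsr.
rewrite /continuous_at ifF; last by apply/negbTE; rewrite -leNgt.
have h : {for t, continuous (cst (0 : R))} by exact: cst_continuous.
apply: cvg_trans h.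
apply: near_eq_cvg; near=> y; case: ltP => // y0; rewrite E0 ?mul0r//.
rewrite -[- L]expRK ler_ln ?posrE ?expR_gt0// ltW//; near: y.
by apply: lt_nbhsl; rewrite (le_lt_trans t0)// expR_gt0.
Unshelve. all: by end_near. Qed.

Lemma is_derive_eta_sqr (b x : R) :
  is_derive x 1 (fun x => eta ((x / b) ^+ 2)) (eta' ((x / b) ^+ 2) * (2 * (x / b) / b)).
Proof.
have d1 : is_derive x 1 (fun y : R => y / b) b^-1.
  have := @is_deriveZ R R R id (b^-1) x 1 1 (is_derive_id _ _).
  rewrite (_ : b^-1 \*: id = fun y => y / b); last by apply/funext => y; rewrite /= mulrC.
  by move=> h; apply: (is_derive_eq h); rewrite /GRing.scale /= mulr1.
have d2 := @is_deriveX R R (fun y : R => y / b) 2 x 1 _ d1.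
have d3 := @is_derive1_comp R eta (fun y : R => (y / b) ^+ 2) x _ _ (is_derive_eta ((x / b) ^+ 2)) d2.
apply: (is_derive_eq d3); rewrite /GRing.scale /=.
by congr (_ * _); rewrite expr1 mulr_natl.
Qed.

Lemma continuous_eta_sqr (b : R) :
  continuous (fun x : R => eta' ((x / b) ^+ 2) * (2 * (x / b) / b)).
Proof.
have cb : continuous (fun x : R => x / b) by move=> x; apply: cvgM; [exact: cvg_id|exact: cvg_cst].
move=> x; apply: cvgM.
  apply: (@continuous_comp _ _ _ (fun x : R => (x / b) ^+ 2) eta'); last exact: continuous_eta'.
  by apply: (@continuous_comp _ _ _ (fun x : R => x / b) (fun x : R => x ^+ 2)); [exact: cb|exact: exprn_continuous].
by apply: cvgM; [apply: cvgM; [exact: cvg_cst|exact: cb]|exact: cvg_cst].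
Qed.

Lemma eta0 (y : R) : 1 <= y -> eta y = 0 /\ eta' y = 0.
Proof.
move=> y1; split; first by rewrite etaE ltNge y1.
rewrite /eta' ler0_norm ?subr_le0//.
rewrite (_ : 3 - 2 = 1 :> R); last by ring.
by rewrite powRr1 ?oppr_ge0 ?subr_le0//; field.
Qed.

Variables (n m : nat) (kd : (n.+1 <= n.+1 + m)%N) (s p alpha beta : R).
Local Notation d := (n.+1 + m)%N.
Local Notation k := (n.+1%:R : R).
Local Notation ax := (fun x => enorm (head_rV kd x)).

(* The cutoff varies slowly in the logarithm of [|x_k|] and at the much larger scale
   [exp (2 a)] in the other variables, so that its own energy is [O(1 / a)] relative
   to the Hardy term. *)
Definition cutoff (a : R) (x : 'rV[R]_d) : R :=
  if 0 < ax x then cut (ln (ax x) / a) * cut (enorm (rsubmx x) / expR (2 * a)) else 0.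

Definition near_extremal (a : R) (x : 'rV[R]_d) : R :=
  ax x `^ (- hardy_gamma n s p alpha beta) * cutoff a x.

Let S1 (x : 'rV[R]_d) : R := \sum_(i <- index_enum 'I_n.+1) x ord0 (lshift m i) ^+ 2.
Let S2 (x : 'rV[R]_d) : R := \sum_(i <- index_enum 'I_m) x ord0 (rshift n.+1 i) ^+ 2.

Let S1E x : S1 x = ax x ^+ 2.
Proof. by rewrite sqr_enorm head_rVE; apply: eq_bigr => i _; rewrite mxE. Qed.

Let S2E x : S2 x = enorm (rsubmx x) ^+ 2.
Proof. by rewrite sqr_enorm; apply: eq_bigr => i _; rewrite mxE. Qed.

Lemma cutoff_support a x : 0 < a -> cutoff a x != 0 ->
  expR (- a) <= ax x <= expR a /\ enorm (rsubmx x) <= expR (2 * a).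
Proof.
move=> a0; rewrite /cutoff; case: ltP => [x0|_]; last by rewrite eqxx.
rewrite mulf_eq0 negb_or => /andP[h1 h2].
have {h1} : `|ln (ax x) / a| < 1 by rewrite ltNge; apply: contra h1 => /cut0 ->.
have {h2} : `|enorm (rsubmx x) / expR (2 * a)| < 1 by rewrite ltNge; apply: contra h2 => /cut0 ->.
rewrite ger0_norm ?divr_ge0 ?enorm_ge0 ?expR_ge0// ltr_pdivrMr ?expR_gt0// mul1r => /ltW h2.
rewrite normrM [X in _ * X]gtr0_norm ?invr_gt0// ltr_pdivrMr// mul1r ltr_norml => /andP[h3 h4].
split=> //; rewrite -[ax x]lnK ?posrE// !ler_expR; apply/andP; split; exact: ltW.
Qed.

(** The support is compact and satisfies [|x_k| >= expR (- a)], so one and the same function is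
    admissible on both sides of the critical exponent. *)
Lemma near_extremal_test a : 0 < a -> s * p != k + alpha + beta ->
  test_function kd s p alpha beta (near_extremal a).
Proof.
move=> a0 crit; pose gam := hardy_gamma n s p alpha beta.
(* The profile is expressed in [l = ln (|x_k| ^+ 2)], the logarithm of a sum of squares; hence
   [gam / 2] and [2 * a]. *)
pose E (l : R) := expR (- gam / 2 * l) * eta ((l / (2 * a)) ^+ 2).
pose E' (l : R) := expR (- gam / 2 * l) * (eta' ((l / (2 * a)) ^+ 2) * (2 * (l / (2 * a)) / (2 * a)))
   + eta ((l / (2 * a)) ^+ 2) * (expR (- gam / 2 * l) * (- gam / 2)).
have dexp (l : R) : is_derive l 1 (fun l : R => expR (- gam / 2 * l)) (expR (- gam / 2 * l) * (- gam / 2)).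
  have d1 := @is_deriveZ R R R id (- gam / 2) l 1 1 (is_derive_id _ _).
  apply: (is_derive_eq (is_derive1_comp (is_derive_expR _) d1)).
  by rewrite /GRing.scale /= mulr1.
have dE (l : R) : is_derive l 1 E (E' l).
  exact: (is_deriveM (dexp l) (is_derive_eta_sqr (2 * a) l)).
have big l : l <= - (2 * a) -> 1 <= (l / (2 * a)) ^+ 2.
  move=> la; rewrite -sqrrN expr_ge1 ?mul0r// -mulNr ?ler_pdivlMr ?mulr_gt0// ?mul1r; lra.
have E0 l : l <= - (2 * a) -> E l = 0.
  by move=> /big/eta0[h _]; rewrite /E h mulr0.
have E'0 l : l <= - (2 * a) -> E' l = 0.
  by move=> /big/eta0[h1 h2]; rewrite /E' h1 h2 !mul0r mulr0 addr0.
have cE' : continuous E'.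
  have ce : continuous (fun l : R => expR (- gam / 2 * l)).
    by move=> l; apply/differentiable_continuous/derivable1_diffP; have [] := dexp l.
  have ct : continuous (fun l : R => eta ((l / (2 * a)) ^+ 2)).
    by move=> l; apply/differentiable_continuous/derivable1_diffP; have [] := is_derive_eta_sqr (2 * a) l.
  move=> l; apply: cvgD; apply: cvgM; first exact: ce.
  - exact: continuous_eta_sqr.
  - exact: ct.
  - by apply: cvgM; [exact: ce|exact: cvg_cst].
pose M := expR (2 * a); have M0 : 0 < M by exact: expR_gt0.
pose G (t : R) := eta (t / M ^+ 2); pose G' (t : R) := eta' (t / M ^+ 2) / M ^+ 2.
have dG (t : R) : is_derive t 1 G (G' t).
  have d1 := @is_deriveZ R R R id ((M ^+ 2)^-1) t 1 1 (is_derive_id _ _).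
  have := is_derive1_comp (is_derive_eta _) d1.
  rewrite (_ : _ \o _ = G); last by apply/funext => y; rewrite /G /= /GRing.scale /= mulrC.
  have e : (M ^- 2 \*: id) t = t / M ^+ 2 := mulrC _ _.
  by move=> h; apply: (is_derive_eq h); rewrite e /GRing.scale /= mulr1.
have cG' : continuous G'.
  move=> t; have h : {for t, continuous (fun t : R => eta' (t / M ^+ 2))}.
    apply: (@continuous_comp _ _ _ (fun t : R => t / M ^+ 2) eta'); last exact: continuous_eta'.
    by apply: cvgM; [exact: cvg_id|exact: cvg_cst].
  by apply: (cvgM h); exact: cvg_cst.
pose F (t : R) := if 0 < t then E (ln t) else 0.
have uE : near_extremal a = fun x => F (S1 x) * G (S2 x).
  apply/funext => x; rewrite /near_extremal /cutoff /F S1E S2E.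
  have [x0|x0] := ltP 0 (ax x); last first.
    rewrite ifF ?mul0r ?mulr0//; apply/negbTE; rewrite -leNgt.
    have -> : ax x = 0 by apply/eqP; rewrite eq_le x0 enorm_ge0.
    by rewrite expr0n.
  rewrite exprn_gt0// /E lnXn// mulrA; congr (_ * _ * _).
  - by rewrite /powR gt_eqF//; congr expR; rewrite -/gam mulr2n; field.
  - by rewrite /cut; congr (eta (_ ^+ 2)); rewrite mulr2n; field; exact: lt0r_neq0.
  - by rewrite /cut /G expr_div_n.
have sub : [set x | near_extremal a x != 0] `<=`
    [set x | [/\ expR (- a) ^+ 2 <= S1 x, S1 x <= expR a ^+ 2 & S2 x <= M ^+ 2]].
  move=> x /=; rewrite /near_extremal mulf_eq0 negb_or => /andP[_ /(cutoff_support a0)[/andP[h1 h2] h3]].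
  rewrite S1E S2E; split; rewrite lerXn2r ?nnegrE ?expR_ge0 ?enorm_ge0//.
have cS1 : continuous S1 by exact: continuous_sum_sqr.
have cS2 : continuous S2 by exact: continuous_sum_sqr.
have clo (f : 'rV[R]_d -> R) (A : set R) : continuous f -> closed A -> closed (f @^-1` A).
  by move=> cf clA; apply: preimage_closed => // x _; exact: cf.
have clB : closed [set x | [/\ expR (- a) ^+ 2 <= S1 x, S1 x <= expR a ^+ 2 & S2 x <= M ^+ 2]].
  rewrite (_ : [set x | _] = S1 @^-1` [set y | expR (- a) ^+ 2 <= y] `&`
     (S1 @^-1` [set y | y <= expR a ^+ 2] `&` S2 @^-1` [set y | y <= M ^+ 2])); last first.
    by apply/seteqP; split => x; [move=> []|move=> [? []]].
  apply: closedI; first by apply: clo => //; exact: closed_ge.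
  by apply: closedI; apply: clo => //; exact: closed_le.
have csub : closed_support (near_extremal a) `<=`
    [set x | [/\ expR (- a) ^+ 2 <= S1 x, S1 x <= expR a ^+ 2 & S2 x <= M ^+ 2]].
  by apply: (subset_trans (closureS sub)); rewrite -(proj1 (closure_id _) clB).
have cptS : compact (closed_support (near_extremal a)).
  apply: bounded_closed_compact; last exact: closed_closure.
  exists (expR a + M); split; first exact: num_real.
  move=> B hB x /csub[_]; rewrite S1E S2E => h1 h2; apply: le_trans (ltW hB).
  have {}h1 : ax x <= expR a by rewrite -(@ler_pXn2r _ 2)// nnegrE ?enorm_ge0 ?expR_ge0.
  have {}h2 : enorm (rsubmx x) <= M by rewrite -(@ler_pXn2r _ 2)// nnegrE ?enorm_ge0 ?expR_ge0.
  rewrite /= [leLHS]/Num.norm /= mx_normrE; apply/bigmax_leP; split => [|[i j] _].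
    by rewrite addr_ge0 ?expR_ge0.
  rewrite (ord1 i) /=; case: (split_ordP j) => j' ->.
    apply: (@le_trans _ _ (ax x)); last by rewrite (le_trans h1)// lerDl ltW.
    by have := coord_le_enorm (head_rV kd x) j'; rewrite head_rVE mxE.
  apply: (@le_trans _ _ (enorm (rsubmx x))); last by rewrite (le_trans h2)// lerDr expR_ge0.
  by have := coord_le_enorm (rsubmx x) j'; rewrite mxE.
have C1 O : closed_support (near_extremal a) `<=` O -> C1c O (near_extremal a).
  move: cptS; rewrite uE => cS sO.
  apply: (C1c_product (is_derive_comp_ln dE E0) _ dG cG' cS sO).
  exact: (continuous_comp_ln cE' E'0).
have [lt|gt|/eqP] := ltgtP (s * p) (k + alpha + beta); last by rewrite (negbTE crit).
  by left; split => //; exact: C1.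
right; split => //; apply: C1 => x /csub[h _ _] x0.
move: h; rewrite S1E; have -> : ax x = 0 by rewrite x0 enorm0.
by rewrite expr0n leNgt exprn_gt0// expR_gt0.
Qed.

End test_functions.

(** * The energy of the cutoff *)

Section cutoff_error.
Context {R : realType}.
Local Open Scope ereal_scope.

Variables (n m : nat) (kd : (n.+1 <= n.+1 + m)%N).
Local Notation d := (n.+1 + m)%N.
Local Notation k := (n.+1%:R : R).
Local Notation mu := (@lebesgue_rV R d).
Local Notation ax := (fun x => enorm (head_rV kd x)).

Definition core (a : R) (x : 'rV[R]_d) : bool :=
  (expR (- a) <= ax x <= expR a)%R && (enorm (rsubmx x) <= expR (2 * a))%R.

(** The [p]-th power of the ground state divided by the Hardy weight is [|x_k| ^ (- k)], so this is
    the Hardy term of the ground state with the cutoff replaced by the indicator of the core. *)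
Definition core_vol (a : R) : \bar R :=
  \int[mu]_x (if core a x then (ax x `^ (- k))%:E else 0).

Definition shell (r : R) : bool := (2^-1 < r < 2)%R.

Variables (tau p q1 q2 : R).

(* Dominates the increment [|phi x - phi y|^p] of the cutoff [phi] with parameter [a];
   [r] stands for [|y_k| / |x_k|] and [e] for [|x - y|]. *)
Definition increment_bound (a r e : R) : R :=
  (`|ln r| `^ p / a + (e / expR (2 * a)) `^ (if shell r then q1 else q2))%R.

Definition cutoff_error (b a : R) (x y : 'rV[R]_d) : R :=
  (if core a x then ax x `^ (tau - k) * ((ax y / ax x) `^ b *
     increment_bound a (ax y / ax x) (enorm (x - y)) *
     enorm (x - y) `^ (- (d%:R + tau))) else 0)%R.

Lemma measurable_core e (T : measurableType e) (a : R) (f : T -> 'rV[R]_d) :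
  measurable_fun [set: T] f -> measurable_fun [set: T] (fun x => core a (f x)).
Proof.
move=> mf; have mh := measurable_head kd mf; have mt := measurable_tail mf.
apply: measurable_and; first apply: measurable_and; apply: measurable_fun_ler; meas2.
Qed.

Lemma measurable_shell e (T : measurableType e) (f : T -> R) :
  measurable_fun [set: T] f -> measurable_fun [set: T] (fun x => shell (f x)).
Proof. by move=> mf; apply: measurable_and; apply: measurable_fun_ltr; meas2. Qed.

Lemma measurable_cutoff_error b a :
  measurable_fun [set: 'rV[R]_d * 'rV[R]_d] (fun q => cutoff_error b a q.1 q.2).
Proof.
apply: measurable_fun_ifT; [by apply: measurable_core; meas2| |exact: measurable_cst].
have mr : measurable_fun [set: 'rV[R]_d * 'rV[R]_d] (fun q => (ax q.2 / ax q.1)%R) by meas2.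
have me : measurable_fun [set: 'rV[R]_d * 'rV[R]_d] (fun q => enorm (q.1 - q.2)%R) by meas2.
apply: measurable_funM; first by meas2.
apply: measurable_funM; last by meas2.
apply: measurable_funM; first by meas2.
have mln := @measurable_ln R.
rewrite /increment_bound; apply: measurable_funD; first by meas2.
rewrite [X in measurable_fun _ X](_ : _ = fun q => if shell (ax q.2 / ax q.1)
   then ((enorm (q.1 - q.2) / expR (2 * a)) `^ q1)%R else ((enorm (q.1 - q.2) / expR (2 * a)) `^ q2)%R); last first.
  by apply/funext => q; case: ifP.
by apply: measurable_fun_ifT; [exact: measurable_shell|meas2|meas2].
Qed.

Lemma cutoff_error_ge0 b a x y : (0 < a)%R -> (0 <= cutoff_error b a x y)%R.
Proof.
move=> a0; rewrite /cutoff_error; case: ifP => // _; rewrite !mulr_ge0 ?powR_ge0//.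
by rewrite addr_ge0 ?powR_ge0// divr_ge0 ?powR_ge0// ltW.
Qed.

Hypotheses (tau0 : (0 < tau)%R) (taup : (tau < p)%R).

(** The factor [|x - y| ^ q] is absorbed into the kernel and lowers its order from [tau] to
    [tau - q], which may be negative but stays above [- k]. *)
Lemma integral_kernel_power q (M : R) (G : R -> R) x : (0 <= q)%R -> (q < tau + k)%R -> (0 < M)%R ->
  (0 < ax x)%R -> measurable_fun [set: R] G -> (forall r, 0 <= G r)%R ->
  \int[mu]_y (ax x `^ (tau - k) * (G (ax y / ax x) * (enorm (x - y) / M) `^ q *
     enorm (x - y) `^ (- (d%:R + tau))))%:E =
  (fiber_cst n m (tau - q) * ((ax x / M) `^ q * ax x `^ (- k)))%:E * mass n (tau - q) (fun r => (G r)%:E).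
Proof.
move=> q0 qk M0 x0 mG G0.
have Mi : (0 <= M^-1)%R by rewrite invr_ge0 ltW.
have dq : (- (d%:R + (tau - q)) != 0 :> R)%R.
  by rewrite oppr_eq0 gt_eqF// natrD; have := ler0n R m; lra.
transitivity (\int[mu]_y ((ax x `^ (tau - k) * M^-1 `^ q)%:E *
    ((G (ax y / ax x))%:E * (enorm (x - y) `^ (- (d%:R + (tau - q))))%:E))).
  apply: eq_integral => y _; rewrite -!EFinM; congr EFin.
  have -> : ((enorm (x - y) / M) `^ q = enorm (x - y) `^ q * M^-1 `^ q)%R by rewrite powRM ?enorm_ge0.
  have -> : (enorm (x - y) `^ (- (d%:R + (tau - q))) = enorm (x - y) `^ q * enorm (x - y) `^ (- (d%:R + tau)))%R.
    have e : (- (d%:R + (tau - q)) = q + - (d%:R + tau))%R by ring.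
    by rewrite e powRD// -e (negbTE dq).
  have E (a b c e f : R) : (a * (b * (c * e) * f) = a * e * (b * (c * f)))%R by ring.
  exact: E.
have mGx : measurable_fun [set: R] (fun r => (G (r / ax x)%R)%:E).
  by apply/measurable_EFinP; apply: (measurableT_comp mG); meas.
have mI : measurable_fun [set: 'rV[R]_d] (fun y => (G (ax y / ax x))%:E * (enorm (x - y) `^ (- (d%:R + (tau - q))))%:E).
  apply: emeasurable_funM; last by meas2.
  by apply: (@measurableT_comp _ _ _ _ _ _ _ _ ax mGx); meas2.
rewrite ge0_integralZlT; [|by rewrite mulr_ge0 ?powR_ge0|by move=> y; rewrite mule_ge0// lee_fin ?G0 ?powR_ge0|exact: mI].
rewrite (@integral_radial_kernel _ n m kd (tau - q)%R (fun r => (G (r / ax x)%R)%:E) x); last first.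
- by move=> r; rewrite lee_fin.
- exact: mGx.
- exact: x0.
- by rewrite ltrBrDr; lra.
rewrite muleA -EFinM; congr (_%:E * mass _ _ _); last first.
  by apply/funext => r; rewrite mulrAC divff ?mul1r// gt_eqF.
have -> : ((ax x / M) `^ q = ax x `^ q * M^-1 `^ q)%R by rewrite powRM ?enorm_ge0.
have E (a b c e f g : R) : (a * c = e * g -> a * b * (f * c) = f * (e * b * g))%R by move=> h; ring: h.
by apply: E; rewrite -!powRD_gt0//; congr (_ `^ _)%R; ring.
Qed.

Hypotheses (q1t : (tau < q1 < tau + k)%R) (q2t : (0 < q2 < tau)%R).

(** The logarithmic part carries the factor [1 / a] by definition. For the other part, [q1 > tau]
    removes the singularity inside the shell and [q2 < tau] keeps the singularity outside it
    excluded with convergence at infinity; since [|x_k| <= expR a] on the core, the scale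
    [expR (2 * a)] leaves [expR (- q a)], at most [1 / (q a)]. *)
Lemma integral_cutoff_error_le b : (- k < b)%R -> (b < tau - q2)%R ->
  exists K : R, (0 <= K)%R /\ forall a : R, (1 <= a)%R ->
    \int[mu]_x \int[mu]_y (cutoff_error b a x y)%:E <= (K / a)%:E * core_vol a.
Proof.
move=> bk bq; have /andP[q1a q1b] := q1t; have /andP[q2a q2b] := q2t.
have k0 : (0 < k)%R by rewrite ltr0n.
have q10 : (0 < q1)%R by apply: lt_trans q1a.
have t1 : (- k < tau - 0)%R by rewrite subr0 (lt_trans _ tau0)// oppr_lt0.
have t2 : (- k < tau - q1)%R by rewrite ltrBrDl ltrBlDr.
have t3 : (- k < tau - q2)%R by apply: (@lt_trans _ _ 0%R); rewrite ?oppr_lt0 ?subr_gt0.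
have t4 : (tau - q1 < 0)%R by rewrite subr_lt0.
have t5 : (0 < tau - q2)%R by rewrite subr_gt0.
have t6 : (b < tau)%R by apply: lt_trans bq _; rewrite ltrBlDr ltrDl.
pose G1 (r : R) := (`|ln r| `^ p * r `^ b)%R.
pose G2 (r : R) := (if shell r then r `^ b else 0)%R.
pose G3 (r : R) := (if shell r then 0 else r `^ b)%R.
have mG1 : measurable_fun [set: R] G1 by have mln := @measurable_ln R; rewrite /G1; meas.
have mG2 : measurable_fun [set: R] G2.
  by apply: measurable_fun_ifT; [apply: measurable_shell; exact: measurable_id|meas|exact: measurable_cst].
have mG3 : measurable_fun [set: R] G3.
  by apply: measurable_fun_ifT; [apply: measurable_shell; exact: measurable_id|exact: measurable_cst|meas].
have G10 r : (0 <= G1 r)%R by rewrite mulr_ge0 ?powR_ge0.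
have G20 r : (0 <= G2 r)%R by rewrite /G2; case: ifP => // _; rewrite powR_ge0.
have G30 r : (0 <= G3 r)%R by rewrite /G3; case: ifP => // _; rewrite powR_ge0.
pose m1 := fine (mass n (tau - 0) (fun r => (G1 r)%:E)).
pose m2 := fine (mass n (tau - q1) (fun r => (G2 r)%:E)).
pose m3 := fine (mass n (tau - q2) (fun r => (G3 r)%:E)).
have finE (z : \bar R) : 0 <= z -> z < +oo -> (fine z)%:E = z by move=> z0 zoo; rewrite fineK// ge0_fin_numE.
have m1E : mass n (tau - 0) (fun r => (G1 r)%:E) = m1%:E.
  rewrite finE//; first by apply: mass_ge0 => r; rewrite lee_fin.
  by rewrite subr0; apply: mass_ln_fin; [rewrite ltW|rewrite bk].
have m2E : mass n (tau - q1) (fun r => (G2 r)%:E) = m2%:E.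
  rewrite finE//; first by apply: mass_ge0 => r; rewrite lee_fin.
  rewrite (_ : (fun r => (G2 r)%:E) = fun r => if (2^-1 < r < 2)%R then (r `^ b)%:E else 0); last first.
    by apply/funext => r; rewrite /G2 /shell; case: ifP.
  exact: mass_shell_fin.
have m3E : mass n (tau - q2) (fun r => (G3 r)%:E) = m3%:E.
  rewrite finE//; first by apply: mass_ge0 => r; rewrite lee_fin.
  rewrite (_ : (fun r => (G3 r)%:E) = fun r => if (2^-1 < r < 2)%R then 0 else (r `^ b)%:E); last first.
    by apply/funext => r; rewrite /G3 /shell; case: ifP.
  by apply: mass_off_shell_fin => //; rewrite bk.
have m10 : (0 <= m1)%R by rewrite -lee_fin -m1E; apply: mass_ge0 => r; rewrite lee_fin.
have m20 : (0 <= m2)%R by rewrite -lee_fin -m2E; apply: mass_ge0 => r; rewrite lee_fin.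
have m30 : (0 <= m3)%R by rewrite -lee_fin -m3E; apply: mass_ge0 => r; rewrite lee_fin.
pose f1 := fiber_cst n m (tau - 0); pose f2 := fiber_cst n m (tau - q1); pose f3 := fiber_cst n m (tau - q2).
have f10 : (0 <= f1)%R := ltW (fiber_cst_gt0 m t1).
have f20 : (0 <= f2)%R := ltW (fiber_cst_gt0 m t2).
have f30 : (0 <= f3)%R := ltW (fiber_cst_gt0 m t3).
have i1 : (0 <= q1^-1)%R by rewrite invr_ge0 ltW.
have i2 : (0 <= q2^-1)%R by rewrite invr_ge0 ltW.
have K0 : (0 <= f1 * m1 + f2 * m2 / q1 + f3 * m3 / q2)%R :=
  addr_ge0 (addr_ge0 (mulr_ge0 f10 m10) (mulr_ge0 (mulr_ge0 f20 m20) i1)) (mulr_ge0 (mulr_ge0 f30 m30) i2).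
exists (f1 * m1 + f2 * m2 / q1 + f3 * m3 / q2)%R; split; first exact: K0.
move=> a a1; have a0 : (0 < a)%R by rewrite (lt_le_trans _ a1).
set M := expR (2 * a); have M0 : (0 < M)%R by exact: expR_gt0.
pose T q (G : R -> R) (x y : 'rV[R]_d) := (ax x `^ (tau - k) * (G (ax y / ax x) * (enorm (x - y) / M) `^ q *
     enorm (x - y) `^ (- (d%:R + tau))))%R.
have mT q (G : R -> R) x : measurable_fun [set: R] G -> measurable_fun [set: 'rV[R]_d] (fun y => (T q G x y)%:E).
  move=> mG; apply/measurable_EFinP.
  have mGx : measurable_fun [set: 'rV[R]_d] (fun y => G (ax y / ax x)%R) by apply: (measurableT_comp mG); meas2.
  apply: measurable_funM; first by meas.
  by apply: measurable_funM; [apply: measurable_funM => //; meas2|meas2].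
have T0 q (G : R -> R) x y : (forall r, 0 <= G r)%R -> 0 <= (T q G x y)%:E.
  by move=> G0; rewrite lee_fin !mulr_ge0 ?powR_ge0.
have decay q : (0 < q)%R -> ((expR a / M) `^ q <= (q * a)^-1)%R.
  move=> q0; have -> : (expR a / M = expR (- a))%R by rewrite -expRN -expRD; congr expR; ring.
  rewrite /powR gt_eqF ?expR_gt0// expRK mulrN expRN lef_pV2 ?posrE ?expR_gt0 ?mulr_gt0//.
  by apply: le_trans (expR_ge1Dx _); rewrite lerDr.
rewrite /core_vol -ge0_integralZlT; last 3 first.
- by rewrite divr_ge0 ?(ltW a0).
- by move=> x; case: ifP => // _; rewrite lee_fin powR_ge0.
- by apply: measurable_fun_ifT; [apply: measurable_core; exact: measurable_id|meas2|exact: measurable_cst].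
apply: ge0_le_integral => //.
- by move=> x _; apply: integral_ge0 => y _; rewrite lee_fin cutoff_error_ge0.
- apply: (@measurable_fun_iint _ _ _ _ R mu (fun q => (cutoff_error b a q.1 q.2)%:E)).
    by apply/measurable_EFinP; exact: measurable_cutoff_error.
  by move=> q; rewrite lee_fin cutoff_error_ge0.
- apply: emeasurable_funM; first exact: measurable_cst.
  by apply: measurable_fun_ifT; [apply: measurable_core; exact: measurable_id|meas2|exact: measurable_cst].
move=> x _; case: ifP => cx; last first.
  rewrite mule0 (eq_integral (fun=> 0)) ?integral0// => y _.
  by rewrite /cutoff_error cx.
have /andP[/andP[x1 x2] _] := cx; have x0 : (0 < ax x)%R by apply: lt_le_trans x1; exact: expR_gt0.
have -> : \int[mu]_y (cutoff_error b a x y)%:E =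
    \int[mu]_y (a^-1%:E * (T 0%R G1 x y)%:E + ((T q1 G2 x y)%:E + (T q2 G3 x y)%:E)).
  apply: eq_integral => y _; rewrite -EFinM -!EFinD /cutoff_error cx /T /increment_bound -/M; congr EFin.
  rewrite /G1 /G2 /G3 powRr0; move: (ax y / ax x)%R => r.
  have E1 (A B L i z N : R) : (A * (B * (L * i + z) * N) = i * (A * (L * B * 1 * N)) + (A * (B * z * N) + A * (0 * 0 * N)))%R by ring.
  have E2 (A B L i z N w : R) : (A * (B * (L * i + z) * N) = i * (A * (L * B * 1 * N)) + (A * (0 * w * N) + A * (B * z * N)))%R by ring.
  case: ifP => _; last exact: E2.
  by rewrite E1 !mul0r.
rewrite ge0_integralDT; last 4 first.
- by move=> y; rewrite mule_ge0 ?T0// lee_fin invr_ge0 ltW.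
- by apply: emeasurable_funM; [exact: measurable_cst|exact: mT].
- by move=> y; rewrite adde_ge0 ?T0.
- by apply: emeasurable_funD; exact: mT.
rewrite ge0_integralDT; [|by move=> y; exact: T0|exact: mT|by move=> y; exact: T0|exact: mT].
rewrite ge0_integralZlT; [|by rewrite invr_ge0 ltW|by move=> y; exact: T0|exact: mT].
rewrite /T (integral_kernel_power (lexx 0%R) _ M0 x0 mG1 G10) ?addr_gt0//.
rewrite (integral_kernel_power (ltW q10) q1b M0 x0 mG2 G20).
rewrite (integral_kernel_power (ltW q2a) _ M0 x0 mG3 G30); last by rewrite (lt_trans q2b)// ltrDl.
rewrite m1E m2E m3E -/f1 -/f2 -/f3 -!EFinM -!EFinD lee_fin powRr0.
have h1 : ((ax x / M) `^ q1 <= (q1 * a)^-1)%R.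
  apply: le_trans (decay _ _) => //.
  by rewrite ge0_ler_powR ?nnegrE ?divr_ge0 ?enorm_ge0 ?expR_ge0 ?(ltW M0)// ?ler_wpM2r ?invr_ge0 ?(ltW M0) ?(ltW q10).
have h2 : ((ax x / M) `^ q2 <= (q2 * a)^-1)%R.
  apply: le_trans (decay _ _) => //.
  by rewrite ge0_ler_powR ?nnegrE ?divr_ge0 ?enorm_ge0 ?expR_ge0 ?(ltW M0)// ?ler_wpM2r ?invr_ge0 ?(ltW M0) ?(ltW q2a).
have V0 := powR_ge0 (ax x) (- k).
have fin (V z1 z2 u1 u2 i j1 j2 : R) : (0 <= V -> z1 <= j1 * i -> z2 <= j2 * i ->
   i * (f1 * (1 * V) * m1) + (f2 * (z1 * V) * m2 + f3 * (z2 * V) * m3) <=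
   (f1 * m1 + f2 * m2 * j1 + f3 * m3 * j2) * i * V)%R.
  move=> V0' z1j z2j.
  have a1' := ler_wpM2l (mulr_ge0 (mulr_ge0 f20 m20) V0') z1j.
  have a2' := ler_wpM2l (mulr_ge0 (mulr_ge0 f30 m30) V0') z2j.
  by nra.
by apply: fin => //; rewrite -invfM.
Qed.

End cutoff_error.

(** * The volume of the core against the Hardy term *)

Section core_volume.
Context {R : realType}.
Local Open Scope ereal_scope.

Definition ball_vol (m : nat) (c : R) : \bar R :=
  \int[lebesgue_rV m]_z (if (enorm z <= c)%R then 1 else 0).

Definition ring_vol (n : nat) (l r : R) : \bar R :=
  \int[lebesgue_rV n]_y (if (l <= enorm y <= r)%R then (enorm y `^ (- n%:R))%:E else 0).

Let measurable_ball m c : measurable_fun [set: 'rV[R]_m] (fun z => if (enorm z <= c)%R then 1 else 0 : \bar R).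
Proof.
apply: measurable_fun_ifT; [|exact: measurable_cst|exact: measurable_cst].
by apply: measurable_fun_ler; meas.
Qed.

Let measurable_ring n l r : measurable_fun [set: 'rV[R]_n]
  (fun y => if (l <= enorm y <= r)%R then (enorm y `^ (- n%:R))%:E else 0).
Proof.
apply: measurable_fun_ifT; [|by meas|exact: measurable_cst].
by apply: measurable_and; apply: measurable_fun_ler; meas.
Qed.

Let ring0 n l r (y : 'rV[R]_n) : 0 <= (if (l <= enorm y <= r)%R then (enorm y `^ (- n%:R))%:E else 0).
Proof. by case: ifP => // _; rewrite lee_fin powR_ge0. Qed.

Lemma ball_vol_double m (c : R) : ball_vol m (2 * c) = (2 ^+ m)%:E * ball_vol m c.
Proof.
have n2 : (2 != 0 :> R)%R by [].
have h := @ge0_integral_rV_affine R m 2 0 _ n2 (@measurable_ball m (2 * c)%R) _.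
rewrite /ball_vol [X in _ * X](eq_integral (fun z : 'rV[R]_m => if (enorm (2 *: z + 0)%R <= 2 * c)%R then 1 else 0)); last first.
  by move=> z _; rewrite addr0 enormZ gtr0_norm// ler_pM2l.
rewrite h; last by move=> z; case: ifP.
by rewrite muleA -EFinM gtr0_norm// -exprMn divff// expr1n mul1e.
Qed.

Lemma ball_vol_gt0 m (c : R) : (0 < c)%R -> 0 < ball_vol m c.
Proof.
move=> c0; pose b : R := (c / (Num.sqrt m%:R + 1))%R.
have s0 : (0 < Num.sqrt m%:R + 1 :> R)%R by rewrite ltr_wpDl ?sqrtr_ge0.
have b0 : (0 < b)%R by rewrite divr_gt0.
have mI : measurable (`[(- b)%R, b]%classic : set R) by exact: measurable_itv.
have h := @lebesgue_rV_box R m (fun=> `[(- b)%R, b]%classic) (fun=> mI).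
have mB := @measurable_rV_box R m _ (fun=> mI).
apply: (@lt_le_trans _ _ (lebesgue_rV m [set x : 'rV[R]_m | forall i : 'I_m, `[(- b)%R, b]%classic (x ord0 i)])).
  rewrite h lebesgue_measure_itv/= lte_fin gtrN// -EFinB prodEFin lte_fin prodr_gt0// => i _.
  by rewrite subr_gt0 gtrN.
rewrite -[leLHS]mul1e -[X in X%:E * _]/(1%R) -integral_cst//.
rewrite integral_mkcond; apply: ge0_le_integral => //.
- by move=> x _; rewrite patchE; case: ifP.
- by apply/(measurable_restrictT _ _).1 => //; exact: measurable_cst.
- exact: measurable_ball.
move=> x _; rewrite patchE; case: ifP => [|_]; last by case: ifP.
rewrite inE /= => hx; rewrite ifT//.
apply: le_trans (enorm_box (ltW b0) _) _.
  by move=> i; have := hx i; rewrite /= in_itv/= ler_norml.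
by rewrite /b mulrA ler_pdivrMr// mulrC ler_wpM2l ?ltW// ltrDl.
Qed.

(** The density is homogeneous of degree minus the dimension, so only the ratio of the radii
    matters. *)
Lemma ring_vol_scale n (c l r : R) : (0 < c)%R -> ring_vol n (c * l) (c * r) = ring_vol n l r.
Proof.
move=> c0; have cn0 : (c != 0)%R by rewrite gt_eqF.
have h := @ge0_integral_rV_affine R n c 0 _ cn0 (@measurable_ring n (c * l)%R (c * r)%R) (@ring0 n _ _).
have cn : (0 <= c ^+ n)%R by rewrite exprn_ge0 ?ltW.
rewrite /ring_vol [RHS](eq_integral (fun y : 'rV[R]_n => (c ^+ n)%:E * (if (c * l <= enorm (c *: y + 0)%R <= c * r)%R
    then (enorm (c *: y + 0)%R `^ (- n%:R))%:E else 0))); last first.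
  move=> y _; rewrite addr0 enormZ gtr0_norm// !ler_pM2l//; case: ifP => _; last by rewrite mule0.
  rewrite -EFinM; congr EFin; rewrite powRM ?enorm_ge0 ?(ltW c0)// !powRN !powR_mulrn ?enorm_ge0 ?(ltW c0)//.
  by rewrite mulrA divff ?mul1r// expf_neq0.
rewrite ge0_integralZlT; [|exact: cn|by move=> y; exact: ring0|]; last first.
  apply: (measurableT_comp (@measurable_ring n (c * l)%R (c * r)%R)).
  by apply: measurable_rV_lin; meas.
by rewrite h (gtr0_norm c0) muleA -EFinM -exprMn divff// expr1n mul1e.
Qed.

Lemma ring_vol_gt0 n (l r : R) : (0 <= l < r)%R -> 0 < ring_vol n.+1 l r.
Proof.
move=> lr; pose f (t : R) : \bar R := if (l <= t <= r)%R then (t `^ (- n.+1%:R))%:E else 0.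
have mf : measurable_fun [set: R] f.
  apply: measurable_fun_ifT; [|by meas|exact: measurable_cst].
  by apply: measurable_and; apply: measurable_fun_ler; meas.
have f0 t : 0 <= f t by rewrite /f; case: ifP => // _; rewrite lee_fin powR_ge0.
rewrite /ring_vol (@ge0_integral_radial R n.+1 f)// integral_pos_if mule_gt0 ?lte_fin ?surface_unit_sphere_gt0//.
apply: (@ipos_gt0 R (fun t => f t * (t ^+ n.+1.-1)%:E) l r lr).
- by apply: emeasurable_funM => //; meas.
- move=> t; rewrite /f; case: ifP => [/andP[lt _]|_]; last by rewrite mul0e.
  by rewrite -EFinM lee_fin mulr_ge0 ?powR_ge0// exprn_ge0// (le_trans _ lt)//; case/andP: lr.
- move=> t /andP[lt tr]; rewrite /f (ltW lt) (ltW tr)/= -EFinM lte_fin mulr_gt0 ?powR_gt0 ?exprn_gt0//.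
  by apply: le_lt_trans lt; case/andP: lr.
  by apply: le_lt_trans lt; case/andP: lr.
Qed.

Lemma ring_vol_split n (l c r : R) : (l <= c <= r)%R -> ring_vol n l r <= ring_vol n l c + ring_vol n c r.
Proof.
move=> /andP[lc cr]; rewrite /ring_vol -ge0_integralDT; [|exact: ring0|exact: measurable_ring|exact: ring0|exact: measurable_ring].
apply: ge0_le_integral => //; first exact: measurable_ring.
  by apply: emeasurable_funD; exact: measurable_ring.
move=> y _; case: ifP => [/andP[ly yr]|_]; last by rewrite adde_ge0.
rewrite ly yr andbT; case: (leP (enorm y) c) => [_|/ltW ->] /=; last by rewrite add0e.
by apply: leeDl; case: ifP => // _; rewrite lee_fin powR_ge0.
Qed.

Variables (m n : nat) (kd : (n.+1 <= n.+1 + m)%N).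
Local Notation d := (n.+1 + m)%N.
Local Notation k := (n.+1%:R : R).
Local Notation mu := (@lebesgue_rV R d).
Local Notation ax := (fun x => enorm (head_rV kd x)).

Lemma integral_ring_ball (l r c : R) :
  \int[mu]_x (if (l <= ax x <= r)%R && (enorm (rsubmx x) <= c)%R then (ax x `^ (- k))%:E else 0) =
  ball_vol m c * ring_vol n.+1 l r.
Proof.
rewrite ge0_integral_rowmx; last 2 first.
- apply: measurable_fun_ifT; [|by meas2|exact: measurable_cst].
  have mx : measurable_fun [set: 'rV[R]_d] (fun x => rsubmx x).
    by apply: measurable_tail; exact: measurable_id.
  by apply: measurable_and; first apply: measurable_and; apply: measurable_fun_ler; meas2.
- by move=> x; case: ifP => // _; rewrite lee_fin powR_ge0.
have I0 : 0 <= ball_vol m c by apply: integral_ge0 => z _; case: ifP.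
have If : ball_vol m c \is a fin_num by rewrite ge0_fin_numE//; exact: integral_ball_fin.
rewrite -(fineK If) /ring_vol -ge0_integralZlT; [|exact: fine_ge0|exact: ring0|exact: measurable_ring].
apply: eq_integral => y _; rewrite (fineK If) -ge0_integralZrT; [|exact: ring0|by move=> z; case: ifP|exact: measurable_ball].
apply: eq_integral => z _; rewrite head_row_mx row_mxKr.
by case: (_ <= c)%R; rewrite ?andbT ?andbF ?mul1e ?mul0e.
Qed.

Variables (s p alpha beta : R).
Hypotheses (p2 : (2 <= p)%R).
Local Notation u := (near_extremal kd s p alpha beta).

Lemma measurable_cutoff e (T : measurableType e) (a : R) (f : T -> 'rV[R]_d) :
  measurable_fun [set: T] f -> measurable_fun [set: T] (fun x => cutoff kd a (f x)).
Proof.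
move=> mf; have mh := measurable_head kd mf; have mt := measurable_tail mf.
have mc g : measurable_fun [set: T] g -> measurable_fun [set: T] (fun x => cut (g x) : R).
  move=> mg; rewrite /cut /eta; meas.
apply: measurable_fun_ifT; [by apply: measurable_fun_ltr; meas| |exact: measurable_cst].
apply: measurable_funM; apply: mc; last by meas.
apply: measurable_funM; last exact: measurable_cst.
by apply: (measurableT_comp (@measurable_ln R)); meas.
Qed.

Lemma core_vol_gt0 (a : R) : (0 < a)%R -> 0 < core_vol kd a.
Proof.
move=> a0; rewrite /core_vol integral_ring_ball mule_gt0 ?ball_vol_gt0 ?expR_gt0//.
by apply: ring_vol_gt0; rewrite expR_ge0 ltr_expR gtrN.
Qed.

Lemma cutoff_ge0 (a : R) x : (0 <= cutoff kd a x :> R)%R.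
Proof. by rewrite /cutoff; case: ifP => // _; rewrite mulr_ge0 ?cut_ge0. Qed.

Lemma hardy_term_near_extremal (a : R) : hardy_term kd s p alpha beta (u a) =
  \int[mu]_x (cutoff kd a x `^ p * ax x `^ (- k))%:E.
Proof.
have p0 : (p != 0)%R by rewrite gt_eqF// (lt_le_trans _ p2).
apply: eq_integral => x _; congr EFin; rewrite /near_extremal.
have [x0|x0] := ltP 0%R (ax x); last first.
  by rewrite /cutoff ltNge x0 mulr0 normr0 powR0// !mul0r.
rewrite normrM (ger0_norm (powR_ge0 _ _)) (ger0_norm (cutoff_ge0 _ _)).
rewrite powRM ?powR_ge0 ?cutoff_ge0// -powRrM -powRN mulrAC -powRD_gt0// mulrC; congr (_ * _ `^ _)%R.
by rewrite /hardy_gamma; field.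
Qed.

(** On the part of the core where both cutoff variables are at most one half, the cutoff is at least
    [1 / 16]. Returning to the full core costs [2 ^ m] for the ball and 2 for the ring, which is
    covered by two rescaled copies of the smaller ring. *)
Lemma core_vol_le (a : R) : (0 < a)%R ->
  core_vol kd a <= (2 * 2 ^+ m * 16 `^ p)%:E * hardy_term kd s p alpha beta (u a).
Proof.
move=> a0; have p0 : (0 <= p)%R by apply: le_trans p2.
have mcut : measurable_fun [set: 'rV[R]_d] (fun x => (cutoff kd a x `^ p * ax x `^ (- k))%:E).
  apply/measurable_EFinP; apply: measurable_funM; last by meas2.
  apply: (measurableT_comp (measurable_powR _)); apply: measurable_cutoff.
  exact: measurable_id.
pose l := expR (- a / 2); pose r := expR (a / 2); pose c := (expR (2 * a) / 2)%R.
have : ball_vol m c * ring_vol n.+1 l r <= (16 `^ p)%:E * hardy_term kd s p alpha beta (u a).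
  rewrite -integral_ring_ball hardy_term_near_extremal -ge0_integralZlT; last 3 first.
  - exact: powR_ge0.
  - by move=> x; rewrite lee_fin mulr_ge0 ?powR_ge0.
  - exact: mcut.
  apply: ge0_le_integral => //.
  - by move=> x _; case: ifP => // _; rewrite lee_fin powR_ge0.
  - apply: measurable_fun_ifT; [|by meas2|exact: measurable_cst].
    have mx : measurable_fun [set: 'rV[R]_d] (fun x => rsubmx x).
      by apply: measurable_tail; exact: measurable_id.
    by apply: measurable_and; first apply: measurable_and; apply: measurable_fun_ler; meas2.
  - by apply: emeasurable_funM; [exact: measurable_cst|exact: mcut].
  move=> x _; case: ifP => [/andP[/andP[x1 x2] x3]|_]; last by rewrite -EFinM lee_fin !mulr_ge0 ?powR_ge0.
  have x0 : (0 < ax x)%R by apply: lt_le_trans x1; exact: expR_gt0.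
  rewrite -EFinM lee_fin mulrA ler_peMl ?powR_ge0// -powRM ?cutoff_ge0//.
  suff h : (1 <= 16 * cutoff kd a x)%R.
    have : (1 `^ p <= (16 * cutoff kd a x) `^ p)%R by rewrite ge0_ler_powR ?nnegrE ?mulr_ge0 ?cutoff_ge0.
    by rewrite one_powR.
  have h1 : (4^-1 <= cut (ln (ax x) / a))%R.
    apply: cut_half; rewrite normrM [X in (_ * X)%R]gtr0_norm ?invr_gt0// ler_pdivrMr// ler_norml.
    have e : (2^-1 * a = a / 2)%R by rewrite mulrC.
    by rewrite e -mulNr -ler_expR -(ler_expR _ (a / 2)%R) lnK ?posrE// x1.
  have h2 : (4^-1 <= cut (enorm (rsubmx x) / expR (2 * a)))%R.
    apply: cut_half; rewrite ger0_norm ?divr_ge0 ?enorm_ge0 ?expR_ge0//.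
    by rewrite ler_pdivrMr ?expR_gt0// mulrC.
  have q0 : (0 <= 4^-1 :> R)%R by rewrite invr_ge0.
  rewrite /cutoff x0; have := ler_pM q0 q0 h1 h2.
  move: (cut _) (cut _) => v w; rewrite (_ : (4^-1 * 4^-1 = 16^-1 :> R)%R); last by field.
  by move=> vw; rewrite -ler_pdivrMl// mulr1.
move=> h; have c0 : 0 <= (2 * 2 ^+ m)%:E :> \bar R by rewrite lee_fin mulr_ge0// exprn_ge0.
rewrite EFinM -muleA; apply: le_trans (lee_wpmul2l c0 h).
rewrite /core_vol integral_ring_ball.
have -> : expR (2 * a) = (2 * c)%R by rewrite /c; field.
rewrite ball_vol_double EFinM -!muleA (muleCA 2%:E) lee_pmul2l// muleCA lee_wpmul2l//.
  by apply: integral_ge0 => z _; case: ifP.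
have e1 : expR (- a) = (expR (- a / 2) * l)%R by rewrite -expRD; congr expR; field.
have e2 : (1 = expR (- a / 2) * r :> R)%R by rewrite -expRD -[LHS]expR0; congr expR; field.
have e3 : (1 = expR (a / 2) * l :> R)%R by rewrite -expRD -[LHS]expR0; congr expR; field.
have e4 : expR a = (expR (a / 2) * r)%R by rewrite -expRD; congr expR; field.
apply: le_trans (ring_vol_split _ (_ : (expR (- a) <= 1 <= expR a)%R)) _.
  by rewrite -expR0 !ler_expR oppr_le0 (ltW a0).
have -> : ring_vol n.+1 (expR (- a)) 1%R = ring_vol n.+1 l r.
  by rewrite e1 [X in ring_vol _ _ X = _]e2 ring_vol_scale ?expR_gt0.
have -> : ring_vol n.+1 1%R (expR a) = ring_vol n.+1 l r.
  by rewrite e4 [X in ring_vol _ X _ = _]e3 ring_vol_scale ?expR_gt0.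
by rewrite -mule2n mule_natl.
Qed.

End core_volume.

(** * Increments of the truncated ground state *)

Section increments.
Context {R : realType}.

(** Cauchy-Schwarz, by summing the squares of [|y| x_i - |x| y_i]. *)
Lemma dot_le_enorm n (x y : 'rV[R]_n) : dot x y <= enorm x * enorm y.
Proof.
have [X0 Y0] := (enorm_ge0 x, enorm_ge0 y).
have [xy0|xy] := eqVneq (enorm x * enorm y) 0.
  rewrite xy0; move/eqP: xy0; rewrite mulf_eq0 !enorm_eq0 => /orP[]/eqP ->.
    by rewrite /dot big1// => i _; rewrite mxE mul0r.
  by rewrite /dot big1// => i _; rewrite mxE mulr0.
have pos : 0 < enorm x * enorm y by rewrite lt_neqAle eq_sym xy mulr_ge0.
have h : 2 * (enorm x * enorm y) * dot x y <= enorm y ^+ 2 * sqn x + enorm x ^+ 2 * sqn y.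
  rewrite /dot /sqn !mulr_sumr -big_split /=; apply: ler_sum => i _.
  have := sqr_ge0 (enorm y * x ord0 i - enorm x * y ord0 i).
  by move: (enorm x) (enorm y) (x ord0 i) (y ord0 i) => X Y a b; nra.
rewrite -!sqr_enorm in h; rewrite -(ler_pM2l pos) -(@ler_pM2l _ 2)//.
by move: h; move: (enorm x) (enorm y) (dot x y) => X Y a; lra.
Qed.

Lemma dist_enorm_le n (x y : 'rV[R]_n) : `|enorm x - enorm y| <= enorm (x - y).
Proof.
rewrite -(@ler_pXn2r _ 2) ?nnegrE ?enorm_ge0// real_normK ?num_real// sqr_enorm sqnB.
rewrite -!sqr_enorm; have := dot_le_enorm x y.
by move: (enorm x) (enorm y) (dot x y) => X Y a; nra.
Qed.

Lemma rsubmx_enorm_le n m (x : 'rV[R]_(n + m)) : enorm (rsubmx x) <= enorm x.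
Proof.
rewrite -(@ler_pXn2r _ 2) ?nnegrE ?enorm_ge0// !sqr_enorm -[in leRHS](hsubmxK x) sqn_row_mx.
by rewrite lerDr sqn_ge0.
Qed.

Lemma powR_add_le (p x y : R) : 0 <= p -> 0 <= x -> 0 <= y ->
  (x + y) `^ p <= 2 `^ p * (x `^ p + y `^ p).
Proof.
move=> p0; wlog xy : x y / x <= y => [hw x0 y0|x0 y0].
  have [|/ltW yx] := leP x y; first by move=> xy; exact: hw.
  by rewrite addrC [X in _ * X]addrC; exact: hw.
apply: (@le_trans _ _ ((2 * y) `^ p)); first by rewrite ge0_ler_powR ?nnegrE//; lra.
by rewrite powRM// ler_wpM2l ?powR_ge0// lerDr powR_ge0.
Qed.

(* Young's inequality with the sharp constant 1 recovered in the limit t -> 0. *)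
Lemma abs_powR_add_le (p t a b : R) : 1 <= p -> 0 < t < 1 ->
  `|a + b| `^ p <= (1 - t) `^ (1 - p) * `|a| `^ p + t `^ (1 - p) * `|b| `^ p.
Proof.
move=> p1 /andP[t0 t1]; have t01 : 0 <= t <= 1 by rewrite !ltW.
have u0 : 0 < 1 - t by rewrite subr_gt0.
have p0 : 0 <= p by lra.
have h := powR_jensen p1 t01 (divr_ge0 (normr_ge0 a) (ltW u0)) (divr_ge0 (normr_ge0 b) (ltW t0)).
have E (z v : R) : 0 < z -> z * (`|v| / z) `^ p = z `^ (1 - p) * `|v| `^ p.
  move=> z0; rewrite powRM ?invr_ge0 ?(ltW z0)// -{1}[z]powRr1 ?(ltW z0)// -powR_inv1 ?(ltW z0)//.
  by rewrite -powRrM mulN1r mulrCA -powRD_gt0// mulrC.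
rewrite !E// in h; apply: le_trans h; rewrite ge0_ler_powR ?nnegrE//.
  have U (z v : R) : 0 < z -> 0 <= z * (`|v| / z).
    by move=> /ltW z0; rewrite mulr_ge0 ?divr_ge0.
  exact: addr_ge0 (U _ _ u0) (U _ _ t0).
rewrite mulrCA divff ?mulr1 ?gt_eqF// mulrCA divff ?mulr1 ?gt_eqF//.
exact: ler_normD.
Qed.

Let combine (S A B V1 V2 V3 c1 c2 z E : R) : 0 <= c2 -> B * V1 * V2 * V3 <= z * E ->
  S * (V1 * V2 * V3) <= (c1 * A + c2 * B) * (V1 * V2 * V3) ->
  S * V1 * V2 * V3 <= c1 * (A * V1 * V2 * V3) + c2 * z * E.
Proof. by move=> c20 BE SE; have := ler_wpM2l c20 BE; lra. Qed.

Variables (n m : nat) (kd : (n.+1 <= n.+1 + m)%N) (s p alpha beta : R).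
Local Notation d := (n.+1 + m)%N.
Local Notation k := (n.+1%:R : R).
Local Notation tau := (s * p).
Local Notation gam := (hardy_gamma n s p alpha beta).
Local Notation ax := (fun x => enorm (head_rV kd x)).
Local Notation u := (near_extremal kd s p alpha beta).

Variables (q1 q2 : R).
Hypotheses (p2 : 2 <= p) (q1p : 0 <= q1 <= p) (q2p : 0 <= q2 <= p).

Lemma cutoff_core a (x : 'rV[R]_d) : 0 < a -> ~~ core kd a x -> cutoff kd a x = 0.
Proof.
move=> a0; apply: contraNeq => /(cutoff_support a0)[h1 h2].
by rewrite /core h1 h2.
Qed.

Lemma increment_boundV (a r e : R) : 0 < r -> increment_bound p q1 q2 a r^-1 e = increment_bound p q1 q2 a r e.
Proof.
move=> r0; have e1 : shell r^-1 = shell r.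
  by rewrite /shell ltf_pV2 ?posrE// andbC invf_plt ?posrE.
by rewrite /increment_bound e1 lnV ?posrE// normrN.
Qed.

(** The increment is at most [A + B], with [A] from the logarithmic factor and [B] from the other.
    In [A ^ p], [a ^ (- p) <= a ^ (- 1)] as [a >= 1]. Since [B] is bounded by 1 as well as by a
    Lipschitz bound, [B ^ p] is controlled by every power [q] in [[0, p]], which allows [q1] and
    [q2] to be chosen independently. [12 = 2 * 6] combines the sum with the Lipschitz constant. *)
Lemma cutoff_increment a (x y : 'rV[R]_d) : 1 <= a -> 0 < ax x -> 0 < ax y ->
  `|cutoff kd a x - cutoff kd a y| `^ p <=
  12 `^ p * increment_bound p q1 q2 a (ax y / ax x) (enorm (x - y)).
Proof.
move=> a1 x0 y0; have a0 : 0 < a by lra.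
have p1 : 1 <= p by apply: le_trans p2; rewrite ler1n.
have p0 : 0 <= p by apply: le_trans p1.
set M := expR (2 * a); have M0 : 0 < M by exact: expR_gt0.
set e := enorm (x - y); have e0 : 0 <= e by exact: enorm_ge0.
set A := 6 * (`|ln (ax y / ax x)| / a).
have A0 : 0 <= A by rewrite mulr_ge0// divr_ge0// ltW.
set B := Num.min 1 (6 * (e / M)).
have B0 : 0 <= B by rewrite le_min ler01 mulr_ge0// divr_ge0// ltW.
have h1 : `|cut (ln (ax x) / a) - cut (ln (ax y) / a)| <= A.
  apply: le_trans (cut_lipschitz _ _) _; rewrite ler_wpM2l// -mulrBl normrM [X in _ * X]gtr0_norm ?invr_gt0//.
  by rewrite ln_div ?posrE// distrC.
have h2 : `|cut (enorm (rsubmx x) / M) - cut (enorm (rsubmx y) / M)| <= B.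
  rewrite le_min; apply/andP; split.
    move: (cut_ge0 (enorm (rsubmx x) / M)) (cut_le1 (enorm (rsubmx x) / M)).
    move: (cut_ge0 (enorm (rsubmx y) / M)) (cut_le1 (enorm (rsubmx y) / M)).
    by move: (cut _) (cut _) => v w v0 v1 w0 w1; rewrite ler_norml; apply/andP; split; lra.
  apply: le_trans (cut_lipschitz _ _) _; rewrite ler_wpM2l// -mulrBl normrM [X in _ * X]gtr0_norm ?invr_gt0//.
  rewrite ler_wpM2r ?invr_ge0 ?(ltW M0)//; apply: le_trans (dist_enorm_le _ _) _.
  by rewrite -linearB; exact: rsubmx_enorm_le.
have h : `|cutoff kd a x - cutoff kd a y| <= A + B.
  rewrite /cutoff x0 y0; move: h1 h2; rewrite -/M.
  move: (cut_ge0 (ln (ax x) / a)) (cut_le1 (ln (ax x) / a)).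
  move: (cut_ge0 (enorm (rsubmx y) / M)) (cut_le1 (enorm (rsubmx y) / M)).
  move: (cut (ln (ax x) / a)) (cut (ln (ax y) / a)) (cut (_ / M)) (cut (_ / M)) => v w v' w' w'0 w'1 v0 v1 h1 h2.
  rewrite (_ : v * v' - w * w' = w' * (v - w) + v * (v' - w')); last by ring.
  apply: le_trans (ler_normD _ _) _; rewrite !normrM (ger0_norm w'0) (ger0_norm v0).
  by apply: lerD; [apply: le_trans h1|apply: le_trans h2]; rewrite ler_piMl.
have Ap : A `^ p <= 6 `^ p * (`|ln (ax y / ax x)| `^ p / a).
  rewrite /A powRM ?divr_ge0 ?(ltW a0)// powRM ?invr_ge0 ?(ltW a0)// !ler_wpM2l ?powR_ge0//.
  rewrite -[leRHS]powRr1 ?invr_ge0 ?(ltW a0)//.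
  by apply: ger_powR => //; rewrite invr_gt0 a0 invf_le1.
have Bp q : 0 <= q <= p -> B `^ p <= 6 `^ p * (e / M) `^ q.
  move=> /andP[q0 qp]; have eM0 : 0 <= e / M by rewrite divr_ge0// ltW.
  have B6 : B <= 6 * (e / M) by rewrite ge_min lexx orbT.
  have B1 : B <= 1 by rewrite ge_min lexx.
  have [eM|eM] := leP (e / M) 1.
    apply: (@le_trans _ _ ((6 * (e / M)) `^ p)); first by rewrite ge0_ler_powR ?nnegrE// mulr_ge0.
    rewrite powRM// ler_wpM2l ?powR_ge0//.
    have [->|z] := eqVneq (e / M) 0; first by rewrite powR0 ?powR_ge0// gt_eqF// (lt_le_trans _ p1).
    by apply: ger_powR => //; rewrite eM andbT lt_neqAle eq_sym z.
  apply: (@le_trans _ _ 1); first by apply: powR_le1 => //; rewrite B0.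
  apply: (@le_trans _ _ (1 * 1)); [by rewrite mulr1|apply: ler_pM => //].
    have : (1 : R) `^ p <= 6 `^ p by rewrite ge0_ler_powR ?nnegrE// ler1n.
    by rewrite one_powR.
  have : (1 : R) `^ q <= (e / M) `^ q by rewrite ge0_ler_powR ?nnegrE// ltW.
  by rewrite one_powR.
apply: (@le_trans _ _ ((A + B) `^ p)); first by rewrite ge0_ler_powR ?nnegrE ?addr_ge0.
apply: le_trans (powR_add_le p0 A0 B0) _.
rewrite (_ : 12 = 2 * 6 :> R); last by ring.
rewrite powRM// -mulrA ler_wpM2l ?powR_ge0// /increment_bound mulrDr -/M -/e lerD//.
by case: ifP => _; exact: Bp.
Qed.

(** The energy density of the pure power [|x_k| ^ (- gam)] times the [p]-th power of the cutoff at
    [x], written through the ratio of the norms. *)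
Definition main_term a (x y : 'rV[R]_d) : R :=
  cutoff kd a x `^ p * (ax x `^ (tau - k) *
    ((`|1 - (ax y / ax x) `^ (- gam)| `^ p * (ax y / ax x) `^ beta) *
     enorm (x - y) `^ (- (d%:R + tau)))).

(** With [w] the pure power and [f] the cutoff, [u(x) - u(y) = f(x) (w(x) - w(y)) + w(y) (f(x) -
    f(y))]. The first summand gives [main_term] exactly. The second vanishes unless [x] or [y] lies
    in the core, and the error is charged to a point that does, whence the two terms with exponents
    [tau - k - alpha] and [alpha]. *)
Lemma near_extremal_pointwise a t (x y : 'rV[R]_d) : gam != 0 -> 1 <= a -> 0 < t < 1 -> 0 < ax x ->
  `|u a x - u a y| `^ p * ax x `^ alpha * ax y `^ beta * enorm (x - y) `^ (- (d%:R + tau)) <=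
  (1 - t) `^ (1 - p) * main_term a x y +
  t `^ (1 - p) * 12 `^ p * (cutoff_error kd tau p q1 q2 (tau - k - alpha) a x y +
                            cutoff_error kd tau p q1 q2 alpha a y x).
Proof.
move=> gam0 a1 t01 x0; have a0 : 0 < a by lra.
have p1 : 1 <= p by apply: le_trans p2; rewrite ler1n.
have p0 : 0 < p by apply: lt_le_trans p1.
pose w z : R := ax z `^ (- gam); pose f z : R := cutoff kd a z.
have [X0 Y0] := (enorm_ge0 (head_rV kd x), enorm_ge0 (head_rV kd y)).
set N := enorm (x - y) `^ _; have N0 : 0 <= N by exact: powR_ge0.
have uE : u a x - u a y = f x * (w x - w y) + w y * (f x - f y).
  rewrite /near_extremal -/(w x) -/(w y) -/(f x) -/(f y).
  by move: (w x) (w y) (f x) (f y) => z1 z2 z3 z4; ring.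
have gamE : gam * p = k + alpha + beta - tau by rewrite /hardy_gamma; field; exact: lt0r_neq0.
have T1 : `|f x * (w x - w y)| `^ p * ax x `^ alpha * ax y `^ beta * N = main_term a x y.
  rewrite /main_term -/N -/(f x); set rho := ax y / ax x; have rho0 : 0 <= rho by exact: divr_ge0.
  have yE : ax y = ax x * rho by rewrite /rho mulrCA divff ?mulr1// gt_eqF.
  have -> : w x - w y = w x * (1 - rho `^ (- gam)).
    by rewrite mulrBr mulr1 /w yE powRM.
  have -> : ax x `^ (tau - k) = w x `^ p * ax x `^ alpha * ax x `^ beta.
    by rewrite -powRrM -!powRD_gt0//; congr (_ `^ _); rewrite mulNr gamE; ring.
  rewrite !normrM (ger0_norm (powR_ge0 _ _)) (ger0_norm (cutoff_ge0 _ _ _)) yE (powRM beta X0 rho0).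
  move: (`|1 - _|) (normr_ge0 (1 - rho `^ (- gam))) => v v0.
  have w0 : 0 <= w x by exact: powR_ge0.
  have f0 : 0 <= f x by exact: cutoff_ge0.
  rewrite (powRM p f0 (mulr_ge0 w0 v0)) (powRM p w0 v0).
  by move: (f x `^ p) (w x `^ p) (v `^ p) (ax x `^ alpha) (ax x `^ beta) (rho `^ beta) => z1 z2 z3 z4 z5 z6; ring.
have T2 : `|w y * (f x - f y)| `^ p * ax x `^ alpha * ax y `^ beta * N <=
    12 `^ p * (cutoff_error kd tau p q1 q2 (tau - k - alpha) a x y + cutoff_error kd tau p q1 q2 alpha a y x).
  have E1 := @cutoff_error_ge0 R n m kd tau p q1 q2 (tau - k - alpha) a x y a0.
  have E2 := @cutoff_error_ge0 R n m kd tau p q1 q2 alpha a y x a0.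
  have rhs0 := mulr_ge0 (powR_ge0 (12 : R) p) (addr_ge0 E1 E2).
  have [y0|y0] := ltP 0 (ax y); last first.
    rewrite {1}(_ : w y = 0); last first.
      by rewrite /w (_ : ax y = 0) ?powR0 ?oppr_eq0//; apply/eqP; rewrite eq_le y0.
    by rewrite mul0r normr0 powR0 ?gt_eqF// !mul0r.
  have inc := cutoff_increment a1 x0 y0.
  set I := increment_bound _ _ _ _ _ _ in inc.
  have lhsE : `|w y * (f x - f y)| `^ p * ax x `^ alpha * ax y `^ beta * N =
      `|f x - f y| `^ p * (ax x `^ alpha * ax y `^ (tau - k - alpha) * N).
    rewrite normrM (ger0_norm (powR_ge0 _ _)) powRM ?powR_ge0// -powRrM.
    have -> : ax y `^ (tau - k - alpha) = ax y `^ (- gam * p) * ax y `^ beta.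
      by rewrite -powRD_gt0//; congr (_ `^ _); rewrite mulNr gamE; ring.
    by move: (ax y `^ _) (`|_| `^ p) (ax x `^ _) (ax y `^ _) => z1 z2 z3 z4; ring.
  have W0 : 0 <= ax x `^ alpha * ax y `^ (tau - k - alpha) * N by rewrite !mulr_ge0 ?powR_ge0.
  have err1 : core kd a x -> cutoff_error kd tau p q1 q2 (tau - k - alpha) a x y =
      I * (ax x `^ alpha * ax y `^ (tau - k - alpha) * N).
    move=> cx; rewrite /cutoff_error cx -/I -/N.
    have -> : ax x `^ (tau - k) = ax x `^ alpha * ax x `^ (tau - k - alpha).
      by rewrite -powRD_gt0//; congr (_ `^ _); ring.
    have -> : ax y `^ (tau - k - alpha) = ax x `^ (tau - k - alpha) * (ax y / ax x) `^ (tau - k - alpha).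
      by rewrite -powRM ?divr_ge0// mulrCA divff ?mulr1// gt_eqF.
    by move: (ax x `^ alpha) (ax x `^ _) ((_ / _) `^ _) => z1 z2 z3; ring.
  have err2 : core kd a y -> cutoff_error kd tau p q1 q2 alpha a y x =
      I * (ax x `^ alpha * ax y `^ (tau - k - alpha) * N).
    move=> cy; rewrite /cutoff_error cy enormB -/N.
    have -> : increment_bound p q1 q2 a (ax x / ax y) (enorm (x - y)) = I.
      by rewrite -[ax x / ax y]invrK invf_div increment_boundV ?divr_gt0.
    have -> : ax y `^ (tau - k) = ax y `^ alpha * ax y `^ (tau - k - alpha).
      by rewrite -powRD_gt0//; congr (_ `^ _); ring.
    have -> : ax x `^ alpha = ax y `^ alpha * (ax x / ax y) `^ alpha.
      by rewrite -powRM ?divr_ge0// mulrCA divff ?mulr1// gt_eqF.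
    by move: (ax y `^ alpha) (ax y `^ _) ((_ / _) `^ _) => z1 z2 z3; ring.
  have inc' := ler_wpM2r W0 inc.
  move: E1 E2 rhs0 err1 err2; move: (cutoff_error _ _ _ _ _ _ _ x y) (cutoff_error _ _ _ _ _ _ _ y x).
  move=> c1 c2 E1 E2 rhs0 err1 err2.
  rewrite lhsE; case cx: (core kd a x); last case cy: (core kd a y).
  - apply: (le_trans inc'); rewrite -[leLHS]mulrA -(err1 cx).
    by apply: ler_wpM2l; rewrite ?powR_ge0// lerDl.
  - apply: (le_trans inc'); rewrite -[leLHS]mulrA -(err2 cy).
    by apply: ler_wpM2l; rewrite ?powR_ge0// lerDr.
  - rewrite /f (cutoff_core a0 (negbT cx)) (cutoff_core a0 (negbT cy)) subrr normr0 powR0 ?gt_eqF// mul0r; exact: rhs0.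
have h := abs_powR_add_le (f x * (w x - w y)) (w y * (f x - f y)) p1 t01.
rewrite uE -T1.
have W0 : 0 <= ax x `^ alpha * ax y `^ beta * N by rewrite !mulr_ge0 ?powR_ge0.
exact: combine (powR_ge0 _ _) T2 (ler_wpM2r W0 h).
Qed.

End increments.

(** Both limits are made explicit: [a = 1 + K' / D] pushes the error below the excess [D], and then
    [t] is chosen with [(p - 1) t C' = (C' - C) / 2], which contradicts Bernoulli's inequality for
    the exponent [p - 1]. *)
Lemma perturbed_le (R : realType) (p C C' K : R) : 2 <= p -> 0 <= K -> 0 <= C ->
  (forall a t : R, 1 <= a -> 0 < t < 1 -> C' <= (1 - t) `^ (1 - p) * C + t `^ (1 - p) * K / a) ->
  C' <= C.
Proof.
move=> p2 K0 C0 h.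
have step t : 0 < t < 1 -> C' <= (1 - t) `^ (1 - p) * C.
  move=> t01; rewrite leNgt; apply/negP => lt; pose D := C' - (1 - t) `^ (1 - p) * C.
  have D0 : 0 < D by rewrite subr_gt0.
  pose K' := t `^ (1 - p) * K; have K'0 : 0 <= K' by rewrite mulr_ge0 ?powR_ge0.
  have a1 : 1 <= 1 + K' / D by rewrite lerDl divr_ge0// ltW.
  have := h _ _ a1 t01; rewrite -/K' -lerBlDl -/D leNgt => /negP; apply.
  rewrite ltr_pdivrMr ?(lt_le_trans _ a1)// mulrDr mulr1 mulrCA divff ?gt_eqF// mulr1.
  by rewrite ltrDr.
rewrite leNgt; apply/negP => CC; have C'0 : 0 < C' by apply: le_lt_trans CC.
pose t := (C' - C) / (2 * (p - 1) * C').
have den : 0 < 2 * (p - 1) * C' by rewrite !mulr_gt0//; lra.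
have t0 : 0 < t by rewrite divr_gt0// subr_gt0.
have tE : (p - 1) * t * C' = (C' - C) / 2.
  by rewrite /t; field; rewrite !gt_eqF//; lra.
have t1 : t < 1 by rewrite ltr_pdivrMr// mul1r; nra.
have u0 : 0 < 1 - t by rewrite subr_gt0.
have hs := step t (_ : 0 < t < 1); rewrite t0 t1 in hs; have {}hs := hs isT.
have := ler_wpM2l (powR_ge0 (1 - t) (p - 1)) hs.
rewrite mulrA -powRD_gt0// (_ : p - 1 + (1 - p) = 0); last by ring.
rewrite powRr0 mul1r.
have := @bernoulli_powR R (p - 1) (1 - t) (_ : 1 <= p - 1) (ltW u0).
move=> /(_ ltac:(lra)) hb hc; have := ler_wpM2r (ltW C'0) hb; lra.
Qed.

(** * The largest constant *)

Section sharpness.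
Context {R : realType}.
Local Open Scope ereal_scope.

Variables (n m : nat) (kd : (n.+1 <= n.+1 + m)%N) (s p alpha beta : R).
Local Notation d := (n.+1 + m)%N.
Local Notation k := (n.+1%:R : R).
Local Notation tau := (s * p)%R.
Local Notation mu := (@lebesgue_rV R d).
Local Notation gam := (hardy_gamma n s p alpha beta).
Local Notation ax := (fun x => enorm (head_rV kd x)).
Local Notation u := (near_extremal kd s p alpha beta).
Local Notation C := (hardy_cst d s p n.+1 alpha beta).
Local Notation H := (hardy_term kd s p alpha beta).

Let iint (F : 'rV[R]_d * 'rV[R]_d -> R) := \int[mu]_x \int[mu]_y (F (x, y))%:E.

Let measurable_section (F : 'rV[R]_d * 'rV[R]_d -> R) x : measurable_fun [set: 'rV[R]_d * 'rV[R]_d] F ->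
  measurable_fun [set: 'rV[R]_d] (fun y => (F (x, y))%:E).
Proof. by move=> mF; apply/measurable_EFinP; apply: (measurableT_comp mF); meas. Qed.

Let measurable_inner_int (F : 'rV[R]_d * 'rV[R]_d -> R) : measurable_fun [set: 'rV[R]_d * 'rV[R]_d] F ->
  (forall q, 0 <= F q)%R -> measurable_fun [set: 'rV[R]_d] (fun x => \int[mu]_y (F (x, y))%:E).
Proof.
move=> mF F0; apply: (@measurable_fun_iint _ _ _ _ R mu (fun q => (F q)%:E)).
  exact/measurable_EFinP.
by move=> q; rewrite lee_fin.
Qed.

Let iintD (F G : 'rV[R]_d * 'rV[R]_d -> R) :
  measurable_fun [set: 'rV[R]_d * 'rV[R]_d] F -> measurable_fun [set: 'rV[R]_d * 'rV[R]_d] G ->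
  (forall q, 0 <= F q)%R -> (forall q, 0 <= G q)%R -> iint (fun q => F q + G q)%R = iint F + iint G.
Proof.
move=> mF mG F0 G0; rewrite /iint -ge0_integralDT.
- apply: eq_integral => x _; rewrite -ge0_integralDT; [by []|..].
  + by move=> y; rewrite lee_fin.
  + exact: measurable_section.
  + by move=> y; rewrite lee_fin.
  + exact: measurable_section.
- by move=> x; apply: integral_ge0 => y _; rewrite lee_fin.
- exact: measurable_inner_int.
- by move=> x; apply: integral_ge0 => y _; rewrite lee_fin.
- exact: measurable_inner_int.
Qed.

Let iintZ (c : R) (F : 'rV[R]_d * 'rV[R]_d -> R) : (0 <= c)%R ->
  measurable_fun [set: 'rV[R]_d * 'rV[R]_d] F -> (forall q, 0 <= F q)%R ->
  iint (fun q => c * F q)%R = c%:E * iint F.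
Proof.
move=> c0 mF F0; rewrite /iint -ge0_integralZlT; [|exact: c0| |exact: measurable_inner_int]; last first.
  by move=> x; apply: integral_ge0 => y _; rewrite lee_fin.
apply: eq_integral => x _; rewrite -ge0_integralZlT; [by []|exact: c0| |exact: measurable_section].
by move=> y; rewrite lee_fin.
Qed.

Let iint_swap (F : 'rV[R]_d * 'rV[R]_d -> R) :
  measurable_fun [set: 'rV[R]_d * 'rV[R]_d] F -> (forall q, 0 <= F q)%R ->
  iint (fun q => F (q.2, q.1)) = iint F.
Proof.
move=> mF F0; rewrite /iint /= [RHS](@fubini_tonelli _ _ _ _ _ mu mu (fun q => (F q)%:E))//.
exact/measurable_EFinP.
Qed.

Hypotheses (p2 : (2 <= p)%R) (s01 : (0 < s < 1)%R).
Hypotheses (ha : (- k < alpha < tau)%R) (hb : (- k < beta < tau)%R).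
Hypotheses (hab : (- k < alpha + beta < tau)%R) (gam0 : gam != 0%R).

Let p0 : (0 < p)%R. Proof. exact: lt_le_trans p2. Qed.
Let tau0 : (0 < tau)%R. Proof. by case/andP: s01 => s0 _; rewrite mulr_gt0. Qed.
Let taup : (tau < p)%R. Proof. by case/andP: s01 => _ s1; rewrite gtr_pMl. Qed.
Let ktau : (- k < tau)%R. Proof. by rewrite (lt_trans _ tau0)// oppr_lt0. Qed.

Let measurable_main a : measurable_fun [set: 'rV[R]_d * 'rV[R]_d] (fun q => main_term kd s p alpha beta a q.1 q.2).
Proof.
have mc : measurable_fun [set: 'rV[R]_d * 'rV[R]_d] (fun q => cutoff kd a q.1).
  by apply: measurable_cutoff; meas.
by rewrite /main_term; meas2.
Qed.

Let main_ge0 a q : (0 <= main_term kd s p alpha beta a q.1 q.2)%R.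
Proof. by rewrite /main_term !mulr_ge0 ?powR_ge0. Qed.

(** The integrand is not symmetrized, so [y] ranges over the whole space and [mass_inv_gam] is what
    identifies the resulting full mass with the one-dimensional constant. *)
Lemma integral_main_term a : iint (fun q => main_term kd s p alpha beta a q.1 q.2) = C%:E * H (u a).
Proof.
pose g (r : R) := (`|1 - r `^ (- gam)| `^ p * r `^ beta)%R.
have mg : measurable_fun [set: R] g by rewrite /g; meas.
have g0 r : (0 <= g r)%R by rewrite mulr_ge0 ?powR_ge0.
have mc : measurable_fun [set: 'rV[R]_d] (fun x => cutoff kd a x).
  by apply: measurable_cutoff; exact: measurable_id.
have C0 : (0 <= C)%R.
  by rewrite hardy_cstE mulr_ge0// ltW//; [exact: fiber_cst_gt0|exact: C1_cst_gt0].
rewrite hardy_term_near_extremal// -ge0_integralZlT; [|exact: C0|by move=> x; rewrite lee_fin mulr_ge0 ?powR_ge0|by meas2].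
apply: eq_integral => x _; have [x0|x0] := ltP 0%R (ax x); last first.
  have c0 : cutoff kd a x = 0%R by rewrite /cutoff ltNge x0.
  rewrite c0 powR0 ?gt_eqF// mul0r mule0 (eq_integral (fun=> 0)) ?integral0// => y _.
  by rewrite /main_term /= c0 powR0 ?gt_eqF// mul0r.
pose K (y : 'rV[R]_d) := (ax x `^ (tau - k) * (g (ax y / ax x) * (enorm (x - y) / 1) `^ 0 *
     enorm (x - y) `^ (- (d%:R + tau))))%R.
have mK : measurable_fun [set: 'rV[R]_d] (fun y => (K y)%:E) by rewrite /K; meas2.
have K0 y : 0 <= (K y)%:E by rewrite lee_fin !mulr_ge0 ?powR_ge0.
transitivity ((cutoff kd a x `^ p)%:E * \int[mu]_y (K y)%:E).
  rewrite -ge0_integralZlT; [|exact: powR_ge0|exact: K0|exact: mK].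
  by apply: eq_integral => y _; rewrite -EFinM /K powRr0 mulr1.
have kt : (0 < tau + k)%R by rewrite -ltrBlDr sub0r.
rewrite /K (@integral_kernel_power R n m kd tau 0%R 1%R g x (lexx _) kt ltr01 x0 mg g0).
rewrite subr0 mass_inv_gam// -EFin_C1_cst// powRr0 mul1r -!EFinM; congr EFin.
rewrite hardy_cstE; move: (cutoff kd a x `^ p)%R (ax x `^ (- k))%R (fiber_cst _ _ _) (C1_cst _ _ _ _ _) => z1 z2 z3 z4.
by ring.
Qed.

Lemma energy_near_extremal_le : exists K : R, (0 <= K)%R /\ forall a t : R, (1 <= a)%R -> (0 < t < 1)%R ->
  energy kd s p alpha beta (u a) <=
    ((1 - t) `^ (1 - p) * C + t `^ (1 - p) * K / a)%:E * H (u a).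
Proof.
have [/andP[a1 a2] k0] : (- k < alpha < tau)%R /\ (0 < k)%R by split; [exact: ha|rewrite ltr0n].
(* The exponents must satisfy [tau < q1 < tau + k] and [q1 <= p], and [0 < q2 < tau] with [tau - q2]
   above both exponents [alpha] and [tau - k - alpha] of the ratio in the error terms. *)
pose q1 := (tau + Num.min (p - tau) k / 2)%R.
pose q2 := (Num.min tau (Num.min (k + alpha) (tau - alpha)) / 2)%R.
have m1 : (0 < Num.min (p - tau) k)%R by rewrite lt_min subr_gt0 taup k0.
have m2 : (0 < Num.min tau (Num.min (k + alpha) (tau - alpha)))%R.
  by rewrite !lt_min tau0 subr_gt0 a2 andbT/= -ltrBlDl sub0r.
have half (z w : R) : (0 < z -> z <= w -> z / 2 < w)%R.
  by move=> z0 zw; rewrite ltr_pdivrMr// (le_lt_trans zw)// ltr_pMr ?ltr1n// (lt_le_trans z0).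
have q1t : (tau < q1 < tau + k)%R.
  by rewrite ltrDl divr_gt0//= ltrD2l half// ge_min lexx orbT.
have q1p : (0 <= q1 <= p)%R.
  rewrite addr_ge0 ?(ltW tau0) ?divr_ge0 ?(ltW m1)//= -lerBrDl ltW// half// ge_min lexx//.
have q2t : (0 < q2 < tau)%R by rewrite divr_gt0//= half// ge_min lexx.
have q2p : (0 <= q2 <= p)%R.
  by case/andP: q2t => h1 h2; rewrite (ltW h1)/= (ltW (lt_trans h2 taup)).
have q2a : (q2 < k + alpha)%R by rewrite half// !ge_min lexx orbT.
have q2b : (q2 < tau - alpha)%R by rewrite half// !ge_min lexx !orbT.
have b1 : (- k < tau - k - alpha)%R by rewrite addrAC ltrDr subr_gt0.
have b2 : (tau - k - alpha < tau - q2)%R by rewrite -addrA ltrD2l -opprD ltrN2.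
have b3 : (alpha < tau - q2)%R by rewrite ltrBrDl -ltrBrDr.
have [K1 [K10 hK1]] := @integral_cutoff_error_le R n m kd tau p q1 q2 tau0 taup q1t q2t _ b1 b2.
have [K2 [K20 hK2]] := @integral_cutoff_error_le R n m kd tau p q1 q2 tau0 taup q1t q2t _ a1 b3.
pose V : R := (2 * 2 ^+ m * 16 `^ p)%R.
have V0 : (0 <= V)%R by rewrite !mulr_ge0 ?exprn_ge0 ?powR_ge0.
exists (12 `^ p * (K1 + K2) * V)%R; split; first by rewrite !mulr_ge0 ?powR_ge0 ?addr_ge0.
move=> a t a_ge1 t01; have a0 : (0 < a)%R by apply: lt_le_trans a_ge1.
pose c1 := ((1 - t) `^ (1 - p))%R; pose c2 := (t `^ (1 - p) * 12 `^ p)%R.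
have c10 : (0 <= c1)%R by exact: powR_ge0.
have c20 : (0 <= c2)%R by rewrite mulr_ge0 ?powR_ge0.
pose F0 q := main_term kd s p alpha beta a q.1 q.2.
pose F1 (q : 'rV[R]_d * 'rV[R]_d) := cutoff_error kd tau p q1 q2 (tau - k - alpha) a q.1 q.2.
pose F2 (q : 'rV[R]_d * 'rV[R]_d) := cutoff_error kd tau p q1 q2 alpha a q.1 q.2.
pose F2' (q : 'rV[R]_d * 'rV[R]_d) := F2 (q.2, q.1).
have mF0 : measurable_fun [set: 'rV[R]_d * 'rV[R]_d] F0 by exact: measurable_main.
have mF1 : measurable_fun [set: 'rV[R]_d * 'rV[R]_d] F1 by exact: measurable_cutoff_error.
have mF2 : measurable_fun [set: 'rV[R]_d * 'rV[R]_d] F2 by exact: measurable_cutoff_error.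
have mF2' : measurable_fun [set: 'rV[R]_d * 'rV[R]_d] F2' by apply: (measurableT_comp mF2); meas.
have F00 q : (0 <= F0 q)%R by exact: main_ge0.
have F10 q : (0 <= F1 q)%R by exact: cutoff_error_ge0.
have F20 q : (0 <= F2 q)%R by exact: cutoff_error_ge0.
have F20' q : (0 <= F2' q)%R by exact: F20.
have mF12 : measurable_fun [set: 'rV[R]_d * 'rV[R]_d] (fun q => F1 q + F2' q)%R :=
  measurable_funD mF1 mF2'.
have F120 q : (0 <= F1 q + F2' q)%R := addr_ge0 (F10 q) (F20' q).
pose G q := (c1 * F0 q + c2 * (F1 q + F2' q))%R.
have mc0 : measurable_fun [set: 'rV[R]_d * 'rV[R]_d] (fun q => c1 * F0 q)%R :=
  measurable_funM (measurable_cst c1) mF0.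
have mc12 : measurable_fun [set: 'rV[R]_d * 'rV[R]_d] (fun q => c2 * (F1 q + F2' q))%R :=
  measurable_funM (measurable_cst c2) mF12.
have mG : measurable_fun [set: 'rV[R]_d * 'rV[R]_d] G := measurable_funD mc0 mc12.
have c1F q : (0 <= c1 * F0 q)%R := mulr_ge0 c10 (F00 q).
have c2F q : (0 <= c2 * (F1 q + F2' q))%R := mulr_ge0 c20 (F120 q).
have G0 q : (0 <= G q)%R := addr_ge0 (c1F q) (c2F q).
have mu_a : measurable_fun [set: 'rV[R]_d] (u a).
  have mc : measurable_fun [set: 'rV[R]_d] (fun x => cutoff kd a x).
    by apply: measurable_cutoff; exact: measurable_id.
  by rewrite /near_extremal; meas2.
pose X (q : 'rV[R]_d * 'rV[R]_d) : R := (`|u a q.1 - u a q.2| `^ p / enorm (q.1 - q.2) `^ (d%:R + tau) *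
     ax q.1 `^ alpha * ax q.2 `^ beta)%R.
have mX : measurable_fun [set: 'rV[R]_d * 'rV[R]_d] X by rewrite /X; meas2.
have X0 q : (0 <= X q)%R by rewrite !mulr_ge0 ?invr_ge0 ?powR_ge0.
have XG x y : (0 < ax x)%R -> (X (x, y) <= G (x, y))%R.
  move=> x0; have := @near_extremal_pointwise R n m kd s p alpha beta q1 q2 p2 q1p q2p a t x y gam0 a_ge1 t01 x0.
  apply: le_trans; rewrite /X /= powRN.
  by move: (`|_| `^ p)%R ((_ `^ _)^-1)%R (ax x `^ alpha)%R (ax y `^ beta)%R => z1 z2 z3 z4; rewrite -!mulrA [(z2 * _)%R]mulrC -!mulrA.
have : energy kd s p alpha beta (u a) <= iint G.
  apply: ae_ge0_le_integral => //.
  - by move=> x _; apply: integral_ge0 => y _; rewrite lee_fin; exact: (X0 (x, y)).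
  - exact: (measurable_inner_int mX X0).
  - by move=> x _; apply: integral_ge0 => y _; rewrite lee_fin.
  - exact: measurable_inner_int.
  apply: filterS (ae_ax_neq kd 0%R) => x xn _.
  have x0 : (0 < ax x)%R by rewrite lt_neqAle eq_sym xn enorm_ge0.
  apply: ge0_le_integral => //.
  - by move=> y _; rewrite lee_fin; exact: (X0 (x, y)).
  - exact: (measurable_section x mX).
  - exact: measurable_section.
  - by move=> y _; rewrite lee_fin; exact: XG.
have C0 : (0 <= C)%R.
  by rewrite hardy_cstE mulr_ge0// ltW//; [exact: fiber_cst_gt0|exact: C1_cst_gt0].
have e0 : iint F0 = C%:E * H (u a) := integral_main_term a.
have e2 : iint F2' = iint F2 := iint_swap mF2 F20.
have eG : iint G = c1%:E * (C%:E * H (u a)) + c2%:E * (iint F1 + iint F2).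
  by rewrite -e0 -e2 -(iintD mF1 mF2' F10 F20') -(iintZ c10 mF0 F00) -(iintZ c20 mF12 F120) -(iintD mc0 mc12 c1F c2F).
rewrite eG; move=> /le_trans; apply; rewrite EFinD ge0_muleDl ?lee_fin; last 2 first.
- exact: (mulr_ge0 c10 C0).
- exact: (divr_ge0 (mulr_ge0 (powR_ge0 _ _) (mulr_ge0 (mulr_ge0 (powR_ge0 _ _) (addr_ge0 K10 K20)) V0)) (ltW a0)).
apply: leeD; first by rewrite muleA -EFinM.
have e12 : iint F1 + iint F2 <= ((K1 + K2) / a)%:E * core_vol kd a.
  rewrite mulrDl EFinD ge0_muleDl ?lee_fin; [|exact: (divr_ge0 K10 (ltW a0))|exact: (divr_ge0 K20 (ltW a0))].
  by apply: leeD; [exact: hK1|exact: hK2].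
have c20' : 0 <= c2%:E by rewrite lee_fin.
apply: le_trans (lee_wpmul2l c20' e12) _.
have KK : 0 <= ((K1 + K2) / a)%:E by rewrite lee_fin; exact: (divr_ge0 (addr_ge0 K10 K20) (ltW a0)).
have := lee_wpmul2l c20' (lee_wpmul2l KK (core_vol_le kd s alpha beta p2 a0)).
move/le_trans; apply; rewrite -/V !muleA -!EFinM.
have E (z1 z2 z3 z4 z5 : R) : (z1 * z2 * (z3 * z4) * z5 = z1 * (z2 * z3 * z5) * z4)%R by ring.
by rewrite /c2 E.
Qed.

(** Test on [near_extremal] and divide by its Hardy term, which is finite because the function is
    admissible and positive because it dominates a multiple of [core_vol]. *)
Lemma hardy_cst_largest (C' : R) : (s * p != k + alpha + beta)%R ->
  hardy_inequality kd s p alpha beta C' -> (C' <= C)%R.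
Proof.
move=> crit hC'; have [K [K0 hK]] := energy_near_extremal_le.
apply: (perturbed_le p2 K0) => [|a t a1 t01].
  by rewrite hardy_cstE mulr_ge0// ltW//; [exact: fiber_cst_gt0|exact: C1_cst_gt0].
have a0 : (0 < a)%R by apply: lt_le_trans a1.
have test := near_extremal_test kd a0 crit.
have h := le_trans (hC' _ test) (hK a t a1 t01); move: h.
have [_ hab2] := andP hab.
have Hfin := hardy_term_fin p2 hab2 test.
have Hpos : 0 < H (u a).
  have := lt_le_trans (core_vol_gt0 kd a0) (core_vol_le kd s alpha beta p2 a0).
  have V0 : (0 < 2 * 2 ^+ m * 16 `^ p :> R)%R by rewrite !mulr_gt0 ?exprn_gt0 ?powR_gt0.
  by rewrite pmule_rgt0// lte_fin.
have Hf : H (u a) \is a fin_num by rewrite ge0_fin_numE// ltW.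
rewrite -(fineK Hf) in Hpos *.
by rewrite -!EFinM lee_fin ler_pM2r.
Qed.

End sharpness.

(** * The inequality, its remainder and the case [p = 2] *)

Section ground_state_consequences.
Context {R : realType}.
Local Open Scope ereal_scope.

Variables (n m : nat) (kd : (n.+1 <= n.+1 + m)%N) (s p alpha beta : R).
Local Notation d := (n.+1 + m)%N.
Local Notation k := (n.+1%:R : R).
Hypotheses (p2 : (2 <= p)%R) (s01 : (0 < s < 1)%R).
Hypotheses (ha : (- k < alpha < s * p)%R) (hb : (- k < beta < s * p)%R).
Hypotheses (hab : (- k < alpha + beta < s * p)%R).

Local Notation C := (hardy_cst d s p n.+1 alpha beta).
Local Notation H := (hardy_term kd s p alpha beta).
Local Notation E := (energy kd s p alpha beta).
Local Notation test := (test_function kd s p alpha beta).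
Local Notation remainder u := (energy kd s p (- ((k - alpha + beta - s * p) / 2))
  (- ((k + alpha - beta - s * p) / 2)) (ground_state kd s p alpha beta u)).
Local Notation defect u := (region_int kd 1 (ground_defect kd s p alpha beta u (remainder_cst p))).

Lemma hardy_gamma_neq0 : (s * p != k + alpha + beta)%R -> hardy_gamma n s p alpha beta != 0%R.
Proof.
move=> crit; apply: mulf_neq0; first by rewrite subr_eq0 eq_sym.
by rewrite invr_eq0 gt_eqF// (lt_le_trans _ p2).
Qed.

Lemma test_function_neq u : test u -> (s * p != k + alpha + beta)%R.
Proof. by move=> [][h _]; rewrite ?(lt_eqF h) ?(gt_eqF h). Qed.

Lemma ground_gap_ge0 (t a b : R) : (0 < t < 1)%R -> (0 <= ground_gap p (remainder_cst p) t a b)%R.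
Proof.
move=> t01; have [_ hc /andP[_ c1]] := remainder_cst_min p2.
have := ground_pointwise_t a b p2 c1 hc t01.
by rewrite /ground_gap -addrA -opprD subr_ge0.
Qed.

Lemma energy_decomposition u : test u ->
  E u = C%:E * H u + ((remainder_cst p)%:E * remainder u + defect u).
Proof.
move=> tu; have [_ _ /andP[c0 _]] := remainder_cst_min p2.
have mu : measurable_fun [set: 'rV[R]_d] u.
  by case: tu => -[_ /C1c_measurable].
apply: ground_identity => //.
- exact: hardy_gamma_neq0 (test_function_neq tu).
- by apply: hardy_term_fin => //; case/andP: hab.
- exact: ground_gap_ge0.
Qed.

Lemma ratio_powR_lt1 (X Y g : R) : (0 < g)%R -> (0 < Y < X)%R -> (0 < (Y / X) `^ g < 1)%R.
Proof.
move=> g0 /andP[Y0 YX]; have X0 := lt_trans Y0 YX.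
rewrite powR_gt0 ?divr_gt0//= -[ltRHS](one_powR g) gt0_ltr_powR ?nnegrE ?divr_ge0 ?(ltW X0) ?(ltW Y0)//.
by rewrite ltr_pdivrMr// mul1r.
Qed.

(** Both signs of the exponent are covered at once: the defect is a nonnegative multiple of a gap,
    so it inherits its sign and, for [p = 2], its vanishing. *)
Lemma ground_defectE u c x y : hardy_gamma n s p alpha beta != 0%R ->
  (0 < enorm (head_rV kd y) < enorm (head_rV kd x))%R -> exists t a b w : R,
  [/\ (0 < t < 1)%R, (0 <= w)%R & ground_defect kd s p alpha beta u c (x, y) = (w * ground_gap p c t a b)%R].
Proof.
move=> gam0 xy; rewrite /ground_defect /=.
case: ltP => [g0|g0].
  eexists _, _, _, (_ `^ _ * (_ * _))%R; split; [exact: ratio_powR_lt1 g0 xy| |by rewrite mulrAC].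
  by rewrite !mulr_ge0 ?addr_ge0 ?mulr_ge0 ?powR_ge0.
have {}g0 : (0 < - hardy_gamma n s p alpha beta)%R by rewrite oppr_gt0 lt_neqAle gam0.
eexists _, _, _, (_ `^ _ * (_ * _))%R; split; [exact: ratio_powR_lt1 g0 xy| |by rewrite mulrAC].
by rewrite !mulr_ge0 ?addr_ge0 ?mulr_ge0 ?powR_ge0.
Qed.

Lemma defect_ge0 u : test u -> 0 <= defect u.
Proof.
move=> tu; apply: region_int_ge0 => x y; rewrite mul1r => xy.
have [t [a [b [w [t01 w0 ->]]]]] :=
  ground_defectE u (remainder_cst p) (hardy_gamma_neq0 (test_function_neq tu)) xy.
by rewrite mulr_ge0// ground_gap_ge0.
Qed.

Lemma hardy_term_fin_num u : test u -> C%:E * H u \is a fin_num.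
Proof.
move=> tu; rewrite fin_numM// ge0_fin_numE.
  by apply: hardy_term_fin => //; case/andP: hab.
by apply: integral_ge0 => x _; rewrite lee_fin divr_ge0 ?powR_ge0.
Qed.

Lemma deficit_eq u : test u ->
  E u - C%:E * H u = (remainder_cst p)%:E * remainder u + defect u.
Proof.
by move=> tu; rewrite (energy_decomposition tu) addeAC subee ?add0e// hardy_term_fin_num.
Qed.

Lemma defect_eq0 u : p = 2%R -> test u -> defect u = 0.
Proof.
move=> p2E tu; have c1 : remainder_cst p = 1%R.
  have [[t t01 <-] _ _] := remainder_cst_min p2; rewrite p2E remainder_fun2//.
  by move: t01; lra.
rewrite (eq_region_int (G := fun=> 0%R)); last first.
  move=> x y; rewrite mul1r => xy.
  have [t [a [b [w [t01 w0 ->]]]]] :=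
    ground_defectE u (remainder_cst p) (hardy_gamma_neq0 (test_function_neq tu)) xy.
  by rewrite /ground_gap c1 p2E -(ground_pointwise_eq2 a b t01) mul1r -addrA -opprD subrr mulr0.
rewrite /region_int (eq_integral (fun=> 0)) ?integral0// => x _.
by rewrite (eq_integral (fun=> 0)) ?integral0// => y _; case: ifP.
Qed.

End ground_state_consequences.

Theorem theorem1p2 (R : realType) (d k : nat) (p s alpha beta : R)
    (hd : (1 <= d)%N) (hk : (1 <= k)%N) (kd : (k <= d)%N)
    (hp : 2 <= p) (hs : 0 < s < 1)
    (ha : - k%:R < alpha < s * p) (hb : - k%:R < beta < s * p)
    (hab : - k%:R < alpha + beta < s * p) :
  let C := hardy_cst d s p k alpha beta in
  let c_p := remainder_cst p in
  let test := test_function kd s p alpha beta in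
  let deficit u := (energy kd s p alpha beta u -
                    C%:E * hardy_term kd s p alpha beta u)%E in
  let remainder u :=
    energy kd s p (- ((k%:R - alpha + beta - s * p) / 2))
                  (- ((k%:R + alpha - beta - s * p) / 2))
                  (ground_state kd s p alpha beta u) in
  [/\ (* C is positive, and is the largest constant in Hardy's inequality *)
      s * p != k%:R + alpha + beta ->
        [/\ 0 < C, hardy_inequality kd s p alpha beta C &
            forall C', hardy_inequality kd s p alpha beta C' -> C' <= C],
      (* c_p is a minimum *)
      (exists2 tau, 0 < tau < 1 / 2 & remainder_fun p tau = c_p) /\
        (forall tau, 0 < tau < 1 / 2 -> c_p <= remainder_fun p tau),
      forall u, test u -> (deficit u >= c_p%:E * remainder u)%E &
      p = 2 -> c_p = 1 /\
        forall u, test u -> (deficit u = c_p%:E * remainder u)%E].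
Proof.
cbv zeta.
(* [k] and [d] are put in the forms [n.+1] and [n.+1 + m], for which row vectors split into two
   blocks. *)
case: k hk kd ha hb hab => // n _ kd ha hb hab.
have [m dE] : exists m, d = (n.+1 + m)%N by exists (d - n.+1)%N; rewrite subnKC.
subst d; have [cmin cle /andP[c0 _]] := remainder_cst_min hp.
have remainder0 u a b : (0 <= (remainder_cst p)%:E * energy kd s p a b (ground_state kd s p alpha beta u))%E.
  rewrite mule_ge0 ?lee_fin//; apply: integral_ge0 => x _; apply: integral_ge0 => y _.
  by rewrite lee_fin !mulr_ge0 ?invr_ge0 ?powR_ge0.
split.
- move=> crit; have gam0 := hardy_gamma_neq0 hp crit.
  split; last by move=> C'; exact: hardy_cst_largest.
    rewrite hardy_cstE mulr_gt0//; last exact: C1_cst_gt0.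
    apply: fiber_cst_gt0; case/andP: ha => h1 h2; exact: lt_trans h1 h2.
  move=> u tu; rewrite (energy_decomposition hp hs ha hb hab tu) leeDl//.
  by rewrite adde_ge0//; exact: defect_ge0.
- split; first exact: cmin.
  by move=> tau /andP[t0 t1]; apply: cle; rewrite t0/=; lra.
- move=> u tu; rewrite (deficit_eq hp hs ha hb hab tu) leeDl//.
  exact: defect_ge0.
- move=> p2; split; last first.
    by move=> u tu; rewrite (deficit_eq hp hs ha hb hab tu) defect_eq0// adde0.
  have [t t01 <-] := cmin; rewrite p2 remainder_fun2//; lra.
Qed.
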